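(* Let $\sigma$ be the representation of $G_2$ on the Hilbert space $L^2\big(K,L^2(\mathbb R^* )\big)$ given by $$\big(\sigma[x,A]F[0,\gamma(\omega)]\big)(t)=\frac{|\det A|^{1/2}\|\omega\|}{\|\omega A\|}e^{2\pi i(\omega x+t^{-1}u_{\omega,A})}\big(F[0,\gamma(\omega A)]\big)(v_{\omega,A}^{-1}t)$$ for a.e. $\omega\in\mathcal O$ and a.e. $t\in\mathbb R^*$. Let $\{\eta_i:i\in I\}$ be an orthonormal basis of $L^2(\mathcal O)$ and let $\{g_j:j\in J\}$ be an orthonormal basis of $L^2(\mathcal O_1)$ consisting of functions in $L^2(\mathbb R^* )$. For each $(i,j)\in I\times J$, form $E_{i,j}\in L^2\big(K,L^2(\mathbb R^* )\big)$ by $$E_{i,j}[0,L](\nu)=\frac{\overline{\eta_i}\big((1,0)L^{-1}\big)}{|\det(L)|}\,g_j(\nu),\quad \nu\in\mathbb R^*,\ [0,L]\in K,$$ and let $\mathcal M_{i,j}=V_{E_{i,j}}L^2\big(K,L^2(\mathbb R^* )\big)$, where $V_{E_{i,j}}F[x,A]=\langle F,\sigma[x,A]E_{i,j}\rangle_{L^2(K,L^2(\mathbb R^* ))}$ for $[x,A]\in G_2$ and $F\in L^2\big(K,L^2(\mathbb R^* )\big)$. Then each $\mathcal M_{i,j}$ is a closed $\lambda_{G_2}$-invariant subspace of $L^2(G_2)$ and $V_{E_{i,j}}$ is an isometry that intertwines $\sigma$ with the restriction of $\lambda_{G_2}$ to $\mathcal M_{i,j}$. Moreover, $L^2(G_2)=\sum^{\oplus}_{(i,j)\in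 I\times J}\mathcal M_{i,j}$ (Hilbert space orthogonal direct sum).
   Context: $\mathbb R^2$ denotes column vectors, $\widehat{\mathbb R^2}$ row vectors; $\|\omega\|$ is the Euclidean norm. $G_2=\{[x,A]:x\in\mathbb R^2,A\in\mathrm{GL}_2(\mathbb R)\}$ has product $[x,A][y,B]=[x+Ay,AB]$ and left Haar measure $\frac{dx\,d\mu_{\mathrm{GL}_2(\mathbb R)}(A)}{|\det A|}$, where $\mu_{\mathrm{GL}_2(\mathbb R)}$ is Lebesgue measure on the four entries divided by $|\det A|^2$. The left regular representation of $G_2$ on $L^2(G_2)$ is $\lambda_{G_2}(x)f(y)=f(x^{-1}y)$. $\mathbb R^*=\mathbb R\setminus\{0\}$ is the multiplicative group with Haar measure $d\mu_{\mathbb R^*}(t)=dt/|t|$. $\mathcal O_1=\widehat{\mathbb R}\setminus\{0\}$ is the same set as $\mathbb R^*$ but carries Lebesgue measure $dt$; $\mathcal O=\widehat{\mathbb R^2}\setminus\{(0,0)\}$ carries Lebesgue measure. $K_0=\left\{\begin{pmatrix}s&-t\\ t&s\end{pmatrix}:s,t\in\mathbb R,\ s^2+t^2>0\right\}$, $K=\{[0,M]:M\in K_0\}\subset G_2$. The map $\gamma:\mathcal O\to K_0$ is the homeomorphism $\gamma(\omega)=\frac1{\|\omega\|^2}\begin{pmatrix}\omega_1&-\omega_2\\ \omega_2&\omega_1\end{pmatrix}$ (so $(1,0)\gamma(\omega)^{-1}=\omega$). Haar measure on $K$ is given by $\int_Kf\,d\mu_K=\int_{\widehat{\mathbb R^2}}f[0,\gamma(\omega)]\frac{d\omega}{\|\omega\|^2}$.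 For $\omega\in\mathcal O$, $A\in\mathrm{GL}_2(\mathbb R)$, the reals $u_{\omega,A}$, $v_{\omega,A}$ are defined by $\gamma(\omega)^{-1}A\gamma(\omega A)=\begin{pmatrix}1&0\\ u_{\omega,A}&v_{\omega,A}\end{pmatrix}$. A bounded operator $T$ intertwines $\pi$ with $\pi'$ if $T\pi(x)=\pi'(x)T$ for all group elements $x$.
   Formalization: The membership of each E_{i,j} in L²(K, L²(R* )) is assumed; it does not follow from η_i in L²(O), since it holds only when ‖ω‖η_i(ω) is square integrable, and otherwise V_{E_{i,j}} is undefined. *)

(* Defs.v *)
From HB Require Import structures.
From mathcomp Require Import all_boot all_order all_algebra.
From mathcomp Require Import all_classical all_reals all_analysis.
From mathcomp Require Import measurable_realfun complex ring.

Set Implicit Arguments.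
Unset Strict Implicit.
Unset Printing Implicit Defensive.
Import Order.TTheory GRing.Theory Num.Theory.
Import numFieldNormedType.Exports.
Local Open Scope classical_set_scope.
Local Open Scope ring_scope.
Local Open Scope complex_scope.

(* The Borel sigma-algebra of a space of real matrices, generated by the
   entries. *)
Definition mx_measurable (R : realType) (m n : nat) : set (set 'M[R]_(m, n)) :=
  <<s [set A | exists i j (B : set R),
         measurable B /\ A = (fun M : 'M[R]_(m, n) => M i j) @^-1` B] >>.

Lemma mx_measurableC (R : realType) (m n : nat) (A : set 'M[R]_(m, n)) :
  mx_measurable A -> mx_measurable (~` A).
Proof. exact: sigma_algebraC. Qed.

HB.instance Definition _ (R : realType) (m n : nat) :=
  @isMeasurable.Build default_measure_display 'M[R]_(m, n)
    (@mx_measurable R m n) (@sigma_algebra0 _ _ _) (@mx_measurableC R m n)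
    (@sigma_algebra_bigcup _ _ _).

Lemma measurable_mx_entry (R : realType) (m n : nat) (i : 'I_m) (j : 'I_n) :
  measurable_fun setT (fun M : 'M[R]_(m, n) => M i j).
Proof.
move=> _ B mB; rewrite setTI; apply: sub_sigma_algebra.
by exists i, j, B.
Qed.

Lemma measurable_fun_mx (R : realType) (m n : nat) d (T : measurableType d)
    (f : T -> 'M[R]_(m, n)) :
  (forall i j, measurable_fun setT (fun x => f x i j)) -> measurable_fun setT f.
Proof.
move=> mf; apply: (@measurability _ _ _ _ setT f _ (erefl _)).
by move=> _ [_ [i [j [B [mB ->]]]] <-]; exact: mf.
Qed.

Lemma det_mx2 (R : realType) (A : 'M[R]_2) :
  \det A = A 0 0 * A 1 1 - A 0 1 * A 1 0.
Proof.
rewrite (expand_det_row _ 0) !big_ord_recl big_ord0 /cofactor !det_mx11 !mxE /=.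
rewrite expr0 expr1 mul1r mulN1r addr0 mulrN.
by congr (_ * A _ _ - A _ _ * A _ _); apply: val_inj.
Qed.

Lemma measurable_det2 (R : realType) :
  measurable_fun setT (fun A : 'M[R]_2 => \det A).
Proof.
under eq_fun do rewrite det_mx2.
by apply: measurable_funB; apply: measurable_funM; exact: measurable_mx_entry.
Qed.

Lemma measurable_ge0_inv (R : realType) d (T : measurableType d) (f : T -> R) :
  (forall x, 0 <= f x) -> measurable_fun setT f ->
  measurable_fun setT (fun x => (f x)^-1).
Proof.
move=> f0 mf.
rewrite (_ : (fun x => _) = (fun x => f x `^ (-1))).
  exact: (measurableT_comp (measurable_powR _) mf).
by apply/funext => x; rewrite powR_inv1.
Qed.

(* The measure w dmu; a measure when w is measurable and nonnegative. *)
Definition mdensity d (T : measurableType d) (R : realType)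
    (mu : {measure set T -> \bar R}) (w : T -> R) (A : set T) : \bar R :=
  (\int[mu]_(x in A) (w x)%:E)%E.

Section mdensity_measure.
Context d (T : measurableType d) (R : realType).
Context (mu : {measure set T -> \bar R}) (w : T -> R).
Context (mw : measurable_fun setT w) (w0 : forall x, 0 <= w x).

Let mdensity0 : mdensity mu w set0 = 0%E.
Proof. by rewrite /mdensity integral_set0. Qed.

Let mdensity_ge0 A : (0 <= mdensity mu w A)%E.
Proof. by apply: integral_ge0 => x _; rewrite lee_fin. Qed.

Let mdensity_sigma_additive : semi_sigma_additive (mdensity mu w).
Proof.
apply: semi_sigma_additive_nng_induced; first exact/measurable_EFinP.
by move=> x; rewrite lee_fin.
Qed.

HB.instance Definition _ := isMeasure.Build _ _ _
  (mdensity mu w) mdensity0 mdensity_ge0 mdensity_sigma_additive.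

End mdensity_measure.

Lemma sigma_finite_product d1 d2 (T1 : measurableType d1)
    (T2 : measurableType d2) (R : realType)
    (m1 : {sigma_finite_measure set T1 -> \bar R})
    (m2 : {sigma_finite_measure set T2 -> \bar R}) :
  sigma_finite setT (m1 \x m2)%E.
Proof.
have /sigma_finiteP[F [TF ndF Foo]] := sigma_finiteT m1.
have /sigma_finiteP[G [TG ndG Goo]] := sigma_finiteT m2.
exists (fun n => F n `*` G n).
  rewrite -setXTT TF TG predeqE => -[x y]; split.
    move=> [/= [n _ Fnx] [k _ Gky]]; exists (maxn n k) => //; split.
    - by move: x Fnx; exact/subsetPset/ndF/leq_maxl.
    - by move: y Gky; exact/subsetPset/ndG/leq_maxr.
  by move=> [n _ []/= ? ?]; split; exists n.
move=> k; have [? ?] := Foo k; have [? ?] := Goo k.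
split; first exact: measurableX.
by rewrite product_measure1E// lte_mul_pinfty// ge0_fin_numE.
Qed.

Lemma sigma_finite_pushforward d d' (T : measurableType d)
    (U : measurableType d') (R : realType)
    (mu : {sigma_finite_measure set T -> \bar R}) (f : T -> U) (h : U -> T) :
  cancel f h -> measurable_fun setT h ->
  sigma_finite setT (pushforward mu f).
Proof.
move=> fK mh; have [F FT Ffin] := sigma_finiteT mu.
exists (fun n => h @^-1` F n).
  by rewrite -preimage_bigcup -FT preimage_setT.
move=> n; have [mF Fn] := Ffin n; split.
  by rewrite -[X in measurable X]setTI; exact: mh.
rewrite /pushforward (_ : _ @^-1` _ = F n)//.
by apply/seteqP; split => x /=; rewrite fK.
Qed.

Section coordinates.
Context (R : realType).
Local Notation mR := (measurableTypeR R).

Definition rv2 (p : mR * mR) : 'rV[R]_2 := \row_j (if j == 0 then p.1 else p.2).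
Definition cv2 (p : mR * mR) : 'cV[R]_2 := \col_i (if i == 0 then p.1 else p.2).
Definition mx2 (a b c d : R) : 'M[R]_2 :=
  \matrix_(i, j) (if i == 0 then (if j == 0 then a else b)
                  else (if j == 0 then c else d)).
Definition mx2_of (p : (mR * mR) * (mR * mR)) : 'M[R]_2 :=
  mx2 p.1.1 p.1.2 p.2.1 p.2.2.

Lemma measurable_rv2 : measurable_fun setT rv2.
Proof.
apply: measurable_fun_mx => i j; under eq_fun do rewrite mxE.
by case: (j == 0); [exact: measurable_fst|exact: measurable_snd].
Qed.

Lemma measurable_cv2 : measurable_fun setT cv2.
Proof.
apply: measurable_fun_mx => i j; under eq_fun do rewrite mxE.
by case: (i == 0); [exact: measurable_fst|exact: measurable_snd].
Qed.

Lemma measurable_mx2_of : measurable_fun setT mx2_of.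
Proof.
apply: measurable_fun_mx => i j; under eq_fun do rewrite mxE.
case: (i == 0); case: (j == 0).
- exact: (measurableT_comp measurable_fst measurable_fst).
- exact: (measurableT_comp measurable_snd measurable_fst).
- exact: (measurableT_comp measurable_fst measurable_snd).
- exact: (measurableT_comp measurable_snd measurable_snd).
Qed.

Definition leb2 : set (mR * mR) -> \bar R :=
  (@lebesgue_measure R \x @lebesgue_measure R)%E.
HB.instance Definition _ := Measure.on leb2.
HB.instance Definition _ := Measure_isSigmaFinite.Build _ _ _ leb2
  (sigma_finite_product (@lebesgue_measure R) (@lebesgue_measure R)).

Definition leb4 : set ((mR * mR) * (mR * mR)) -> \bar R := (leb2 \x leb2)%E.
HB.instance Definition _ := Measure.on leb4.
HB.instance Definition _ := Measure_isSigmaFinite.Build _ _ _ leb4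
  (sigma_finite_product leb2 leb2).

(* Lebesgue measure on row vectors, column vectors and 2 x 2 matrices. *)
Definition leb_rV : set 'rV[R]_2 -> \bar R := pushforward leb2 rv2.
Definition leb_cV : set 'cV[R]_2 -> \bar R := pushforward leb2 cv2.
Definition leb_mx : set 'M[R]_2 -> \bar R :=
  pushforward leb4 mx2_of.

HB.instance Definition _ := Measure.copy leb_rV
  (measure_function_pushforward__canonical__measure_function_Measure
     leb2 measurable_rv2).
HB.instance Definition _ := Measure.copy leb_cV
  (measure_function_pushforward__canonical__measure_function_Measure
     leb2 measurable_cv2).
HB.instance Definition _ := Measure.copy leb_mx
  (measure_function_pushforward__canonical__measure_function_Measure
     leb4 measurable_mx2_of).

Lemma leb_rV_sigma_finite : sigma_finite setT leb_rV.
Proof.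
apply: (@sigma_finite_pushforward _ _ _ _ R leb2 rv2
  (fun v => (v 0 0 : mR, v 0 1 : mR))).
  by move=> [a b]; rewrite !mxE.
by apply/measurable_fun_pair; exact: measurable_mx_entry.
Qed.

Lemma leb_cV_sigma_finite : sigma_finite setT leb_cV.
Proof.
apply: (@sigma_finite_pushforward _ _ _ _ R leb2 cv2
  (fun v => (v 0 0 : mR, v 1 0 : mR))).
  by move=> [a b]; rewrite !mxE.
by apply/measurable_fun_pair; exact: measurable_mx_entry.
Qed.

Lemma leb_mx_sigma_finite : sigma_finite setT leb_mx.
Proof.
apply: (@sigma_finite_pushforward _ _ _ _ R leb4 mx2_of
  (fun A => ((A 0 0 : mR, A 0 1 : mR), (A 1 0 : mR, A 1 1 : mR)))).
  by move=> [[a b] [c d]]; rewrite !mxE.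
by apply/measurable_fun_pair; apply/measurable_fun_pair;
  exact: measurable_mx_entry.
Qed.

HB.instance Definition _ :=
  Measure_isSigmaFinite.Build _ _ _ leb_rV leb_rV_sigma_finite.
HB.instance Definition _ :=
  Measure_isSigmaFinite.Build _ _ _ leb_cV leb_cV_sigma_finite.
HB.instance Definition _ :=
  Measure_isSigmaFinite.Build _ _ _ leb_mx leb_mx_sigma_finite.

End coordinates.

(* Complex L^2-spaces.  Elements are represented by functions; an equality in
   L^2 is an equality almost everywhere.  The functions are defined on an
   ambient type, D being the space on which they are considered. *)
Section scalar_L2.
Context d (T : measurableType d) (R : realType).
Context (mu : {measure set T -> \bar R}) (D : set T).
Implicit Types f g : T -> R[i].

Definition cmeasurable f : Prop :=
  measurable_fun D (fun x => complex.Re (f x)) /\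
  measurable_fun D (fun x => complex.Im (f x)).

Definition csqr (z : R[i]) : R := complex.Re z ^+ 2 + complex.Im z ^+ 2.

Definition sqnorm f : \bar R := (\int[mu]_(x in D) (csqr (f x))%:E)%E.

Definition sqdist f g : \bar R := sqnorm (fun x => f x - g x).

Definition L2 : set (T -> R[i]) :=
  [set f | cmeasurable f /\ (sqnorm f < +oo)%E].

Definition cintegral f : R[i] :=
  (\int[mu]_(x in D) complex.Re (f x)) +i* (\int[mu]_(x in D) complex.Im (f x)).

Definition inner f g : R[i] := cintegral (fun x => f x * (g x)^*).

Definition ae_equal f g : Prop := {ae mu, forall x, D x -> f x = g x}.

Definition orthonormal_basis (I : Type) (e : I -> T -> R[i]) : Prop :=
  [/\ forall i, L2 (e i),
      forall i, inner (e i) (e i) = 1,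
      forall i i', i <> i' -> inner (e i) (e i') = 0 &
      forall f, L2 f -> forall eps : R, 0 < eps ->
        exists s : seq (R[i] * I),
          (sqdist f (fun x => \sum_(p <- s) p.1 * e p.2 x)%R < eps%:E)%E].

Definition closed_subspace (M : set (T -> R[i])) : Prop :=
  [/\ M `<=` L2,
      M (fun=> 0),
      forall (a : R[i]) f g, M f -> M g -> M (fun x => a * f x + g x) &
      forall f, L2 f ->
        (forall eps : R, 0 < eps ->
           exists2 g, M g & (sqdist f g < eps%:E)%E) ->
        M f].

(* L^2 is the Hilbert space orthogonal direct sum of the subspaces M p. *)
Definition orthogonal_direct_sum (P : Type) (M : P -> set (T -> R[i])) : Prop :=
  [/\ forall p, closed_subspace (M p),
      forall p q, p <> q -> forall f g, M p f -> M q g -> inner f g = 0 &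
      forall f, L2 f -> forall eps : R, 0 < eps ->
        exists2 s : seq (T -> R[i]),
          (forall i, (i < size s)%N -> exists p, M p (nth (fun=> 0) s i)) &
          (sqdist f (fun x => \sum_(h <- s) h x)%R < eps%:E)%E].

End scalar_L2.

(* The space L^2(X, H) of H-valued functions on (X, mu), for H = L^2(Y, nu).
   Measurability of F : X -> H is that of all the coefficients
   x |-> <F x, h>; when H is separable, as L^2(R^* ) is, this is strong
   measurability. *)
Section vector_L2.
Context d (T : measurableType d) d' (U : measurableType d') (R : realType).
Context (mu : {measure set T -> \bar R}) (X : set T).
Context (nu : {measure set U -> \bar R}) (Y : set U).
Implicit Types F G : T -> U -> R[i].

Definition vsqnorm F : \bar R := (\int[mu]_(x in X) sqnorm nu Y (F x))%E.

Definition vL2 : set (T -> U -> R[i]) :=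
  [set F | [/\ forall x, X x -> L2 nu Y (F x),
               forall h, L2 nu Y h ->
                 cmeasurable X (fun x => inner nu Y (F x) h) &
               (vsqnorm F < +oo)%E]].

Definition vinner F G : R[i] :=
  cintegral mu X (fun x => inner nu Y (F x) (G x)).

End vector_L2.

Section affine_group.
Context (R : realType).
Local Notation C := R[i].
Local Notation mR := (measurableTypeR R).

(* The pair (x, A) stands for [x, A]; it belongs to G_2 when A is invertible. *)
Local Notation affine := ('cV[R]_2 * 'M[R]_2)%type.

Definition G2 : set affine := [set g | g.2 \in unitmx].
Definition mulG2 (g h : affine) : affine := (g.1 + g.2 *m h.1, g.2 *m h.2).
Definition invG2 (g : affine) : affine := (- (invmx g.2 *m g.1), invmx g.2).

Definition leb_affine : set affine -> \bar R := (@leb_cV R \x @leb_mx R)%E.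
HB.instance Definition _ := Measure.on leb_affine.

Definition haar_G2_density (g : affine) : R :=
  (`|\det g.2| ^+ 2)^-1 * `|\det g.2|^-1.

Lemma haar_G2_density_ge0 g : 0 <= haar_G2_density g.
Proof. by rewrite mulr_ge0 ?invr_ge0 ?exprn_ge0. Qed.

Lemma measurable_haar_G2_density : measurable_fun setT haar_G2_density.
Proof.
have mdet : measurable_fun setT (fun g : affine => `|\det g.2|).
  apply: measurableT_comp => //.
  exact: (measurableT_comp (@measurable_det2 R) measurable_snd).
apply: measurable_funM; last exact: measurable_ge0_inv.
apply: measurable_ge0_inv; last exact: measurable_funX.
by move=> g; rewrite exprn_ge0.
Qed.

(* dx dmu_{GL_2}(A) / |det A| with dmu_{GL_2}(A) = dA / |det A|^2. *)
Definition haar_G2 : set affine -> \bar R :=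
  mdensity leb_affine haar_G2_density.
HB.instance Definition _ := Measure.copy haar_G2
  (Defs_mdensity__canonical__measure_function_Measure leb_affine
     measurable_haar_G2_density haar_G2_density_ge0).

Definition leftreg (g : affine) (f : affine -> C) : affine -> C :=
  fun y => f (mulG2 (invG2 g) y).

Definition Rstar : set mR := [set~ 0].
Definition O1 : set mR := [set~ 0].
Definition O : set 'rV[R]_2 := [set~ 0].

Lemma measurable_Rstar_density : measurable_fun setT (fun t : mR => `|t|^-1).
Proof. by apply: measurable_ge0_inv => //; exact: normr_measurable. Qed.

Lemma Rstar_density_ge0 (t : mR) : 0 <= `|t|^-1.
Proof. by rewrite invr_ge0. Qed.

Definition haar_Rstar : set mR -> \bar R :=
  mdensity (@lebesgue_measure R) (fun t : mR => `|t|^-1).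
HB.instance Definition _ := Measure.copy haar_Rstar
  (Defs_mdensity__canonical__measure_function_Measure (@lebesgue_measure R)
     measurable_Rstar_density Rstar_density_ge0).

Definition enorm (w : 'rV[R]_2) : R := Num.sqrt (w 0 0 ^+ 2 + w 0 1 ^+ 2).

Definition K0 : set 'M[R]_2 :=
  [set M | exists s t : R, 0 < s ^+ 2 + t ^+ 2 /\ M = mx2 s (- t) t s].
Definition K : set affine := [set k | k.1 = 0 /\ K0 k.2].

Definition gamma (w : 'rV[R]_2) : 'M[R]_2 :=
  (enorm w ^+ 2)^-1 *: mx2 (w 0 0) (- w 0 1) (w 0 1) (w 0 0).

Definition row10 : 'rV[R]_2 := delta_mx 0 0.

Lemma enorm_sqr w : enorm w ^+ 2 = w 0 0 ^+ 2 + w 0 1 ^+ 2.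
Proof. by rewrite sqr_sqrtr// addr_ge0 ?sqr_ge0. Qed.

Lemma measurable_K_density :
  measurable_fun setT (fun w : 'rV[R]_2 => (enorm w ^+ 2)^-1).
Proof.
apply: measurable_ge0_inv; first by move=> w; rewrite sqr_ge0.
under eq_fun do rewrite enorm_sqr.
by apply: measurable_funD; apply: measurable_funX; exact: measurable_mx_entry.
Qed.

Lemma K_density_ge0 (w : 'rV[R]_2) : 0 <= (enorm w ^+ 2)^-1.
Proof. by rewrite invr_ge0 sqr_ge0. Qed.

Lemma measurable_gamma : measurable_fun setT gamma.
Proof.
apply: measurable_fun_mx => i j; under eq_fun do rewrite !mxE.
apply: measurable_funM; first exact: measurable_K_density.
case: (i == 0); case: (j == 0); try exact: measurable_mx_entry.
by apply: measurableT_comp => //; exact: measurable_mx_entry.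
Qed.

Definition dw_over_sqnorm : set 'rV[R]_2 -> \bar R :=
  mdensity (@leb_rV R) (fun w : 'rV[R]_2 => (enorm w ^+ 2)^-1).
HB.instance Definition _ := Measure.copy dw_over_sqnorm
  (Defs_mdensity__canonical__measure_function_Measure (@leb_rV R)
     measurable_K_density K_density_ge0).

Definition Kpoint (w : 'rV[R]_2) : affine := (0, gamma w).

Lemma measurable_Kpoint : measurable_fun setT Kpoint.
Proof. by apply/measurable_fun_pair => //; exact: measurable_gamma. Qed.

(* The image of dw / |w|^2 by w |-> [0, gamma w]. *)
Definition haar_K : set affine -> \bar R := pushforward dw_over_sqnorm Kpoint.
HB.instance Definition _ := Measure.copy haar_K
  (measure_function_pushforward__canonical__measure_function_Measure
     dw_over_sqnorm measurable_Kpoint).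

Definition lower_factor (w : 'rV[R]_2) (A : 'M[R]_2) : 'M[R]_2 :=
  invmx (gamma w) *m A *m gamma (w *m A).
Definition u_ (w : 'rV[R]_2) (A : 'M[R]_2) : R := lower_factor w A 1 0.
Definition v_ (w : 'rV[R]_2) (A : 'M[R]_2) : R := lower_factor w A 1 1.

Lemma enorm_sqr_gt0 w : O w -> 0 < enorm w ^+ 2.
Proof.
move=> w0; rewrite lt0r sqr_ge0 andbT; apply/negP; rewrite enorm_sqr.
rewrite paddr_eq0 ?sqr_ge0// !sqrf_eq0 => /andP[/eqP w00 /eqP w01].
apply: w0; apply/rowP => j; rewrite mxE.
by case: j => -[|[|//]] j2; [rewrite -[RHS]w00|rewrite -[RHS]w01];
  congr (w _ _); apply: val_inj.
Qed.

Lemma mul_gamma w : O w -> w *m gamma w = row10.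
Proof.
move=> /enorm_sqr_gt0/lt0r_neq0 n0.
apply/rowP => j; rewrite !mxE !big_ord_recl big_ord0 !mxE/= addr0.
have -> : lift ord0 ord0 = 1 :> 'I_2 by apply: val_inj.
case: j => -[|[|//]] j2; move: n0; rewrite enorm_sqr /= => n0; by field.
Qed.

Lemma gamma_unitmx w : O w -> gamma w \in unitmx.
Proof.
move=> /enorm_sqr_gt0/lt0r_neq0 n0.
rewrite unitmxE unitfE detZ det_mx2 !mxE /= mulf_neq0//.
  by rewrite expf_neq0// invr_neq0.
by rewrite mulNr opprK -!expr2 -enorm_sqr.
Qed.

Lemma gammaK w : O w -> row10 *m invmx (gamma w) = w.
Proof. by move=> w0; rewrite -(mul_gamma w0) mulmxK// gamma_unitmx. Qed.

Lemma row10_lower_factor w A : O w -> A \in unitmx ->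
  row10 *m lower_factor w A = row10.
Proof.
move=> w0 uA; rewrite /lower_factor !mulmxA gammaK// mul_gamma//.
by move=> wA0; apply: w0; rewrite /= -(mulmxK uA w) wA0 mul0mx.
Qed.

Definition expi (x : R) : C := cos x +i* sin x.

Definition L2K : set (affine -> mR -> C) := vL2 haar_K K haar_Rstar Rstar.

(* The point [0, L] of K is [0, gamma w] for w = (1,0) L^-1. *)
Definition sigma (g : affine) (F : affine -> mR -> C) : affine -> mR -> C :=
  fun k t =>
    let: (x, A) := g in
    let w := row10 *m invmx k.2 in
    (Num.sqrt `|\det A| * enorm w / enorm (w *m A))%:C *
    expi (2 * pi * ((w *m x) 0 0 + t^-1 * u_ w A)) *
    F (0, gamma (w *m A)) ((v_ w A)^-1 * t).

(* Since |det gamma w| = |w|^-2, this is in L^2(K, L^2(R^* )) only if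
   w |-> |w| eta w is square integrable (or g = 0). *)
Definition coherent_vector (eta : 'rV[R]_2 -> C) (g : mR -> C) :
    affine -> mR -> C :=
  fun k nu => (eta (row10 *m invmx k.2))^* / `|\det k.2|%:C * g nu.

Definition V (E F : affine -> mR -> C) : affine -> C :=
  fun g => vinner haar_K K haar_Rstar Rstar F (sigma g E).

(* The image of L^2(K, L^2(R^* )) by V E. *)
Definition V_image (E : affine -> mR -> C) : set (affine -> C) :=
  [set f | cmeasurable G2 f /\
           exists2 F, L2K F & ae_equal haar_G2 G2 f (V E F)].

Definition leftreg_invariant (M : set (affine -> C)) : Prop :=
  forall g, G2 g -> forall f, M f -> M (leftreg g f).

Definition linear_isometry (T : (affine -> mR -> C) -> affine -> C) : Prop :=
  [/\ forall F, L2K F -> L2 haar_G2 G2 (T F),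
      forall (a : C) F F', L2K F -> L2K F' ->
        ae_equal haar_G2 G2 (T (fun k t => a * F k t + F' k t))
          (fun y => a * T F y + T F' y) &
      forall F, L2K F ->
        sqnorm haar_G2 G2 (T F) = vsqnorm haar_K K haar_Rstar Rstar F].

Definition intertwines_sigma_leftreg (T : (affine -> mR -> C) -> affine -> C)
    (M : set (affine -> C)) : Prop :=
  (forall F, L2K F -> M (T F)) /\
  (forall g, G2 g -> forall F, L2K F ->
     ae_equal haar_G2 G2 (T (sigma g F)) (leftreg g (T F))).

End affine_group.

(* Main.v *)
(* Put w for the coordinate of K given by gamma and t for that of R^*.  A vector
   F becomes phi(w, t) = |w|^-1 |t|^(-1/2) F[0, gamma w](t), a function in
   L^2(R^2 x R, dw dt), and V_E F [x, A] becomes |det A|^(3/2) (U H)(A, x), where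
     H(w, t, w', r) = phi(w, t) eta(w') conj(g(r))
   and the operator U does not depend on E.  The factor |det A|^(3/2) turns Haar
   measure on G_2 into Lebesgue measure.  U is the composition of the change of
   variables s = 1/t, v = t/r, a Fourier transform in s (with dual variable u),
   the change of variables w' = w A, v = v_{w,A}, u = u_{w,A}, and a Fourier
   transform in w (with dual variable x).  Each step, with its Jacobian, is
   isometric and has dense range, so everything is read off from the tensors
   phi (x) eta_i (x) conj g_j: they are orthogonal for distinct (i, j), hence so
   are the images, they are total in L^2(R^6), hence the images span L^2(G_2),
   and F |-> H is isometric, hence so is V_E, whose image is then complete.

   The Fourier integrals are kept absolutely convergent on the tensors that occur:
   the square integrability of |w| eta, forced by E in L^2(K, L^2(R^* )), and that
   of |t|^(-1/2) g compensate for the weights of the changes of variables. *)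
Require Import Defs.
From HB Require Import structures.
From mathcomp Require Import all_boot all_order all_algebra.
From mathcomp Require Import all_classical all_reals all_analysis.
From mathcomp Require Import measurable_realfun complex ring lra.

Set Implicit Arguments.
Unset Strict Implicit.
Unset Printing Implicit Defensive.
Import Order.TTheory GRing.Theory Num.Theory.
Import numFieldNormedType.Exports.
Local Open Scope classical_set_scope.
Local Open Scope ring_scope.
Local Open Scope complex_scope.

Local Notation Re := complex.Re.
Local Notation Im := complex.Im.

(** * Complex-valued functions and their integrals *)

(** Two obstacles shape the proof. First, an element of [L2K] is only weakly measurable: it gives an
    element of L^2 for each point of [K], with nothing known jointly in both variables, so no Fubini
    argument applies to it directly. Each vector is therefore replaced by a jointly measurable
    [phi], recovered by Lebesgue differentiation from its coefficients against intervals
    ([representable]); conversely every L^2 function of (w, t) comes from a vector after a change on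
    a null set. Second, V_E F is a pointwise integral, so the Fourier transforms are never extended
    by continuity: they stay integrals, isometric on the intersection of L^1 and L^2, and unitarity
    is replaced by isometry plus dense range. Integrability must then hold for all values of the
    parameters, which is the content of [regular]. Inner products of images are recovered from norms
    by polarization. The measures on [K], [Rstar], [G2], [O] and [O1] are carried to Lebesgue
    measure by one scheme, [weighted], in which the convention 1/0 = 0 or an indicator discards the
    exceptional points. *)

Section complex_numbers.
Context (R : realType).
Implicit Types z w : R[i].

Lemma ReD z w : Re (z + w) = Re z + Re w. Proof. by case: z; case: w. Qed.
Lemma ImD z w : Im (z + w) = Im z + Im w. Proof. by case: z; case: w. Qed.
Lemma ReN z : Re (- z) = - Re z. Proof. by case: z. Qed.
Lemma ImN z : Im (- z) = - Im z. Proof. by case: z. Qed.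
Lemma ReB z w : Re (z - w) = Re z - Re w. Proof. by rewrite ReD ReN. Qed.
Lemma ImB z w : Im (z - w) = Im z - Im w. Proof. by rewrite ImD ImN. Qed.
Lemma ReM z w : Re (z * w) = Re z * Re w - Im z * Im w.
Proof. by case: z; case: w. Qed.
Lemma ImM z w : Im (z * w) = Re z * Im w + Im z * Re w.
Proof. by case: z; case: w. Qed.
Lemma ReJ z : Re z^*%R = Re z. Proof. by case: z. Qed.
Lemma ImJ z : Im z^*%R = - Im z. Proof. by case: z. Qed.

Lemma conjM z w : (z * w)^*%R = z^*%R * w^*%R.
Proof. by case: z => a b; case: w => c e; congr Complex; rewrite /=; ring. Qed.

Lemma complexP z w : Re z = Re w -> Im z = Im w -> z = w.
Proof. by case: z; case: w => ? ? ? ? /= -> ->. Qed.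

Lemma csqr_ge0 z : 0 <= csqr z.
Proof. by rewrite addr_ge0 ?sqr_ge0. Qed.

Lemma csqrM z w : csqr (z * w) = csqr z * csqr w.
Proof. by rewrite /csqr ReM ImM; ring. Qed.

Lemma csqrN z : csqr (- z) = csqr z.
Proof. by rewrite /csqr ReN ImN !sqrrN. Qed.

Lemma csqrB z w : csqr (z - w) = csqr (w - z).
Proof. by rewrite -csqrN opprB. Qed.

Lemma csqrJ z : csqr z^*%R = csqr z.
Proof. by rewrite /csqr ReJ ImJ sqrrN. Qed.

Lemma csqr0 : csqr 0 = 0 :> R.
Proof. by rewrite /csqr /= expr0n /= addr0. Qed.

Lemma csqr_real (r : R) : csqr r%:C = r ^+ 2.
Proof. by rewrite /csqr /= expr0n /= addr0. Qed.

Lemma csqr_eq0 z : csqr z = 0 -> z = 0.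
Proof.
move/eqP; rewrite paddr_eq0 ?sqr_ge0// !sqrf_eq0 => /andP[/eqP a /eqP b].
exact: complexP.
Qed.

(** The difference of the two sides is [csqr (z - w)]: the parallelogram law. It serves as triangle
    inequality, so that distances can stay squared throughout, at the price of a factor 2. *)
Lemma csqrD_le z w : csqr (z + w) <= 2 * csqr z + 2 * csqr w.
Proof.
rewrite -subr_ge0 (_ : _ - _ = csqr (z - w)) ?csqr_ge0//.
by rewrite /csqr ReB ImB ReD ImD; ring.
Qed.

(** Stands in for the modulus, to which it is equivalent: it takes values in [R] instead of [R[i]],
    it is submultiplicative, and for measurable functions its integral is finite exactly when the
    real and imaginary parts are integrable ([cintegrableP]). *)
Definition n1 z : R := `|Re z| + `|Im z|.

Lemma n1_ge0 z : 0 <= n1 z.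
Proof. by rewrite addr_ge0. Qed.

Lemma n1M z w : n1 (z * w) <= n1 z * n1 w.
Proof.
rewrite /n1 ReM ImM.
have h1 := ler_normB (Re z * Re w) (Im z * Im w).
have h2 := ler_normD (Re z * Im w) (Im z * Re w).
by move: h1 h2; rewrite !normrM; nra.
Qed.

Lemma n1J z : n1 z^*%R = n1 z.
Proof. by rewrite /n1 ReJ ImJ normrN. Qed.

Lemma n1_csqr z : n1 z ^+ 2 <= 2 * csqr z.
Proof.
rewrite /csqr /n1 -(real_normK (num_real (Re z))) -(real_normK (num_real (Im z))).
have := sqr_ge0 (`|Re z| - `|Im z|); nra.
Qed.

Lemma n1M_le z w : n1 (z * w) <= csqr z + csqr w.
Proof.
apply: le_trans (n1M _ _) _.
have := n1_csqr z; have := n1_csqr w; have := sqr_ge0 (n1 z - n1 w); nra.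
Qed.

Lemma mul_conj_csqr z : z * z^*%R = (csqr z)%:C.
Proof. by apply: complexP; rewrite ?ReM ?ImM ReJ ImJ /= /csqr; ring. Qed.

Lemma expiD (x y : R) : expi (x + y) = expi x * expi y.
Proof. by apply: complexP; rewrite ?ReM ?ImM /= ?cosD ?sinD; ring. Qed.

Lemma conj_expi (x : R) : (expi x)^*%R = expi (- x).
Proof. by apply: complexP; rewrite /= ?cosN ?sinN. Qed.

Lemma csqr_expi (x : R) : csqr (expi x) = 1.
Proof. by rewrite /csqr /= cos2Dsin2. Qed.

Lemma n1_expi_le (x : R) : n1 (expi x) <= 2.
Proof.
rewrite /n1 /= (_ : 2 = 1 + 1)// lerD//.
  by rewrite ler_norml cos_geN1 cos_le1.
by rewrite ler_norml sin_geN1 sin_le1.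
Qed.

End complex_numbers.

Section complex_measurability.
Context d (T : measurableType d) (R : realType).
Implicit Types (D : set T) (f g : T -> R[i]).

Lemma cmeasurable_cst D (c : R[i]) : cmeasurable D (fun=> c).
Proof. by split; exact: measurable_cst. Qed.

Lemma cmeasurableD D f g : cmeasurable D f -> cmeasurable D g ->
  cmeasurable D (fun x => f x + g x).
Proof.
move=> [f1 f2] [g1 g2]; split.
  by under eq_fun do rewrite ReD; exact: measurable_funD.
by under eq_fun do rewrite ImD; exact: measurable_funD.
Qed.

Lemma cmeasurableN D f : cmeasurable D f -> cmeasurable D (fun x => - f x).
Proof.
move=> [f1 f2]; split.
  by under eq_fun do rewrite ReN; exact: measurable_funN.
by under eq_fun do rewrite ImN; exact: measurable_funN.
Qed.

Lemma cmeasurableB D f g : cmeasurable D f -> cmeasurable D g ->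
  cmeasurable D (fun x => f x - g x).
Proof. by move=> mf /cmeasurableN; exact: cmeasurableD. Qed.

Lemma cmeasurableM D f g : cmeasurable D f -> cmeasurable D g ->
  cmeasurable D (fun x => f x * g x).
Proof.
move=> [f1 f2] [g1 g2]; split.
  under eq_fun do rewrite ReM; apply: measurable_funB; exact: measurable_funM.
under eq_fun do rewrite ImM; apply: measurable_funD; exact: measurable_funM.
Qed.

Lemma cmeasurableJ D f : cmeasurable D f -> cmeasurable D (fun x => (f x)^*%R).
Proof.
move=> [f1 f2]; split.
  by under eq_fun do rewrite ReJ.
by under eq_fun do rewrite ImJ; exact: measurable_funN.
Qed.

Lemma cmeasurable_real D (r : T -> R) : measurable_fun D r ->
  cmeasurable D (fun x => (r x)%:C).
Proof. by move=> mr; split => //=; exact: measurable_cst. Qed.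

Lemma measurable_cos' : measurable_fun setT (@cos R).
Proof. by apply: continuous_measurable_fun; exact: continuous_cos. Qed.

Lemma measurable_sin' : measurable_fun setT (@sin R).
Proof. by apply: continuous_measurable_fun; exact: continuous_sin. Qed.

Lemma cmeasurable_expi D (r : T -> R) : measurable_fun D r ->
  cmeasurable D (fun x => expi (r x)).
Proof.
move=> mr; split => /=.
  exact: (measurableT_comp measurable_cos' mr).
exact: (measurableT_comp measurable_sin' mr).
Qed.

Lemma cmeasurable_sum D I (s : seq I) (F : I -> T -> R[i]) :
  (forall i, cmeasurable D (F i)) ->
  cmeasurable D (fun x => \sum_(i <- s) F i x).
Proof.
move=> mF; elim: s => [|i s ih].
  by under eq_fun do rewrite big_nil; exact: cmeasurable_cst.
by under eq_fun do rewrite big_cons; exact: cmeasurableD.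
Qed.

Lemma measurable_csqr D f : cmeasurable D f ->
  measurable_fun D (fun x => csqr (f x)).
Proof. by move=> [f1 f2]; apply: measurable_funD; exact: measurable_funX. Qed.

Lemma measurable_n1 D f : cmeasurable D f ->
  measurable_fun D (fun x => n1 (f x)).
Proof.
by move=> [f1 f2]; apply: measurable_funD; exact: measurableT_comp.
Qed.

Lemma cmeasurable_restrict D f : measurable D ->
  cmeasurable D f -> cmeasurable setT (fun x => if x \in D then f x else 0).
Proof.
move=> mD [f1 f2]; split.
  rewrite (_ : (fun x => _) = (fun x => Re (f x)) \_ D); first by apply/(measurable_restrictT _ mD).
  by apply/funext => x; rewrite patchE /=; case: ifP.
rewrite (_ : (fun x => _) = (fun x => Im (f x)) \_ D); first by apply/(measurable_restrictT _ mD).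
by apply/funext => x; rewrite patchE /=; case: ifP.
Qed.

Lemma eq_cmeasurable D f g : {in D, f =1 g} -> cmeasurable D f ->
  cmeasurable D g.
Proof.
move=> fg [f1 f2]; split.
  by apply: eq_measurable_fun f1 => x xD; rewrite fg.
by apply: eq_measurable_fun f2 => x xD; rewrite fg.
Qed.

Lemma cmeasurableS D D' f : measurable D -> D' `<=` D -> cmeasurable D f ->
  cmeasurable D' f.
Proof. by move=> mD DD [f1 f2]; split; exact: measurable_funS DD _. Qed.

(** Writing 1/r as r times the inverse of the nonnegative [r ^+ 2] reduces to [measurable_ge0_inv];
    the identity persists at r = 0 because 1/0 = 0. *)
Lemma measurable_inv (r : T -> R) D : measurable_fun D r ->
  measurable_fun D (fun x => (r x)^-1).
Proof.
move=> mr; rewrite (_ : (fun x => _) = (fun x => r x * (r x ^+ 2)^-1)).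
  apply: measurable_funM => //.
  have m2 : measurable_fun setT (fun y : R => (y ^+ 2)^-1).
    apply: measurable_ge0_inv; first by move=> y; exact: sqr_ge0.
    exact: measurable_funX.
  exact: (measurableT_comp m2 mr).
apply/funext => x; have [->|x0] := eqVneq (r x) 0; first by rewrite invr0 mul0r.
by rewrite expr2 invfM mulrA mulfV// mul1r.
Qed.

Lemma measurable_sqrt' (r : T -> R) D : measurable_fun D r ->
  measurable_fun D (fun x => Num.sqrt (r x)).
Proof.
move=> mr; have ms : measurable_fun setT (@Num.sqrt R).
  by apply: continuous_measurable_fun; exact: sqrt_continuous.
exact: (measurableT_comp ms mr).
Qed.

End complex_measurability.

Lemma cmeasurable_comp d d' (T : measurableType d) (U : measurableType d')
    (R : realType) (f : U -> R[i]) (phi : T -> U) :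
  cmeasurable setT f -> measurable_fun setT phi ->
  cmeasurable setT (fun x => f (phi x)).
Proof.
by move=> [f1 f2] mphi; split; [exact: (measurableT_comp f1 mphi)|exact:
  (measurableT_comp f2 mphi)].
Qed.

Section complex_integral.
Context d (T : measurableType d) (R : realType) (mu : {measure set T -> \bar R}).
Implicit Types (f g : T -> R[i]).

Local Notation N2 := (sqnorm mu setT).
Local Notation cint := (cintegral mu setT).

Lemma sqnorm_ge0 D f : (0 <= sqnorm mu D f)%E.
Proof. by apply: integral_ge0 => x _; rewrite lee_fin csqr_ge0. Qed.

Lemma measurable_csqrE f : cmeasurable setT f ->
  measurable_fun setT (fun x => (csqr (f x))%:E).
Proof. by move=> /measurable_csqr mf; exact/measurable_EFinP. Qed.

Lemma sqnormD_le f g : cmeasurable setT f -> cmeasurable setT g ->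
  (N2 (fun x => f x + g x)%R <= 2%:E * N2 f + 2%:E * N2 g)%E.
Proof.
move=> mf mg; rewrite /sqnorm.
have c0 (h : T -> R[i]) x : setT x -> (0 <= (csqr (h x))%:E)%E by rewrite lee_fin csqr_ge0.
rewrite -!ge0_integralZl//; try exact: measurable_csqrE; try exact: c0.
have m2 (h : T -> R[i]) : cmeasurable setT h ->
    measurable_fun setT (fun x => 2%:E * (csqr (h x))%:E)%E.
  by move=> mh; apply: measurable_funeM; exact: measurable_csqrE.
rewrite -ge0_integralD//; try exact: m2; last 2 first.
- by move=> x _; rewrite mule_ge0// c0.
- by move=> x _; rewrite mule_ge0// c0.
apply: ge0_le_integral => //.
- by move=> x _; exact: (c0 (fun x => f x + g x)).
- exact/measurable_csqrE/cmeasurableD.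
- by apply: emeasurable_funD; exact: m2.
- by move=> x _; rewrite -!EFinM -EFinD lee_fin csqrD_le.
Qed.

Lemma sqnormZ c f : cmeasurable setT f ->
  N2 (fun x => c * f x) = ((csqr c)%:E * N2 f)%E.
Proof.
move=> mf; rewrite /sqnorm -ge0_integralZl//.
- by apply: eq_integral => x _; rewrite csqrM EFinM.
- exact: measurable_csqrE.
- by move=> x _; rewrite lee_fin csqr_ge0.
- by rewrite lee_fin csqr_ge0.
Qed.

Lemma sqdistC f g : sqdist mu setT f g = sqdist mu setT g f.
Proof. by apply: eq_integral => x _; rewrite csqrB. Qed.

Lemma sqdist_triangle f g h : cmeasurable setT f -> cmeasurable setT g ->
  cmeasurable setT h -> (sqdist mu setT f h <=
    2%:E * sqdist mu setT f g + 2%:E * sqdist mu setT g h)%E.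
Proof.
move=> mf mg mh; rewrite /sqdist (_ : (fun x => f x - h x) =
  (fun x => (f x - g x) + (g x - h x))).
  by apply: sqnormD_le; exact: cmeasurableB.
by apply/funext => x; rewrite addrA subrK.
Qed.

Lemma L2D f g : L2 mu setT f -> L2 mu setT g ->
  L2 mu setT (fun x => f x + g x).
Proof.
move=> [mf nf] [mg ng]; split; first exact: cmeasurableD.
apply: le_lt_trans (sqnormD_le mf mg) _.
by rewrite lte_add_pinfty// lte_mul_pinfty.
Qed.

Lemma L2Z c f : L2 mu setT f -> L2 mu setT (fun x => c * f x).
Proof.
move=> [mf nf]; split; first exact/cmeasurableM/mf/cmeasurable_cst.
by rewrite sqnormZ// lte_mul_pinfty// lee_fin csqr_ge0.
Qed.

Lemma L20 : L2 mu setT (fun=> 0 : R[i]).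
Proof.
split; first exact: cmeasurable_cst.
by rewrite /sqnorm; under eq_integral do rewrite csqr0; rewrite integral0.
Qed.

Definition cintegrable f : Prop :=
  cmeasurable setT f /\ (\int[mu]_x (n1 (f x))%:E < +oo)%E.

Lemma cintegrableP f : cintegrable f <->
  mu.-integrable setT (fun x => (Re (f x))%:E) /\
  mu.-integrable setT (fun x => (Im (f x))%:E).
Proof.
split=> [[[f1 f2] foo]|].
  split; apply/integrableP; split; try exact/measurable_EFinP;
    apply: le_lt_trans foo; apply: ge0_le_integral => //;
    try exact/measurable_EFinP/measurable_n1;
    try (by apply: measurableT_comp => //; exact/measurable_EFinP);
    by move=> x _; rewrite abse_EFin lee_fin /n1 ?lerDl ?lerDr.
move=> [/integrableP[/measurable_EFinP m1 i1] /integrableP[/measurable_EFinP m2 i2]].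
split; first by split.
rewrite (_ : (fun x => _) =
  (fun x => `|(Re (f x))%:E| + `|(Im (f x))%:E|)%E).
  rewrite ge0_integralD//.
  - exact: lte_add_pinfty.
  - by apply: measurableT_comp => //; exact/measurable_EFinP.
  - by apply: measurableT_comp => //; exact/measurable_EFinP.
by apply/funext => x; rewrite !abse_EFin -EFinD.
Qed.

Lemma cintegrable_le f (h : T -> \bar R) : cmeasurable setT f ->
  measurable_fun setT h -> (forall x, (n1 (f x))%:E <= h x)%E ->
  (\int[mu]_x h x < +oo)%E -> cintegrable f.
Proof.
move=> mf mh fh hoo; split => //; apply: le_lt_trans hoo.
apply: ge0_le_integral => //.
- by move=> x _; rewrite lee_fin n1_ge0.
- exact/measurable_EFinP/measurable_n1.
Qed.

Lemma cintegrableD f g : cintegrable f -> cintegrable g ->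
  cintegrable (fun x => f x + g x).
Proof.
move=> /cintegrableP[f1 f2] /cintegrableP[g1 g2]; apply/cintegrableP; split.
  by under eq_fun do rewrite ReD EFinD; exact: integrableD.
by under eq_fun do rewrite ImD EFinD; exact: integrableD.
Qed.

Lemma cintegrableZ c f : cintegrable f -> cintegrable (fun x => c * f x).
Proof.
move=> /cintegrableP[f1 f2]; apply/cintegrableP; split.
  under eq_fun do rewrite ReM EFinB !EFinM.
  by apply: integrableB => //; exact: integrableZl.
under eq_fun do rewrite ImM EFinD !EFinM.
by apply: integrableD => //; exact: integrableZl.
Qed.

Lemma cintegrable0 : cintegrable (fun=> 0).
Proof.
split; first exact: cmeasurable_cst.
by under eq_integral do rewrite /n1 /= normr0 addr0; rewrite integral0.
Qed.

(** The pointwise bound [n1M_le] by the sum of the two squares takes the place of the Cauchy-Schwarz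
    inequality. *)
Lemma cintegrableM_L2 f g : L2 mu setT f -> L2 mu setT g ->
  cintegrable (fun x => f x * g x).
Proof.
move=> [mf nf] [mg ng].
apply: (@cintegrable_le _ (fun x => (csqr (f x))%:E + (csqr (g x))%:E)%E).
- exact: cmeasurableM.
- by apply: emeasurable_funD; exact: measurable_csqrE.
- by move=> x; rewrite -EFinD lee_fin n1M_le.
- rewrite ge0_integralD//; try exact: measurable_csqrE.
  + exact: lte_add_pinfty.
  + by move=> x _; rewrite lee_fin csqr_ge0.
  + by move=> x _; rewrite lee_fin csqr_ge0.
Qed.

Lemma cintegrable_phase f (r : T -> R) : measurable_fun setT r ->
  cintegrable f -> cintegrable (fun x => expi (r x) * f x).
Proof.
move=> mr [mf nf].
apply: (@cintegrable_le _ (fun x => 2%:E * (n1 (f x))%:E)%E).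
- by apply: cmeasurableM => //; exact: cmeasurable_expi.
- by apply: measurable_funeM; exact/measurable_EFinP/measurable_n1.
- move=> x; rewrite -EFinM lee_fin (le_trans (n1M _ _))//.
  by rewrite ler_wpM2r ?n1_ge0 ?n1_expi_le.
- rewrite ge0_integralZl//.
  + by rewrite lte_mul_pinfty.
  + exact/measurable_EFinP/measurable_n1.
  + by move=> x _; rewrite lee_fin n1_ge0.
Qed.

Lemma cintD f g : cintegrable f -> cintegrable g ->
  cint (fun x => f x + g x) = cint f + cint g.
Proof.
move=> /cintegrableP[f1 f2] /cintegrableP[g1 g2]; apply: complexP => /=.
  by under eq_Rintegral do rewrite ReD; rewrite RintegralD.
by under eq_Rintegral do rewrite ImD; rewrite RintegralD.
Qed.

Lemma cintZ c f : cintegrable f -> cint (fun x => c * f x) = c * cint f.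
Proof.
move=> /cintegrableP[f1 f2].
have zl (a : R) (h : T -> R) : mu.-integrable setT (fun x => (h x)%:E) ->
    mu.-integrable setT (fun x => (a * h x)%:E) by exact: integrableZl.
apply: complexP => /=.
  under eq_Rintegral do rewrite ReM.
  rewrite RintegralB//; try exact: zl.
  by rewrite !RintegralZl// ReM.
under eq_Rintegral do rewrite ImM.
rewrite RintegralD//; try exact: zl.
by rewrite !RintegralZl// ImM.
Qed.

Lemma eq_cint f g : f =1 g -> cint f = cint g.
Proof. by move=> fg; congr cintegral; exact/funext. Qed.

Lemma n1_cint_le f : cintegrable f ->
  ((n1 (cint f))%:E <= \int[mu]_x (n1 (f x))%:E)%E.
Proof.
move=> cf; have [[f1 f2] _] := cf; have /cintegrableP[i1 i2] := cf.
rewrite /n1 /= EFinD.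
under eq_integral do rewrite EFinD.
rewrite ge0_integralD//; first by rewrite leeD// EFin_normr_Rintegral// le_abse_integral//;
  exact/measurable_EFinP.
- by apply/measurable_EFinP; exact: measurableT_comp.
- by apply/measurable_EFinP; exact: measurableT_comp.
Qed.

Lemma ae_eq_cint f g : cmeasurable setT f -> cmeasurable setT g ->
  {ae mu, forall x, f x = g x} -> cint f = cint g.
Proof.
move=> [f1 f2] [g1 g2] fg; apply: complexP => /=.
  congr fine; apply: ae_eq_integral => //; try exact/measurable_EFinP.
  by apply: filterS fg => x /= ->.
congr fine; apply: ae_eq_integral => //; try exact/measurable_EFinP.
by apply: filterS fg => x /= ->.
Qed.

Lemma ae_eq_sqnorm f g : cmeasurable setT f -> cmeasurable setT g ->
  {ae mu, forall x, f x = g x} -> N2 f = N2 g.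
Proof.
move=> mf mg fg; apply: ae_eq_integral => //; try exact: measurable_csqrE.
by apply: filterS fg => x /= ->.
Qed.

Lemma sqnorm_eq0 f : cmeasurable setT f -> N2 f = 0%E ->
  {ae mu, forall x, f x = 0}.
Proof.
move=> mf; rewrite /sqnorm => f0.
have [_ ] := ae_eq_integral_abs mu measurableT (measurable_csqrE mf).
move=> _.
have := (ae_eq_integral_abs mu measurableT (measurable_csqrE mf)).1.
move=> /(_ _)[|].
  by rewrite -[RHS]f0; apply: eq_integral => x _; rewrite gee0_abs ?lee_fin ?csqr_ge0.
move=> N [mN N0 h]; exists N; split => // x /= nx; apply: h => /= hx.
by apply: nx; apply: csqr_eq0; have [] := hx I.
Qed.

End complex_integral.

Section nonneg_integral.
Context d (T : measurableType d) (R : realType) (mu : {measure set T -> \bar R}).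
Implicit Types f g : T -> \bar R.

Lemma le_integralT f g : measurable_fun setT f -> measurable_fun setT g ->
  (forall x, 0 <= f x)%E -> (forall x, f x <= g x)%E ->
  (\int[mu]_x f x <= \int[mu]_x g x)%E.
Proof. by move=> mf mg f0 fg; exact: ge0_le_integral. Qed.

Lemma integralDT f g : measurable_fun setT f -> measurable_fun setT g ->
  (forall x, 0 <= f x)%E -> (forall x, 0 <= g x)%E ->
  (\int[mu]_x (f x + g x) = \int[mu]_x f x + \int[mu]_x g x)%E.
Proof. by move=> mf mg f0 g0; exact: ge0_integralD. Qed.

Lemma integralZT (k : R) f : measurable_fun setT f -> (0 <= k)%R ->
  (forall x, 0 <= f x)%E ->
  (\int[mu]_x (k%:E * f x) = k%:E * \int[mu]_x f x)%E.
Proof. by move=> mf k0 f0; exact: ge0_integralZl_EFin. Qed.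

Lemma integral_lty_ae f : measurable_fun setT f -> (forall x, 0 <= f x)%E ->
  (\int[mu]_x f x < +oo)%E -> {ae mu, forall x, f x < +oo}%E.
Proof.
move=> mf f0 foo.
have /integrable_ae : mu.-integrable setT f.
  apply/integrableP; split => //.
  by under eq_integral do rewrite gee0_abs//.
move=> /(_ measurableT); apply: filterS => x /= /(_ I).
by rewrite ge0_fin_numE.
Qed.

Lemma ae_eq_ge0_integral f g : measurable_fun setT f -> measurable_fun setT g ->
  (forall x, 0 <= f x)%E -> (forall x, 0 <= g x)%E ->
  {ae mu, forall x, f x = g x} -> (\int[mu]_x f x = \int[mu]_x g x)%E.
Proof.
move=> mf mg f0 g0 fg; apply: ge0_ae_eq_integral => //.
by apply: filterS fg => x /= ->.
Qed.

Lemma integral_eq0_ae f : measurable_fun setT f -> (forall x, 0 <= f x)%E ->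
  (\int[mu]_x f x = 0)%E -> {ae mu, forall x, f x = 0}%E.
Proof.
move=> mf f0 i0.
have /(ae_eq_integral_abs mu measurableT mf) :
    (\int[mu]_(x in setT) `|f x| = 0)%E.
  by rewrite -[RHS]i0; apply: eq_integral => x _; rewrite gee0_abs.
by apply: filterS => x /= /(_ I).
Qed.

End nonneg_integral.

(** * Integrals with a parameter: measurability, Tonelli and Fubini *)

Section parameter_integral.
Context d1 d2 (T1 : measurableType d1) (T2 : measurableType d2) (R : realType).
Variables (m1 : {sigma_finite_measure set T1 -> \bar R}).
Variables (m2 : {sigma_finite_measure set T2 -> \bar R}).

Lemma measurable_fun_pairr d (T : measurableType d) (f : T1 * T2 -> T) (y : T2) :
  measurable_fun setT f -> measurable_fun setT (fun x => f (x, y)).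
Proof. by move=> mf; exact: (measurableT_comp mf (pair2_measurable y)). Qed.

Lemma cmeasurable_pairl (f : T1 * T2 -> R[i]) x :
  cmeasurable setT f -> cmeasurable setT (fun y => f (x, y)).
Proof. by move=> mf; apply: cmeasurable_comp mf (pair1_measurable x). Qed.

Lemma measurable_integralr (f : T1 * T2 -> \bar R) :
  measurable_fun setT f -> (forall z, 0 <= f z)%E ->
  measurable_fun setT (fun x => \int[m2]_y f (x, y))%E.
Proof. by move=> mf f0; exact: measurable_fun_fubini_tonelli_F. Qed.

Lemma measurable_integrall (f : T1 * T2 -> \bar R) :
  measurable_fun setT f -> (forall z, 0 <= f z)%E ->
  measurable_fun setT (fun y => \int[m1]_x f (x, y))%E.
Proof. by move=> mf f0; exact: measurable_fun_fubini_tonelli_G. Qed.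

(** The extended integral is the difference of the integrals of the positive and negative parts,
    each measurable in the parameter by Tonelli, and [fine] is measurable. The argument covers the
    parameters at which the integral diverges and [fine] returns a default value. *)
Lemma measurable_Rintegralr (f : T1 * T2 -> R) :
  measurable_fun setT f -> measurable_fun setT (fun x => \int[m2]_y f (x, y)).
Proof.
move=> mf; rewrite /Rintegral.
apply: (measurableT_comp (@fine_measurable R setT measurableT)).
have mEf : measurable_fun setT (EFin \o f) by exact/measurable_EFinP.
rewrite (_ : (fun x => _) = (fun x =>
  \int[m2]_y (EFin \o f)^\+ (x, y) - \int[m2]_y (EFin \o f)^\- (x, y)))%E.
  apply: emeasurable_funB; apply: measurable_integralr => //.
    exact: measurable_funepos.
  exact: measurable_funeneg.
apply/funext => x; rewrite [LHS]integralE.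
by congr (_ - _)%E; apply: eq_integral => y _; rewrite ?funeposE ?funenegE.
Qed.

Lemma cmeasurable_cintr (f : T1 * T2 -> R[i]) : cmeasurable setT f ->
  cmeasurable setT (fun x => cintegral m2 setT (fun y => f (x, y))).
Proof.
move=> [f1 f2]; split => /=.
  exact: (measurable_Rintegralr f1).
exact: (measurable_Rintegralr f2).
Qed.

Lemma cintegrable_prodP (f : T1 * T2 -> R[i]) : cmeasurable setT f ->
  (\int[m1]_x \int[m2]_y (n1 (f (x, y)))%:E < +oo)%E ->
  cintegrable (m1 \x m2)%E f.
Proof.
move=> mf; rewrite -(fubini_tonelli1 (fun z => (n1 (f z))%:E))//.
- exact/measurable_EFinP/measurable_n1.
- by move=> x; rewrite lee_fin n1_ge0.
Qed.

(** Fubini for extended integrals is transferred through [fine]: for almost every value of the outer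
    variable the inner integral is finite, and there [fine] loses nothing. *)
Let RFubini (f : T1 * T2 -> R) :
  (m1 \x m2)%E.-integrable setT (fun z => (f z)%:E) ->
  \int[m1]_x \int[m2]_y f (x, y) = \int[m2]_y \int[m1]_x f (x, y).
Proof.
move=> fi.
have mf : measurable_fun setT f by apply/measurable_EFinP; exact: measurable_int fi.
have mEf : measurable_fun setT (fun z => (f z)%:E) by exact/measurable_EFinP.
have mR1 : measurable_fun setT (fun x => \int[m2]_y f (x, y)).
  exact: measurable_Rintegralr.
have mR2 : measurable_fun setT (fun y => \int[m1]_x f (x, y)).
  have mswap : measurable_fun setT (fun z : T2 * T1 => f (z.2, z.1)).
    by apply: (measurableT_comp mf); exact/measurable_fun_pair.
  rewrite /Rintegral.
  apply: (measurableT_comp (@fine_measurable R setT measurableT)).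
  have mEf' : measurable_fun setT (EFin \o f) by exact/measurable_EFinP.
  rewrite (_ : (fun x => _) = (fun y =>
    \int[m1]_x (EFin \o f)^\+ (x, y) - \int[m1]_x (EFin \o f)^\- (x, y)))%E.
    apply: emeasurable_funB; apply: measurable_integrall => //.
      exact: measurable_funepos.
    exact: measurable_funeneg.
  apply/funext => y; rewrite [LHS]integralE.
  by congr (_ - _)%E; apply: eq_integral => x _; rewrite ?funeposE ?funenegE.
have := Fubini fi.
rewrite {1 3}/Rintegral => FE; congr fine.
transitivity (\int[m1]_x \int[m2]_y (f (x, y))%:E)%E.
  apply: ae_eq_integral => //; first exact/measurable_EFinP.
    exact: (measurable_fubini_F fi).
  apply: filterS (ae_integrable1 fi) => x /= xi _.
  by rewrite /Rintegral fineK//; exact: integrable_fin_num.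
rewrite FE.
apply: ae_eq_integral => //; last 1 first.
  apply: filterS (ae_integrable2 fi) => x /= xi _.
  by rewrite /Rintegral fineK//; exact: integrable_fin_num.
  exact: (measurable_fubini_G fi).
exact/measurable_EFinP.
Qed.

Lemma cFubini (f : T1 * T2 -> R[i]) : cintegrable (m1 \x m2)%E f ->
  cintegral m1 setT (fun x => cintegral m2 setT (fun y => f (x, y))) =
  cintegral m2 setT (fun y => cintegral m1 setT (fun x => f (x, y))).
Proof.
move=> /cintegrableP[f1 f2]; apply: complexP => /=.
  exact: RFubini f1.
exact: RFubini f2.
Qed.

Lemma ae_cintegrable (f : T1 * T2 -> R[i]) : cmeasurable setT f ->
  (\int[m1]_x \int[m2]_y (n1 (f (x, y)))%:E < +oo)%E ->
  {ae m1, forall x, cintegrable m2 (fun y => f (x, y))}.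
Proof.
move=> mf foo.
have mn1 : measurable_fun setT (fun z => (n1 (f z))%:E).
  exact/measurable_EFinP/measurable_n1.
have n10 z : (0 <= (n1 (f z))%:E)%E by rewrite lee_fin n1_ge0.
have := integral_lty_ae (measurable_integralr mn1 n10) _ foo.
move=> /(_ _)[|N [mN N0 h]].
  by move=> x; exact: integral_ge0.
exists N; split => // x /= nx; apply: h => /= hx; apply: nx.
by split => //; exact: cmeasurable_pairl.
Qed.

Lemma cintegrable_cintr (f : T1 * T2 -> R[i]) : cmeasurable setT f ->
  (\int[m1]_x \int[m2]_y (n1 (f (x, y)))%:E < +oo)%E ->
  cintegrable m1 (fun x => cintegral m2 setT (fun y => f (x, y))).
Proof.
move=> mf foo; split; first exact: cmeasurable_cintr.
apply: le_lt_trans foo.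
have mn1 : measurable_fun setT (fun z => (n1 (f z))%:E).
  exact/measurable_EFinP/measurable_n1.
have n10 z : (0 <= (n1 (f z))%:E)%E by rewrite lee_fin n1_ge0.
apply: le_integralT.
- exact/measurable_EFinP/measurable_n1/cmeasurable_cintr.
- exact: (measurable_integralr mn1 n10).
- by move=> x; rewrite lee_fin n1_ge0.
- move=> x.
  have [xoo|] := ltP (\int[m2]_y (n1 (f (x, y)))%:E)%E +oo%E.
    by apply: n1_cint_le; split => //; exact: cmeasurable_pairl.
  by apply: le_trans; rewrite leey.
Qed.

Lemma sqnorm_prod1 (f : T1 * T2 -> R[i]) : cmeasurable setT f ->
  sqnorm (m1 \x m2)%E setT f =
  (\int[m1]_x sqnorm m2 setT (fun y => f (x, y)))%E.
Proof.
move=> mf; rewrite /sqnorm fubini_tonelli1//; first exact: measurable_csqrE.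
by move=> z; rewrite lee_fin csqr_ge0.
Qed.

Lemma sqnorm_prod2 (f : T1 * T2 -> R[i]) : cmeasurable setT f ->
  sqnorm (m1 \x m2)%E setT f =
  (\int[m2]_y sqnorm m1 setT (fun x => f (x, y)))%E.
Proof.
move=> mf; rewrite /sqnorm fubini_tonelli2//; first exact: measurable_csqrE.
by move=> z; rewrite lee_fin csqr_ge0.
Qed.

Lemma measurable_sqnormr (f : T1 * T2 -> R[i]) : cmeasurable setT f ->
  measurable_fun setT (fun x => sqnorm m2 setT (fun y => f (x, y))).
Proof.
move=> mf; apply: (measurable_integralr (f := fun z => (csqr (f z))%:E)).
  exact: measurable_csqrE.
by move=> z; rewrite lee_fin csqr_ge0.
Qed.

End parameter_integral.

Section transport.
Context d1 d2 (T1 : measurableType d1) (T2 : measurableType d2) (R : realType).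
Variables (m1 : {measure set T1 -> \bar R}) (m2 : {measure set T2 -> \bar R}).
Variables (phi : T1 -> T2) (w : T1 -> R).
Hypothesis w0 : forall x, 0 <= w x.
Hypothesis H : forall f : T2 -> \bar R, measurable_fun setT f ->
  (forall y, 0 <= f y)%E -> (\int[m1]_x ((w x)%:E * f (phi x)) = \int[m2]_y f y)%E.

Let Rtransport (f : T2 -> R) : measurable_fun setT f ->
  \int[m1]_x (w x * f (phi x)) = \int[m2]_y f y.
Proof.
move=> mf; congr fine; rewrite integralE [RHS]integralE.
have mEf : measurable_fun setT (EFin \o f) by exact/measurable_EFinP.
rewrite -(H (measurable_funepos mEf))// -(H (measurable_funeneg mEf))//.
congr (_ - _)%E; apply: eq_integral => x _.
  by rewrite !funeposE /= EFinM maxe_pMr ?lee_fin// mule0.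
by rewrite !funenegE maxe_pMr ?lee_fin// mule0 muleN -EFinM.
Qed.

(** Changes of variables are established for nonnegative functions only. Since [w] is nonnegative it
    commutes with taking positive and negative parts, which extends them to complex integrands; the
    identity holds even between default values when an integral diverges. *)
Lemma cint_transport (f : T2 -> R[i]) : cmeasurable setT f ->
  cintegral m1 setT (fun x => (w x)%:C * f (phi x)) = cintegral m2 setT f.
Proof.
move=> [f1 f2]; apply: complexP => /=.
  rewrite -(Rtransport f1); apply: eq_Rintegral => x _.
  by rewrite ReM /= mul0r subr0.
rewrite -(Rtransport f2); apply: eq_Rintegral => x _.
by rewrite ImM /= mul0r addr0.
Qed.

End transport.

Section tonelli_reorder.
Context d1 d2 d3 (T1 : measurableType d1) (T2 : measurableType d2)
  (T3 : measurableType d3) (R : realType).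
Variables (m1 : {sigma_finite_measure set T1 -> \bar R}).
Variables (m2 : {sigma_finite_measure set T2 -> \bar R}).
Variables (m3 : {sigma_finite_measure set T3 -> \bar R}).

Lemma tonelli_swap (f : T1 * T2 -> \bar R) : measurable_fun setT f ->
  (forall z, 0 <= f z)%E ->
  (\int[m1]_x \int[m2]_y f (x, y) = \int[m2]_y \int[m1]_x f (x, y))%E.
Proof. by move=> mf f0; exact: fubini_tonelli. Qed.

End tonelli_reorder.

(** * Changes of variables for Lebesgue measure *)

Section measurability_closure.
Context d (T : measurableType d) (R : realType).
Implicit Types f g : T -> R.

Lemma mf_add D f g : measurable_fun D f -> measurable_fun D g ->
  measurable_fun D (fun x => f x + g x).
Proof. exact: measurable_funD. Qed.

Lemma mf_mul D f g : measurable_fun D f -> measurable_fun D g ->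
  measurable_fun D (fun x => f x * g x).
Proof. exact: measurable_funM. Qed.

Lemma mf_opp D f : measurable_fun D f -> measurable_fun D (fun x => - f x).
Proof. exact: measurable_funN. Qed.

Lemma mf_exp D f n : measurable_fun D f -> measurable_fun D (fun x => f x ^+ n).
Proof. exact: measurable_funX. Qed.

Lemma mf_norm D f : measurable_fun D f -> measurable_fun D (fun x => `|f x|).
Proof. by move=> mf; exact: measurableT_comp. Qed.

Lemma mf_emul D (f g : T -> \bar R) : measurable_fun D f -> measurable_fun D g ->
  measurable_fun D (fun x => f x * g x)%E.
Proof. exact: emeasurable_funM. Qed.

Lemma mf_eadd D (f g : T -> \bar R) : measurable_fun D f -> measurable_fun D g ->
  measurable_fun D (fun x => f x + g x)%E.
Proof. exact: emeasurable_funD. Qed.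

Lemma mf_EFin D f : measurable_fun D f -> measurable_fun D (fun x => (f x)%:E).
Proof. by move=> mf; exact/measurable_EFinP. Qed.

Lemma mf_fst d1 d2 (T1 : measurableType d1) (T2 : measurableType d2)
  (f : T -> T1 * T2) : measurable_fun setT f -> measurable_fun setT (fun x => (f x).1).
Proof. exact: (measurableT_comp measurable_fst). Qed.

Lemma mf_snd d1 d2 (T1 : measurableType d1) (T2 : measurableType d2)
  (f : T -> T1 * T2) : measurable_fun setT f -> measurable_fun setT (fun x => (f x).2).
Proof. exact: (measurableT_comp measurable_snd). Qed.

Lemma mf_pair d1 d2 (T1 : measurableType d1) (T2 : measurableType d2)
  (f : T -> T1) (g : T -> T2) : measurable_fun setT f -> measurable_fun setT g ->
  measurable_fun setT (fun x => (f x, g x)).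
Proof. by move=> mf mg; exact/measurable_fun_pair. Qed.

End measurability_closure.

Lemma mf_comp d d' d'' (T : measurableType d) (U : measurableType d')
  (W : measurableType d'') (f : U -> W) (g : T -> U) :
  measurable_fun setT f -> measurable_fun setT g ->
  measurable_fun setT (fun x => f (g x)).
Proof. exact: measurableT_comp. Qed.

(** One step of a syntax-directed proof of measurability: remove the outermost operation, or close
    the goal with a hypothesis on the function applied. Composite maps have to be unfolded
    beforehand. *)
Ltac mfun1 := match goal with
  | H : measurable_fun _ ?f |- measurable_fun _ ?f => exact H
  | H : cmeasurable _ ?f |- cmeasurable _ ?f => exact H
  | |- measurable_fun _ (fun _ => ?c) => exact: measurable_cst
  | |- measurable_fun _ (fun x => x) => exact: measurable_id
  | |- measurable_fun _ fst => exact: measurable_fst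
  | |- measurable_fun _ snd => exact: measurable_snd
  | |- measurable_fun _ (pair _) => exact: pair1_measurable
  | |- measurable_fun _ (@Num.norm _ _) => apply: (mf_norm (f := fun x => x))
  | |- measurable_fun _ (@GRing.inv _) => apply: (measurable_inv (r := fun x => x))
  | |- measurable_fun _ (fun x => fst x) => exact: measurable_fst
  | |- measurable_fun _ (fun x => snd x) => exact: measurable_snd
  | |- measurable_fun _ (fun x => EFin (@?f x)) => apply: mf_EFin
  | |- measurable_fun _ (fun x => mule (@?f x) (@?g x)) => apply: mf_emul
  | |- measurable_fun _ (fun x => adde (@?f x) (@?g x)) => apply: mf_eadd
  | |- measurable_fun _ (fun x => GRing.add (@?f x) (@?g x)) => apply: mf_add
  | |- measurable_fun _ (fun x => GRing.mul (@?f x) (@?g x)) => apply: mf_mul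
  | |- measurable_fun _ (fun x => GRing.opp (@?f x)) => apply: mf_opp
  | |- measurable_fun _ (fun x => GRing.exp (@?f x) _) => apply: mf_exp
  | |- measurable_fun _ (fun x => GRing.inv (@?f x)) => apply: measurable_inv
  | |- measurable_fun _ (fun x => Num.norm (@?f x)) => apply: mf_norm
  | |- measurable_fun _ (fun x => Num.sqrt (@?f x)) => apply: measurable_sqrt'
  | |- measurable_fun _ (fun x => csqr (@?f x)) => apply: measurable_csqr
  | |- measurable_fun _ (fun x => n1 (@?f x)) => apply: measurable_n1
  | |- measurable_fun _ (fun x => (@?f x, @?g x)) => apply: mf_pair
  | |- measurable_fun _ (fun x => fst (@?f x)) => apply: mf_fst
  | |- measurable_fun _ (fun x => snd (@?f x)) => apply: mf_snd
  | H : measurable_fun _ ?f |- measurable_fun _ (fun x => ?f (@?g x)) =>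
      apply: (mf_comp H)
  | |- cmeasurable _ (fun _ => ?c) => exact: cmeasurable_cst
  | |- cmeasurable _ (fun x => GRing.mul (@?f x) (@?g x)) => apply: cmeasurableM
  | |- cmeasurable _ (fun x => GRing.add (@?f x) (GRing.opp (@?g x))) => apply: cmeasurableB
  | |- cmeasurable _ (fun x => GRing.add (@?f x) (@?g x)) => apply: cmeasurableD
  | |- cmeasurable _ (fun x => GRing.opp (@?f x)) => apply: cmeasurableN
  | |- cmeasurable _ (fun x => expi (@?f x)) => apply: cmeasurable_expi
  | |- cmeasurable _ (fun x => Complex (@?f x) 0) => apply: cmeasurable_real
  | |- cmeasurable _ (fun x => (@?f x)%:C) => apply: cmeasurable_real
  | |- cmeasurable _ (fun x => Num.conj (@?f x)) => apply: cmeasurableJ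
  | H : cmeasurable _ ?f |- cmeasurable _ (fun x => ?f (@?g x)) =>
      apply: (cmeasurable_comp H)
  end.
Ltac mfun := repeat mfun1.

Local Opaque lebesgue_measure.

Section change_of_variables.
Context (R : realType).
Local Notation mR := (measurableTypeR R).
Local Notation L := (@lebesgue_measure R).
Implicit Types (a b c : R).

(** Lebesgue measure is determined by its values on half-open intervals, and |a| times the image of
    [L] has the same values. For a < 0 the preimage of such an interval is closed at the opposite
    end, which leaves its length unchanged. *)
Let affine_measure a b : a != 0 -> forall A : set mR, measurable A ->
  L A = (`|a|%:E * L ((fun x : mR => a * x + b : mR)%R @^-1` A))%E.
Proof.
move=> a0 A mA.
have mphi : measurable_fun setT (fun x : mR => a * x + b : mR) by mfun.
pose k : {nonneg R} := NngNum (normr_ge0 a).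
pose m : {measure set mR -> \bar R} :=
  mscale k (measure_function_pushforward__canonical__measure_function_Measure L mphi).
rewrite (lebesgue_measure_unique (mu := m)) => // X.
case=> -[x y] /= _ <-.
have a_gt0 : 0 < `|a| by rewrite normr_gt0.
rewrite /m /mscale /= /pushforward.
have [xy|yx] := ltP x y; last first.
  have /(_ x y yx) -> : forall x y : R, y <= x -> `]x, y]%classic = set0.
    by move=> {}x {}y {}yx; rewrite set_itv_ge// bnd_simp -leNgt.
  by rewrite /pushforward preimage_set0 !measure0 mule0.
have [a_pos|a_neg] := ltP 0 a.
  rewrite (_ : _ @^-1` `]x, y]%classic =
      `](x - b) / a, (y - b) / a]%classic); last first.
    apply/seteqP; split=> z /=; rewrite !in_itv /= ltr_pdivrMr// ler_pdivlMr//;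
      rewrite ltrBlDr lerBrDr mulrC//.
  rewrite !lebesgue_measure_itv /= !lte_fin xy ltr_pM2r ?invr_gt0// ltrD2r xy -!EFinD -EFinM
    gtr0_norm//; congr _%:E.
  by field.
have {}a_neg : a < 0 by rewrite lt_neqAle a0.
rewrite (_ : _ @^-1` `]x, y]%classic =
    `[(y - b) / a, (x - b) / a[%classic); last first.
  apply/seteqP; split=> z /=; rewrite !in_itv /= ltr_ndivlMr// ler_ndivrMr//;
    rewrite ltrBlDr lerBrDr mulrC// andbC//.
rewrite !lebesgue_measure_itv /= !lte_fin xy ltr_nM2r ?invr_lt0// ltrD2r xy.
rewrite -!EFinD -EFinM ltr0_norm//; congr _%:E.
by field.
Qed.

Lemma integral_affine a b (f : mR -> \bar R) : a != 0 -> measurable_fun setT f ->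
  (forall x, 0 <= f x)%E ->
  (\int[L]_x (`|a|%:E * f (a * x + b)%R) = \int[L]_x f x)%E.
Proof.
move=> a0 mf f0.
have mphi : measurable_fun setT (fun x : mR => a * x + b : mR) by mfun.
pose k : {nonneg R} := NngNum (normr_ge0 a).
pose p : {measure set mR -> \bar R} :=
  measure_function_pushforward__canonical__measure_function_Measure L mphi.
rewrite integralZT//; last exact: (mf_comp mf mphi).
rewrite [RHS](eq_measure_integral (mscale k p)); last first.
  by move=> A mA _; exact: affine_measure.
rewrite ge0_integral_mscale// ge0_integral_pushforward//.
Qed.

Lemma integral_scale c (f : mR -> \bar R) : c != 0 -> measurable_fun setT f ->
  (forall x, 0 <= f x)%E ->
  (\int[L]_x (`|x|^-1%:E * f (c * x)%R) = \int[L]_x (`|x|^-1%:E * f x))%E.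
Proof.
move=> c0 mf f0; rewrite -(integral_affine 0 c0 (f := fun x => (`|x|^-1%:E * f x)%E)); last 2 first.
- by mfun.
- by move=> x; rewrite mule_ge0// lee_fin.
apply: eq_integral => x _; rewrite addr0 muleA -EFinM; congr (_%:E * _)%E.
by rewrite normrM invfM mulrA mulfV ?mul1r// normr_eq0.
Qed.

(* Unimodularity of the multiplicative group: compare the integral of
   [f (1 / x) * g y] before and after [y := x y], [x := x / y]. *)
Lemma integral_inv (f : mR -> \bar R) : measurable_fun setT f ->
  (forall x, 0 <= f x)%E ->
  (\int[L]_x (`|x|^-1%:E * f (x^-1)%R) = \int[L]_x (`|x|^-1%:E * f x))%E.
Proof.
move=> mf f0.
(* On [1, 2] the weight 1/|x| lies between 1/2 and 1, so the integral [Ig] of [g] for dx/|x| is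
   finite and nonzero and can be cancelled at the end. *)
pose g : mR -> R := \1_(`[1, 2]%classic).
have g0 x : 0 <= g x by [].
have mg : measurable_fun setT g by exact: measurable_indic.
pose Ig := (\int[L]_x (`|x|^-1%:E * (g x)%:E))%E.
have mh : measurable_fun setT (fun x : mR => (`|x|^-1%:E * (g x)%:E)%E) by mfun.
have Ig_lt : (Ig < +oo)%E.
  rewrite (@le_lt_trans _ _ (\int[L]_x (g x)%:E)%E)//.
    apply: le_integralT => //; first by mfun.
      by move=> x; rewrite mule_ge0// lee_fin.
    move=> x; rewrite /g indicE; case: (boolP (x \in _)) => /=; last by rewrite mule0.
    rewrite inE /= in_itv /= => /andP[x1 x2]; rewrite mule1 lee_fin.
    by rewrite invf_le1 ger0_norm// ?(le_trans _ x1) ?(lt_le_trans _ x1).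
  by rewrite integral_indic// setIT [X in (X < _)%E]lebesgue_measure_itv /= lte_fin ltr1n ltry.
have Ig_gt : (0 < Ig)%E.
  rewrite (@lt_le_trans _ _ (\int[L]_x ((2^-1)%:E * (g x)%:E))%E)//.
    rewrite integralZT//; last by mfun.
    rewrite integral_indic// setIT [X in (_ * X)%E]lebesgue_measure_itv /= lte_fin ltr1n.
    by rewrite -EFinD -EFinM lte_fin mulr_gt0.
  apply: le_integralT => //; first by mfun.
    by move=> x; rewrite mule_ge0// lee_fin.
  move=> x; rewrite /g indicE; case: (boolP (x \in _)) => /=; last by rewrite !mule0.
  rewrite inE /= in_itv /= => /andP[x1 x2]; rewrite !mule1 lee_fin.
  have x0 : 0 < x by rewrite (lt_le_trans _ x1).
  by rewrite ger0_norm ?(ltW x0)// lef_pV2 ?posrE.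
have Igfin : Ig \is a fin_num by rewrite ge0_fin_numE// ltW.
suff : (Ig * \int[L]_x (`|x|^-1%:E * f (x^-1)%R) = Ig * \int[L]_x (`|x|^-1%:E * f x))%E.
  have Ig1 : ((fine Ig)^-1%:E * Ig = 1)%E.
    rewrite -[X in (_ * X)%E](fineK Igfin) -EFinM mulVf//.
    by rewrite gt_eqF// fine_gt0// Ig_gt Ig_lt.
  by move/(congr1 (fun z => (fine Ig)^-1%:E * z)%E); rewrite !muleA Ig1 !mul1e.
have mxi : measurable_fun setT (fun x : mR => x^-1 : mR) by mfun.
have e0 (x : R) : (0 <= `|x|^-1%:E)%E by rewrite lee_fin.
have ig0 : (0 <= Ig)%E by exact: ltW.
transitivity (\int[L]_x \int[L]_y (`|x|^-1%:E * f (x^-1)%R * (`|y|^-1%:E * (g (x * y)%R)%:E)))%E.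
  rewrite -ge0_integralZl//; last 2 first.
  - by mfun.
  - by move=> x _; rewrite mule_ge0.
  apply: eq_integral => x _; rewrite muleC.
  have [->|x0] := eqVneq x 0.
    by rewrite normr0 !invr0 !mul0e integral0_eq// => y _; rewrite !mul0e.
  rewrite /Ig -(integral_scale x0 (f := fun x => (g x)%:E))//; last by mfun.
  rewrite ge0_integralZl//.
  - by mfun.
  - by move=> y _; rewrite mule_ge0// lee_fin.
  - by rewrite mule_ge0.
rewrite (@tonelli_swap _ _ _ _ _ L L
  (fun z : mR * mR => `|z.1|^-1%:E * f (z.1^-1)%R * (`|z.2|^-1%:E * (g (z.1 * z.2)%R)%:E))%E);
    last 2 first.
- by mfun.
- by move=> z; rewrite !mule_ge0// lee_fin.
transitivity (\int[L]_y \int[L]_x (`|x|^-1%:E * f (y / x)%R * (`|y|^-1%:E * (g x)%:E)))%E.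
  apply: eq_integral => y _ /=.
  have [->|y0] := eqVneq y 0.
    by rewrite normr0 !invr0 !integral0_eq// => x _; rewrite !mul0e mule0.
  under eq_integral do rewrite -muleA.
  rewrite -(@integral_scale y^-1 (fun x => f (x^-1)%R * (`|y|^-1%:E * (g (x * y)%R)%:E))%E).
  - apply: eq_integral => x _; rewrite -muleA invfM invrK mulrAC mulVf// mul1r.
    by [].
  - by rewrite invr_eq0.
  - by mfun.
  - by move=> x; rewrite !mule_ge0// lee_fin.
rewrite -(@tonelli_swap _ _ _ _ _ L L
  (fun z : mR * mR => `|z.1|^-1%:E * f (z.2 / z.1)%R * (`|z.2|^-1%:E * (g z.1)%:E))%E);
    last 2 first.
- by mfun.
- by move=> z; rewrite !mule_ge0// lee_fin.
rewrite -ge0_integralZr//; last 2 first.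
- by move=> x _; rewrite mule_ge0// lee_fin.
- by apply: integral_ge0 => x _; rewrite mule_ge0.
apply: eq_integral => x _ /=.
have [->|x0] := eqVneq x 0.
  by rewrite normr0 invr0 !mul0e integral0_eq// => y _; rewrite !mul0e.
rewrite -(@integral_scale x^-1 f)//; last by rewrite invr_eq0.
rewrite -ge0_integralZl//; last 3 first.
- by apply: (@mf_emul); mfun.
- by move=> y _; rewrite mule_ge0.
- by rewrite mule_ge0// lee_fin.
by apply: eq_integral => y _; rewrite muleACA [RHS]muleACA [in RHS](muleC (g x)%:E) (mulrC y).
Qed.

Local Notation R2 := (mR * mR)%type.
Local Notation leb2 := (@leb2 R).

(** Gaussian elimination with pivot [a]: a substitution in x at fixed y, then one in y at fixed x
    with factor e = (a d - b c)/a. Two one-dimensional affine substitutions and Tonelli suffice. *)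
Let shear2 a b c d (f : R2 -> \bar R) : a * d - b * c != 0 -> a != 0 ->
  measurable_fun setT f -> (forall z, 0 <= f z)%E ->
  (\int[L]_y \int[L]_x (`|a * d - b * c|%:E * f (a * x + b * y, c * x + d * y)%R)
  = \int[L]_y \int[L]_x f (x, y))%E.
Proof.
move=> D0 a0 mf f0.
pose e := (a * d - b * c) / a.
have e0 : e != 0 by rewrite mulf_neq0// invr_eq0.
transitivity (\int[L]_y \int[L]_x (`|e|%:E * f (x, c / a * x + e * y)%R))%E.
  apply: eq_integral => y _.
  rewrite -[RHS](integral_affine (b * y) a0); last 2 first.
  - by mfun.
  - by move=> x; rewrite mule_ge0// lee_fin.
  apply: eq_integral => x _; rewrite muleA -EFinM -normrM; congr (`|_|%:E * f (_, _))%E.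
    by rewrite /e mulrCA mulfV// mulr1.
  by rewrite /e; field.
rewrite -(@tonelli_swap _ _ _ _ _ L L (fun z : R2 => (`|e|%:E * f (z.1, c / a * z.1 +
  e * z.2)%R)%E)); last 2 first.
- by mfun.
- by move=> x; rewrite mule_ge0// lee_fin.
rewrite -(tonelli_swap L L mf f0).
apply: eq_integral => x _ /=.
rewrite -[RHS](integral_affine (c / a * x) e0); last 2 first.
- by mfun.
- by [].
by apply: eq_integral => y _; rewrite addrC.
Qed.

Lemma integral_leb2 (f : R2 -> \bar R) : measurable_fun setT f ->
  (forall z, 0 <= f z)%E ->
  (\int[leb2]_z f z = \int[L]_x \int[L]_y f (x, y))%E.
Proof. by move=> mf f0; rewrite -(fubini_tonelli1 f). Qed.

Lemma integral_linear2 a b c d (f : R2 -> \bar R) : a * d - b * c != 0 ->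
  measurable_fun setT f -> (forall z, 0 <= f z)%E ->
  (\int[leb2]_z (`|a * d - b * c|%:E * f (a * z.1 + b * z.2, c * z.1 + d * z.2)%R)
  = \int[leb2]_z f z)%E.
Proof.
move=> D0 mf f0.
have mg : measurable_fun setT (fun z : R2 =>
   (`|a * d - b * c|%:E * f (a * z.1 + b * z.2, c * z.1 + d * z.2)%R)%E) by mfun.
have g0 (z : R2) : (0 <= `|a * d - b * c|%:E * f (a * z.1 + b * z.2, c * z.1 + d * z.2)%R)%E.
  by rewrite mule_ge0// lee_fin.
rewrite !integral_leb2//.
have [a0|a0] := eqVneq a 0; last first.
  by rewrite (tonelli_swap L L mg g0) (tonelli_swap L L mf f0) shear2.
(* When [a] vanishes the two variables exchange roles: [b] becomes the pivot and the determinant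
   changes sign, which the absolute value ignores. *)
have b0 : b != 0.
  by apply: contra_neq D0 => ->; rewrite a0 !mul0r subrr.
have D1 : b * c - a * d != 0 by rewrite -oppr_eq0 opprB.
rewrite [RHS](tonelli_swap L L mf f0) -(shear2 (f := f) D1 b0 mf f0).
apply: eq_integral => x _; apply: eq_integral => y _ /=.
by rewrite distrC [(b * y + _)%R]addrC [(d * y + _)%R]addrC.
Qed.

Section reorder4.
Context d1 d2 d3 d4 (T1 : measurableType d1) (T2 : measurableType d2)
  (T3 : measurableType d3) (T4 : measurableType d4).
Variables (m1 : {sigma_finite_measure set T1 -> \bar R}).
Variables (m2 : {sigma_finite_measure set T2 -> \bar R}).
Variables (m3 : {sigma_finite_measure set T3 -> \bar R}).
Variables (m4 : {sigma_finite_measure set T4 -> \bar R}).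

Lemma tonelli_swap23 (f : T1 -> T2 -> T3 -> T4 -> \bar R) :
  measurable_fun setT (fun z : (T1 * T2) * (T3 * T4) => f z.1.1 z.1.2 z.2.1 z.2.2) ->
  (forall x y z t, 0 <= f x y z t)%E ->
  (\int[m1]_x \int[m2]_y \int[m3]_z \int[m4]_t f x y z t =
   \int[m1]_x \int[m3]_z \int[m2]_y \int[m4]_t f x y z t)%E.
Proof.
move=> mf f0; apply: eq_integral => x _.
apply: (@tonelli_swap _ _ _ _ _ m2 m3 (fun z => \int[m4]_t f x z.1 z.2 t)%E).
  apply: (@measurable_integralr _ _ _ _ _ m4 (fun z => f x z.1.1 z.1.2 z.2)) => //.
  by apply: (@mf_comp _ _ _ _ _ _ _
    (fun z : (T2 * T3) * T4 => ((x, z.1.1), (z.1.2, z.2))) mf); mfun.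
by move=> z; exact: integral_ge0.
Qed.

End reorder4.

Local Notation leb4 := (@leb4 R).
Local Notation R4 := (R2 * R2)%type.

Lemma integral_leb4 (f : R4 -> \bar R) : measurable_fun setT f ->
  (forall z, 0 <= f z)%E ->
  (\int[leb4]_z f z = \int[leb2]_p \int[leb2]_q f (p, q))%E.
Proof. by move=> mf f0; rewrite -(fubini_tonelli1 f). Qed.

Let integral_leb4_iter (f : R4 -> \bar R) : measurable_fun setT f ->
  (forall z, 0 <= f z)%E ->
  (\int[leb4]_z f z =
   \int[L]_x \int[L]_y \int[L]_z \int[L]_t f ((x, y), (z, t)))%E.
Proof.
move=> mf f0; rewrite integral_leb4// integral_leb2.
- apply: eq_integral => x _; apply: eq_integral => y _; rewrite integral_leb2//.
  by mfun.
- exact: (measurable_integralr _ mf f0).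
- by move=> z; exact: integral_ge0.
Qed.

Lemma integral_leb4_columns (f : R4 -> \bar R) : measurable_fun setT f ->
  (forall z, 0 <= f z)%E ->
  (\int[leb4]_z f z = \int[leb4]_z f ((z.1.1, z.2.1), (z.1.2, z.2.2)))%E.
Proof.
move=> mf f0.
have mg : measurable_fun setT (fun z : R4 => f ((z.1.1, z.2.1), (z.1.2, z.2.2))).
  by mfun.
rewrite [LHS](integral_leb4_iter mf f0) [RHS](integral_leb4_iter mg _); last first.
  by move=> z; exact: f0.
apply: (@tonelli_swap23 _ _ _ _ _ _ _ _ L L L L (fun x y z t => f ((x, y), (z, t)))).
  by mfun.
by move=> *; exact: f0.
Qed.

(** Left multiplication of a 2 x 2 matrix acts on both columns by the same linear map, hence the
    square of the determinant. As [leb4] groups the entries by rows, the integral is first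
    transposed by [integral_leb4_columns]. *)
Lemma integral_linear4 a b c d (f : R4 -> \bar R) : a * d - b * c != 0 ->
  measurable_fun setT f -> (forall z, 0 <= f z)%E ->
  (\int[leb4]_z ((`|a * d - b * c| ^+ 2)%:E *
     f ((a * z.1.1 + b * z.2.1, a * z.1.2 + b * z.2.2),
        (c * z.1.1 + d * z.2.1, c * z.1.2 + d * z.2.2))%R)
  = \int[leb4]_z f z)%E.
Proof.
move=> D0 mf f0.
rewrite integral_leb4_columns; last 2 first.
- by mfun.
- by move=> z; rewrite mule_ge0// lee_fin sqr_ge0.
rewrite [RHS]integral_leb4_columns// [LHS]integral_leb4 ?[RHS]integral_leb4/=; last 4 first.
- by mfun.
- by [].
- by mfun.
- by move=> z; rewrite mule_ge0// lee_fin sqr_ge0.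
set D := (a * d - b * c).
transitivity (\int[leb2]_p \int[leb2]_q (`|D|%:E *
   f ((a * p.1 + b * p.2, q.1), (c * p.1 + d * p.2, q.2))%R))%E.
  apply: eq_integral => p _.
  rewrite -[RHS](@integral_linear2 a b c d); last 3 first.
  - by [].
  - by mfun.
  - by move=> z; rewrite mule_ge0// lee_fin.
  by apply: eq_integral => q _; rewrite muleA -EFinM -expr2.
rewrite -[RHS](@integral_linear2 a b c d); last 3 first.
- by [].
- apply: (@measurable_integralr _ _ _ _ _ leb2 (fun z : R4 => f ((z.1.1, z.2.1), (z.1.2,
  z.2.2)))) => //.
  by mfun.
- by move=> z; exact: integral_ge0.
apply: eq_integral => p _; rewrite integralZT//.
by mfun.
Qed.

End change_of_variables.

(** * Approximation in L2 *)

Section approximation.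
Context d (T : measurableType d) (R : realType) (mu : {measure set T -> \bar R}).
Implicit Types (f g h : T -> R[i]) (S : set (T -> R[i])).
Local Notation N2 := (sqnorm mu setT).
Local Notation dist2 := (sqdist mu setT).

Definition approx S f : Prop :=
  forall eps : R, 0 < eps -> exists2 h, S h & (dist2 f h < eps%:E)%E.

Definition subspace S : Prop :=
  S `<=` L2 mu setT /\
  forall (a : R[i]) f g, S f -> S g -> S (fun x => a * f x + g x).

Lemma sqdistxx f : dist2 f f = 0%E.
Proof.
by rewrite /sqdist /sqnorm; under eq_integral do rewrite subrr csqr0; rewrite integral0.
Qed.

Lemma approx_self S f : S f -> approx S f.
Proof. by move=> Sf e e0; exists f => //; rewrite sqdistxx lte_fin. Qed.

Lemma approx_sub S S' f : S `<=` S' -> approx S f -> approx S' f.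
Proof. by move=> SS' Sf e /Sf[h /SS' Sh fh]; exists h. Qed.

Lemma approx_lin S a f g : subspace S -> cmeasurable setT f -> cmeasurable setT g ->
  approx S f -> approx S g -> approx S (fun x => a * f x + g x).
Proof.
move=> [SL Slin] mf mg Sf Sg e e0.
(* The factor 4 absorbs the 2 of [sqnormD_le] and the halving of [e]; the added 1 keeps the divisor
   positive when a = 0. *)
have k0 : 0 < 4 * (csqr a + 1) by rewrite mulr_gt0// ltr_pwDr// csqr_ge0.
have [h Sh fh] := Sf (e / (4 * (csqr a + 1))) (divr_gt0 e0 k0).
have [h' Sh' gh'] := Sg (e / 4) (divr_gt0 e0 (ltr0n _ 4)).
have [mh _] := SL _ Sh; have [mh' _] := SL _ Sh'.
exists (fun x => a * h x + h' x); first exact: Slin.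
rewrite /sqdist (_ : (fun x => _ - _) =
  (fun x => a * (f x - h x) + (g x - h' x))); last first.
  by apply/funext => x; ring.
apply: le_lt_trans (sqnormD_le _ _ _) _; [by mfun|by mfun|].
rewrite sqnormZ; last by mfun.
have -> : e = e / 2 + e / 2 by rewrite -splitr.
rewrite [X in (_ < X)%E]EFinD lteD//.
  rewrite muleA -EFinM (@le_lt_trans _ _ ((2 * (csqr a + 1))%:E * dist2 f h)%E)//.
    by rewrite lee_wpmul2r ?sqnorm_ge0// lee_fin ler_wpM2l// lerDl.
  rewrite -lte_pdivlMl ?mulr_gt0 ?ltr_pwDr ?csqr_ge0// -EFinM.
  rewrite (lt_le_trans fh)// lee_fin le_eqVlt; apply/orP; left; apply/eqP.
  by field; rewrite lt0r_neq0// ltr_pwDr ?csqr_ge0.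
rewrite -lte_pdivlMl// -EFinM (lt_le_trans gh')// lee_fin le_eqVlt.
by apply/orP; left; apply/eqP; field.
Qed.

Lemma approx_limit S f : S `<=` L2 mu setT -> cmeasurable setT f ->
  (forall eps : R, 0 < eps -> exists g, [/\ cmeasurable setT g, approx S g &
     (dist2 f g < eps%:E)%E]) -> approx S f.
Proof.
move=> SL mf H e e0.
have e40 : 0 < e / 4 by rewrite divr_gt0.
have [g [mg Sg fg]] := H _ e40; have [h Sh gh] := Sg _ e40.
exists h => //; have [mh _] := SL _ Sh.
apply: le_lt_trans (sqdist_triangle _ mf mg mh) _.
have -> : e = e / 2 + e / 2 by rewrite -splitr.
by rewrite [X in (_ < X)%E]EFinD lteD//; rewrite -lte_pdivlMl// -EFinM;
  [rewrite (lt_le_trans fg)//|rewrite (lt_le_trans gh)//]; rewrite lee_fin le_eqVlt;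
  apply/orP; left; apply/eqP; field.
Qed.

Lemma approx_trans S S' f : S `<=` L2 mu setT -> cmeasurable setT f ->
  (forall g, S' g -> cmeasurable setT g /\ approx S g) -> approx S' f -> approx S f.
Proof.
move=> SL mf SS' S'f; apply: approx_limit => // e /S'f[g S'g fg].
by exists g; have [] := SS' _ S'g; split.
Qed.

Lemma subspace0 S f : subspace S -> S f -> S (fun=> 0).
Proof.
move=> [SL Slin] Sf; have := Slin (-1) _ _ Sf Sf.
by rewrite (_ : (fun x => -1 * f x + f x) = fun=> 0)//;
  apply/funext => x; rewrite mulN1r addNr.
Qed.

Lemma cvg_sqnorm0 (F : nat -> T -> R[i]) (h : T -> R) :
  (forall n, cmeasurable setT (F n)) -> measurable_fun setT h ->
  (forall x, csqr (F n x) @[n --> \oo] --> 0) ->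
  (forall n x, csqr (F n x) <= h x) -> (\int[mu]_x (h x)%:E < +oo)%E ->
  N2 (F n) @[n --> \oo] --> 0%E.
Proof.
move=> mF mh F0 Fh hoo.
have h0 x : 0 <= h x by exact: le_trans (csqr_ge0 _) (Fh 0 x).
have := @dominated_convergence _ _ _ mu setT measurableT
  (fun n x => (csqr (F n x))%:E) (fun=> 0%E) (fun x => (h x)%:E).
case=> //.
- by move=> n; mfun; exact: mF.
- by apply: aeW => x _; apply/fine_cvgP; split; [exact: nearW|exact: F0].
- apply/integrableP; split; first by mfun.
  by under eq_integral do rewrite gee0_abs ?lee_fin//.
- by apply: aeW => x n _; rewrite gee0_abs lee_fin ?csqr_ge0.
- by move=> _ _; rewrite integral0.
Qed.

Lemma cvg0_lt (u : nat -> \bar R) (eps : R) : 0 < eps ->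
  u n @[n --> \oo] --> 0%E -> exists n, (u n < eps%:E)%E.
Proof.
move=> e0 u0.
have : \forall n \near \oo, (u n < eps%:E)%E.
  have /fine_cvgP[ufin uf0] := u0.
  have ue : \forall n \near \oo, ((fine \o u) n < eps) by apply: (cvgr_lt _ uf0).
  by apply: filterS2 ufin ue => n /fineK <-; rewrite lte_fin.
by move=> [n _ /(_ n (leqnn n))] un; exists n.
Qed.

Lemma approx_cvg S f (F : nat -> T -> R[i]) (h : T -> R) :
  S `<=` L2 mu setT -> cmeasurable setT f ->
  (forall n, cmeasurable setT (F n)) -> (forall n, approx S (F n)) ->
  measurable_fun setT h ->
  (forall x, csqr (f x - F n x) @[n --> \oo] --> 0) ->
  (forall n x, csqr (f x - F n x) <= h x) -> (\int[mu]_x (h x)%:E < +oo)%E ->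
  approx S f.
Proof.
move=> SL mf mF SF mh cf fh hoo; apply: approx_limit => // e e0.
have /(cvg0_lt e0)[n ne] : N2 (fun x => f x - F n x) @[n --> \oo] --> 0%E.
  apply: cvg_sqnorm0 cf fh hoo => //.
  by move=> n; apply: cmeasurableB.
by exists (F n).
Qed.

Lemma L2_trunc S f (E : nat -> set T) : S `<=` L2 mu setT -> L2 mu setT f ->
  (forall n, measurable (E n)) -> (forall x, \forall n \near \oo, E n x) ->
  (forall n, approx S (fun x => (\1_(E n) x)%:C * f x)) -> approx S f.
Proof.
move=> SL [mf fL] mE Ex SE.
apply: (@approx_cvg _ _ (fun n x => (\1_(E n) x)%:C * f x) (fun x => csqr (f x))) => //.
- by move=> n; apply: cmeasurableM => //; apply: cmeasurable_real; exact: measurable_indic.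
- exact: measurable_csqr.
- move=> x; have := Ex x; rewrite /= => En; apply: cvg_near_cst.
  apply: filterS En => n En; rewrite indicE mem_set// mul1r subrr csqr0//.
- move=> n x; rewrite indicE; case: (x \in E n).
    by rewrite mul1r subrr csqr0 csqr_ge0.
  by rewrite mul0r subr0.
Qed.

Definition cindic (A : set T) : T -> R[i] := fun x => (\1_A x)%:C.

Lemma cmeasurable_cindic A : measurable A -> cmeasurable setT (cindic A).
Proof. by move=> mA; apply: cmeasurable_real; exact: measurable_indic. Qed.

Lemma csqr_cindic A x : csqr (cindic A x) = \1_A x.
Proof. by rewrite csqr_real indicE; case: (_ \in _); rewrite ?expr1n ?expr0n. Qed.

Lemma sqnorm_cindic A : measurable A -> N2 (cindic A) = mu A.
Proof.
move=> mA; rewrite /sqnorm; under eq_integral do rewrite csqr_cindic.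
by rewrite integral_indic// setIT.
Qed.

Section pi_system.
Import HBNNSimple.
Variables (S : set (T -> R[i])) (G : set (set T)) (g : nat -> set T).
Hypothesis Ssub : subspace S.
Hypothesis mG : @measurable _ T = <<s G >>.
Hypothesis GI : setI_closed G.
Hypothesis Gg : forall n, G (g n).
Hypothesis gcover : forall x, \forall n \near \oo, g n x.
Hypothesis gfin : forall n, (mu (g n) < +oo)%E.
Hypothesis SG : forall n A, G A -> approx S (cindic (A `&` g n)).

Let GM A : G A -> measurable A.
Proof. by move=> GA; rewrite mG; exact: sub_sigma_algebra. Qed.

(** Dynkin's pi-lambda theorem. The sets whose trace on [g n] has an approximable indicator are
    stable under proper differences by linearity, and under increasing unions by dominated
    convergence, the indicator of [g n] being an integrable bound. *)
Let approx_cindic n E : measurable E -> approx S (cindic (E `&` g n)).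
Proof.
have [SL Slin] := Ssub.
have mg := GM (Gg n).
pose H := [set E | measurable E /\ approx S (cindic (E `&` g n))].
suff GH : <<s G >> `<=` H by rewrite mG => /GH[].
apply: lambda_system_subset => //; last first.
  by move=> A GA; split; [exact: GM|exact: SG].
split.
- by [].
- by split => //; rewrite setTI -[g n]setIid; exact: SG.
- move=> A B BA [mA SA] [mB SB]; split; first exact: measurableD.
  have -> : cindic ((A `\` B) `&` g n) =
      (fun x => -1 * cindic (B `&` g n) x + cindic (A `&` g n) x).
    apply/funext => x; rewrite /cindic !indicE (in_setI _ (A `\` B)) in_setD !in_setI.
    case: (boolP (x \in B)) => [xB|xB] /=; last by rewrite andbT mulr0 add0r.
    have -> : x \in A by rewrite inE; apply: BA; rewrite -inE.
    by case: (x \in g n); rewrite /= ?mulr0 ?addr0// mulN1r addNr.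
  by apply: approx_lin => //; apply: cmeasurable_cindic; exact: measurableI.
- move=> F ndF HF; have mF k : measurable (F k) by have [] := HF k.
  have mU : measurable (\bigcup_k F k) by exact: bigcupT_measurable.
  split => //.
  apply: (@approx_cvg _ _ (fun k => cindic (F k `&` g n)) (\1_(g n))) => //.
  + by apply: cmeasurable_cindic; exact: measurableI.
  + by move=> k; apply: cmeasurable_cindic; exact: measurableI.
  + by move=> k; have [] := HF k.
  + move=> x; apply: cvg_near_cst.
    have [[k _ Fkx]|nx] := pselect ((\bigcup_k F k) x).
      exists k => // m /= km.
      have Fmx : F m x by move: Fkx; apply/subsetPset/ndF.
      have Ux : (\bigcup_k F k) x by exists k.
      by rewrite /cindic !indicE !in_setI (mem_set Fmx) (mem_set Ux) subrr csqr0.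
    apply: nearW => m; have nF : ~ F m x by move=> Fmx; apply: nx; exists m.
    by rewrite /cindic !indicE !in_setI (memNset nF) (memNset nx) subrr csqr0.
  + move=> k x; rewrite /cindic !indicE !in_setI.
    case: (x \in g n); rewrite ?andbT ?andbF; last by rewrite subrr csqr0.
    case: (boolP (x \in F k)) => [xF|_].
      rewrite mem_set; last by exists k => //; rewrite -inE.
      by rewrite subrr csqr0.
    by rewrite subr0 csqr_real; case: (x \in _); rewrite ?expr1n ?expr0n.
  + by rewrite integral_indic// setIT.
Qed.

Let approx_nnsfun n (f : {nnsfun T >-> R}) :
  approx S (fun x => (f x)%:C * cindic (g n) x).
Proof.
have [SL Slin] := Ssub; have mg := GM (Gg n).
have -> : (fun x => (f x)%:C * cindic (g n) x) = (fun x =>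
    \sum_(y <- finmap.enum_fset (fset_set (range f)))
      y%:C * cindic (f @^-1` [set y] `&` g n) x).
  apply/funext => x; rewrite fimfunE fsbig_finite//=.
  rewrite -[in LHS]/((real_complex R) _) rmorph_sum /= mulr_suml.
  apply: eq_bigr => y _; rewrite /cindic rmorphM /= -mulrA; congr (_ * _).
  by rewrite !indicE in_setI -[_%:C * _]rmorphM -natrM mulnb.
elim: (finmap.enum_fset _) => [|y s ih].
  under eq_fun do rewrite big_nil.
  have /= S0 := SG n (Gg n).
  move=> e e0; have [h Sh _] := S0 e e0; exists (fun=> 0); first exact: subspace0 Sh.
  by rewrite sqdistxx lte_fin.
under eq_fun do rewrite big_cons.
apply: approx_lin => //.
- apply: cmeasurable_cindic; apply: measurableI => //.
- apply: cmeasurable_sum => r; apply: cmeasurableM; first exact: cmeasurable_cst.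
  by apply: cmeasurable_cindic; apply: measurableI.
- exact: approx_cindic.
Qed.

Let approx_ge0 (f : T -> R) : measurable_fun setT f -> (forall x, 0 <= f x) ->
  (\int[mu]_x (f x ^+ 2)%:E < +oo)%E -> approx S (fun x => (f x)%:C).
Proof.
have [SL _] := Ssub.
move=> mf f0 foo.
have mEf : measurable_fun setT (EFin \o f) by exact/measurable_EFinP.
pose fn := nnsfun_approx measurableT mEf.
have fn_le n x : fn n x <= f x.
  by rewrite -lee_fin nnsfun_approxE; apply: le_approx => // y _; rewrite lee_fin.
have fn_cvg x : fn n x @[n --> \oo] --> f x.
  have := @cvg_nnsfun_approx _ _ _ setT measurableT (EFin \o f) mEf _ x I.
  move=> /(_ (fun y _ => f0 y)).
  by move=> /fine_cvgP[_].
have mg n := GM (Gg n).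
apply: (@approx_cvg _ _ (fun n x => (fn n x)%:C * cindic (g n) x) (fun x => f x ^+ 2)) => //.
- move=> n; apply: cmeasurableM; first exact: cmeasurable_real.
  exact: cmeasurable_cindic.
- by mfun.
- move=> x.
  have : (f x - fn n x) ^+ 2 @[n --> \oo] --> (f x - f x) ^+ 2.
    have fB : f x - fn n x @[n --> \oo] --> f x - f x by apply: cvgB => //; exact: cvg_cst.
    by under eq_fun do rewrite expr2; rewrite expr2; exact: cvgM.
  rewrite subrr expr0n /=; apply: cvg_trans; apply: near_eq_cvg.
  have := gcover x; apply: filterS => n gnx.
  by rewrite /cindic indicE mem_set// mulr1 -[_%:C - _]rmorphB csqr_real.
- move=> n x; rewrite /cindic -[_%:C * _]rmorphM -[_%:C - _]rmorphB csqr_real /=.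
  rewrite ler_sqr ?nnegrE ?subr_ge0//; rewrite indicE; case: (_ \in _) => /=.
  + by rewrite mulr1 lerBlDr lerDl.
  + by rewrite mulr0 subr0.
  + by rewrite mulr1.
  + by rewrite mulr0.
Qed.

(** Density criterion: it is enough to approximate indicators of the sets of a generating pi-system,
    cut by an exhausting sequence of finite measure. Measurable sets come from [approx_cindic],
    simple functions by linearity, nonnegative functions by dominated convergence with bound f^2;
    the rest is splitting into positive, negative, real and imaginary parts. *)
Lemma approx_L2 (f : T -> R[i]) : L2 mu setT f -> approx S f.
Proof.
have [SL Slin] := Ssub.
move=> [[mRe mIm] foo].
have part (r : T -> R) : measurable_fun setT r -> (forall x, r x ^+ 2 <= csqr (f x)) ->
    approx S (fun x => (r x)%:C).
  move=> mr rf.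
  have mp : measurable_fun setT (fun x => Num.max (r x) 0) by exact: measurable_maxr.
  have mn : measurable_fun setT (fun x => Num.max (- r x) 0).
    by apply: measurable_maxr => //; mfun.
  have le_oo (q : T -> R) : measurable_fun setT q -> (forall x, q x ^+ 2 <= r x ^+ 2) ->
      (\int[mu]_x (q x ^+ 2)%:E < +oo)%E.
    move=> mq qr; apply: le_lt_trans foo; apply: le_integralT.
    - by mfun.
    - by apply: mf_EFin; exact: measurable_csqr.
    - by move=> x; rewrite lee_fin sqr_ge0.
    - by move=> x; rewrite lee_fin (le_trans (qr x)).
  have -> : (fun x => (r x)%:C) =
      (fun x => -1 * (Num.max (- r x) 0)%:C + (Num.max (r x) 0)%:C).
    apply/funext => x; rewrite mulN1r addrC -[RHS]rmorphB /=; congr (_%:C).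
    have [r0|r0] := leP 0 (r x).
      have -> : Num.max (- r x) 0 = 0 by apply/max_idPr; rewrite oppr_le0.
      by rewrite subr0.
    have -> : Num.max (- r x) 0 = - r x by apply/max_idPl; rewrite oppr_ge0 ltW.
    by rewrite sub0r opprK.
  apply: approx_lin => //; try exact: cmeasurable_real.
  - apply: approx_ge0 => //; first by move=> x; rewrite le_max lexx orbT.
    apply: le_oo => // x; rewrite maxEle; case: ifP => _.
      by rewrite expr0n sqr_ge0.
    by rewrite sqrrN.
  - apply: approx_ge0 => //; first by move=> x; rewrite le_max lexx orbT.
    by apply: le_oo => // x; rewrite maxEle; case: ifP => _; rewrite ?expr0n ?sqr_ge0.
have -> : f = (fun x => 'i * (Im (f x))%:C + (Re (f x))%:C).
  by apply/funext => x; apply: complexP; rewrite ?ReD ?ImD ?ReM ?ImM /=; ring.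
apply: approx_lin => //; try exact: cmeasurable_real.
- by apply: part => // x; rewrite /csqr lerDr sqr_ge0.
- by apply: part => // x; rewrite /csqr lerDl sqr_ge0.
Qed.

End pi_system.
End approximation.
Arguments cindic {d T R} A x.

(** * Tensor products of L^2 functions *)

Section tensor.
Context d1 d2 (T1 : measurableType d1) (T2 : measurableType d2) (R : realType).
Variables (m1 : {sigma_finite_measure set T1 -> \bar R}).
Variables (m2 : {sigma_finite_measure set T2 -> \bar R}).

Lemma sqnorm_tensor (f : T1 -> R[i]) (g : T2 -> R[i]) :
  cmeasurable setT f -> cmeasurable setT g ->
  sqnorm (m1 \x m2)%E setT (fun z => f z.1 * g z.2) =
  (sqnorm m1 setT f * sqnorm m2 setT g)%E.
Proof.
move=> mf mg; rewrite sqnorm_prod1; last by mfun.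
transitivity (\int[m1]_x ((csqr (f x))%:E * sqnorm m2 setT g))%E.
  by apply: eq_integral => x _; rewrite -sqnormZ.
rewrite ge0_integralZr//; first exact: measurable_csqrE.
  by move=> x _; rewrite lee_fin csqr_ge0.
exact: sqnorm_ge0.
Qed.

Lemma L2_tensor (f : T1 -> R[i]) (g : T2 -> R[i]) :
  L2 m1 setT f -> L2 m2 setT g ->
  L2 (m1 \x m2)%E setT (fun z => f z.1 * g z.2).
Proof.
move=> [mf fL] [mg gL]; split; first by mfun.
by rewrite sqnorm_tensor// lte_mul_pinfty ?sqnorm_ge0// ge0_fin_numE ?sqnorm_ge0.
Qed.

(** Norms of tensors multiply, so the two factors can be approximated one after the other.
    Indicators of rectangles are tensors, and rectangles form a pi-system generating the product
    sigma-algebra, so [approx_L2] concludes. *)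
Lemma approx_tensor (S1 : set (T1 -> R[i])) (S2 : set (T2 -> R[i]))
    (S : set (T1 * T2 -> R[i])) :
  S1 `<=` L2 m1 setT -> S2 `<=` L2 m2 setT ->
  subspace (m1 \x m2)%E S ->
  (forall f, L2 m1 setT f -> approx m1 S1 f) ->
  (forall f, L2 m2 setT f -> approx m2 S2 f) ->
  (forall f g, S1 f -> S2 g -> approx (m1 \x m2)%E S (fun z => f z.1 * g z.2)) ->
  forall f, L2 (m1 \x m2)%E setT f -> approx (m1 \x m2)%E S f.
Proof.
move=> S1L S2L Ssub S1d S2d S12.
have [SL Slin] := Ssub.
have tens f g : L2 m1 setT f -> L2 m2 setT g ->
    approx (m1 \x m2)%E S (fun z => f z.1 * g z.2).
  move=> Lf Lg; have [mf fL] := Lf; have [mg gL] := Lg.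
  have mfg (a : T1 -> R[i]) (b : T2 -> R[i]) : cmeasurable setT a -> cmeasurable setT b ->
      cmeasurable setT (fun z : T1 * T2 => a z.1 * b z.2).
    by move=> ma mb; mfun.
  pose Mg := fine (sqnorm m2 setT g).
  have Mg0 : 0 <= Mg by rewrite fine_ge0 ?sqnorm_ge0.
  have gM : sqnorm m2 setT g = Mg%:E by rewrite fineK// ge0_fin_numE ?sqnorm_ge0.
  apply: approx_limit => //; first exact: mfg.
  move=> e e0.
  have e1 : 0 < e / (Mg + 1) by rewrite divr_gt0// ltr_pwDr.
  have [f' Sf' ff'] := S1d _ Lf _ e1.
  have [mf' f'L] := S1L _ Sf'.
  exists (fun z => f' z.1 * g z.2); split; first exact: mfg.
    pose Mf := fine (sqnorm m1 setT f').
    have Mf0 : 0 <= Mf by rewrite fine_ge0 ?sqnorm_ge0.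
    have fM : sqnorm m1 setT f' = Mf%:E by rewrite fineK// ge0_fin_numE ?sqnorm_ge0.
    apply: approx_limit => //; first exact: mfg.
    move=> e' e'0.
    have e2 : 0 < e' / (Mf + 1) by rewrite divr_gt0// ltr_pwDr.
    have [g' Sg' gg'] := S2d _ Lg _ e2.
    have [mg' _] := S2L _ Sg'.
    exists (fun z => f' z.1 * g' z.2); split; [exact: mfg|exact: S12|].
    rewrite /sqdist; under eq_fun do rewrite -mulrBr.
    have -> := sqnorm_tensor mf' (cmeasurableB mg mg').
    rewrite fM (@le_lt_trans _ _ ((Mf + 1)%:E * sqdist m2 setT g g')%E)//.
      by rewrite lee_wpmul2r ?sqnorm_ge0// lee_fin lerDl.
    by rewrite -lte_pdivlMl ?ltr_pwDr// -EFinM mulrC.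
  rewrite /sqdist; under eq_fun do rewrite -mulrBl.
  have -> := sqnorm_tensor (cmeasurableB mf mf') mg.
  rewrite gM (@le_lt_trans _ _ (sqdist m1 setT f f' * (Mg + 1)%:E)%E)//.
    by rewrite lee_wpmul2l ?sqnorm_ge0// lee_fin lerDl.
  by rewrite -lte_pdivlMr ?ltr_pwDr// -EFinM.
have /sigma_finiteP[F [TF ndF Foo]] := sigma_finiteT m1.
have /sigma_finiteP[G [TG ndG Goo]] := sigma_finiteT m2.
pose rect := [set A `*` B | A in @measurable _ T1 & B in @measurable _ T2].
apply: (@approx_L2 _ _ _ _ _ rect (fun n => F n `*` G n) Ssub).
- exact: measurable_prod_measurableType.
- move=> _ _ [A mA [B mB <-]] [A' mA' [B' mB' <-]].
  exists (A `&` A'); first exact: measurableI.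
  exists (B `&` B'); first exact: measurableI.
  by rewrite setXI.
- move=> n; have [? _] := Foo n; have [? _] := Goo n.
  by exists (F n) => //; exists (G n).
- move=> [x y].
  have [n _ Fn] : (\bigcup_k F k) x by rewrite -TF.
  have [k _ Gk] : (\bigcup_k G k) y by rewrite -TG.
  exists (maxn n k) => // i /= ki; split => /=.
    by move: Fn; apply/subsetPset/ndF; rewrite (leq_trans _ ki)// leq_maxl.
  by move: Gk; apply/subsetPset/ndG; rewrite (leq_trans _ ki)// leq_maxr.
- move=> n; have [? ?] := Foo n; have [? ?] := Goo n.
  by rewrite /= product_measure1E// lte_mul_pinfty// ge0_fin_numE.
- move=> n _ [A mA [B mB <-]].
  have [mF ?] := Foo n; have [mGn ?] := Goo n.
  rewrite -setXI (_ : cindic _ = fun z => cindic (A `&` F n) z.1 * cindic (B `&` G n) z.2).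
    apply: tens.
      split; first exact/cmeasurable_cindic/measurableI.
      rewrite sqnorm_cindic; last exact: measurableI.
      apply: le_lt_trans (_ : (m1 (F n) < +oo)%E) => //.
      by rewrite le_measure ?inE//; exact: measurableI.
    split; first exact/cmeasurable_cindic/measurableI.
    rewrite sqnorm_cindic; last exact: measurableI.
    apply: le_lt_trans (_ : (m2 (G n) < +oo)%E) => //.
    by rewrite le_measure ?inE//; exact: measurableI.
  apply/funext => -[x y]; rewrite /cindic !indicE in_setX /=.
  by case: (_ \in _); case: (_ \in _); rewrite ?mulr0 ?mul0r ?mulr1.
Qed.

End tensor.

(** * The Plancherel theorem *)

Section poisson_kernel.
Context (R : realType).
Local Notation mR := (measurableTypeR R).
Local Notation L := (@lebesgue_measure R).

(** Adding 1 to the cosine makes the integrand nonnegative, as the fundamental theorem of calculus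
    on a half-line requires; the contribution of the 1 is subtracted in [int_weight_cos]. *)
Let exp_osc (a b x : R) : R := expR (- a * x) * (1 + cos (b * x)).

(** The primitive of [exp_osc] that tends to 0 at infinity, so that the integral over the half-line
    is minus its value at 0. *)
Let exp_osc_prim (a b x : R) : R :=
  expR (- a * x) * ((b * sin (b * x) - a * cos (b * x)) / (a ^+ 2 + b ^+ 2) - a^-1).

Let is_derive_prim (a b x : R) : 0 < a ->
  is_derive x 1 (exp_osc_prim a b) (exp_osc a b x).
Proof.
move=> a0; have ab0 : a ^+ 2 + b ^+ 2 != 0.
  by rewrite gt_eqF// ltr_pwDl ?exprn_gt0// sqr_ge0.
have dl (c : R) : is_derive x 1 (fun y : R => c * y) c.
  by apply: is_derive_eq; rewrite /= ?scaler0 ?add0r ?addr0 /GRing.scale /= ?mulr1.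
have dexp : is_derive x 1 (fun y : R => expR (- a * y)) (expR (- a * x) * - a).
  by apply: (is_derive1_comp (f := expR) (g := fun y => - a * y)).
have dsin : is_derive x 1 (fun y : R => sin (b * y)) (cos (b * x) * b).
  by apply: (is_derive1_comp (f := sin) (g := fun y => b * y)).
have dcos : is_derive x 1 (fun y : R => cos (b * y)) (- sin (b * x) * b).
  by apply: (is_derive1_comp (f := cos) (g := fun y => b * y)).
pose q : R := (a ^+ 2 + b ^+ 2)^-1.
have d1 : is_derive x 1 (fun y : R => b * q * sin (b * y)) (b * q * (cos (b * x) * b)).
  exact: (is_deriveZ (b * q) dsin).
have d2 : is_derive x 1 (fun y : R => - a * q * cos (b * y)) (- a * q * (- sin (b * x) * b)).
  exact: (is_deriveZ (- a * q) dcos).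
have d3 : is_derive x 1 (fun y : R => b * q * sin (b * y) + - a * q * cos (b * y) + - a^-1)
    (b * q * (cos (b * x) * b) + - a * q * (- sin (b * x) * b) + 0).
  exact: (is_deriveD (is_deriveD d1 d2) (is_derive_cst _ _ _)).
have d4 : is_derive x 1 (exp_osc_prim a b)
    (expR (- a * x) * (b * q * (cos (b * x) * b) + - a * q * (- sin (b * x) * b) + 0) +
     (b * q * sin (b * x) + - a * q * cos (b * x) + - a^-1) * (expR (- a * x) * - a)).
  rewrite (_ : exp_osc_prim a b = (fun y : R => expR (- a * y) *
      (b * q * sin (b * y) + - a * q * cos (b * y) + - a^-1))).
    exact: (is_deriveM dexp d3).
  by apply/funext => y; rewrite /exp_osc_prim -/q; ring.
apply: is_derive_eq d4 _; rewrite /exp_osc.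
have h1 : q * (a ^+ 2 + b ^+ 2) = 1 by rewrite mulVf.
have h2 : a^-1 * a = 1 by rewrite mulVf// gt_eqF.
set E := expR _; set C := cos _; set S := sin _.
rewrite (_ : _ + _ = E * (C * (q * (a ^+ 2 + b ^+ 2)) + a^-1 * a)).
  by rewrite h1 h2 mulr1 addrC.
by ring.
Qed.

Let continuous_prim (a b : R) : 0 < a -> continuous (exp_osc_prim a b).
Proof.
move=> a0 x; have [d _] := is_derive_prim b x a0.
exact/differentiable_continuous/derivable1_diffP.
Qed.

Let continuous_osc (a b : R) : continuous (exp_osc a b).
Proof.
move=> x; rewrite /exp_osc; apply: cvgM.
  apply: (@continuous_comp _ _ _ (fun y : R => - a * y) expR).
    exact: mulrl_continuous.
  exact: continuous_expR.
apply: cvgD; first exact: cvg_cst.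
apply: (@continuous_comp _ _ _ (fun y : R => b * y) cos).
  exact: mulrl_continuous.
exact: continuous_cos.
Qed.

Let exp_osc_ge0 (a b x : R) : 0 <= exp_osc a b x.
Proof.
rewrite mulr_ge0 ?expR_ge0// -lerBlDl sub0r; exact: cos_geN1.
Qed.

Let prim_cvgy (a b : R) : 0 < a -> exp_osc_prim a b x @[x --> +oo] --> 0.
Proof.
move=> a0.
have ab0 : 0 < a ^+ 2 + b ^+ 2 by rewrite ltr_pwDl ?exprn_gt0// sqr_ge0.
have e0 : expR (- a * x) @[x --> +oo] --> (0 : R).
  rewrite (_ : (fun x => expR (- a * x)) = (fun z => expR (- z)) \o (fun z => a * z)).
    apply: (@cvg_comp _ _ _ _ _ _ (pinfty_nbhs R)); last exact: cvgr_expR.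
    exact: gt0_cvgMry.
  by apply: eq_fun => x; rewrite mulNr.
pose K := (`|b| + a) / (a ^+ 2 + b ^+ 2) + a^-1.
have eK : expR (- a * x) * K @[x --> +oo] --> (0 : R).
  by rewrite -[X in _ --> X](mul0r K); apply: cvgM => //; exact: cvg_cst.
have eNK : - (expR (- a * x) * K) @[x --> +oo] --> (0 : R).
  by rewrite -oppr0; exact: cvgN.
apply: (squeeze_cvgr _ eNK eK); apply: nearW => x.
rewrite -ler_norml normrM ger0_norm ?expR_ge0// ler_wpM2l ?expR_ge0//.
apply: le_trans (ler_normB _ _) _; rewrite (ger0_norm (x := a^-1)) ?invr_ge0 ?(ltW a0)//.
rewrite lerD2r normrM (ger0_norm (x := _^-1)) ?invr_ge0 ?(ltW ab0)//.
rewrite ler_wpM2r ?invr_ge0 ?(ltW ab0)//.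
apply: le_trans (ler_normB _ _) _; rewrite !normrM (gtr0_norm a0) lerD//.
  by rewrite ler_piMr// ler_norml sin_geN1 sin_le1.
by rewrite ler_piMr ?(ltW a0)// ler_norml cos_geN1 cos_le1.
Qed.

Let integral_exp_osc (a b : R) : 0 < a ->
  (\int[L]_(x in `[0%R, +oo[) (exp_osc a b x)%:E =
   (a / (a ^+ 2 + b ^+ 2) + a^-1)%:E)%E.
Proof.
move=> a0; rewrite (@ge0_continuous_FTC2y _ _ (exp_osc_prim a b) _ 0).
- rewrite -EFinD /exp_osc_prim !mulr0 expR0 sin0 cos0; congr _%:E.
  by ring.
- by move=> x _; exact: exp_osc_ge0.
- by apply: continuous_subspaceT; exact: continuous_osc.
- exact: prim_cvgy.
- by move=> x _; have [] := is_derive_prim b x a0.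
- by apply: cvg_at_right_filter; exact: continuous_prim.
- by move=> x _; rewrite derive1E; have [_] := is_derive_prim b x a0.
Qed.

Let integralT_exp_osc (a b : R) : 0 < a ->
  (\int[L]_x (exp_osc a b `|x|)%:E = (2 * (a / (a ^+ 2 + b ^+ 2) + a^-1))%:E)%E.
Proof.
move=> a0; rewrite ge0_symfun_integralT.
- rewrite EFinM -(integral_exp_osc b a0); congr (_ * _)%E.
  rewrite -set_itvcy; apply: eq_integral => x.
  by rewrite inE /= in_itv/= andbT => x0; rewrite ger0_norm.
- by move=> x; exact: exp_osc_ge0.
- move=> x; apply: (@continuous_comp _ _ _ (@Num.norm R R) (exp_osc a b)).
    exact: norm_continuous.
  exact: continuous_osc.
- by move=> x /=; rewrite normrN.
Qed.

(** Abel's summation factor. Its Fourier transform is the Poisson kernel [poisson e] of the upper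
    half-plane ([fourier_poisson_weight]). *)
Definition poisson_weight (e xi : R) : R := expR (- (2 * pi * e) * `|xi|).
Definition poisson (e z : R) : R := e / (pi * (e ^+ 2 + z ^+ 2)).

Lemma poisson_weight_ge0 e xi : 0 <= poisson_weight e xi.
Proof. exact: expR_ge0. Qed.

Lemma poisson_weight_le1 e xi : 0 < e -> poisson_weight e xi <= 1.
Proof.
move=> e0; rewrite /poisson_weight -expR0 ler_expR mulNr oppr_le0.
by rewrite !mulr_ge0// ?pi_ge0// ltW.
Qed.

Lemma measurable_poisson_weight e : measurable_fun setT (poisson_weight e : mR -> R).
Proof.
rewrite /poisson_weight; apply: (mf_comp (@measurable_expR R)).
by mfun.
Qed.

Lemma poisson_ge0 e z : 0 < e -> 0 <= poisson e z.
Proof.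
move=> e0; rewrite divr_ge0 ?(ltW e0)// mulr_ge0 ?pi_ge0//.
by rewrite addr_ge0 ?sqr_ge0.
Qed.

Lemma measurable_poisson e : measurable_fun setT (poisson e : mR -> R).
Proof. by rewrite /poisson; mfun. Qed.

Let two_pi_e (e : R) : 0 < e -> 0 < 2 * pi * e.
Proof. by move=> e0; rewrite !mulr_gt0// pi_gt0. Qed.

Lemma integral_poisson_weight e : 0 < e ->
  (\int[L]_x (poisson_weight e x)%:E = (pi * e)^-1%:E)%E.
Proof.
move=> /two_pi_e a0; have := integralT_exp_osc 0 a0.
have pn : pi != 0 :> R by rewrite gt_eqF ?pi_gt0.
have en : e != 0 by move: a0; rewrite pmulr_rgt0 ?mulr_gt0 ?pi_gt0// => /lt0r_neq0.
rewrite (_ : (fun x => _) = (fun x : R => 2%:E * (poisson_weight e x)%:E))%E; last first.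
  by apply/funext => x; rewrite /exp_osc mul0r cos0 -EFinM mulrC.
rewrite integralZT//.
- move=> h; have : ((2^-1)%:E * (2%:E * \int[L]_x (poisson_weight e x)%:E) =
    (2^-1)%:E * (2 * (2 * pi * e / ((2 * pi * e) ^+ 2 + 0 ^+ 2) + (2 * pi * e)^-1))%:E)%E.
    by rewrite h.
  rewrite muleA -EFinM mulVf// mul1e => ->; rewrite -EFinM; congr _%:E.
  by rewrite expr0n addr0; move: (pi : R) pn => p pn; field; rewrite pn en.
- by apply: mf_EFin; exact: measurable_poisson_weight.
- by move=> x; rewrite lee_fin poisson_weight_ge0.
Qed.

Lemma cintegrable_poisson_weight e : 0 < e ->
  cintegrable L (fun x => (poisson_weight e x)%:C).
Proof.
move=> e0; split; first by apply: cmeasurable_real; exact: measurable_poisson_weight.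
under eq_integral => x _.
  rewrite (_ : n1 _ = poisson_weight e x); first over.
  by rewrite /n1 /= normr0 addr0 ger0_norm ?poisson_weight_ge0.
by rewrite integral_poisson_weight// ltry.
Qed.

Let int_weight_cos (e z : R) : 0 < e ->
  \int[L]_x (poisson_weight e x * cos (2 * pi * z * x)) = poisson e z.
Proof.
move=> e0; have a0 := two_pi_e e0.
have pn : pi != 0 :> R by rewrite gt_eqF ?pi_gt0.
have wi : L.-integrable setT (fun x => (poisson_weight e x)%:E).
  by have /cintegrableP[] := cintegrable_poisson_weight e0.
have oi : L.-integrable setT (fun x => (exp_osc (2 * pi * e) (2 * pi * z) `|x|)%:E).
  apply/integrableP; split.
    apply: mf_EFin; rewrite /exp_osc; apply: mf_mul.
      by apply: (mf_comp (@measurable_expR R)); mfun.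
    apply: mf_add; first exact: measurable_cst.
    by apply: (mf_comp (@measurable_cos' R)); mfun.
  under eq_integral do rewrite gee0_abs ?lee_fin ?exp_osc_ge0//.
  by rewrite integralT_exp_osc// ltry.
have -> : (fun x : R => poisson_weight e x * cos (2 * pi * z * x)) =
    (fun x => exp_osc (2 * pi * e) (2 * pi * z) `|x| - poisson_weight e x).
  apply/funext => x; rewrite /exp_osc /poisson_weight [RHS](_ :
    _ = expR (- (2 * pi * e) * `|x|) * cos (2 * pi * z * `|x|)); last by ring.
  congr (_ * _).
  by have [x0|x0] := leP 0 x; rewrite ?(ger0_norm x0) ?(ltr0_norm x0) ?mulrN ?cosN.
rewrite RintegralB// /Rintegral integralT_exp_osc// integral_poisson_weight//=.
have h1 : e ^+ 2 + z ^+ 2 != 0.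
  by rewrite gt_eqF// ltr_pwDl ?exprn_gt0// sqr_ge0.
have h2 : (2 * pi * e) ^+ 2 + (2 * pi * z) ^+ 2 != 0.
  by rewrite gt_eqF// ltr_pwDl ?exprn_gt0// sqr_ge0.
have en : e != 0 by rewrite gt_eqF.
move: pn h2; rewrite /poisson; move: (pi : R) => p pn h2.
by field; rewrite h1 pn en h2.
Qed.

(** The integrand is odd, so the reflection of the line shows that the integral is its own
    opposite. *)
Let int_weight_sin (e z : R) : 0 < e ->
  \int[L]_x (poisson_weight e x * sin (2 * pi * z * x)) = 0.
Proof.
move=> e0; set I := Rintegral _ _ _.
suff : I = - I by move/eqP; rewrite -addr_eq0 -mulr2n mulrn_eq0 => /eqP.
have wi : L.-integrable setT (fun x => (poisson_weight e x * sin (2 * pi * z * x))%:E).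
  have /cintegrableP[_] := cintegrable_phase (r := fun x : mR => 2 * pi * z * x)
    ltac:(mfun) (cintegrable_poisson_weight e0).
  by under eq_fun do rewrite ImM /= mulr0 add0r mulrC.
have := @cint_transport _ _ _ _ _ L L (fun x : mR => - x : mR) (fun=> 1) (fun=> ler01).
have H (f : mR -> \bar R) : measurable_fun setT f -> (forall y, 0 <= f y)%E ->
    (\int[L]_x (1%:E * f (- x)%R) = \int[L]_y f y)%E.
  move=> mf f0; have n0 : (-1 : R) != 0 by rewrite oppr_eq0 oner_eq0.
  rewrite -[RHS](integral_affine 0 n0)//.
  by apply: eq_integral => x _; rewrite normrN1 addr0 mulN1r.
move=> /(_ H (fun x => (poisson_weight e x * sin (2 * pi * z * x))%:C)) => HH.
have : cmeasurable setT (fun x : mR => (poisson_weight e x * sin (2 * pi * z * x))%:C).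
  by apply: cmeasurable_real; apply/measurable_EFinP; exact: measurable_int wi.
move=> /HH/(congr1 (@complex.Re R)) /= E.
transitivity (\int[L]_x (-1 * (poisson_weight e x * sin (2 * pi * z * x)))).
  rewrite /I -[LHS]E; apply: eq_Rintegral => x _.
  by rewrite mul0r subr0 mul1r /poisson_weight normrN mulrN sinN mulrN mulN1r.
by rewrite RintegralZl// mulN1r.
Qed.

Lemma fourier_poisson_weight (e z : R) : 0 < e ->
  cintegral L setT (fun x => expi (2 * pi * z * x) * (poisson_weight e x)%:C) =
  (poisson e z)%:C.
Proof.
move=> e0; apply: complexP => /=.
  rewrite -(int_weight_cos z e0); apply: eq_Rintegral => x _.
  by rewrite mulr0 subr0 mulrC.
apply: etrans (int_weight_sin z e0); apply: eq_Rintegral => x _.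
by rewrite mulr0 add0r mulrC.
Qed.

Let p1 (s : R) : R := (pi * (1 + s ^+ 2))^-1.

(** The substitution y = x - e s turns the kernel into 1 / (pi (1 + s^2)), whose integral over a
    half-line is 1/2. *)
Lemma integral_poisson (e x : R) : 0 < e ->
  (\int[L]_y (poisson e (x - y))%:E = 1)%E.
Proof.
move=> e0; have pn : pi != 0 :> R by rewrite gt_eqF ?pi_gt0.
rewrite -(integral_affine (a := - e) x) ?oppr_eq0 ?gt_eqF//; last 2 first.
- by apply: mf_EFin; apply: (mf_comp (measurable_poisson e)); mfun.
- by move=> y; rewrite lee_fin poisson_ge0.
rewrite (_ : (fun y => _) = (fun y : R => (pi^-1)%:E * ((oneDsqr y)^-1)%:E)%E); last first.
  apply/funext => y; rewrite -!EFinM; congr _%:E; rewrite normrN gtr0_norm// /poisson.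
  rewrite opprD addrCA subrr addr0 mulNr opprK exprMn.
  have -> : e ^+ 2 + e ^+ 2 * y ^+ 2 = e ^+ 2 * oneDsqr y by rewrite /oneDsqr mulrDr mulr1.
  have on : oneDsqr y != 0 by rewrite gt_eqF// oneDsqr_gt0.
  move: (pi : R) pn (oneDsqr y) on => p pn o on; field; rewrite pn on gt_eqF//.
rewrite integralZT; last 3 first.
- apply: mf_EFin; apply: measurable_inv; rewrite /oneDsqr; mfun.
- by rewrite invr_ge0 pi_ge0.
- by move=> y; rewrite lee_fin invr_ge0 ltW// oneDsqr_gt0.
rewrite ge0_symfun_integralT.
- rewrite -set_itvcy integral0y_oneDsqr -!EFinM; congr _%:E.
  by move: (pi : R) pn => p pn; field.
- by move=> y; rewrite invr_ge0 ltW// oneDsqr_gt0.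
- exact: continuous_oneDsqrV.
- by move=> y /=; rewrite /oneDsqr sqrrN.
Qed.

End poisson_kernel.

(** * Continuity of translations in L^2 of the line *)

Section translation.
Context (R : realType).
Local Notation mR := (measurableTypeR R).
Local Notation L := (@lebesgue_measure R).
Implicit Types f g : mR -> R[i].

Definition shift_dist f (h : R) : \bar R := sqdist L setT f (fun x => f (x + h)).

Lemma integral_shift (f : mR -> \bar R) (h : R) : measurable_fun setT f ->
  (forall x, 0 <= f x)%E -> (\int[L]_x f (x + h)%R = \int[L]_x f x)%E.
Proof.
move=> mf f0; rewrite -[RHS](integral_affine h (oner_neq0 _))//.
by apply: eq_integral => x _; rewrite normr1 mul1e mul1r.
Qed.

Lemma cmeasurable_shift f h : cmeasurable setT f -> cmeasurable setT (fun x : mR => f (x + h)).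
Proof. by move=> mf; apply: (cmeasurable_comp mf); mfun. Qed.

Lemma sqnorm_shift f h : cmeasurable setT f ->
  sqnorm L setT (fun x => f (x + h)) = sqnorm L setT f.
Proof.
move=> mf; rewrite /sqnorm (@integral_shift (fun x => (csqr (f x))%:E))//.
  exact: measurable_csqrE.
by move=> x; rewrite lee_fin csqr_ge0.
Qed.

Lemma shift_dist_le f h : cmeasurable setT f ->
  (shift_dist f h <= 4%:E * sqnorm L setT f)%E.
Proof.
move=> mf; have ms := cmeasurable_shift h mf.
apply: le_trans (sqnormD_le L mf (cmeasurableN ms)) _.
rewrite (_ : sqnorm L setT (fun x => - f (x + h)) = sqnorm L setT f); last first.
  rewrite -(sqnorm_shift h mf); apply: eq_integral => x _; congr _%:E; exact: csqrN.
have := sqnorm_ge0 L setT f; case: (sqnorm _ _ _) => [r|_|//].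
  by rewrite lee_fin => r0; rewrite -!EFinM -EFinD lee_fin; lra.
by rewrite !gt0_muley.
Qed.

(** Write f as g + (f - g). The difference f - g moves by at most 4 times its squared norm, and the
    factor 2 of [sqnormD_le] makes this 8. *)
Lemma shift_dist_triangle f g h : cmeasurable setT f -> cmeasurable setT g ->
  (shift_dist f h <= 2%:E * shift_dist g h + 8%:E * sqdist L setT f g)%E.
Proof.
move=> mf mg; have mf' := cmeasurable_shift h mf; have mg' := cmeasurable_shift h mg.
have mfg := cmeasurableB mf mg.
have -> : shift_dist f h = sqnorm L setT
    (fun x => (g x - g (x + h)) + ((f x - g x) - (f (x + h) - g (x + h)))).
  by apply: eq_integral => x _; congr (csqr _)%:E; ring.
apply: le_trans (sqnormD_le L (cmeasurableB mg mg') (cmeasurableB mfg (cmeasurable_shift h mfg))) _.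
rewrite leeD2l// (_ : 8%:E = 2%:E * 4%:E)%E; last by rewrite -EFinM; congr _%:E; ring.
rewrite -muleA lee_wpmul2l//.
exact: (shift_dist_le h mfg).
Qed.

(** The indicator and its translate differ only at points within |h| of one of the two endpoints,
    that is inside two intervals of length 2 |h|. *)
Lemma shift_dist_itv (a b h : R) : a <= b ->
  (shift_dist (cindic `]a, b]%classic) h <= (4 * `|h|)%:E)%E.
Proof.
move=> ab.
have mI (x y : R) : measurable (`[x, y]%classic : set mR) by exact: measurable_itv.
apply: (@le_trans _ _ (\int[L]_x ((\1_(`[a - `|h|, a + `|h|]%classic) x : R)%:E +
   (\1_(`[b - `|h|, b + `|h|]%classic) x : R)%:E))%E).
  apply: le_integralT.
  - apply: measurable_csqrE; apply: cmeasurableB; last apply: cmeasurable_shift;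
      by apply: cmeasurable_cindic; exact: measurable_itv.
  - by apply: mf_eadd; apply: mf_EFin; apply: measurable_indic; exact: measurable_itv.
  - by move=> x; rewrite lee_fin csqr_ge0.
  - move=> x; rewrite -EFinD lee_fin /cindic -rmorphB csqr_real !indicE.
    have ind0 (b1 b2 : bool) : 0 <= b1%:R + b2%:R :> R by case: b1; case: b2; rewrite ?addr0.
    have h1 := ler_norm h; have h2 := ler_norm (- h); rewrite normrN in h2.
    have cas (p q : R) : (x \in `[p - `|h|, p + `|h|]%classic) = (p - `|h| <= x <= p + `|h|).
      by apply/idP/idP; rewrite inE /= in_itv.
    have cas2 (y : R) : (y \in `]a, b]%classic) = (a < y <= b).
      by apply/idP/idP; rewrite inE /= in_itv.
    rewrite !cas// !cas2.
    have [ax|ax] := ltP a x; have [xb|xb] := leP x b; have [ay|ay] := ltP a (x + h);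
      have [yb|yb] := leP (x + h) b => /=; rewrite ?subrr ?subr0 ?sub0r ?sqrrN ?expr0n ?expr1n /=
        ?ind0//;
      do ?[have -> : a - `|h| <= x by lra]; do ?[have -> : x <= a + `|h| by lra];
      do ?[have -> : b - `|h| <= x by lra]; do ?[have -> : x <= b + `|h| by lra];
      rewrite /= ?lerDl ?lerDr ?ler0n//; lra.
rewrite integralDT//; last 2 first.
- by apply: mf_EFin; apply: measurable_indic; exact: measurable_itv.
- by apply: mf_EFin; apply: measurable_indic; exact: measurable_itv.
have ii (p q : R) : (\int[L]_x (\1_(`[p, q]%classic) x : R)%:E = L `[p, q]%classic)%E.
  by rewrite integral_indic ?setIT//; exact: measurable_itv.
rewrite !ii.
rewrite [X in (X + _)%E]lebesgue_measure_itv [X in (_ + X)%E]lebesgue_measure_itv /= !lte_fin.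
have h0 := normr_ge0 h.
have E (p : R) : (if p - `|h| < p + `|h| then ((p +
  `|h|)%:E - (p - `|h|)%:E)%E else 0%E) = (2 * `|h|)%:E.
  case: ltP => ph; first by rewrite -EFinB; congr _%:E; ring.
  by congr _%:E; lra.
by rewrite !E -EFinD lee_fin; lra.
Qed.

End translation.

Section intervals.
Context (R : realType).
Local Notation mR := (measurableTypeR R).
Local Notation L := (@lebesgue_measure R).

Lemma approx_itv (S : set (mR -> R[i])) : subspace L S ->
  (forall a b : R, a <= b -> approx L S (cindic `]a, b]%classic)) ->
  forall f, L2 L setT f -> approx L S f.
Proof.
move=> Ssub Sitv; have [SL Slin] := Ssub.
apply: (@approx_L2 _ _ _ L S (@ocitv R) (fun n : nat => `](- n%:R), n%:R]%classic) Ssub).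
- by [].
- exact: ocitvI.
- by move=> n; exact: is_ocitv.
- move=> x; near=> n => /=; rewrite in_itv /=.
  have : `|x| < n%:R.
    near: n; exact: nbhs_infty_gtr.
  by rewrite ltr_norml => /andP[-> /ltW].
- by move=> n; rewrite [X in (X < _)%E]lebesgue_measure_itv /=; case: ifP;
  rewrite ?ltry// -EFinB ltry.
- move=> n _ [[a b] _ <-] /=.
  have : ocitv (`]a, b]%classic `&` `](- n%:R), n%:R]%classic).
    by apply: ocitvI; exact: is_ocitv.
  move=> /ocitvP[->|[[c d] /= cd ->]]; last by apply: Sitv; exact: ltW.
  have := Sitv 0 0 (lexx _).
  by rewrite (_ : `]0, 0]%classic = set0)// set_itv_ge// bnd_simp ltxx.
Unshelve. all: by end_near. Qed.

End intervals.

Section translation_continuity.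
Context (R : realType).
Local Notation mR := (measurableTypeR R).
Local Notation L := (@lebesgue_measure R).
Implicit Types f g : mR -> R[i].

(** The functions on which translation is continuous at zero. They form a subspace containing the
    indicators of intervals, hence a dense one; the uniform bound [shift_dist_triangle] then gives
    the property for all of L^2. *)
Let tc : set (mR -> R[i]) :=
  [set f | L2 L setT f /\
     forall eps : R, 0 < eps -> exists2 d : R, 0 < d &
       forall h, `|h| < d -> (shift_dist f h < eps%:E)%E].

Let tc_subspace : subspace L tc.
Proof.
split; first by move=> f [].
move=> a f g [Lf cf] [Lg cg]; split; first exact: L2D (L2Z a Lf) Lg.
have [mf _] := Lf; have [mg _] := Lg.
move=> e e0.
have k0 : 0 < 4 * (csqr a + 1) by rewrite mulr_gt0// ltr_pwDr// csqr_ge0.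
have [d1 d10 fd1] := cf (e / (4 * (csqr a + 1))) (divr_gt0 e0 k0).
have [d2 d20 gd2] := cg (e / 4) (divr_gt0 e0 (ltr0n _ 4)).
exists (Num.min d1 d2); first by rewrite lt_min d10.
move=> h; rewrite lt_min => /andP[/fd1 hf /gd2 hg].
have mfh := cmeasurable_shift h mf; have mgh := cmeasurable_shift h mg.
rewrite /shift_dist /sqdist (_ : (fun x => _ - _) =
  (fun x => a * (f x - f (x + h)) + (g x - g (x + h)))); last first.
  by apply/funext => x; ring.
apply: le_lt_trans (sqnormD_le L _ _) _; [by mfun|by mfun|].
rewrite sqnormZ; last by mfun.
have -> : e = e / 2 + e / 2 by rewrite -splitr.
rewrite [X in (_ < X)%E]EFinD lteD//.
  rewrite muleA -EFinM (@le_lt_trans _ _ ((2 * (csqr a + 1))%:E * shift_dist f h)%E)//.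
    by rewrite lee_wpmul2r ?sqnorm_ge0// lee_fin ler_wpM2l// lerDl.
  rewrite -lte_pdivlMl ?mulr_gt0 ?ltr_pwDr ?csqr_ge0// -EFinM.
  rewrite (lt_le_trans hf)// lee_fin le_eqVlt; apply/orP; left; apply/eqP.
  by field; rewrite lt0r_neq0// ltr_pwDr ?csqr_ge0.
rewrite -lte_pdivlMl// -EFinM (lt_le_trans hg)// lee_fin le_eqVlt.
by apply/orP; left; apply/eqP; field.
Qed.

Lemma shift_dist_continuous f : L2 L setT f ->
  forall eps : R, 0 < eps -> exists2 d : R, 0 < d &
       forall h, `|h| < d -> (shift_dist f h < eps%:E)%E.
Proof.
move=> Lf e e0; have [mf _] := Lf.
have tcd : forall g, L2 L setT g -> approx L tc g.
  apply: approx_itv tc_subspace _ => a b ab.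
  apply: approx_self; split.
    split; first by apply: cmeasurable_cindic; exact: measurable_itv.
    rewrite sqnorm_cindic; last exact: measurable_itv.
    by rewrite [X in (X < _)%E]lebesgue_measure_itv /=; case: ifP; rewrite ?ltry// -EFinB ltry.
  move=> {}e {}e0; exists (e / 4); first by rewrite divr_gt0.
  move=> h hd; apply: le_lt_trans (shift_dist_itv h ab) _.
  by rewrite lte_fin; move: hd; rewrite ltr_pdivlMr// mulrC.
(* [shift_dist_triangle] has coefficients 2 and 8, so two errors of e / 20 add up to less than e /
   2. *)
have e20 : 0 < e / 20 by rewrite divr_gt0.
have [g [[mg _] cg] fg] := tcd _ Lf _ e20.
have [d d0 gd] := cg _ e20; exists d => // h /gd hg.
apply: le_lt_trans (shift_dist_triangle h mf mg) _.
have -> : e = 2 * (e / 20) + 18 * (e / 20) by field.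
rewrite [X in (_ < X)%E]EFinD lteD//.
  by rewrite EFinM lte_pmul2l.
rewrite EFinM; apply: (@lt_trans _ _ (8%:E * (e / 20)%:E)%E).
  by rewrite lte_pmul2l.
by rewrite -!EFinM lte_fin ltr_pM2r// ltr_nat.
Qed.

Lemma shift_dist_cvg f (s : R) : L2 L setT f ->
  shift_dist f (s / n.+1%:R) @[n --> \oo] --> 0%E.
Proof.
move=> Lf; have [mf fL] := Lf.
apply/fine_cvgP; split.
  apply: nearW => n; rewrite ge0_fin_numE ?sqnorm_ge0//.
  by apply: le_lt_trans (shift_dist_le _ mf) _; rewrite lte_mul_pinfty.
apply/cvgr0Pnorm_lt => e e0.
have [d d0 fd] := shift_dist_continuous Lf e0.
near=> n.
have h : (shift_dist f (s / n.+1%:R) < e%:E)%E.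
  apply: fd; rewrite normrM (ger0_norm (x := _^-1)) ?invr_ge0//.
  rewrite ltr_pdivrMr// mulrC -ltr_pdivrMr//.
  apply: (@lt_trans _ _ n%:R); last by rewrite ltr_nat.
  by near: n; exact: nbhs_infty_gtr.
rewrite /= ger0_norm; last by rewrite fine_ge0// sqnorm_ge0.
rewrite -lte_fin fineK// ge0_fin_numE ?sqnorm_ge0//.
by apply: lt_trans h _; exact: ltry.
Unshelve. all: by end_near. Qed.

End translation_continuity.

Section complex_product.
Context d1 d2 (T1 : measurableType d1) (T2 : measurableType d2) (R : realType).
Variables (m1 : {sigma_finite_measure set T1 -> \bar R}).
Variables (m2 : {sigma_finite_measure set T2 -> \bar R}).

Let Rintegral_prod (f : T1 * T2 -> R) :
  (m1 \x m2)%E.-integrable setT (fun z => (f z)%:E) ->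
  \int[(m1 \x m2)%E]_z f z = \int[m1]_x \int[m2]_y f (x, y).
Proof.
move=> fi.
have mf : measurable_fun setT f by apply/measurable_EFinP; exact: measurable_int fi.
rewrite /Rintegral -(integral12_prod_meas1 fi); congr fine.
apply: ae_eq_integral => //.
- exact: (measurable_fubini_F fi).
- by apply/measurable_EFinP; exact: (measurable_Rintegralr m2 mf).
- apply: filterS (ae_integrable1 fi) => x /= xi _.
  by rewrite /fubini_F fineK//; exact: integrable_fin_num.
Qed.

Lemma cint_prod1 (f : T1 * T2 -> R[i]) : cintegrable (m1 \x m2)%E f ->
  cintegral (m1 \x m2)%E setT f =
  cintegral m1 setT (fun x => cintegral m2 setT (fun y => f (x, y))).
Proof.
move=> /cintegrableP[f1 f2]; apply: complexP => /=.
  exact: Rintegral_prod f1.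
exact: Rintegral_prod f2.
Qed.

Lemma cintegrable_tensor (f : T1 -> R[i]) (g : T2 -> R[i]) :
  cintegrable m1 f -> cintegrable m2 g ->
  cintegrable (m1 \x m2)%E (fun z => f z.1 * g z.2).
Proof.
move=> [mf fi] [mg gi].
have mfg : cmeasurable setT (fun z : T1 * T2 => f z.1 * g z.2).
  by mfun.
apply: cintegrable_prodP => //.
have m1f : measurable_fun setT (fun x => (n1 (f x))%:E).
  by apply: mf_EFin; exact: measurable_n1.
have m1g : measurable_fun setT (fun x => (n1 (g x))%:E).
  by apply: mf_EFin; exact: measurable_n1.
have n0 (z : R[i]) : (0 <= (n1 z)%:E)%E by rewrite lee_fin n1_ge0.
apply: (@le_lt_trans _ _ (\int[m1]_x ((n1 (f x))%:E * \int[m2]_y (n1 (g y))%:E))%E).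
  apply: le_integralT.
  - apply: (measurable_integralr m2 (f := fun z : T1 * T2 => (n1 (f z.1 * g z.2))%:E)) => //.
    by apply: mf_EFin; exact: measurable_n1.
  - by apply: mf_emul => //; exact: measurable_cst.
  - by move=> x; exact: integral_ge0.
  - move=> x; rewrite -integralZT ?n1_ge0//; apply: le_integralT.
    + apply: mf_EFin; apply: measurable_n1; mfun.
    + by apply: mf_emul => //; exact: measurable_cst.
    + by [].
    + by move=> y; rewrite -EFinM lee_fin n1M.
rewrite ge0_integralZr//; last exact: integral_ge0.
by rewrite lte_mul_pinfty ?integral_ge0// ge0_fin_numE ?integral_ge0.
Qed.

Lemma cint_tensor (f : T1 -> R[i]) (g : T2 -> R[i]) :
  cintegrable m1 f -> cintegrable m2 g ->
  cintegral (m1 \x m2)%E setT (fun z => f z.1 * g z.2) =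
  cintegral m1 setT f * cintegral m2 setT g.
Proof.
move=> fi gi; rewrite cint_prod1; last exact: cintegrable_tensor.
rewrite /= [RHS]mulrC -cintZ//; apply: eq_cint => x.
by rewrite cintZ// mulrC.
Qed.

End complex_product.

Lemma cintJ d (T : measurableType d) (R : realType) (mu : {measure set T -> \bar R})
    (f : T -> R[i]) : cintegrable mu f ->
  cintegral mu setT (fun x => (f x)^*%R) = (cintegral mu setT f)^*%R.
Proof.
move=> /cintegrableP[f1 f2]; apply: complexP => /=.
  by apply: eq_Rintegral => x _; rewrite ReJ.
under eq_Rintegral do rewrite ImJ -mulN1r.
by rewrite RintegralZl// mulN1r.
Qed.

Lemma cintegrableJ d (T : measurableType d) (R : realType) (mu : {measure set T -> \bar R})
    (f : T -> R[i]) : cintegrable mu f -> cintegrable mu (fun x => (f x)^*%R).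
Proof.
move=> [mf fi]; split; first exact: cmeasurableJ.
by under eq_integral do rewrite n1J.
Qed.

Section plancherel.
Context (R : realType).
Local Notation mR := (measurableTypeR R).
Local Notation L := (@lebesgue_measure R).
Local Notation LL := (@leb2 R).
Implicit Types f g : mR -> R[i].

Definition FT f (xi : R) : R[i] :=
  cintegral L setT (fun x : mR => expi (- (2 * pi * x * xi)) * f x).

(* Abel summation: weighting |FT f|^2 with exp (- 2 pi e |xi|) makes its integral
   equal to sqnorm f - osc e f / 2, and osc e f tends to 0 with e because
   translations are continuous in L^2. *)
Definition osc (e : R) f : \bar R :=
  (\int[L]_x \int[L]_y ((poisson e (x - y))%:E * (csqr (f x - f y))%:E))%E.

(** The substitution y = x + e s rescales the Poisson kernel to scale 1 and moves the dependence on
    [e] into the translation. In this form dominated convergence applies, with 4 times the squared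
    norm of [f] times [poisson 1] as bound. *)
Let oscE (e : R) f : 0 < e -> cmeasurable setT f ->
  osc e f = (\int[L]_s ((poisson 1 s)%:E * shift_dist f (e * s)))%E.
Proof.
move=> e0 mf; have pn : pi != 0 :> R by rewrite gt_eqF ?pi_gt0.
have en : e != 0 by rewrite gt_eqF.
have mp := measurable_poisson e; have mp1 := measurable_poisson (1 : R).
have h0 a b (z w : R[i]) : 0 < a -> (0 <= (poisson a b)%:E * (csqr (z - w))%:E)%E.
  by move=> a0; rewrite mule_ge0// lee_fin ?poisson_ge0// csqr_ge0.
transitivity (\int[L]_x \int[L]_s ((poisson 1 s)%:E * (csqr (f x - f (x + e * s)))%:E))%E.
  apply: eq_integral => x _.
  rewrite -(integral_affine x en); last 2 first.
  - by mfun.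
  - by move=> y; exact: h0.
  apply: eq_integral => s _; rewrite muleA -EFinM.
  suff -> : `|e| * poisson e (x - (e * s + x)) = poisson 1 s.
    by rewrite EFinM (addrC (e * s) x).
  rewrite gtr0_norm// /poisson opprD addrCA subrr addr0 sqrrN exprMn.
  rewrite (_ : e ^+ 2 + _ = e ^+ 2 * (1 ^+ 2 + s ^+ 2)); last by ring.
  have s1 : 1 ^+ 2 + s ^+ 2 != 0 by rewrite gt_eqF// ltr_pwDl// ?expr1n// sqr_ge0.
  move: (pi : R) pn => p pn; move: (1 ^+ 2 + s ^+ 2) s1 => q qn.
  by field; rewrite pn en qn.
rewrite (@tonelli_swap _ _ _ _ _ L L (fun z : mR * mR =>
  ((poisson 1 z.2)%:E * (csqr (f z.1 - f (z.1 + e * z.2)%R))%:E)%E)); last 2 first.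
- by mfun.
- by move=> z; exact: h0.
apply: eq_integral => s _; rewrite /= integralZT ?poisson_ge0//.
- by mfun.
- by move=> x; rewrite lee_fin csqr_ge0.
Qed.

Let measurable_shift_dist (e : R) f : cmeasurable setT f ->
  measurable_fun setT (fun s : mR => shift_dist f (e * s)).
Proof.
move=> mf; apply: (measurable_sqnormr L (f := fun z : mR * mR => f z.2 - f (z.2 + e * z.1))).
by mfun.
Qed.

Let integral_poisson1 : (\int[L]_s (poisson 1 s : R)%:E = 1)%E.
Proof.
rewrite -(integral_poisson 0 (@ltr01 R)); apply: eq_integral => s _.
by rewrite /poisson sub0r sqrrN.
Qed.

Lemma osc_cvg f : L2 L setT f -> osc n.+1%:R^-1 f @[n --> \oo] --> 0%E.
Proof.
move=> Lf; have [mf fL] := Lf.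
have mp1 := measurable_poisson (1 : R).
pose M := fine (sqnorm L setT f).
have fM : sqnorm L setT f = M%:E by rewrite fineK// ge0_fin_numE ?sqnorm_ge0.
have sM (h : R) : (shift_dist f h <= (4 * M)%:E)%E.
  by rewrite EFinM -fM; exact: shift_dist_le.
have M0 : 0 <= M by rewrite fine_ge0 ?sqnorm_ge0.
under eq_fun do rewrite oscE//.
have := @dominated_convergence _ _ _ L setT measurableT
  (fun n s => (poisson 1 s)%:E * shift_dist f (n.+1%:R^-1 * s))%E (fun=> 0%E)
  (fun s => (poisson 1 s)%:E * (4 * M)%:E)%E.
case=> //.
- by move=> n; apply: mf_emul; [mfun|exact: measurable_shift_dist].
- apply: aeW => s _.
  rewrite -[X in _ --> X](mule0 (poisson 1 s)%:E); apply: cvgeZl => //.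
  by under eq_fun do rewrite mulrC; exact: shift_dist_cvg.
- apply/integrableP; split; first by mfun.
  under eq_integral do rewrite gee0_abs ?mule_ge0 ?lee_fin ?poisson_ge0 ?mulr_ge0//.
  rewrite ge0_integralZr// ?lee_fin ?mulr_ge0//.
  + by rewrite integral_poisson1 mul1e ltry.
  + by mfun.
  + by move=> s _; rewrite lee_fin poisson_ge0.
- apply: aeW => s n _; rewrite gee0_abs ?mule_ge0 ?lee_fin ?poisson_ge0 ?sqnorm_ge0//.
  by rewrite lee_wpmul2l// lee_fin poisson_ge0.
- by move=> _ _; rewrite integral0.
Qed.

Let integral_poisson_l (e x : R) : 0 < e ->
  (\int[L]_y (poisson e (y - x))%:E = 1)%E.
Proof.
move=> e0; rewrite -(integral_poisson x e0); apply: eq_integral => y _.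
by rewrite /poisson -[(y - x) ^+ 2]sqrrN opprB.
Qed.

Let cross (e : R) f (z : mR * mR) : R[i] :=
  f z.1 * (f z.2)^*%R * (poisson e (z.1 - z.2))%:C.

(** Integrate 2 Re (f(x) conj f(y)) + |f(x) - f(y)|^2 = |f(x)|^2 + |f(y)|^2 against the kernel
    [poisson e (x - y)], which has total mass 1 in either variable. *)
Let half_sum (e : R) f : 0 < e -> L2 L setT f ->
  LL.-integrable setT (fun z => (Re (cross e f z))%:E) /\
  (2%:E * \int[LL]_z (Re (cross e f z))%:E + osc e f = 2%:E * sqnorm L setT f)%E.
Proof.
move=> e0 [mf fL]; have mp := measurable_poisson e.
pose F (z : mR * mR) := ((csqr (f z.1))%:E * (poisson e (z.1 - z.2))%:E)%E.
pose G (z : mR * mR) := ((csqr (f z.2))%:E * (poisson e (z.1 - z.2))%:E)%E.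
pose H (z : mR * mR) := ((poisson e (z.1 - z.2))%:E * (csqr (f z.1 - f z.2))%:E)%E.
have mF : measurable_fun setT F by rewrite /F; mfun.
have mG : measurable_fun setT G by rewrite /G; mfun.
have mH : measurable_fun setT H by rewrite /H; mfun.
have F0 z : (0 <= F z)%E by rewrite mule_ge0// lee_fin ?csqr_ge0 ?poisson_ge0.
have G0 z : (0 <= G z)%E by rewrite mule_ge0// lee_fin ?csqr_ge0 ?poisson_ge0.
have H0 z : (0 <= H z)%E by rewrite mule_ge0// lee_fin ?csqr_ge0 ?poisson_ge0.
have IF : (\int[LL]_z F z = sqnorm L setT f)%E.
  rewrite (integral_leb2 mF F0); apply: eq_integral => x _; rewrite /F /=.
  rewrite integralZT ?csqr_ge0// ?integral_poisson ?mule1//; first by mfun.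
  by move=> y; rewrite lee_fin poisson_ge0.
have IG : (\int[LL]_z G z = sqnorm L setT f)%E.
  rewrite (integral_leb2 mG G0) (tonelli_swap L L mG G0); apply: eq_integral => x _; rewrite /G /=.
  rewrite integralZT ?csqr_ge0// ?integral_poisson_l ?mule1//; first by mfun.
  by move=> y; rewrite lee_fin poisson_ge0.
have IH : (\int[LL]_z H z = osc e f)%E by rewrite (integral_leb2 mH H0).
have eqFG z : (2%:E * (Re (cross e f z))%:E + H z = F z + G z)%E.
  rewrite /F /G /H /cross -!EFinM -!EFinD; congr _%:E.
  by rewrite !(ReM, ImM) /csqr !(ReB, ImB) ReJ ImJ /=; ring.
have mc : measurable_fun setT (fun z => (Re (cross e f z))%:E).
  have mcr : cmeasurable setT (fun z : mR * mR =>
    f z.1 * (f z.2)^*%R * (poisson e (z.1 - z.2))%:C) by mfun.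
  by apply: mf_EFin; case: mcr.
have FGi : LL.-integrable setT (fun z => F z + G z)%E.
  apply/integrableP; split; first exact: (mf_eadd mF mG).
  under eq_integral do rewrite gee0_abs ?adde_ge0//.
  by rewrite integralDT// IF IG lte_add_pinfty.
have ci : LL.-integrable setT (fun z => (Re (cross e f z))%:E).
  apply: le_integrable FGi => //= z _.
  have p0 := poisson_ge0 (z.1 - z.2) e0.
  rewrite lee_fin [X in _ <= X]ger0_norm; last by apply: addr_ge0; apply: mulr_ge0 => //; exact:
    csqr_ge0.
  rewrite /cross ReM /= mulr0 subr0 -mulrDl normrM (ger0_norm p0).
  apply: (ler_wpM2r p0).
  have := n1M_le (f z.1) (f z.2)^*%R; rewrite csqrJ; apply: le_trans.
  by rewrite /n1 lerDl.
split => //.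
have Hi : LL.-integrable setT H.
  apply: le_integrable (integrableZl measurableT 2 FGi) => // z _.
  have p0 := poisson_ge0 (z.1 - z.2) e0.
  rewrite gee0_abs; last exact: H0.
  rewrite gee0_abs; last by rewrite mule_ge0// adde_ge0.
  have -> : (2%:E * (F z + G z) = ((2 * csqr (f z.1) +
    2 * csqr (f z.2)) * poisson e (z.1 - z.2))%:E)%E.
    rewrite (_ : (F z + G z)%E = (csqr (f z.1) * poisson e (z.1 - z.2) +
      csqr (f z.2) * poisson e (z.1 - z.2))%:E); last by rewrite EFinD !EFinM.
    by rewrite -EFinM; congr _%:E; ring.
  rewrite /H -EFinM lee_fin mulrC; apply: (ler_wpM2r p0).
  by rewrite -(csqrN (f z.2)) csqrD_le.
rewrite -IH -integralZl// -integralD//; last exact: integrableZl.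
under eq_integral do rewrite eqFG.
rewrite integralDT// IF IG.
have := sqnorm_ge0 L setT f; move: fL; case: (sqnorm _ _ _) => [r|//|//] _ _.
by rewrite -EFinD -EFinM mulr2n mulrDl mul1r.
Qed.

Let cross_cintegrable (e : R) f : 0 < e -> cintegrable L f ->
  cintegrable (L \x LL)%E (fun p : mR * (mR * mR) => (poisson_weight e p.1)%:C *
    (expi (- (2 * pi * p.2.1 * p.1)) * f p.2.1 *
     (expi (- (2 * pi * p.2.2 * p.1)) * f p.2.2)^*%R)).
Proof.
move=> e0 fi; have [mf _] := fi.
have mw := measurable_poisson_weight e.
have := cintegrable_tensor (m1 := L) (m2 := LL) (cintegrable_poisson_weight e0)
  (cintegrable_tensor (m1 := L) (m2 := L) fi (cintegrableJ fi)).
move=> /(cintegrable_phase (r := fun p : mR * (mR * mR) =>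
  2 * pi * (p.2.2 - p.2.1) * p.1) ltac:(mfun)).
rewrite (_ : (fun x => _) = (fun p : mR * (mR * mR) => (poisson_weight e p.1)%:C *
    (expi (- (2 * pi * p.2.1 * p.1)) * f p.2.1 *
     (expi (- (2 * pi * p.2.2 * p.1)) * f p.2.2)^*%R)))//.
apply/funext => p; rewrite conjM conj_expi opprK.
rewrite (_ : 2 * pi * (p.2.2 - p.2.1) * p.1 =
   - (2 * pi * p.2.1 * p.1) + 2 * pi * p.2.2 * p.1); last by ring.
by rewrite expiD; ring.
Qed.

(** Expand |FT f|^2 as a double integral and integrate over xi first: the weight becomes the Poisson
    kernel. The triple integral converges absolutely because [f] and the weight are integrable. *)
Let weighted_norm (e : R) f : 0 < e -> cintegrable L f ->
  (\int[L]_xi ((poisson_weight e xi)%:E * (csqr (FT f xi))%:E) =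
   (Re (cintegral LL setT (cross e f)))%:E)%E.
Proof.
move=> e0 fi; have [mf _] := fi.
have mw := measurable_poisson_weight e.
have mFT : cmeasurable setT (FT f).
  apply: (cmeasurable_cintr L (f := fun z : mR * mR => expi (- (2 * pi * z.2 * z.1)) * f z.2)).
  by mfun.
have phase_int xi : cintegrable L (fun x : mR => expi (- (2 * pi * x * xi)) * f x).
  by apply: cintegrable_phase => //; mfun.
have prodE xi : FT f xi * (FT f xi)^*%R = cintegral LL setT (fun z : mR * mR =>
    expi (- (2 * pi * z.1 * xi)) * f z.1 * (expi (- (2 * pi * z.2 * xi)) * f z.2)^*%R).
  rewrite /FT -cintJ//; symmetry.
  exact: (cint_tensor (m1 := L) (m2 := L) (phase_int xi) (cintegrableJ (phase_int xi))).
have ci := cross_cintegrable e0 fi.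
have Fub := cFubini ci.
have in1 : (fun xi => cintegral LL setT (fun z : mR * mR => (poisson_weight e xi)%:C *
    (expi (- (2 * pi * z.1 * xi)) * f z.1 * (expi (- (2 * pi * z.2 * xi)) * f z.2)^*%R))) =
    (fun xi => (poisson_weight e xi * csqr (FT f xi))%:C).
  apply/funext => xi; rewrite cintZ; last first.
    exact: (cintegrable_tensor (m1 := L) (m2 := L) (phase_int xi) (cintegrableJ (phase_int xi))).
  by rewrite -prodE mul_conj_csqr -rmorphM.
have in2 (z : mR * mR) : cintegral L setT (fun xi => (poisson_weight e xi)%:C *
    (expi (- (2 * pi * z.1 * xi)) * f z.1 * (expi (- (2 * pi * z.2 * xi)) * f z.2)^*%R)) =
    cross e f z.
  rewrite /cross (_ : poisson e (z.1 - z.2) = poisson e (z.2 - z.1)); last first.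
    by rewrite /poisson -[(z.1 - z.2) ^+ 2]sqrrN opprB.
  rewrite -fourier_poisson_weight// -cintZ; last first.
    by apply: cintegrable_phase; [mfun|exact: cintegrable_poisson_weight].
  apply: eq_cint => xi; rewrite conjM conj_expi opprK.
  rewrite (_ : 2 * pi * (z.2 - z.1) * xi =
    - (2 * pi * z.1 * xi) + 2 * pi * z.2 * xi); last by ring.
  by rewrite expiD; ring.
have wi : cintegrable L (fun xi => (poisson_weight e xi * csqr (FT f xi))%:C).
  rewrite -in1.
  apply: (@cintegrable_cintr _ _ _ _ _ L LL (fun p : mR * (mR * mR) => (poisson_weight e p.1)%:C *
    (expi (- (2 * pi * p.2.1 * p.1)) * f p.2.1 *
     (expi (- (2 * pi * p.2.2 * p.1)) * f p.2.2)^*%R))).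
    by case: ci.
  rewrite -(fubini_tonelli1 (fun p : mR * (mR * mR) => (n1 ((poisson_weight e p.1)%:C *
    (expi (- (2 * pi * p.2.1 * p.1)) * f p.2.1 *
     (expi (- (2 * pi * p.2.2 * p.1)) * f p.2.2)^*%R )))%:E)).
  - by case: ci.
  - by apply: mf_EFin; apply: measurable_n1; case: ci.
  - by move=> p; rewrite lee_fin n1_ge0.
transitivity ((Re (cintegral L setT (fun xi => (poisson_weight e xi * csqr (FT f xi))%:C)))%:E).
  have /cintegrableP[wr _] := wi.
  rewrite /= /Rintegral fineK; last exact: integrable_fin_num wr.
  by apply: eq_integral => xi _; rewrite EFinM.
congr (Re _)%:E; rewrite -in1; apply: etrans Fub _.
exact: eq_cint.
Qed.

(** Along e = 1/(n + 1) the weights increase to 1, so the weighted norms tend to the norm of [FT f]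
    by monotone convergence; by [weighted_norm], [half_sum] and [osc_cvg] they also tend to the norm
    of [f]. *)
Lemma plancherel f : cintegrable L f -> L2 L setT f ->
  sqnorm L setT (FT f) = sqnorm L setT f.
Proof.
move=> fi Lf; have [mf fL] := Lf.
have mFT : cmeasurable setT (FT f).
  apply: (cmeasurable_cintr L (f := fun z : mR * mR => expi (- (2 * pi * z.2 * z.1)) * f z.2)).
  by mfun.
pose e n : R := n.+1%:R^-1.
have e0 n : 0 < e n by rewrite invr_gt0.
pose w n xi := ((poisson_weight (e n) xi)%:E * (csqr (FT f xi))%:E)%E.
have wE n : (2%:E * \int[L]_xi w n xi + osc (e n) f = 2%:E * sqnorm L setT f)%E.
  rewrite weighted_norm//; have [ci <-] := half_sum (e0 n) Lf.
  by rewrite /= /Rintegral fineK//; exact: integrable_fin_num ci.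
have ndw xi : nondecreasing_seq (fun n => w n xi).
  move=> n m nm; rewrite /w lee_wpmul2r ?lee_fin ?csqr_ge0//.
  rewrite /poisson_weight ler_expR ler_wpM2r// lerN2 ler_wpM2l ?mulr_ge0 ?pi_ge0//.
  by rewrite lef_pV2 ?posrE// ler_nat.
have w_cvg xi : w n xi @[n --> \oo] --> (csqr (FT f xi))%:E.
  rewrite /w; under eq_fun do rewrite -EFinM.
  apply/fine_cvgP; split; first exact: nearW.
  rewrite -[X in _ --> X]mul1r; apply: cvgM; last exact: cvg_cst.
  rewrite -expR0 /poisson_weight; apply: (cvg_comp _ (@expR R)); last exact: continuous_expR.
  have : - (2 * pi * e n) * `|xi| @[n --> \oo] --> - (2 * pi * 0) * `|xi|.
    apply: cvgM; last exact: cvg_cst.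
    apply: cvgN; apply: cvgM; first exact: cvg_cst.
    by rewrite /e; exact: cvg_harmonic.
  by rewrite mulr0 oppr0 mul0r.
have mw n : measurable_fun setT (w n).
  rewrite /w; apply: mf_emul; apply: mf_EFin; first exact: measurable_poisson_weight.
  exact: measurable_csqr.
have lim1 : (\int[L]_xi w n xi)%E @[n --> \oo] --> sqnorm L setT (FT f).
  rewrite /sqnorm (_ : (fun x => (csqr (FT f x))%:E) = (fun x => limn (fun n => w n x))).
    apply: cvg_monotone_convergence => //.
    by move=> n x _; rewrite mule_ge0// lee_fin ?expR_ge0 ?csqr_ge0.
  by apply/funext => x; apply/esym/cvg_lim.
have lim2 : (\int[L]_xi w n xi)%E @[n --> \oo] --> sqnorm L setT f.
  have -> : (fun n => \int[L]_xi w n xi)%E =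
      (fun n => sqnorm L setT f - (2^-1)%:E * osc (e n) f)%E.
    apply/funext => n.
    (* Both terms on the left of [wE] are nonnegative and the right side is finite, which excludes
       infinite values and allows the identity to be solved in [R]. *)
    have o0 : (0 <= osc (e n) f)%E.
      apply: integral_ge0 => x _; apply: integral_ge0 => y _.
      by rewrite mule_ge0// lee_fin ?csqr_ge0// poisson_ge0.
    have w0 : (0 <= \int[L]_xi w n xi)%E.
      by apply: integral_ge0 => x _; rewrite mule_ge0// lee_fin ?expR_ge0 ?csqr_ge0.
    have := wE n; have := sqnorm_ge0 L setT f; move: fL o0 w0.
    case: (sqnorm _ _ _) => [a|//|//]; case: (osc _ _) => [b| |//];
      case: (\int[L]_xi w n xi)%E => [c| |//] _ _ _ _;
      rewrite -?EFinM -?EFinD ?gt0_muley//= => -[abc].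
    by congr _%:E; lra.
  rewrite -[X in _ --> X]sube0; apply: cvgeB.
  - by rewrite fin_num_adde_defl// fin_numN.
  - exact: cvg_cst.
  - rewrite -[X in _ --> X](mule0 (2^-1)%:E); apply: cvgeZl => //.
    exact: osc_cvg.
exact: (cvg_unique _ lim1 lim2).
Qed.

End plancherel.

(** * Partial Fourier transforms *)

Section partial_fourier.
Context d (T : measurableType d) (R : realType).
Variable m : {sigma_finite_measure set T -> \bar R}.
Variable theta : T * T -> R.
Hypothesis mtheta : measurable_fun setT theta.
Implicit Types f g : T -> R[i].

(** The phase [theta] and the isometry are parameters, so that the transforms on the line and on the
    plane share the theory of partial transforms. *)
Definition fourier f (xi : T) : R[i] :=
  cintegral m setT (fun x => expi (- theta (x, xi)) * f x).

Let mphase xi : measurable_fun setT (fun x => - theta (x, xi)).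
Proof. by apply: mf_opp; exact: measurable_fun_pairr. Qed.

Lemma cmeasurable_fourier f : cmeasurable setT f -> cmeasurable setT (fourier f).
Proof.
move=> mf; apply: (cmeasurable_cintr m (f := fun z => expi (- theta (z.2, z.1)) * f z.2)).
apply: cmeasurableM; last exact: (cmeasurable_comp mf measurable_snd).
apply: cmeasurable_expi; apply: mf_opp; apply: (mf_comp mtheta).
by apply/measurable_fun_pair.
Qed.

Lemma fourier_linear a f g : cintegrable m f -> cintegrable m g ->
  fourier (fun x => a * f x + g x) = (fun xi => a * fourier f xi + fourier g xi).
Proof.
move=> fi gi; apply/funext => xi; rewrite /fourier.
have fi' := cintegrable_phase (mphase xi) fi.
have gi' := cintegrable_phase (mphase xi) gi.
rewrite -cintZ// -cintD//; last exact: cintegrableZ.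
by apply: eq_cint => x; ring.
Qed.

Hypothesis fourier_isometry : forall f, cintegrable m f -> L2 m setT f ->
  sqnorm m setT (fourier f) = sqnorm m setT f.

Definition fourier_range : set (T -> R[i]) :=
  [set fourier f | f in [set f | cintegrable m f /\ L2 m setT f]].

Lemma fourier_range_subspace : subspace m fourier_range.
Proof.
split=> [_ [f [fi [mf fL]] <-]|a _ _ [f [fi Lf] <-] [g [gi Lg] <-]].
  by split; [exact: cmeasurable_fourier|rewrite fourier_isometry].
exists (fun x => a * f x + g x); last by rewrite fourier_linear.
by split; [apply: cintegrableD => //; exact: cintegrableZ|apply: L2D => //; exact: L2Z].
Qed.

Context dY (Y : measurableType dY) (mY : {sigma_finite_measure set Y -> \bar R}).
Implicit Types h : Y * T -> R[i].

Definition pfourier h (z : Y * T) : R[i] := fourier (fun x => h (z.1, x)) z.2.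

Lemma cmeasurable_pfourier h : cmeasurable setT h -> cmeasurable setT (pfourier h).
Proof.
move=> mh; apply: (cmeasurable_cintr m
  (f := fun w : (Y * T) * T => expi (- theta (w.2, w.1.2)) * h (w.1.1, w.2))).
apply: cmeasurableM.
  apply: cmeasurable_expi; apply: mf_opp; apply: (mf_comp mtheta); mfun.
by apply: (cmeasurable_comp mh); mfun.
Qed.

(** By Tonelli it is enough to have the isometry on almost every fibre: almost all fibres are in
    L^2, and almost all are integrable by hypothesis. *)
Lemma sqnorm_pfourier h : L2 (mY \x m)%E setT h ->
  {ae mY, forall y, cintegrable m (fun x => h (y, x))} ->
  sqnorm (mY \x m)%E setT (pfourier h) = sqnorm (mY \x m)%E setT h.
Proof.
move=> [mh hL] hi; 
rewrite (sqnorm_prod1 mY m (cmeasurable_pfourier mh)) (sqnorm_prod1 mY m mh).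
have h0 (k : Y * T -> R[i]) y : (0 <= sqnorm m setT (fun x => k (y, x)))%E by exact: sqnorm_ge0.
have mn (k : Y * T -> R[i]) : cmeasurable setT k ->
  measurable_fun setT (fun y => sqnorm m setT (fun x => k (y, x))).
  exact: measurable_sqnormr.
apply: ae_eq_ge0_integral; [exact/mn/cmeasurable_pfourier|exact: mn|exact: h0|exact: h0|].
have : {ae mY, forall y, sqnorm m setT (fun x => h (y, x)) < +oo}%E.
  by apply: integral_lty_ae; [exact: mn|exact: h0|rewrite -sqnorm_prod1].
apply: filterS2 hi => y yi yL.
exact: (fourier_isometry yi (conj (cmeasurable_pairl y mh) yL)).
Qed.

Lemma pfourier_linear a h k : (forall y, cintegrable m (fun x => h (y, x))) ->
  (forall y, cintegrable m (fun x => k (y, x))) ->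
  pfourier (fun z => a * h z + k z) = (fun z => a * pfourier h z + pfourier k z).
Proof.
by move=> hi ki; apply/funext => -[y xi]; rewrite /pfourier fourier_linear.
Qed.

End partial_fourier.

(** * Fourier transforms on the line and the plane: isometry and dense range *)

Section fourier_density.
Context (R : realType).
Local Notation mR := (measurableTypeR R).
Local Notation L := (@lebesgue_measure R).
Local Notation L2R := (@leb2 R).

Definition phase1 (z : mR * mR) : R := 2 * pi * z.1 * z.2.

Definition phase2 (z : (mR * mR) * (mR * mR)) : R :=
  2 * pi * (z.1.1 * z.2.1 + z.1.2 * z.2.2).

Lemma measurable_phase1 : measurable_fun setT phase1.
Proof. by rewrite /phase1; mfun. Qed.

Lemma measurable_phase2 : measurable_fun setT phase2.
Proof. by rewrite /phase2; mfun. Qed.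

Lemma fourier1_isometry (f : mR -> R[i]) : cintegrable L f -> L2 L setT f ->
  sqnorm L setT (fourier L phase1 f) = sqnorm L setT f.
Proof. exact: plancherel. Qed.

Let ae_fibers (f : mR * mR -> R[i]) : cintegrable L2R f ->
  {ae L, forall x1, cintegrable L (fun x2 => f (x1, x2))}.
Proof.
move=> [mf fi]; apply: (ae_cintegrable (m1 := L) (m2 := L) mf).
rewrite -(integral_leb2 (f := fun z => (n1 (f z))%:E)); first exact: fi.
  by apply: mf_EFin; exact: measurable_n1.
by move=> z; rewrite lee_fin n1_ge0.
Qed.

Lemma fourier2_iterated (f : mR * mR -> R[i]) (xi : mR * mR) : cintegrable L2R f ->
  fourier L2R phase2 f xi =
  fourier L phase1 (fun x1 => pfourier L phase1 f (x1, xi.2)) xi.1.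
Proof.
move=> fi; rewrite /fourier /pfourier /fourier.
have [mf _] := fi; have m1 := measurable_phase1; have m2 := measurable_phase2.
have pfi : cintegrable L2R (fun x => expi (- phase2 (x, xi)) * f x).
  by apply: cintegrable_phase => //; mfun.
rewrite (cint_prod1 (m1 := L) (m2 := L) pfi); apply: ae_eq_cint.
- exact: (cmeasurable_cintr L (f := fun x => expi (- phase2 (x, xi)) * f x) (proj1 pfi)).
- apply: cmeasurableM; first by mfun.
  by apply: (cmeasurable_cintr L (f := fun z => expi (- phase1 (z.2, xi.2)) * f z)); mfun.
- apply: filterS (ae_fibers fi) => x1 f1 /=.
  rewrite -cintZ; last by apply: cintegrable_phase => //; mfun.
  apply: eq_cint => x2; rewrite mulrA -expiD; congr (expi _ * _).
  by rewrite /phase1 /phase2 /=; ring.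
Qed.

(** [phi] is the inverse transform of the indicator of I, damped by the Abel weight, so its
    transform is the Poisson average q of that indicator. Since an indicator takes only the values 0
    and 1, |1_I - q| is the Poisson average of |1_I(x) - 1_I(y)|^2, and its square is no larger
    because q lies in [0, 1]. *)
Let osc_indicator_le (e a b : R) : 0 < e -> a <= b ->
  exists phi, [/\ cintegrable L phi, L2 L setT phi &
    (sqdist L setT (cindic `]a, b]%classic) (fourier L phase1 phi) <=
     osc e (cindic `]a, b]%classic))%E].
Proof.
move=> e0 ab; pose I := `]a, b]%classic : set mR.
have m1 := measurable_phase1; have mw := measurable_poisson_weight e.
have mp := measurable_poisson e.
have mI : measurable I by exact: measurable_itv.
have mcI : cmeasurable setT (cindic I : mR -> R[i]) by exact: cmeasurable_cindic.
have n1I y : n1 (cindic I y : R[i]) = \1_I y by rewrite /n1 /= normr0 addr0 ger0_norm.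
have II : cintegrable L (cindic I).
  split=> //; under eq_integral do rewrite n1I.
  rewrite integral_indic// setIT.
  by rewrite [X in (X < _)%E]lebesgue_measure_itv /=; case: ifP; rewrite ?ltry// -EFinB ltry.
pose psi (xi : mR) := cintegral L setT (fun y => expi (2 * pi * y * xi) * cindic I y).
have psi_int xi : cintegrable L (fun y => expi (2 * pi * y * xi) * cindic I y).
  by apply: cintegrable_phase => //; mfun.
have mpsi : cmeasurable setT psi.
  by apply: (cmeasurable_cintr L (f := fun z : mR * mR =>
    expi (2 * pi * z.2 * z.1) * cindic I z.2)); mfun.
pose phi (xi : mR) := (poisson_weight e xi)%:C * psi xi.
have Iint : cintegrable (L \x L)%E (fun z : mR * mR => (poisson_weight e z.1)%:C *
    (expi (2 * pi * z.2 * z.1) * cindic I z.2)).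
  have := cintegrable_tensor (m1 := L) (m2 := L) (cintegrable_poisson_weight e0) II.
  move=> /(cintegrable_phase (r := fun z : mR * mR => 2 * pi * z.2 * z.1) ltac:(mfun)).
  by congr (cintegrable _ _); apply/funext => z; ring.
have ciE xi : cintegral L setT (fun y => (poisson_weight e xi)%:C *
    (expi (2 * pi * y * xi) * cindic I y)) = phi xi.
  by rewrite cintZ//; exact: psi_int.
have phi_int : cintegrable L phi.
  rewrite -(_ : (fun xi => cintegral L setT (fun y => (poisson_weight e xi)%:C *
    (expi (2 * pi * y * xi) * cindic I y))) = phi); last by apply/funext.
  apply: (cintegrable_cintr (m1 := L) (m2 := L) (f := fun z : mR * mR => (poisson_weight e z.1)%:C *
    (expi (2 * pi * z.2 * z.1) * cindic I z.2)) (proj1 Iint)).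
  rewrite -(integral_leb2 (f := fun z => (n1 ((poisson_weight e z.1)%:C *
    (expi (2 * pi * z.2 * z.1) * cindic I z.2)))%:E)); first exact: (proj2 Iint).
    by apply: mf_EFin; apply: measurable_n1; exact: (proj1 Iint).
  by move=> z; rewrite lee_fin n1_ge0.
have LI : L2 L setT (cindic I).
  split=> //; rewrite sqnorm_cindic//.
  by rewrite [X in (X < _)%E]lebesgue_measure_itv /=; case: ifP; rewrite ?ltry// -EFinB ltry.
have mphi : cmeasurable setT phi by rewrite /phi; mfun.
have Lphi : L2 L setT phi.
  split=> //; apply: le_lt_trans (proj2 LI); rewrite -(fourier1_isometry II LI).
  apply: (@le_trans _ _ (sqnorm L setT psi)).
    apply: le_integralT => [||x|x]; try exact: measurable_csqrE; rewrite lee_fin ?csqr_ge0//.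
    rewrite csqrM csqr_real ler_piMl ?csqr_ge0// exprn_ile1 ?poisson_weight_ge0//.
    exact: poisson_weight_le1.
  (* [psi] is the Fourier transform of the indicator reflected through 0, so it has the norm given
     by Plancherel. *)
  have mF := cmeasurable_fourier L m1 mcI.
  rewrite le_eqVlt; apply/orP; left; apply/eqP; symmetry.
  rewrite /sqnorm -(integral_affine (a := -1) 0 _ (measurable_csqrE mF)); last 2 first.
  - by rewrite oppr_eq0 oner_eq0.
  - by move=> x; rewrite lee_fin csqr_ge0.
  apply: eq_integral => xi _; rewrite normrN1 mul1e addr0 mulN1r; congr (csqr _)%:E.
  by apply: eq_cint => y; rewrite /phase1 /= mulrN opprK.
exists phi; split => //.
pose q (x : mR) := (\int[L]_y ((\1_I y : R)%:E * (poisson e (x - y))%:E))%E.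
have q0 x : (0 <= q x)%E.
  by apply: integral_ge0 => y _; rewrite mule_ge0// lee_fin poisson_ge0.
have mIr : measurable_fun setT (\1_I : mR -> R) by exact: measurable_indic.
have q1 x : (q x <= 1)%E.
  rewrite -(integral_poisson x e0); apply: le_integralT => [||y|y].
  - by mfun.
  - by mfun.
  - by rewrite mule_ge0// lee_fin poisson_ge0.
  - by rewrite -EFinM lee_fin ler_piMl ?(poisson_ge0 _ e0)// indicE lern1 leq_b1.
have qfin x : q x \is a fin_num by rewrite ge0_fin_numE// (le_lt_trans (q1 x))// ltry.
have FE x : fourier L phase1 phi x = (fine (q x))%:C.
  transitivity (cintegral L setT (fun xi => cintegral L setT (fun y =>
     expi (- phase1 (xi, x)) * ((poisson_weight e xi)%:C * (expi (2 * pi * y * xi) * cindic I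
       y))))).
    apply: eq_cint => xi.
    by rewrite cintZ ?ciE//; apply: cintegrableZ; exact: psi_int.
  rewrite (cFubini (m1 := L) (m2 := L) (f := fun z => expi (- phase1 (z.1, x)) *
    ((poisson_weight e z.1)%:C * (expi (2 * pi * z.2 * z.1) * cindic I z.2)))); last first.
    by apply: cintegrable_phase => //; rewrite /phase1; mfun.
  transitivity (cintegral L setT (fun y : mR => (\1_I y * poisson e (x - y))%:C)).
    apply: eq_cint => y; rewrite [poisson e _](_ : _ = poisson e (y - x)); last first.
      by rewrite /poisson -[(x - y) ^+ 2]sqrrN opprB.
    rewrite rmorphM /= -fourier_poisson_weight// -cintZ; last first.
      by apply: cintegrable_phase; [mfun|exact: cintegrable_poisson_weight].
    apply: eq_cint => xi; rewrite /phase1 /=.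
    rewrite (_ : 2 * pi * (y - x) * xi = - (2 * pi * xi * x) + 2 * pi * y * xi); last by ring.
    by rewrite expiD /cindic; ring.
  apply: complexP => /=; last by rewrite /Rintegral integral0.
  by rewrite /Rintegral; congr fine; apply: eq_integral => y _; rewrite EFinM.
apply: le_integralT => [||x|x].
- by apply: measurable_csqrE; apply: cmeasurableB => //; exact: cmeasurable_fourier.
- by apply: (measurable_integralr L (f := fun z : mR * mR =>
  ((poisson e (z.1 - z.2))%:E * (csqr (cindic I z.1 - cindic I z.2))%:E)%E)); [mfun|move=> z;
  rewrite mule_ge0// lee_fin ?csqr_ge0// poisson_ge0].
- by rewrite lee_fin csqr_ge0.
- rewrite FE /cindic -rmorphB csqr_real.
  pose D := (\int[L]_y ((poisson e (x - y))%:E * (csqr ((\1_I x)%:C - (\1_I y)%:C : R[i]))%:E))%E.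
  have D0 : (0 <= D)%E.
    by apply: integral_ge0 => y _; rewrite mule_ge0// lee_fin ?csqr_ge0// poisson_ge0.
  rewrite -/D.
  have := q1 x; have := q0 x; have := qfin x.
  have [xI|xI] := boolP (x \in I).
    have : (D + q x = 1)%E.
      rewrite /D /q -integralDT.
      + rewrite -(integral_poisson x e0); apply: eq_integral => y _.
        rewrite -rmorphB csqr_real -!EFinM -EFinD; congr _%:E; rewrite !indicE xI.
        by case: (y \in I); rewrite ?subrr ?subr0 ?expr0n ?expr1n /= ?mulr0 ?mul0r ?mulr1 ?mul1r
          ?add0r ?addr0.
      + by mfun.
      + by mfun.
      + by move=> y; rewrite mule_ge0// lee_fin ?csqr_ge0 ?poisson_ge0.
      + by move=> y; rewrite mule_ge0// lee_fin ?poisson_ge0.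
    rewrite indicE xI /=; case: (q x) => // r; move: D0; case: D => [s| |]//.
    rewrite !lee_fin => s0 + _ r0 r1 => -[sr].
    rewrite (_ : 1%:R - r = s); last by rewrite -sr addrK.
    by rewrite expr2 ler_piMl// -sr lerDl.
  have <- : q x = D.
    apply: eq_integral => y _; rewrite muleC; congr (_ * _)%E.
    rewrite -rmorphB csqr_real !indicE (negbTE xI).
    by case: (y \in I); rewrite ?subrr ?sub0r ?sqrrN ?expr0n ?expr1n.
  rewrite indicE (negbTE xI) sub0r sqrrN; case: (q x) => // r _; rewrite !lee_fin => r0 r1.
  by rewrite expr2 ler_piMl.
Qed.

Lemma fourier1_dense (f : mR -> R[i]) : L2 L setT f ->
  approx L (fourier_range L phase1) f.
Proof.
move=> Lf; have m1 := measurable_phase1.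
have sub := fourier_range_subspace m1 fourier1_isometry.
apply: (approx_itv sub) Lf => a b ab eps eps0.
have LI : L2 L setT (cindic `]a, b]%classic : mR -> R[i]).
  split; first by apply: cmeasurable_cindic; exact: measurable_itv.
  rewrite sqnorm_cindic; last exact: measurable_itv.
  by rewrite [X in (X < _)%E]lebesgue_measure_itv /=; case: ifP; rewrite ?ltry// -EFinB ltry.
have [n on] := cvg0_lt eps0 (osc_cvg LI).
have [phi [phii Lphi le]] := osc_indicator_le (e := n.+1%:R^-1) ltac:(by rewrite invr_gt0) ab.
by exists (fourier L phase1 phi); [exists phi|exact: le_lt_trans le on].
Qed.

(** Transform in the second variable, exchange the variables, transform in the first. Integrability
    of [f] on the plane makes the intermediate function integrable in the first variable for every
    second frequency. *)
Lemma fourier2_isometry (f : mR * mR -> R[i]) : cintegrable L2R f -> L2 L2R setT f ->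
  sqnorm L2R setT (fourier L2R phase2 f) = sqnorm L2R setT f.
Proof.
move=> fi Lf; have [mf fL] := Lf; have m1 := measurable_phase1.
pose g := pfourier L phase1 f.
have mg : cmeasurable setT g by exact: (cmeasurable_pfourier L m1 mf).
have gE : sqnorm L2R setT g = sqnorm L2R setT f.
  exact: (sqnorm_pfourier (m := L) m1 fourier1_isometry (mY := L) Lf (ae_fibers fi)).
have gi xi2 : cintegrable L (fun x1 => g (x1, xi2)).
  have ki : cintegrable L2R (fun z => expi (- phase1 (z.2, xi2)) * f z).
    by apply: cintegrable_phase => //; mfun.
  have [mk kL] := ki.
  apply: (cintegrable_cintr (m1 := L) (m2 := L) mk).
  rewrite -(integral_leb2 (f := fun z => (n1 (expi (- phase1 (z.2, xi2)) * f z))%:E));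
    first exact: kL.
    by apply: mf_EFin; exact: measurable_n1.
  by move=> z; rewrite lee_fin n1_ge0.
have msw : cmeasurable setT (fun z : mR * mR => g (z.2, z.1)) by mfun.
have gsw : sqnorm L2R setT (fun z : mR * mR => g (z.2, z.1)) = sqnorm L2R setT g.
  rewrite (sqnorm_prod1 L L msw) -(sqnorm_prod2 L L mg).
  by [].
have Lsw : L2 (L \x L)%E setT (fun z : mR * mR => g (z.2, z.1)).
  have gL : (sqnorm L2R setT (fun z : mR * mR => g (z.2, z.1)) < +oo)%E by rewrite gsw gE.
  exact: (conj msw gL).
have := sqnorm_pfourier (m := L) m1 fourier1_isometry (mY := L) Lsw (aeW _ gi).
rewrite gsw gE => <-.
have mp := cmeasurable_pfourier L m1 msw.
rewrite (sqnorm_prod1 L L mp) (sqnorm_prod2 L L (cmeasurable_fourier L2R measurable_phase2 mf)).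
apply: eq_integral => xi2 _; apply: eq_integral => xi1 _.
by rewrite (fourier2_iterated _ fi).
Qed.

(** The transform of a tensor is the tensor of the one-dimensional transforms, and tensors of
    elements of two dense ranges are total. *)
Lemma fourier2_dense (f : mR * mR -> R[i]) : L2 L2R setT f ->
  approx L2R (fourier_range L2R phase2) f.
Proof.
move=> Lf; have m2 := measurable_phase2; have m1 := measurable_phase1.
have sub := fourier_range_subspace m2 fourier2_isometry.
have [sub1 _] := fourier_range_subspace m1 fourier1_isometry.
apply: (approx_tensor (m1 := L) (m2 := L) sub1 sub1 sub fourier1_dense fourier1_dense) Lf.
move=> _ _ [f1 [i1 L1] <-] [f2 [i2 L2'] <-]; apply: approx_self.
exists (fun z => f1 z.1 * f2 z.2).
  split; first exact: (cintegrable_tensor (m1 := L) (m2 := L)).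
  exact: (L2_tensor (m1 := L) (m2 := L)).
apply/funext => xi; rewrite {1}/fourier.
transitivity (cintegral L2R setT (fun x => (expi (- phase1 (x.1, xi.1)) * f1 x.1) *
   (expi (- phase1 (x.2, xi.2)) * f2 x.2))).
  apply: eq_cint => x; rewrite (_ : - phase2 (x, xi) = - phase1 (x.1, xi.1) + - phase1 (x.2, xi.2)).
    by rewrite expiD; ring.
  by rewrite /phase1 /phase2 /=; ring.
by apply: (cint_tensor (m1 := L) (m2 := L)); apply: cintegrable_phase => //; rewrite /phase1; mfun.
Qed.

End fourier_density.

(** * Coordinates on the orbit space *)

Section weighted_pullback.
Context d d' (Z : measurableType d) (Z' : measurableType d') (R : realType).
Variables (m : {measure set Z -> \bar R}) (m' : {measure set Z' -> \bar R}).
Variables (w : Z' -> R) (phi : Z' -> Z).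
Hypotheses (mw : measurable_fun setT w) (mphi : measurable_fun setT phi).
Hypothesis transport : forall k : Z -> \bar R, measurable_fun setT k ->
  (forall z, 0 <= k z)%E ->
  (\int[m']_z ((w z ^+ 2)%:E * k (phi z)) = \int[m]_z k z)%E.
Implicit Types h : Z -> R[i].

(** [w] is the square root of a Jacobian: [transport] is the substitution rule for its square, so
    composing with [phi] and multiplying by [w] is an isometry of L^2. *)
Definition pullback h (z : Z') : R[i] := (w z)%:C * h (phi z).

Lemma cmeasurable_pullback h : cmeasurable setT h -> cmeasurable setT (pullback h).
Proof. by move=> mh; apply: cmeasurableM; mfun. Qed.

Lemma sqnorm_pullback h : cmeasurable setT h ->
  sqnorm m' setT (pullback h) = sqnorm m setT h.
Proof.
move=> mh; rewrite [RHS](esym (transport (k := fun z => (csqr (h z))%:E) _ _)).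
- by apply: eq_integral => z _; rewrite /pullback csqrM csqr_real EFinM.
- exact: measurable_csqrE.
- by move=> z; rewrite lee_fin csqr_ge0.
Qed.

Lemma L2_pullback h : L2 m setT h -> L2 m' setT (pullback h).
Proof. by move=> [mh hL]; split; [exact: cmeasurable_pullback|rewrite sqnorm_pullback]. Qed.

Lemma pullback_linear a h h' :
  pullback (fun z => a * h z + h' z) = (fun z => a * pullback h z + pullback h' z).
Proof. by apply/funext => z; rewrite /pullback; ring. Qed.

End weighted_pullback.

Section pullback_inverse.
Context d d' (Z : measurableType d) (Z' : measurableType d') (R : realType).
Variables (m : {measure set Z -> \bar R}) (m' : {measure set Z' -> \bar R}).
Variables (w : Z' -> R) (phi : Z' -> Z) (w' : Z -> R) (phi' : Z -> Z').
Hypotheses (mw : measurable_fun setT w) (mphi : measurable_fun setT phi).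
Hypotheses (mw' : measurable_fun setT w') (mphi' : measurable_fun setT phi').
Hypothesis transport : forall k : Z -> \bar R, measurable_fun setT k ->
  (forall z, 0 <= k z)%E ->
  (\int[m']_z ((w z ^+ 2)%:E * k (phi z)) = \int[m]_z k z)%E.
Hypothesis inverse : {ae m', forall z, phi' (phi z) = z /\ w z * w' (phi z) = 1}.

Let pullbackK (f : Z' -> R[i]) : {ae m', forall z, pullback w phi (pullback w' phi' f) z = f z}.
Proof.
apply: filterS inverse => z [h1 h2].
by rewrite /pullback h1 mulrA -rmorphM /= h2 mul1r.
Qed.

Lemma L2_pullback_inverse f : L2 m' setT f -> L2 m setT (pullback w' phi' f).
Proof.
move=> [mf fL]; have mg := cmeasurable_pullback mw' mphi' mf.
split=> //; rewrite -(sqnorm_pullback transport mg).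
by rewrite (ae_eq_sqnorm (cmeasurable_pullback mw mphi mg) mf (pullbackK f)).
Qed.

(** An almost everywhere left inverse of [phi] makes the pull-back surjective; approximants of the
    function pulled back along the inverse are carried to approximants of [f] at the same
    distance. *)
Lemma approx_pullback S f : S `<=` L2 m setT -> L2 m' setT f ->
  approx m S (pullback w' phi' f) -> approx m' [set pullback w phi h | h in S] f.
Proof.
move=> SL Lf Sf e /Sf[h Sh hd]; exists (pullback w phi h); first by exists h.
have [mf _] := Lf; have [mh _] := SL _ Sh.
have mg := cmeasurable_pullback mw' mphi' mf.
have mgh := cmeasurableB mg mh.
apply: le_lt_trans hd; rewrite /sqdist -(sqnorm_pullback transport mgh).
rewrite le_eqVlt; apply/orP; left; apply/eqP; apply: ae_eq_sqnorm.
- by apply: cmeasurableB => //; exact: cmeasurable_pullback.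
- exact: cmeasurable_pullback.
- apply: filterS (pullbackK f) => z <-; rewrite /pullback; ring.
Qed.

End pullback_inverse.

Section ae_product.
Context d1 d2 (T1 : measurableType d1) (T2 : measurableType d2) (R : realType).
Variables (m1 : {sigma_finite_measure set T1 -> \bar R}).
Variables (m2 : {sigma_finite_measure set T2 -> \bar R}).

Lemma ae_prod1 (P : T1 -> Prop) : {ae m1, forall x, P x} ->
  {ae (m1 \x m2)%E, forall z, P z.1}.
Proof.
move=> [N [mN N0 PN]]; exists (N `*` setT); split.
- exact: measurableX.
- rewrite [LHS](product_measure1E m1 m2 mN measurableT).
  by transitivity (0 * m2 setT)%E; [congr (_ * _)%E; exact: N0|exact: mul0e].
- by move=> z Pz; split => //; exact: PN.
Qed.

Lemma ae_prod2 (P : T2 -> Prop) : {ae m2, forall x, P x} ->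
  {ae (m1 \x m2)%E, forall z, P z.2}.
Proof.
move=> [N [mN N0 PN]]; exists (setT `*` N); split.
- exact: measurableX.
- rewrite [LHS](product_measure1E m1 m2 measurableT mN).
  by transitivity (m1 setT * 0)%E; [congr (_ * _)%E; exact: N0|exact: mule0].
- by move=> z Pz; split => //; exact: PN.
Qed.

End ae_product.

Section coordinate_spaces.
Context (R : realType).
Local Notation mR := (measurableTypeR R).
Local Notation R2 := (mR * mR)%type.
Local Notation M4 := ((mR * mR) * (mR * mR))%type.
Local Notation L := (@lebesgue_measure R).

(** For the pairs (w, t) and (w', r). [leb5] below is for the triples (w, w', v) that act as
    parameters during the first Fourier transform, from s to u. *)
Definition leb3 : set (R2 * mR) -> \bar R := (@leb2 R \x L)%E.
HB.instance Definition _ := Measure.on leb3.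
HB.instance Definition _ := Measure_isSigmaFinite.Build _ _ _ leb3
  (sigma_finite_product (@leb2 R) L).

Definition leb5 : set (M4 * mR) -> \bar R := (@leb4 R \x L)%E.
HB.instance Definition _ := Measure.on leb5.
HB.instance Definition _ := Measure_isSigmaFinite.Build _ _ _ leb5
  (sigma_finite_product (@leb4 R) L).

Definition nsq (p : R2) : R := p.1 ^+ 2 + p.2 ^+ 2.
Definition perp (p : R2) : R2 := (- p.2, p.1).
Definition dot (p q : R2) : R := p.1 * q.1 + p.2 * q.2.
Definition rowmul (p : R2) (A : M4) : R2 :=
  (p.1 * A.1.1 + p.2 * A.2.1, p.1 * A.1.2 + p.2 * A.2.2).
(** [p] and [perp p] are the rows of the inverse of gamma at [p]. Hence u and v are the coordinates
    of (perp p) A in the orthogonal basis p A, perp (p A); they agree with [u_] and [v_] away from p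
    = 0 ([u_coord], [v_coord]). *)
Definition ucoord (p : R2) (A : M4) : R :=
  dot (rowmul p A) (rowmul (perp p) A) / nsq (rowmul p A).
Definition vcoord (p : R2) (A : M4) : R :=
  dot (perp (rowmul p A)) (rowmul (perp p) A) / nsq (rowmul p A).
Definition det4 (A : M4) : R := A.1.1 * A.2.2 - A.1.2 * A.2.1.

Lemma nsq_ge0 p : 0 <= nsq p.
Proof. by rewrite addr_ge0 ?sqr_ge0. Qed.

Lemma nsq_eq0 p : (nsq p == 0) = (p == (0, 0)).
Proof. by case: p => a b; rewrite /nsq paddr_eq0 ?sqr_ge0// !sqrf_eq0. Qed.

(** v is the determinant of the lower triangular factor, and the determinant of gamma at [p] is the
    inverse of |p|^2. *)
Lemma vcoordE p A : vcoord p A = nsq p * det4 A / nsq (rowmul p A).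
Proof. by rewrite /vcoord; congr (_ / _); rewrite /dot /nsq /det4 /=; ring. Qed.

(* With s = 1/t and v = t/r, the coordinates (w, t), (w', r) become
   (w, w', v, s). *)
Definition inv_map (z : M4 * mR * mR) : (R2 * mR) * (R2 * mR) :=
  ((z.1.1.1, z.2^-1), (z.1.1.2, (z.2 * z.1.2)^-1)).
(** Square root of the Jacobian in dt dr = |s|^-3 |v|^-2 dv ds, for t = 1/s and r = 1/(s v). *)
Definition inv_weight (z : M4 * mR * mR) : R :=
  `|z.1.2|^-1 * (`|z.2| * Num.sqrt `|z.2|)^-1.

Definition row_map (z : M4 * R2) : M4 * mR * mR :=
  (((z.2, rowmul z.2 z.1), vcoord z.2 z.1), ucoord z.2 z.1).
(** Square root of |p|^4 / |p A|^2. At fixed p, passing from A to the rows p A and (perp p) A has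
    Jacobian |p|^4, and passing from the second row to (v, u) has Jacobian |p A|^-2. *)
Definition row_weight (z : M4 * R2) : R :=
  nsq z.2 / Num.sqrt (nsq (rowmul z.2 z.1)).

Lemma measurable_inv_map : measurable_fun setT inv_map.
Proof. by rewrite /inv_map; mfun. Qed.

Lemma measurable_inv_weight : measurable_fun setT inv_weight.
Proof. by rewrite /inv_weight; mfun. Qed.

Lemma measurable_row_map : measurable_fun setT row_map.
Proof. by rewrite /row_map /ucoord /vcoord /dot /nsq /perp /rowmul /=; mfun. Qed.

Lemma measurable_row_weight : measurable_fun setT row_weight.
Proof. by rewrite /row_weight /nsq /rowmul /=; mfun. Qed.

Lemma ae_neq0 : {ae L, forall x : mR, x != 0}.
Proof.
exists [set 0]; split; [exact: measurable_set1|exact: lebesgue_measure_set1|].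
by move=> x /= /negP; rewrite negbK => /eqP.
Qed.

Lemma ae_leb2_neq0 : {ae @leb2 R, forall p : R2, nsq p != 0}.
Proof.
have h : {ae @leb2 R, forall p : R2, p.1 != 0} by exact: (ae_prod1 L ae_neq0).
apply: filterS h => p p0.
by rewrite nsq_eq0; apply: contra p0 => /eqP ->.
Qed.

End coordinate_spaces.

Section coordinate_transport.
Context (R : realType).
Local Notation mR := (measurableTypeR R).
Local Notation R2 := (mR * mR)%type.
Local Notation M4 := ((mR * mR) * (mR * mR))%type.
Local Notation L := (@lebesgue_measure R).

(** The measure dx/|x| is invariant under dilations and under inversion; apply both to the function
    |x| g(x). *)
Lemma integral_inv_sqr (c : R) (g : mR -> \bar R) : c != 0 -> measurable_fun setT g ->
  (forall x, 0 <= g x)%E ->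
  (\int[L]_v ((`|v|^-1 ^+ 2)%:E * g ((c * v)^-1)%R) = `|c|%:E * \int[L]_x g x)%E.
Proof.
move=> c0 mg g0.
have mi : measurable_fun setT (fun x : mR => (`|x|^-1)%R%:E * g (x^-1)%R)%E by mfun.
have i0 (x : mR) : (0 <= (`|x|^-1)%:E * g (x^-1)%R)%E by rewrite mule_ge0// lee_fin invr_ge0.
have mn : measurable_fun setT (fun x : mR => (`|x|)%:E * g x)%E by mfun.
have n0 (x : mR) : (0 <= (`|x|)%:E * g x)%E by rewrite mule_ge0// lee_fin.
transitivity (`|c|%:E * \int[L]_v (`|v|^-1%:E * ((`|(c * v)%R|^-1)%:E * g ((c * v)^-1)%R)))%E.
  rewrite -integralZT//; last 2 first.
  - by mfun.
  - by move=> x; rewrite !mule_ge0// lee_fin invr_ge0.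
  apply: eq_integral => v _; rewrite !muleA -!EFinM; congr (_%:E * _)%E.
  have [->|v0] := eqVneq v 0; first by rewrite normr0 invr0 expr0n /= !mulr0 mul0r.
  by rewrite normrM; field; rewrite !normr_eq0 v0 c0.
congr (_ * _)%E.
rewrite (integral_scale (f := fun x => ((`|x|^-1)%:E * g (x^-1)%R)%E) c0 mi i0).
transitivity (\int[L]_x (`|x|^-1%:E * (`|x|%:E * g x)))%E; last first.
  apply: ae_eq_ge0_integral.
  - by mfun.
  - by [].
  - by move=> x; rewrite mule_ge0// lee_fin invr_ge0.
  - by [].
  - apply: filterS (ae_neq0 R) => x x0.
    by rewrite muleA -EFinM mulVf ?normr_eq0// mul1e.
rewrite -(integral_inv (f := fun x => (`|x|%:E * g x)%E) mn n0).
by apply: eq_integral => x _; rewrite normfV.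
Qed.

Let integral_inv_plane (g : mR * mR -> \bar R) : measurable_fun setT g ->
  (forall x, 0 <= g x)%E ->
  (\int[L]_v \int[L]_s (((`|v|^-1 * (`|s| * Num.sqrt `|s|)^-1) ^+ 2)%:E *
     g (s^-1, (s * v)^-1)%R) = \int[L]_t \int[L]_r g (t, r))%E.
Proof.
move=> mg g0.
rewrite (tonelli_swap L L (f := fun z : mR * mR =>
  (((`|z.1|^-1 * (`|z.2| * Num.sqrt `|z.2|)^-1) ^+ 2)%:E * g (z.2^-1, (z.2 * z.1)^-1)%R)%E));
    last 2 first.
- by mfun.
- by move=> z; rewrite mule_ge0// lee_fin sqr_ge0.
have mh : measurable_fun setT (fun t : mR => \int[L]_r g (t, r))%E.
  exact: (measurable_integralr L (f := g)).
have h0 (t : mR) : (0 <= \int[L]_r g (t, r))%E by exact: integral_ge0.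
have hi := integral_inv_sqr (oner_neq0 R) mh h0.
rewrite normr1 mul1e in hi; rewrite -hi.
apply: ae_eq_ge0_integral.
- apply: (measurable_integralr L (f := fun z : mR * mR =>
   (((`|z.2|^-1 * (`|z.1| * Num.sqrt `|z.1|)^-1) ^+ 2)%:E * g (z.1^-1, (z.1 * z.2)^-1)%R)%E));
     first by mfun.
  by move=> z; rewrite mule_ge0// lee_fin sqr_ge0.
- have mk : measurable_fun setT (fun s : mR => \int[L]_r g ((1 * s)^-1, r)%R)%E.
    by apply: (measurable_integralr L (f := fun z : mR * mR => g ((1 * z.1)^-1, z.2)%R));
      [mfun|move=> z].
  by mfun.
- by move=> s; apply: integral_ge0 => v _; rewrite mule_ge0// lee_fin sqr_ge0.
- by move=> s; rewrite mule_ge0// lee_fin sqr_ge0.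
apply: filterS (ae_neq0 R) => s s0.
have mgs : measurable_fun setT (fun x : mR => g (s^-1, x)%R) by mfun.
have gs0 (x : mR) : (0 <= g (s^-1, x)%R)%E by [].
have := integral_inv_sqr s0 mgs gs0 => /= gi.
have n0 : `|s| != 0 by rewrite normr_eq0.
have ss : Num.sqrt `|s| ^+ 2 = `|s| by rewrite sqr_sqrtr.
have k0 : 0 <= (`|s|^-1) ^+ 3 by rewrite exprn_ge0.
transitivity ((`|s|^-1 ^+ 3)%:E * \int[L]_v ((`|v|^-1 ^+ 2)%:E * g (s^-1, (s * v)^-1)%R))%E.
  rewrite -integralZT//; last 2 first.
  - by mfun.
  - by move=> v; rewrite mule_ge0// lee_fin sqr_ge0.
  apply: eq_integral => v _; rewrite muleA -EFinM; congr (_%:E * _)%E.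
  rewrite [LHS]exprMn [LHS]mulrC; congr (_ * _).
  by rewrite [LHS]exprVn exprMn ss [RHS]exprVn -exprSr.
rewrite gi muleA -EFinM mul1r; congr (_%:E * _)%E.
by field.
Qed.

(** [integral_inv_plane] handles (v, s) at fixed (w, w'). The target groups its variables as (w, t),
    (w', r), whence the exchange of t and w'. *)
Lemma inv_transport (k : (R2 * mR) * (R2 * mR) -> \bar R) : measurable_fun setT k ->
  (forall z, 0 <= k z)%E ->
  (\int[(@leb5 R \x L)%E]_z ((inv_weight z ^+ 2)%:E * k (inv_map z)) =
   \int[(@leb3 R \x @leb3 R)%E]_z k z)%E.
Proof.
move=> mk k0.
have mi := @measurable_inv_map R; have mw := @measurable_inv_weight R.
pose K z := ((inv_weight z ^+ 2)%:E * k (inv_map z))%E.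
have mK : measurable_fun setT K by rewrite /K; mfun.
have K0 z : (0 <= K z)%E by rewrite mule_ge0// lee_fin sqr_ge0.
have -> : (\int[(@leb5 R \x L)%E]_z K z = \int[@leb2 R]_w \int[@leb2 R]_w' \int[L]_v \int[L]_s K
  (((w, w'), v), s))%E.
  rewrite (fubini_tonelli1 K mK K0) /fubini_F.
  have mK1 := measurable_integralr L mK K0.
  have K10 (z : M4 * mR) : (0 <= \int[L]_s K (z, s))%E by exact: integral_ge0.
  rewrite -[LHS]/(\int[(@leb4 R \x L)%E]_z \int[L]_s K (z, s))%E.
  rewrite (fubini_tonelli1 (fun z : M4 * mR => (\int[L]_s K (z, s))%E) mK1 K10) /fubini_F.
  have mK2 := measurable_integralr L mK1 K10.
  by rewrite (integral_leb4 mK2) //; move=> z; exact: integral_ge0.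
have -> : (\int[(@leb3 R \x @leb3 R)%E]_z k z = \int[@leb2 R]_w \int[L]_t \int[@leb2 R]_w'
  \int[L]_r k ((w, t), (w', r)))%E.
  rewrite (fubini_tonelli1 k mk k0) /fubini_F.
  have mk1 := measurable_integralr (@leb3 R) mk k0.
  have k10 (z : R2 * mR) : (0 <= \int[@leb3 R]_y k (z, y))%E by exact: integral_ge0.
  rewrite -[LHS]/(\int[(@leb2 R \x L)%E]_z \int[@leb3 R]_y k (z, y))%E.
  rewrite (fubini_tonelli1 (fun z => (\int[@leb3 R]_y k (z, y))%E) mk1 k10) /fubini_F.
  apply: eq_integral => w _; apply: eq_integral => t _.
  have mkw : measurable_fun setT (fun y => k ((w, t), y)) by mfun.
  rewrite -[LHS]/(\int[(@leb2 R \x L)%E]_y k ((w, t), y))%E.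
  by rewrite (fubini_tonelli1 (fun y => k ((w, t), y)) mkw).
rewrite (tonelli_swap23 (@leb2 R) L (@leb2 R) L (f := fun w t w' r => k ((w, t), (w', r))));
  last 2 first.
- by mfun.
- by move=> *; exact: k0.
apply: eq_integral => w _; apply: eq_integral => w' _.
have mkw : measurable_fun setT (fun z : mR * mR => k ((w, z.1), (w', z.2))) by mfun.
by rewrite -(integral_inv_plane mkw).
Qed.

(** For fixed p != 0 two linear substitutions: left multiplication of A by the matrix with rows p
    and perp p, then the expression of the second row in the basis w', perp w', where w' = p A is
    the first. *)
Lemma row_transport (k : M4 * mR * mR -> \bar R) : measurable_fun setT k ->
  (forall z, 0 <= k z)%E ->
  (\int[(@leb4 R \x @leb2 R)%E]_z ((row_weight z ^+ 2)%:E * k (row_map z)) =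
   \int[(@leb5 R \x L)%E]_z k z)%E.
Proof.
move=> mk k0.
have mi := @measurable_row_map R; have mw := @measurable_row_weight R.
pose K z := ((row_weight z ^+ 2)%:E * k (row_map z))%E.
have mK : measurable_fun setT K by rewrite /K; mfun.
have K0 z : (0 <= K z)%E by rewrite mule_ge0// lee_fin sqr_ge0.
have -> : (\int[(@leb5 R \x L)%E]_z k z = \int[@leb2 R]_p \int[@leb2 R]_w' \int[@leb2 R]_y k
  (((p, w'), y.1), y.2))%E.
  rewrite (fubini_tonelli1 k mk k0) /fubini_F.
  have mK1 := measurable_integralr L mk k0.
  have K10 (z : M4 * mR) : (0 <= \int[L]_s k (z, s))%E by exact: integral_ge0.
  rewrite -[LHS]/(\int[(@leb4 R \x L)%E]_z \int[L]_s k (z, s))%E.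
  rewrite (fubini_tonelli1 (fun z : M4 * mR => (\int[L]_s k (z, s))%E) mK1 K10) /fubini_F.
  have mK2 := measurable_integralr L mK1 K10.
  rewrite (integral_leb4 mK2); last by move=> z; exact: integral_ge0.
  apply: eq_integral => p _; apply: eq_integral => w' _.
  have mkw : measurable_fun setT (fun y : R2 => k (((p, w'), y.1), y.2)) by mfun.
  by rewrite (integral_leb2 mkw).
rewrite -/K (fubini_tonelli2 K mK K0) /fubini_G.
have mk2 : measurable_fun setT (fun p : R2 => \int[@leb2 R]_w' \int[@leb2 R]_y k (((p, w'), y.1),
  y.2))%E.
  apply: (measurable_integralr (@leb2 R) (f := fun z : R2 * R2 => (\int[@leb2 R]_y k ((z, y.1),
    y.2))%E)).
    by apply: (measurable_integralr (@leb2 R) (f := fun z : (R2 * R2) * R2 => k ((z.1, z.2.1),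
      z.2.2))); [mfun|move=> z; exact: k0].
  by move=> z; exact: integral_ge0.
apply: ae_eq_ge0_integral.
- exact: (measurable_integrall (@leb4 R) mK K0).
- exact: mk2.
- by move=> p; exact: integral_ge0.
- by move=> p; apply: integral_ge0 => w' _; exact: integral_ge0.
apply: filterS (ae_leb2_neq0 R) => p p0.
(* [B] stands for the matrix with rows p A and (perp p) A; the factor |w'|^-2 is the Jacobian of its
   second row in terms of (v, u). *)
pose f (B : M4) := (((nsq B.1)^-1)%:E * k (((p, B.1), dot (perp B.1) B.2 / nsq B.1),
  dot B.1 B.2 / nsq B.1)%R)%E.
have mf : measurable_fun setT f by rewrite /f /nsq /dot /perp /=; mfun.
have f0 B : (0 <= f B)%E by rewrite mule_ge0// lee_fin invr_ge0 nsq_ge0.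
transitivity (\int[@leb4 R]_B f B)%E.
  rewrite -(integral_linear4 (a := p.1) (b := p.2) (c := - p.2) (d := p.1) _ mf f0); last first.
    by rewrite mulrN opprK -!expr2.
  apply: eq_integral => A _; rewrite /K /f /= mulrN opprK -!expr2 -/(nsq p) ger0_norm ?nsq_ge0//.
  rewrite muleA -EFinM; congr (_%:E * _)%E.
  by rewrite /row_weight exprMn exprVn sqr_sqrtr ?nsq_ge0.
rewrite (integral_leb4 mf f0).
apply: ae_eq_ge0_integral.
- exact: (measurable_integralr (@leb2 R) mf f0).
- apply: (measurable_integralr (@leb2 R) (f := fun z : R2 * R2 => k (((p, z.1), z.2.1), z.2.2)));
  first by mfun.
  by move=> z; exact: k0.
- by move=> w'; exact: integral_ge0.
- by move=> w'; exact: integral_ge0.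
apply: filterS (ae_leb2_neq0 R) => w' w0.
have mg : measurable_fun setT (fun y : R2 => k (((p, w'), y.1), y.2)) by mfun.
have g0 (y : R2) : (0 <= k (((p, w'), y.1), y.2))%E by exact: k0.
have detE : (- w'.2 / nsq w') * (w'.2 / nsq w') - (w'.1 / nsq w') * (w'.1 / nsq w') = - (nsq w')^-1.
  by move: w0; rewrite /nsq => w0; field.
rewrite -(integral_linear2 (a := - w'.2 / nsq w') (b := w'.1 / nsq w')
  (c := w'.1 / nsq w') (d := w'.2 / nsq w') _ mg g0); last first.
  by rewrite detE oppr_eq0 invr_eq0.
apply: eq_integral => q _; rewrite detE normrN ger0_norm ?invr_ge0 ?nsq_ge0//.
rewrite /f /=; congr (_ * k _)%E; congr (_, _, _).
  by rewrite /dot /perp /=; move: w0; rewrite /nsq => w0; field.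
by rewrite /dot /=; move: w0; rewrite /nsq => w0; field.
Qed.

End coordinate_transport.

Lemma ae_imply2 d (T : measurableType d) (R : realType) (mu : {measure set T -> \bar R})
    (P Q S : T -> Prop) : {ae mu, forall x, P x} -> {ae mu, forall x, Q x} ->
  (forall x, P x -> Q x -> S x) -> {ae mu, forall x, S x}.
Proof. by move=> hP hQ h; apply: filterS2 hP hQ. Qed.

(** * The unitary transform underlying the voice transform *)

Section transform.
Context (R : realType).
Local Notation mR := (measurableTypeR R).
Local Notation R2 := (mR * mR)%type.
Local Notation M4 := ((mR * mR) * (mR * mR))%type.
Local Notation L := (@lebesgue_measure R).
Local Notation m1 := (@leb5 R \x L)%E.
Local Notation m3 := (@leb4 R \x @leb2 R)%E.
Local Notation F1 := (pfourier L (@phase1 R)).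
Local Notation F2 := (pfourier (@leb2 R) (@phase2 R)).
Local Notation row_pullback := (pullback (@row_weight R) (@row_map R)).
Implicit Types h : M4 * mR * mR -> R[i].

Let mp1 := @measurable_phase1 R.
Let mp2 := @measurable_phase2 R.

Definition transform h : M4 * R2 -> R[i] := F2 (row_pullback (F1 h)).

(** Both Fourier integrals converge absolutely for every value of the remaining variables, not just
    almost every one. This makes [transform] linear pointwise and lets it be compared with V_E F at
    each point of the group. *)
Definition regular h : Prop :=
  [/\ L2 m1 setT h, forall y, cintegrable L (fun s => h (y, s)) &
      forall A, cintegrable (@leb2 R) (fun p => row_pullback (F1 h) (A, p))].

Let F1_linear a h h' : regular h -> regular h' ->
  F1 (fun z => a * h z + h' z) = (fun z => a * F1 h z + F1 h' z).
Proof. by move=> [_ hi _] [_ hi' _]; exact: pfourier_linear. Qed.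

Let row_F1_linear a h h' : regular h -> regular h' ->
  row_pullback (F1 (fun z => a * h z + h' z)) =
  (fun z => a * row_pullback (F1 h) z + row_pullback (F1 h') z).
Proof. by move=> hr hr'; rewrite F1_linear// pullback_linear. Qed.

Lemma regular_linear a h h' : regular h -> regular h' ->
  regular (fun z => a * h z + h' z).
Proof.
move=> hr hr'; have [Lh hi hj] := hr; have [Lh' hi' hj'] := hr'; split.
- by apply: L2D => //; exact: L2Z.
- by move=> y; apply: cintegrableD => //; exact: cintegrableZ.
- by move=> A; rewrite row_F1_linear//; apply: cintegrableD => //; exact: cintegrableZ.
Qed.

Lemma transform_linear a h h' : regular h -> regular h' ->
  transform (fun z => a * h z + h' z) = (fun z => a * transform h z + transform h' z).
Proof.
move=> hr hr'; have [_ _ hj] := hr; have [_ _ hj'] := hr'.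
rewrite /transform row_F1_linear//.
exact: (pfourier_linear mp2 a hj hj').
Qed.

Let F1_isometry h : L2 m1 setT h -> (forall y, cintegrable L (fun s => h (y, s))) ->
  sqnorm m1 setT (F1 h) = sqnorm m1 setT h.
Proof.
move=> Lh hi; apply: (sqnorm_pfourier mp1 (@fourier1_isometry R) Lh).
exact: aeW.
Qed.

Let F2_isometry (f : M4 * R2 -> R[i]) : L2 m3 setT f ->
  (forall A, cintegrable (@leb2 R) (fun p => f (A, p))) ->
  sqnorm m3 setT (F2 f) = sqnorm m3 setT f.
Proof.
move=> Lf fi; apply: (sqnorm_pfourier mp2 (@fourier2_isometry R) Lf).
exact: aeW.
Qed.

Let mrow_map := @measurable_row_map R.
Let mrow_weight := @measurable_row_weight R.

Let L2_F1 h : regular h -> L2 m1 setT (F1 h).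
Proof.
move=> [Lh hi _]; have [mh hL] := Lh; split; first exact: cmeasurable_pfourier.
by rewrite F1_isometry.
Qed.

Let L2_row_F1 h : regular h -> L2 m3 setT (row_pullback (F1 h)).
Proof. by move=> hr; apply: (L2_pullback mrow_weight mrow_map (@row_transport R)); exact: L2_F1.
  Qed.

Lemma transform_isometry h : regular h ->
  sqnorm m3 setT (transform h) = sqnorm m1 setT h.
Proof.
move=> hr; have [Lh hi hj] := hr; have [mF _] := L2_F1 hr.
rewrite /transform (F2_isometry (L2_row_F1 hr) hj).
by rewrite (sqnorm_pullback (@row_transport R) mF) F1_isometry.
Qed.

Lemma L2_transform h : regular h -> L2 m3 setT (transform h).
Proof.
move=> hr; have [mF _] := L2_row_F1 hr; have [[_ hL] _ _] := hr.
by split; [exact: cmeasurable_pfourier|rewrite transform_isometry].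
Qed.

(* Inverse of [row_map]: the matrix with p A = w' and perp p A = u w' + v perp w'. *)
Definition row_inv (z : M4 * mR * mR) : M4 * R2 :=
  let p := z.1.1.1 in let w := z.1.1.2 in
  let q := (z.2 * w.1 - z.1.2 * w.2, z.2 * w.2 + z.1.2 * w.1) in
  ((((p.1 * w.1 - p.2 * q.1) / nsq p, (p.1 * w.2 - p.2 * q.2) / nsq p),
    ((p.2 * w.1 + p.1 * q.1) / nsq p, (p.2 * w.2 + p.1 * q.2) / nsq p)), p).
Definition row_inv_weight (z : M4 * mR * mR) : R :=
  Num.sqrt (nsq z.1.1.2) / nsq z.1.1.1.

Let mrow_inv : measurable_fun setT row_inv.
Proof. by rewrite /row_inv /nsq /=; mfun. Qed.

Let mrow_inv_weight : measurable_fun setT row_inv_weight.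
Proof. by rewrite /row_inv_weight /nsq /=; mfun. Qed.

(** For fixed p != 0 the exceptional set is the preimage, under the linear substitution B = (p A,
    (perp p) A), of the null set where the first row vanishes. Its indicator, multiplied by the
    Jacobian |p|^4, therefore integrates to 0. *)
Let ae_rowmul_neq0 : {ae m3, forall z, nsq z.2 != 0 /\ nsq (rowmul z.2 z.1) != 0}.
Proof.
have h2 : {ae m3, forall z, nsq z.2 != 0} by exact: (ae_prod2 (@leb4 R) (ae_leb2_neq0 R)).
pose f (B : M4) : \bar R := ((nsq B.1 == 0)%:R)%:E.
have mf : measurable_fun setT f.
  apply: mf_EFin; rewrite [X in measurable_fun _ X](_ : _ =
    (\1_[set B : M4 | nsq B.1 = 0] : M4 -> R)).
    apply: measurable_indic; rewrite -[X in measurable X]setTI.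
    have mn : measurable_fun setT (fun B : M4 => nsq B.1) by rewrite /nsq; mfun.
    exact: (mn measurableT [set 0] (measurable_set1 _)).
  by apply/funext => B; rewrite indicE; case: eqP => h; [rewrite mem_set|rewrite memNset].
have f0 B : (0 <= f B)%E by rewrite lee_fin.
have fi : (\int[@leb4 R]_B f B = 0)%E.
  have h4 : {ae @leb4 R, forall B : M4, nsq B.1 != 0} by exact:
    (ae_prod1 (@leb2 R) (ae_leb2_neq0 R)).
  rewrite (ae_eq_ge0_integral (g := fun=> 0%E)) ?integral0//.
  by apply: filterS h4 => B /negbTE; rewrite /f => ->.
pose g (z : M4 * R2) := (((nsq z.2) ^+ 2)%:E * f (rowmul z.2 z.1, rowmul (perp z.2) z.1))%E.
have mg : measurable_fun setT g by rewrite /g /nsq /rowmul /perp /=; mfun.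
have g0 z : (0 <= g z)%E by rewrite mule_ge0// lee_fin sqr_ge0.
have gi : (\int[m3]_z g z = 0)%E.
  rewrite (fubini_tonelli2 g mg g0) /fubini_G.
  rewrite (ae_eq_ge0_integral (g := fun=> 0%E)) ?integral0//.
  - exact: (measurable_integrall (@leb4 R) mg g0).
  - by move=> p; exact: integral_ge0.
  - apply: filterS (ae_leb2_neq0 R) => p p0.
    rewrite -[RHS]fi -(integral_linear4 (a := p.1) (b := p.2) (c := - p.2) (d := p.1) _ mf f0);
      last first.
      by rewrite mulrN opprK -!expr2.
    apply: eq_integral => A _.
    by rewrite /g mulrN opprK -!expr2 -/(nsq p) ger0_norm ?nsq_ge0.
have := integral_eq0_ae mg g0 gi; apply: filterS2 h2 => z z0; rewrite /g /f /=.
rewrite -EFinM => /eqP; rewrite eqe mulf_eq0 expf_eq0 (negbTE z0) /= => h; split => //.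
by move: h; case: (nsq _ == 0); rewrite ?oner_eq0.
Qed.

Let row_inverse : {ae m3, forall z, row_inv (row_map z) = z /\
   row_weight z * row_inv_weight (row_map z) = 1}.
Proof.
apply: filterS ae_rowmul_neq0 => -[[[a b] [c e]] [p1 p2]] /= [n0 k0]; split; last first.
  rewrite /row_weight /row_inv_weight /=.
  have s0 : Num.sqrt (nsq (rowmul (p1, p2) (a, b, (c, e)))) != 0.
    by rewrite sqrtr_eq0 -ltNge lt_neqAle eq_sym k0 nsq_ge0.
  by field; rewrite n0 s0.
rewrite /row_inv /row_map /ucoord /vcoord /dot /=.
move: n0 k0; rewrite /nsq /rowmul /perp /= => n0 k0.
by congr (_, _, (_, _), _); field; rewrite k0 n0.
Qed.

Definition inv_inv (z : (R2 * mR) * (R2 * mR)) : M4 * mR * mR :=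
  (((z.1.1, z.2.1), z.1.2 / z.2.2), z.1.2^-1).
Definition inv_inv_weight (z : (R2 * mR) * (R2 * mR)) : R :=
  (`|z.2.2| * Num.sqrt `|z.1.2|)^-1.

Let minv_inv : measurable_fun setT inv_inv.
Proof. by rewrite /inv_inv; mfun. Qed.

Let minv_inv_weight : measurable_fun setT inv_inv_weight.
Proof. by rewrite /inv_inv_weight; mfun. Qed.

Let inv_inverse : {ae m1, forall z : M4 * mR * mR, inv_inv (inv_map z) = z /\
   inv_weight z * inv_inv_weight (inv_map z) = 1}.
Proof.
have h1 : {ae m1, forall z, z.2 != 0} by exact: (ae_prod2 (@leb5 R) (ae_neq0 R)).
have h5 : {ae @leb5 R, forall z, z.2 != 0} by exact: (ae_prod2 (@leb4 R) (ae_neq0 R)).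
have h2 : {ae m1, forall z, z.1.2 != 0} by exact: (ae_prod1 L h5).
apply: (ae_imply2 (mu := m1) h1 h2) => -[[[w w'] v] s] /= s0 v0; split.
  rewrite /inv_inv /inv_map /= invrK; congr (_, _, _); last by rewrite invrK.
  by rewrite mulKf.
rewrite /inv_weight /inv_inv_weight /=.
have ss : 0 < Num.sqrt `|s| by rewrite sqrtr_gt0 normr_gt0.
rewrite normfV normrM normfV sqrtrV//.
have n0 : `|v| != 0 by rewrite normr_eq0.
have s1 : Num.sqrt `|s| != 0 by rewrite gt_eqF.
move: s1 (sqr_sqrtr (normr_ge0 s)) {ss}; move: (Num.sqrt `|s|) => q q0 <-.
by field; rewrite n0 q0.
Qed.

Let bounded_support (N : nat) (y : M4 * mR) : Prop :=
  [/\ nsq y.1.1 <= N%:R, nsq y.1.2 <= N%:R, `|y.2| <= N%:R &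
      y.1.2 = (0, 0) \/ N%:R^-1 <= nsq y.1.2].

Let truncated : set (M4 * mR -> R[i]) :=
  [set c | L2 (@leb5 R) setT c /\ exists N : nat,
     forall y, csqr (c y) <= N%:R /\ (c y != 0 -> bounded_support N y)].

Let measurable_bounded_support N : measurable [set y | bounded_support N y].
Proof.
have mle (r : M4 * mR -> R) (k : R) : measurable_fun setT r -> measurable [set y | r y <= k].
  move=> mr; rewrite -[X in measurable X]setTI.
  rewrite (_ : [set y | _] = r @^-1` `]-oo, k]%classic); first exact: mr.
  by apply/seteqP; split => y /=; rewrite in_itv.
have mn1 : measurable_fun setT (fun y : M4 * mR => nsq y.1.1) by rewrite /nsq; mfun.
have mn2 : measurable_fun setT (fun y : M4 * mR => nsq y.1.2) by rewrite /nsq; mfun.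
have mv : measurable_fun setT (fun y : M4 * mR => `|y.2|) by mfun.
rewrite (_ : [set y | _] = [set y | nsq y.1.1 <= N%:R] `&` [set y | nsq y.1.2 <= N%:R] `&`
  [set y | `|y.2| <= N%:R] `&` ([set y | nsq y.1.2 <= 0] `|` [set y | - nsq y.1.2 <= - N%:R^-1])).
  apply: measurableI; first by apply: measurableI; [apply: measurableI|]; exact: mle.
  by apply: measurableU; apply: mle => //; exact: mf_opp.
have n0 (p : R2) : (nsq p <= 0) = (p == (0, 0)).
  by rewrite -nsq_eq0 eq_le nsq_ge0 andbT.
apply/seteqP; split => y /=; rewrite n0 lerN2.
  by move=> [h1 h2 h3 h4]; split; [|case: h4 => [->|]; [left|right]].
by move=> [[[h1 h2] h3] h4]; split => //; case: h4 => [/eqP|]; [left|right].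
Qed.

Let eventually_bounded_support y : \forall N \near \oo, bounded_support N y.
Proof.
pose r := Num.max (Num.max (nsq y.1.1) (nsq y.1.2)) (Num.max `|y.2| (nsq y.1.2)^-1).
near=> N; have rN : r <= N%:R.
  by near: N; exact: nbhs_infty_ger.
move: rN; rewrite !ge_max => /andP[/andP[h1 h2] /andP[h3 h4]]; split => //.
have [->|n0] := eqVneq y.1.2 (0, 0); [by left|right].
have n0' : 0 < nsq y.1.2 by rewrite lt_neqAle eq_sym nsq_eq0 n0 nsq_ge0.
rewrite -[leRHS]invrK lef_pV2 ?posrE ?invr_gt0//.
by apply: lt_le_trans h4; rewrite invr_gt0.
Unshelve. all: by end_near. Qed.

Let truncated_dense c : L2 (@leb5 R) setT c -> approx (@leb5 R) truncated c.
Proof.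
move=> Lc; have [mc cL] := Lc.
pose E n := [set y | bounded_support n y] `&` [set y | csqr (c y) <= n%:R].
have mE n : measurable (E n).
  apply: measurableI; first exact: measurable_bounded_support.
  rewrite -[X in measurable X]setTI.
  rewrite (_ : [set y | csqr _ <= _] = (fun y => csqr (c y)) @^-1` `]-oo, n%:R]%classic).
    by apply: measurable_csqr.
  by apply/seteqP; split => y /=; rewrite in_itv.
apply: (L2_trunc (E := E)) => //.
- by move=> f [].
- move=> y; near=> n; split; first by near: n; exact: eventually_bounded_support.
  by near: n; exact: nbhs_infty_ger.
move=> n; apply: approx_self.
have mEc : cmeasurable setT (fun y => (\1_(E n) y)%:C * c y).
  by apply: cmeasurableM => //; apply: cmeasurable_cindic.
split; first split => //.
  apply: le_lt_trans cL; apply: le_integralT => [||y|y]; try exact: measurable_csqrE.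
    by rewrite lee_fin csqr_ge0.
  rewrite lee_fin csqrM csqr_real ler_piMl ?csqr_ge0// indicE.
exists n => y; rewrite indicE; have [yE|yE] := boolP (y \in E n).
  by rewrite mul1r; have [] := set_mem yE.
by rewrite mul0r csqr0 ler0n eqxx.
Unshelve. all: by end_near. Qed.

Let bounded_fourier (phi : mR -> R[i]) : cintegrable L phi ->
  exists K : R, forall u, n1 (fourier L (@phase1 R) phi u) <= K.
Proof.
move=> pi; exists (2 * fine (\int[L]_x (n1 (phi x))%:E)) => u.
have [mphi pL] := pi.
have ci : cintegrable L (fun x => expi (- phase1 (x, u)) * phi x).
  by apply: cintegrable_phase => //; mfun.
have fi : (\int[L]_x (n1 (phi x))%:E)%E \is a fin_num.
  by rewrite ge0_fin_numE// integral_ge0// => x _; rewrite lee_fin n1_ge0.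
rewrite -lee_fin EFinM fineK//; apply: le_trans (n1_cint_le ci) _.
have mn : measurable_fun setT (fun x => (n1 (phi x))%:E) by mfun.
have n0 x : (0 <= (n1 (phi x))%:E)%E by rewrite lee_fin n1_ge0.
rewrite -integralZT//; apply: le_integralT.
- by apply: mf_EFin; apply: measurable_n1; case: ci.
- by mfun.
- by move=> x; rewrite lee_fin n1_ge0.
move=> x; rewrite -EFinM lee_fin; apply: le_trans (n1M _ _) _.
by rewrite ler_wpM2r ?n1_ge0// n1_expi_le.
Qed.

(** The transform of [phi] is bounded, and truncation makes [c] and the row weight bounded on a set
    of bounded p; at each A the function of p is thus bounded and vanishes off a square. *)
Let regular_tensor c phi : truncated c -> cintegrable L phi -> L2 L setT phi ->
  regular (fun z => c z.1 * phi z.2).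
Proof.
move=> [Lc [N cN]] phii Lphi; have [mc _] := Lc.
split; first exact: (L2_tensor (m1 := @leb5 R) (m2 := L)).
  by move=> y; exact: (cintegrableZ (c y) phii).
move=> A; have [K phiK] := bounded_fourier phii.
have F1E y u : F1 (fun z => c z.1 * phi z.2) (y, u) = c y * fourier L (@phase1 R) phi u.
  rewrite /pfourier /fourier /= -cintZ; last by apply: cintegrable_phase => //; mfun.
  by apply: eq_cint => x; ring.
have mf : cmeasurable setT (fun p => row_pullback (F1 (fun z => c z.1 * phi z.2)) (A, p)).
  apply: (cmeasurable_pairl (f := row_pullback (F1 (fun z => c z.1 * phi z.2)))).
  have [mphi _] := Lphi.
  have mh : cmeasurable setT (fun z : M4 * mR * mR => c z.1 * phi z.2) by mfun.
  exact: (cmeasurable_pullback mrow_weight mrow_map (cmeasurable_pfourier L mp1 mh)).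
pose I := `[- N%:R, N%:R]%classic : set mR.
have mI : measurable I by exact: measurable_itv.
pose Q : set R2 := I `*` I.
have mQ : measurable Q by exact: measurableX.
have NN : N%:R <= N%:R ^+ 2 :> R by rewrite -natrX ler_nat; case: (N) => // k; rewrite leq_pmulr.
have inQ p : nsq p <= N%:R -> Q p.
  move=> pN; have h1 := sqr_ge0 p.1; have h2 := sqr_ge0 p.2; have N0 := ler0n R N.
  move: pN; rewrite /nsq => pN.
  by split; rewrite /I /= in_itv /= -ler_norml -ler_sqr ?nnegrE// real_normK ?num_real//; lra.
have LQ : (@leb2 R Q < +oo)%E.
  have LI : (L I < +oo)%E.
    by rewrite /I [X in (X < _)%E]lebesgue_measure_itv /=; case: ifP; rewrite ?ltry// -EFinB ltry.
  rewrite [X in (X < _)%E](product_measure1E L L mI mI) lte_mul_pinfty//.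
  by rewrite ge0_fin_numE.
have K0 : 0 <= K by apply: le_trans (phiK 0); exact: n1_ge0.
(* The row weight is at most N * N, from |p|^2 <= N and 1/|w'| <= N; [n1] of [c] is at most 2 N + 1
   because its square is at most 2 N; and K bounds the Fourier transform of [phi]. *)
pose C := N%:R * N%:R * ((2 * N%:R + 1) * K).
have C0 : 0 <= C by rewrite /C !mulr_ge0 ?addr_ge0 ?mulr_ge0.
have mIQ : measurable_fun setT (\1_Q : R2 -> R) by exact: measurable_indic.
apply: (cintegrable_le (h := fun p => (C%:E * (\1_Q p : R)%:E)%E) mf); first by mfun.
- move=> p; rewrite -EFinM lee_fin /pullback /row_map F1E.
  set y := ((p, _), _); set u := ucoord _ _.
  have [c0|c0] := eqVneq (c y) 0.
    by rewrite c0 mul0r mulr0 /n1 /= normr0 addr0 mulr_ge0.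
  have [cle /(_ c0)[h1 _ _ h4]] := cN y.
  rewrite indicE mem_set ?mulr1; last exact: inQ.
  have wle : 0 <= row_weight (A, p) <= N%:R * N%:R.
    rewrite /row_weight /= mulr_ge0 ?invr_ge0 ?nsq_ge0 ?sqrtr_ge0//=.
    apply: ler_pM => //; rewrite ?invr_ge0 ?nsq_ge0 ?sqrtr_ge0//.
    case: h4 => /= [->|h4]; first by rewrite /nsq /= expr0n addr0 sqrtr0 invr0.
    (* For N = 0 the bound below on |w'| is void as 1/0 = 0, but the support reduces to p = 0, where
       the inverse norm of p A is 0 by convention. *)
    have [N0|N0] := eqVneq (N%:R : R) 0.
      have n0 : nsq p = 0 by apply/eqP; rewrite eq_le nsq_ge0 andbT -N0.
      have /eqP p0 : p == (0, 0) by rewrite -nsq_eq0 n0.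
      by rewrite p0 /rowmul /nsq /= !mul0r addr0 expr0n addr0 sqrtr0 invr0.
    have Np : 0 < N%:R :> R by rewrite lt_neqAle eq_sym N0 ler0n.
    have wp : 0 < nsq (rowmul p A) by apply: lt_le_trans h4; rewrite invr_gt0.
    rewrite -[leRHS]invrK lef_pV2 ?posrE ?invr_gt0 ?sqrtr_gt0//.
    rewrite -ler_sqr ?nnegrE ?invr_ge0 ?sqrtr_ge0// sqr_sqrtr ?nsq_ge0//.
    apply: le_trans h4; rewrite exprVn lef_pV2 ?posrE ?exprn_gt0//.
  have [w0 wN] := andP wle.
  apply: le_trans (n1M _ _) _; rewrite {1}/n1 /= normr0 addr0 ger0_norm//.
  apply: ler_pM => //; first exact: n1_ge0.
  apply: le_trans (n1M _ _) _; apply: ler_pM; rewrite ?n1_ge0//.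
  have := n1_csqr (c y); have := sqr_ge0 (n1 (c y) - 1); have := n1_ge0 (c y); nra.
- rewrite integralZT//; last exact: mf_EFin.
  by rewrite integral_indic// setIT lte_mul_pinfty.
Qed.

Let F1_range : set (M4 * mR * mR -> R[i]) := [set F1 h | h in regular].

Let F1_dense f : L2 m1 setT f -> approx m1 F1_range f.
Proof.
move=> Lf.
have sub : subspace m1 F1_range.
  split=> [_ [h hr <-]|a _ _ [h hr <-] [h' hr' <-]]; first exact: L2_F1.
  exists (fun z => a * h z + h' z); first exact: regular_linear.
  by rewrite F1_linear.
have [sub1 _] := fourier_range_subspace mp1 (@fourier1_isometry R).
apply: (approx_tensor (m1 := @leb5 R) (m2 := L) _ sub1 sub truncated_dense (@fourier1_dense R)) Lf.
  by move=> c [].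
move=> c _ tc [phi [phii Lphi] <-]; apply: approx_self.
exists (fun z => c z.1 * phi z.2); first exact: regular_tensor.
apply/funext => -[y u]; rewrite /pfourier /fourier /= -cintZ; last first.
  by apply: cintegrable_phase => //; mfun.
by apply: eq_cint => x; ring.
Qed.

(** The second partial transform has dense range already on the tensors in [D2]. It is isometric, so
    it is enough to approximate an element of [D2] by pulled-back values of the first transform;
    this follows from [F1_dense] through the inverse [row_inv]. *)
Lemma transform_dense f : L2 m3 setT f -> approx m3 [set transform h | h in regular] f.
Proof.
move=> Lf.
pose D2 : set (M4 * R2 -> R[i]) := [set Phi | L2 m3 setT Phi /\
  forall A, cintegrable (@leb2 R) (fun p => Phi (A, p))].
have D2_linear a f1 f2 : D2 f1 -> D2 f2 -> D2 (fun z => a * f1 z + f2 z).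
  move=> [L1 i1] [L2' i2]; split; first by apply: L2D => //; exact: L2Z.
  by move=> A; apply: cintegrableD => //; exact: cintegrableZ.
have sub2 : subspace m3 [set F2 Phi | Phi in D2].
  split=> [_ [Phi [LP Pi] <-]|a _ _ [P1 [L1 i1] <-] [P2 [L2' i2] <-]].
    have [mP PL] := LP; split; first exact: cmeasurable_pfourier.
    by rewrite F2_isometry.
  exists (fun z => a * P1 z + P2 z); first exact: D2_linear.
  exact: (pfourier_linear mp2 a i1 i2).
have [subf _] := fourier_range_subspace mp2 (@fourier2_isometry R).
have D2f : approx m3 [set F2 Phi | Phi in D2] f.
  apply: (approx_tensor (m1 := @leb4 R) (m2 := @leb2 R) (S1 :=
    L2 (@leb4 R) setT) _ subf sub2 _ (@fourier2_dense R)) Lf => //.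
    by move=> g Lg; exact: approx_self.
  move=> g _ Lg [phi [phii Lphi] <-]; apply: approx_self.
  exists (fun z => g z.1 * phi z.2).
    split; first exact: (L2_tensor (m1 := @leb4 R) (m2 := @leb2 R)).
    by move=> A; exact: (cintegrableZ (g A) phii).
  apply/funext => -[A x]; rewrite /pfourier /fourier /= -cintZ; last first.
    by apply: cintegrable_phase => //; mfun.
  by apply: eq_cint => p; ring.
have subT : [set transform h | h in regular] `<=` L2 m3 setT.
  by move=> _ [h hr <-]; exact: L2_transform.
have [mf _] := Lf.
apply: (approx_trans subT mf _ D2f) => _ [Phi DP <-].
have [LP Pi] := DP; have [mP _] := LP.
split; first exact: cmeasurable_pfourier.
have LiP := L2_pullback_inverse mrow_weight mrow_map mrow_inv_weight mrow_inv
  (@row_transport R) row_inverse LP.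
have F1sub : F1_range `<=` L2 m1 setT by move=> _ [h hr <-]; exact: L2_F1.
have := approx_pullback mrow_weight mrow_map mrow_inv_weight mrow_inv
  (@row_transport R) row_inverse F1sub LP (F1_dense LiP).
move=> aP e /aP[_ [_ [h hr <-] <-] hd]; exists (transform h); first by exists h.
have [_ _ hj] := hr.
have Dr : D2 (row_pullback (F1 h)) by split=> //; exact: L2_row_F1.
apply: le_lt_trans hd; rewrite /sqdist.
have [LD Di] := D2_linear (-1) _ _ Dr DP.
have -> : (fun x => F2 Phi x - transform h x) =
    F2 (fun z => -1 * row_pullback (F1 h) z + Phi z).
  rewrite (pfourier_linear mp2 _ hj Pi); apply/funext => z.
  by rewrite mulN1r addrC.
rewrite (F2_isometry LD Di) le_eqVlt; apply/orP; left; apply/eqP.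
by apply: eq_integral => z _; congr (csqr _)%:E; rewrite mulN1r addrC.
Qed.

(** Carries density through the first change of variables: a dense family of regular functions of
    (w, t), (w', r) is dense after the pull-back, and [transform] preserves distances between
    regular functions. *)
Lemma inv_transform_dense (S : set ((R2 * mR) * (R2 * mR) -> R[i])) f :
  (forall H, S H -> L2 (@leb3 R \x @leb3 R)%E setT H /\
     regular (pullback (@inv_weight R) (@inv_map R) H)) ->
  (forall H, L2 (@leb3 R \x @leb3 R)%E setT H -> approx (@leb3 R \x @leb3 R)%E S H) ->
  L2 m3 setT f ->
  approx m3 [set transform (pullback (@inv_weight R) (@inv_map R) H) | H in S] f.
Proof.
move=> SL Sdense Lf; have [mf _] := Lf.
apply: (approx_trans _ mf _ (transform_dense Lf)).
  by move=> _ [H /SL[LH Hr] <-]; exact: L2_transform.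
move=> _ [h hr <-]; have [[mh _] _ _] := hr; have [Lh _ _] := hr.
split; first by have [] := L2_transform hr.
have SL' : S `<=` L2 (@leb3 R \x @leb3 R)%E setT by move=> H /SL[].
have Li := L2_pullback_inverse (@measurable_inv_weight R) (@measurable_inv_map R)
  minv_inv_weight minv_inv (@inv_transport R) inv_inverse Lh.
have := approx_pullback (@measurable_inv_weight R) (@measurable_inv_map R)
  minv_inv_weight minv_inv (@inv_transport R) inv_inverse SL' Lh (Sdense _ Li).
move=> ah e /ah[_ [H SH <-] hd]; have [LH Hr] := SL _ SH.
exists (transform (pullback (@inv_weight R) (@inv_map R) H)); first by exists H.
apply: le_lt_trans hd; rewrite /sqdist.
have -> : (fun x => transform h x - transform (pullback (@inv_weight R) (@inv_map R) H) x) =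
    transform (fun z => -1 * pullback (@inv_weight R) (@inv_map R) H z + h z).
  by rewrite transform_linear//; apply/funext => z; rewrite mulN1r addrC.
rewrite transform_isometry; last exact: regular_linear.
rewrite le_eqVlt; apply/orP; left; apply/eqP.
by apply: eq_integral => z _; congr (csqr _)%:E; rewrite mulN1r addrC.
Qed.

End transform.

(** * Haar measures in coordinates *)

Section density.
Context d (T : measurableType d) (R : realType).
Variables (mu nu : {measure set T -> \bar R}) (w : T -> R).
Hypotheses (mw : measurable_fun setT w) (w0 : forall x, 0 <= w x).
Hypothesis nuE : forall A, measurable A -> nu A = (\int[mu]_(x in A) (w x)%:E)%E.

Import HBNNSimple.

Let integral_density_nnsfun (h : {nnsfun T >-> R}) :
  (\int[nu]_x (h x)%:E = \int[mu]_x ((w x)%:E * (h x)%:E))%E.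
Proof.
pose s := finmap.enum_fset (fset_set (range h)).
have hE x : (h x)%:E = (\sum_(y <- s) (y * \1_(h @^-1` [set y]) x)%:E)%E.
  by rewrite sumEFin fimfunE fsbig_finite.
have ms y : measurable (h @^-1` [set y]) by [].
have s0 y x : (0 <= (y * \1_(h @^-1` [set y]) x)%:E)%E.
  rewrite lee_fin indicE; have [/set_mem /= <-|_] := boolP (x \in _).
    by rewrite mulr1.
  by rewrite mulr0.
have mi y : measurable_fun setT (fun x => (y * \1_(h @^-1` [set y]) x)%:E).
  by apply: mf_EFin; apply: mf_mul => //; exact: measurable_indic.
under eq_integral do rewrite hE.
under [RHS]eq_integral do rewrite hE ge0_sume_distrr//.
rewrite ge0_integral_sum// ge0_integral_sum//; last 2 first.
- by move=> y; apply: mf_emul => //; exact: mf_EFin.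
- by move=> y x _; rewrite mule_ge0// lee_fin.
apply: eq_bigr => y _.
have [y0|y0] := leP 0 y; last first.
  have E0 : h @^-1` [set y] = set0.
    apply/seteqP; split => x //= xy.
    by have : 0 <= h x by []; rewrite xy leNgt y0.
  rewrite E0; under eq_integral do rewrite indic0 mulr0.
  by under [RHS]eq_integral do rewrite indic0 mulr0 mule0; rewrite !integral0.
under eq_integral do rewrite EFinM.
rewrite integralZT//; last by apply: mf_EFin; exact: measurable_indic.
under [RHS]eq_integral do rewrite EFinM muleCA.
rewrite integralZT//; last 2 first.
- by apply: mf_emul; apply: mf_EFin => //; exact: measurable_indic.
- by move=> x; rewrite mule_ge0// lee_fin.
congr (_ * _)%E; rewrite integral_indic// setIT nuE// integral_mkcond.
apply: eq_integral => x _; rewrite patchE indicE.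
by case: (x \in _); rewrite ?mule1 ?mule0.
Qed.

(** The measure is given only by its values on sets. These determine the integrals of simple
    functions, and monotone convergence does the rest. *)
Lemma integral_density (f : T -> \bar R) : measurable_fun setT f -> (forall x, 0 <= f x)%E ->
  (\int[nu]_x f x = \int[mu]_x ((w x)%:E * f x))%E.
Proof.
move=> mf f0; pose h := nnsfun_approx measurableT mf.
have hf x : (h n x)%:E @[n --> \oo] --> f x.
  by apply: (cvg_nnsfun_approx measurableT mf) => // y _; exact: f0.
have nd x : nondecreasing_seq (fun n => (h n x)%:E).
  by move=> n m nm; rewrite lee_fin; exact/lefP/nd_nnsfun_approx.
have -> : (\int[nu]_x f x = limn (fun n => \int[nu]_x (h n x)%:E))%E.
  rewrite -monotone_convergence//.
  - by apply: eq_integral => x _; apply/esym/cvg_lim.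
  - by move=> n; exact: mf_EFin.
  - by move=> n x _; rewrite lee_fin.
have -> : (\int[mu]_x ((w x)%:E * f x) = limn (fun n => \int[mu]_x ((w x)%:E * (h n x)%:E)))%E.
  rewrite -monotone_convergence//.
  - by apply: eq_integral => x _; apply/esym/cvg_lim => //; exact: cvgeZl.
  - by move=> n; apply: mf_emul; exact: mf_EFin.
  - by move=> n x _; rewrite mule_ge0// lee_fin.
  - by move=> x _ n m nm; rewrite lee_wpmul2l ?lee_fin//; exact: nd.
by congr (limn _); apply/funext => n; exact: integral_density_nnsfun.
Qed.

End density.

(** * Transport of L^2 spaces to coordinates *)

Section weighted_parametrization.
Context d d' (T : measurableType d) (X : measurableType d') (R : realType).
Variables (mu : {measure set T -> \bar R}) (D : set T).
Variables (m : {measure set X -> \bar R}) (psi : X -> T) (w : X -> R).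
Hypotheses (mD : measurable D) (mpsi : measurable_fun setT psi).
Hypotheses (mw : measurable_fun setT w) (w0 : forall x, 0 <= w x).
Hypothesis wD : forall x, w x != 0 -> D (psi x).
Hypothesis transport : forall f : T -> \bar R, measurable_fun setT f ->
  (forall x, 0 <= f x)%E ->
  (\int[mu]_(x in D) f x = \int[m]_x ((w x)%:E * f (psi x)))%E.
Implicit Types F G : T -> R[i].

Lemma transportD (f : T -> \bar R) : measurable_fun D f ->
  (forall x, D x -> 0 <= f x)%E ->
  (\int[mu]_(x in D) f x = \int[m]_x ((w x)%:E * f (psi x)))%E.
Proof.
move=> mf f0; transitivity (\int[mu]_(x in D) (f \_ D) x)%E.
  by apply: eq_integral => x xD; rewrite patchE xD.
rewrite transport.
- apply: eq_integral => x _; have [->|n0] := eqVneq (w x) 0; first by rewrite !mul0e.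
  by rewrite patchE mem_set//; exact: wD.
- exact/(measurable_restrictT f mD).
- move=> x; rewrite patchE; case: ifP => // /set_mem; exact: f0.
Qed.

(** On [D] the measure [mu] is the image of w dm under [psi]; including the square root of [w] in
    the function makes F -> [weighted F] an isometry into L^2 of [m]. By [wD] the weight is 0
    wherever [psi] leaves [D], so values of [F] outside [D] do not matter. *)
Definition weighted F (x : X) : R[i] := (Num.sqrt (w x))%:C * F (psi x).

Let weighted_restrict F (a : X -> R) : (forall x, w x = 0 -> a x = 0) ->
  (fun x => (a x)%:C * F (psi x)) =
  (fun x => (a x)%:C * (if psi x \in D then F (psi x) else 0)).
Proof.
move=> aw; apply/funext => x; have [/aw->|n0] := eqVneq (w x) 0; first by rewrite !mul0r.
by rewrite mem_set//; exact: wD.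
Qed.

Lemma cmeasurable_weighted F : cmeasurable D F -> cmeasurable setT (weighted F).
Proof.
move=> mF; rewrite /weighted weighted_restrict; last by move=> x ->; rewrite sqrtr0.
have mF' := cmeasurable_restrict mD mF.
by apply: cmeasurableM; [mfun|exact: (cmeasurable_comp mF' mpsi)].
Qed.

Lemma sqnorm_weighted F : cmeasurable D F -> sqnorm mu D F = sqnorm m setT (weighted F).
Proof.
move=> mF; rewrite /sqnorm transportD.
- apply: eq_integral => x _; rewrite csqrM csqr_real sqr_sqrtr//.
- by apply: mf_EFin; exact: measurable_csqr.
- by move=> x _; rewrite lee_fin csqr_ge0.
Qed.

Lemma L2_weighted F : L2 mu D F -> L2 m setT (weighted F).
Proof. by move=> [mF FL]; split; [exact: cmeasurable_weighted|rewrite -sqnorm_weighted]. Qed.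

Let Rintegral_param (r : T -> R) : measurable_fun D r ->
  \int[mu]_(x in D) r x = \int[m]_x (w x * r (psi x)).
Proof.
move=> mr; congr fine; rewrite integralE [RHS]integralE.
have mEf : measurable_fun D (EFin \o r) by exact/measurable_EFinP.
rewrite (transportD (measurable_funepos mEf))// (transportD (measurable_funeneg mEf))//.
congr (_ - _)%E; apply: eq_integral => x _.
  by rewrite !funeposE /= EFinM maxe_pMr ?lee_fin// mule0.
by rewrite !funenegE maxe_pMr ?lee_fin// mule0 muleN -EFinM.
Qed.

Lemma cintegral_param F : cmeasurable D F ->
  cintegral mu D F = cintegral m setT (fun x => (w x)%:C * F (psi x)).
Proof.
move=> [f1 f2]; apply: complexP => /=.
  rewrite (Rintegral_param f1); apply: eq_Rintegral => x _.
  by rewrite ReM /= mul0r subr0.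
rewrite (Rintegral_param f2); apply: eq_Rintegral => x _.
by rewrite ImM /= mul0r addr0.
Qed.

Lemma inner_weighted F G : cmeasurable D F -> cmeasurable D G ->
  inner mu D F G = cintegral m setT (fun x => weighted F x * (weighted G x)^*%R).
Proof.
move=> mF mG; rewrite /inner cintegral_param; last first.
  by apply: cmeasurableM => //; exact: cmeasurableJ.
apply: eq_cint => x; rewrite /weighted conjM.
have -> : (Num.sqrt (w x))%:C^*%R = (Num.sqrt (w x))%:C :> R[i].
  by apply: complexP; rewrite ?ReJ ?ImJ //= oppr0.
rewrite mulrACA -rmorphM /= -expr2 sqr_sqrtr//.
Qed.

End weighted_parametrization.

Section ae_equality.
Context d (T : measurableType d) (R : realType).
Variables (mu : {measure set T -> \bar R}) (D : set T).
Hypothesis mD : measurable D.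
Implicit Types f g : T -> R[i].

Lemma ae_equal_sqnorm f g : cmeasurable D f -> cmeasurable D g ->
  ae_equal mu D f g -> sqnorm mu D f = sqnorm mu D g.
Proof.
move=> mf mg fg; apply: ae_eq_integral => //.
- by apply: mf_EFin; exact: measurable_csqr.
- by apply: mf_EFin; exact: measurable_csqr.
- by apply: filterS fg => x fgx Dx; rewrite fgx.
Qed.

Lemma ae_equal_cintegral f g : cmeasurable D f -> cmeasurable D g ->
  ae_equal mu D f g -> cintegral mu D f = cintegral mu D g.
Proof.
move=> [f1 f2] [g1 g2] fg; apply: complexP => /=; congr fine; apply: ae_eq_integral => //.
- exact: mf_EFin.
- exact: mf_EFin.
- by apply: filterS fg => x fgx Dx; rewrite fgx.
- exact: mf_EFin.
- exact: mf_EFin.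
- by apply: filterS fg => x fgx Dx; rewrite fgx.
Qed.

Lemma sqdist_eq0 f g : cmeasurable D f -> cmeasurable D g ->
  sqdist mu D f g = 0%E -> ae_equal mu D f g.
Proof.
move=> mf mg fg0; have mfg := cmeasurableB mf mg.
have mr := cmeasurable_restrict mD mfg.
have : sqnorm mu setT (fun x => if x \in D then f x - g x else 0) = 0%E.
  rewrite -fg0 /sqdist /sqnorm [RHS]integral_mkcond; apply: eq_integral => x _.
  by rewrite patchE; case: ifP; rewrite ?csqr0.
move/(sqnorm_eq0 mr); apply: filterS => x + Dx; rewrite mem_set// => /eqP.
by rewrite subr_eq0 => /eqP.
Qed.

Lemma ae_equal_sqdist f g : cmeasurable D f -> cmeasurable D g ->
  ae_equal mu D f g -> sqdist mu D f g = 0%E.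
Proof.
move=> mf mg fg; rewrite /sqdist (@ae_equal_sqnorm _ (fun=> 0)).
- by rewrite /sqnorm; under eq_integral do rewrite csqr0; rewrite integral0.
- exact: cmeasurableB.
- exact: cmeasurable_cst.
- by apply: filterS fg => x fgx Dx; rewrite fgx// subrr.
Qed.

End ae_equality.

Section group_measures.
Context (R : realType).
Local Notation mR := (measurableTypeR R).
Local Notation R2 := (mR * mR)%type.
Local Notation M4 := ((mR * mR) * (mR * mR))%type.
Local Notation L := (@lebesgue_measure R).
Local Notation affine := ('cV[R]_2 * 'M[R]_2)%type.

Definition Kcoord (p : R2) : affine := Kpoint (rv2 p).
Definition Gcoord (z : M4 * R2) : affine := (cv2 z.2, mx2_of z.1).
Definition Gweight (z : M4 * R2) : R := (`|det4 z.1| ^+ 2)^-1 * `|det4 z.1|^-1.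

Lemma ord2 (i : 'I_2) : i = 0 \/ i = 1.
Proof. by case: i => -[|[|//]] i2; [left|right]; apply: val_inj. Qed.

Let row_entry (p : R2) : (rv2 p 0 0 = p.1) * (rv2 p 0 1 = p.2).
Proof. by rewrite !mxE. Qed.

Lemma enorm_rv2 (p : R2) : enorm (rv2 p) = Num.sqrt (nsq p).
Proof. by rewrite /enorm !row_entry. Qed.

Lemma rv2_neq0 (p : R2) : nsq p != 0 -> O (rv2 p).
Proof.
by move=> n0 /= p0; move: n0; rewrite /nsq -!row_entry p0 !mxE expr0n addr0 eqxx.
Qed.

Lemma det_mx2_of (A : M4) : \det (mx2_of A) = det4 A.
Proof. by rewrite det_mx2 /mx2_of /mx2 !mxE. Qed.

Lemma measurable_G2 : measurable (@G2 R).
Proof.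
rewrite (_ : @G2 R = (fun g : affine => \det g.2) @^-1` [set~ 0]).
  rewrite -[X in measurable X]setTI.
  apply: (measurableT_comp (@measurable_det2 R) measurable_snd) => //.
  by apply: measurableC; exact: measurable_set1.
by apply/seteqP; split => g /=; rewrite /G2 /= unitmxE unitfE => /eqP.
Qed.

Lemma measurable_K : measurable (@K R).
Proof.
have mfst (i : 'I_2) : measurable_fun setT (fun k : affine => k.1 i 0).
  exact: (measurableT_comp (measurable_mx_entry i 0) measurable_fst).
have msnd (i j : 'I_2) : measurable_fun setT (fun k : affine => k.2 i j).
  exact: (measurableT_comp (measurable_mx_entry i j) measurable_snd).
have meq (r : affine -> R) : measurable_fun setT r -> measurable [set k | r k = 0].
  move=> mr; rewrite -[X in measurable X]setTI.
  exact: (mr measurableT [set 0] (measurable_set1 _)).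
rewrite (_ : @K R = [set k : affine | k.1 0 0 = 0] `&` [set k : affine | k.1 1 0 = 0] `&`
  ([set k : affine | k.2 0 0 - k.2 1 1 = 0] `&` [set k : affine | k.2 0 1 + k.2 1 0 = 0] `&`
   ~` [set k : affine | k.2 0 0 ^+ 2 + k.2 1 0 ^+ 2 = 0])).
  apply: measurableI; first by apply: measurableI; exact: meq.
  apply: measurableI; first by apply: measurableI; apply: meq; mfun.
  by apply: measurableC; apply: meq; mfun.
apply/seteqP; split => -[x M] /=.
  move=> [/= -> [s [t [st ->]]]]; rewrite !mxE /= subrr addNr; split => //; split => //.
  by move=> st0; rewrite st0 ltxx in st.
move=> [[x0 x1] [[d0 o0] n0]]; split => /=.
  by apply/colP => -[[|[|//]] i2]; rewrite mxE; [rewrite -[RHS]x0|rewrite -[RHS]x1];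
    congr (x _ _); apply: val_inj.
exists (M 0 0), (M 1 0); split.
  by rewrite lt_neqAle addr_ge0 ?sqr_ge0// andbT eq_sym; apply/eqP.
apply/matrixP => i j; rewrite !mxE.
have e11 : M 1 1 = M 0 0 by apply/eqP; rewrite eq_sym -subr_eq0; apply/eqP.
have e01 : M 0 1 = - M 1 0 by apply/eqP; rewrite -addr_eq0; apply/eqP.
by have [->|->] := ord2 i; have [->|->] := ord2 j; rewrite /= ?e11 ?e01.
Qed.

Let measurable_nsq : measurable_fun setT (@nsq R).
Proof. by rewrite /nsq; mfun. Qed.

Lemma Kweight_K (p : R2) : (nsq p)^-1 != 0 -> K (Kcoord p).
Proof.
rewrite invr_eq0 => n0; split => //=.
exists (p.1 / nsq p), (p.2 / nsq p); split.
  rewrite !exprMn -mulrDl mulr_gt0// lt_neqAle eq_sym.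
    by rewrite n0 nsq_ge0.
  by rewrite sqr_ge0 andbT expf_neq0// invr_eq0.
rewrite /gamma enorm_rv2 sqr_sqrtr ?nsq_ge0//; apply/matrixP => i j; rewrite !mxE.
by have [->|->] := ord2 i; have [->|->] := ord2 j; rewrite /= ?mulrN mulrC.
Qed.

Lemma measurable_Kcoord : measurable_fun setT Kcoord.
Proof. exact: (measurableT_comp (@measurable_Kpoint R) (@measurable_rv2 R)). Qed.

Lemma measurable_Gcoord : measurable_fun setT Gcoord.
Proof.
apply: mf_pair.
  exact: (measurableT_comp (@measurable_cv2 R) measurable_snd).
exact: (measurableT_comp (@measurable_mx2_of R) measurable_fst).
Qed.

Lemma measurable_Gweight : measurable_fun setT Gweight.
Proof. by rewrite /Gweight /det4; mfun. Qed.

Lemma Gweight_ge0 z : 0 <= Gweight z.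
Proof. by rewrite mulr_ge0 ?invr_ge0 ?exprn_ge0. Qed.

Lemma Gcoord_G2 z : (G2 (Gcoord z) : Prop) <-> det4 z.1 != 0.
Proof. by rewrite /G2 /= unitmxE unitfE det_mx2_of. Qed.

Lemma Gweight_G2 z : Gweight z != 0 -> G2 (Gcoord z).
Proof.
move=> w0; apply/Gcoord_G2; apply: contra w0 => /eqP d0.
by rewrite /Gweight d0 normr0 invr0 mulr0.
Qed.

Let integral_restrict d (T : measurableType d) (mu : {measure set T -> \bar R})
    (D : set T) (f : T -> \bar R) :
  (\int[mu]_(x in D) f x = \int[mu]_x (f \_ D) x)%E.
Proof. by rewrite integral_mkcond. Qed.

Let mpatch d (T : measurableType d) (D : set T) (f : T -> \bar R) : measurable D ->
  measurable_fun setT f -> measurable_fun setT (f \_ D).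
Proof.
by move=> mD mf; apply/(measurable_restrictT f mD); exact: measurable_funTS.
Qed.

Let patch_ge0 T (D : set T) (f : T -> \bar R) : (forall x, 0 <= f x)%E ->
  (forall x, 0 <= (f \_ D) x)%E.
Proof. by move=> f0 x; rewrite patchE; case: ifP. Qed.

Let integral_pushforward_ge0 d1 d2 (T1 : measurableType d1) (T2 : measurableType d2)
    (mu : {measure set T1 -> \bar R}) (phi : T1 -> T2) (f : T2 -> \bar R) :
  measurable_fun setT phi -> measurable_fun setT f -> (forall x, 0 <= f x)%E ->
  (\int[pushforward mu phi]_x f x = \int[mu]_x f (phi x))%E.
Proof.
by move=> mphi mf f0; rewrite ge0_integral_pushforward// preimage_setT.
Qed.

(** Two image measures and a density are undone in turn. At the origin, where [Kcoord] leaves [K],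
    the weight vanishes because 1/0 = 0. *)
Lemma transport_K (f : affine -> \bar R) : measurable_fun setT f ->
  (forall x, 0 <= f x)%E ->
  (\int[@haar_K R]_(x in @K R) f x =
   \int[@leb2 R]_p (((nsq p)^-1)%:E * f (Kcoord p)))%E.
Proof.
move=> mf f0; rewrite integral_restrict.
have mg := mpatch measurable_K mf; have g0 := patch_ge0 (@K R) f0.
rewrite [LHS](integral_pushforward_ge0 (@dw_over_sqnorm R) (@measurable_Kpoint R) mg g0).
have mgK : measurable_fun setT (fun w => (f \_ (@K R)) (Kpoint w)).
  exact: (measurableT_comp mg (@measurable_Kpoint R)).
rewrite [LHS](integral_density (mu := @leb_rV R) (@measurable_K_density R) (@K_density_ge0 R))//.
have mh : measurable_fun setT (fun w : 'rV[R]_2 =>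
  (((enorm w ^+ 2)^-1)%:E * (f \_ (@K R)) (Kpoint w))%E).
  by apply: mf_emul => //; apply: mf_EFin; exact: measurable_K_density.
rewrite [LHS](integral_pushforward_ge0 (@leb2 R) (@measurable_rv2 R) mh); last first.
  by move=> w; rewrite mule_ge0// lee_fin K_density_ge0.
apply: eq_integral => p _; rewrite enorm_rv2 sqr_sqrtr ?nsq_ge0//.
have [->|n0] := eqVneq (nsq p)^-1 0; first by rewrite !mul0e.
by rewrite patchE mem_set//; exact: Kweight_K.
Qed.

Lemma transport_Rstar (f : mR -> \bar R) : measurable_fun setT f ->
  (forall x, 0 <= f x)%E ->
  (\int[@haar_Rstar R]_(x in @Rstar R) f x = \int[L]_t ((`|t|^-1)%R%:E * f t))%E.
Proof.
move=> mf f0; rewrite integral_restrict.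
have mD : measurable (@Rstar R) by apply: measurableC; exact: measurable_set1.
have mg := mpatch mD mf; have g0 := patch_ge0 (@Rstar R) f0.
rewrite [LHS](integral_density (mu := L) (@measurable_Rstar_density R) (@Rstar_density_ge0 R))//.
apply: eq_integral => t _.
have [->|n0] := eqVneq t 0; first by rewrite normr0 invr0 !mul0e.
by rewrite patchE mem_set//; exact/eqP.
Qed.

Lemma transport_G2 (f : affine -> \bar R) : measurable_fun setT f ->
  (forall x, 0 <= f x)%E ->
  (\int[@haar_G2 R]_(x in @G2 R) f x =
   \int[(@leb4 R \x @leb2 R)%E]_z ((Gweight z)%:E * f (Gcoord z)))%E.
Proof.
move=> mf f0; rewrite integral_restrict.
have mg := mpatch measurable_G2 mf; have g0 := patch_ge0 (@G2 R) f0.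
rewrite [LHS](integral_density (mu := @leb_affine R) (@measurable_haar_G2_density R)
  (@haar_G2_density_ge0 R))//.
pose h (x : affine) := ((haar_G2_density x)%:E * (f \_ (@G2 R)) x)%E.
have mh : measurable_fun setT h.
  by apply: mf_emul => //; apply: mf_EFin; exact: measurable_haar_G2_density.
have h0 x : (0 <= h x)%E by rewrite mule_ge0// lee_fin haar_G2_density_ge0.
rewrite -[LHS]/(\int[(@leb_cV R \x @leb_mx R)%E]_x h x)%E.
rewrite (fubini_tonelli2 h mh h0) /fubini_G.
have mh1 := measurable_integrall (@leb_cV R) mh h0.
have h10 (A : 'M[R]_2) : (0 <= \int[@leb_cV R]_x h (x, A))%E by exact: integral_ge0.
rewrite [LHS](integral_pushforward_ge0 (@leb4 R) (@measurable_mx2_of R) mh1 h10).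
have mk : measurable_fun setT (fun z : M4 * R2 => h (Gcoord z)).
  exact: (measurableT_comp mh measurable_Gcoord).
transitivity (\int[(@leb4 R \x @leb2 R)%E]_z h (Gcoord z))%E.
  rewrite (fubini_tonelli1 (fun z => h (Gcoord z)) mk)//; apply: eq_integral => A _.
  have mhA : measurable_fun setT (fun x => h (x, mx2_of A)).
    exact: (measurable_fun_pairr (f := h)).
  by rewrite [LHS](integral_pushforward_ge0 (@leb2 R) (@measurable_cv2 R) mhA).
apply: eq_integral => z _; rewrite /h /haar_G2_density det_mx2_of -/(Gweight z).
have [->|n0] := eqVneq (Gweight z) 0; first by rewrite !mul0e.
by rewrite patchE mem_set//; exact: Gweight_G2.
Qed.

Definition Oweight (p : R2) : R := (nsq p != 0)%:R.
Definition O1weight (t : mR) : R := (t != 0)%:R.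

Lemma measurable_Oweight : measurable_fun setT Oweight.
Proof.
rewrite (_ : Oweight = \1_(@nsq R @^-1` [set~ 0])).
  apply: measurable_indic; rewrite -[X in measurable X]setTI.
  by apply: measurable_nsq => //; apply: measurableC; exact: measurable_set1.
apply/funext => p; rewrite /Oweight indicE; case: eqP => [n0|n0] /=.
  by rewrite memNset//= n0; apply.
by rewrite mem_set.
Qed.

Lemma measurable_O1weight : measurable_fun setT O1weight.
Proof.
rewrite (_ : O1weight = \1_[set~ 0]).
  by apply: measurable_indic; apply: measurableC; exact: measurable_set1.
apply/funext => p; rewrite /O1weight indicE; case: eqP => [->|n0] /=.
  by rewrite memNset//=; apply.
by rewrite mem_set.
Qed.

Lemma measurable_O : measurable (@O R).
Proof.
rewrite (_ : @O R = (fun w : 'rV[R]_2 => w 0 0 ^+ 2 + w 0 1 ^+ 2) @^-1` [set~ 0]).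
  rewrite -[X in measurable X]setTI.
  have m (j : 'I_2) : measurable_fun setT (fun w : 'rV[R]_2 => w 0 j) by exact: measurable_mx_entry.
  have mn : measurable_fun setT (fun w : 'rV[R]_2 => w 0 0 ^+ 2 + w 0 1 ^+ 2) by mfun.
  by apply: mn => //; apply: measurableC; exact: measurable_set1.
apply/seteqP; split => w /=; last by move=> n0 w0; apply: n0; rewrite w0 !mxE expr0n addr0.
by move=> /enorm_sqr_gt0; rewrite enorm_sqr => /lt0r_neq0/eqP.
Qed.

Lemma transport_O (f : 'rV[R]_2 -> \bar R) : measurable_fun setT f ->
  (forall x, 0 <= f x)%E ->
  (\int[@leb_rV R]_(x in @O R) f x =
   \int[@leb2 R]_p ((Oweight p)%:E * f (rv2 p)))%E.
Proof.
move=> mf f0; rewrite integral_restrict.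
have mg := mpatch measurable_O mf; have g0 := patch_ge0 (@O R) f0.
rewrite [LHS](integral_pushforward_ge0 (@leb2 R) (@measurable_rv2 R) mg g0).
apply: eq_integral => p _; rewrite patchE /Oweight; have [n0|n0] := eqVneq (nsq p) 0.
  rewrite mul0e memNset//= => -[]; apply/rowP => j; rewrite !mxE.
  by move/eqP: n0; rewrite nsq_eq0 => /eqP ->; case: (j == 0).
by rewrite mem_set ?mul1e//; exact: rv2_neq0.
Qed.

Lemma transport_O1 (f : mR -> \bar R) : measurable_fun setT f ->
  (forall x, 0 <= f x)%E ->
  (\int[L]_(x in @O1 R) f x = \int[L]_t ((O1weight t)%:E * f t))%E.
Proof.
move=> mf f0; rewrite integral_restrict.
apply: eq_integral => t _; rewrite patchE /O1weight; have [->|n0] := eqVneq t 0.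
  by rewrite mul0e memNset//=; apply.
by rewrite mem_set ?mul1e//; exact/eqP.
Qed.

End group_measures.

(** * Coordinates on the representation space *)

Section joint_representative.
Context d (X : measurableType d) (R : realType).
Local Notation mR := (measurableTypeR R).
Local Notation L := (@lebesgue_measure R).

Let cell (n : nat) (k : int) : set mR :=
  `[k%:~R / n.+1%:R, (k + 1)%:~R / n.+1%:R[%classic.

Let cell_of (x : R) (n : nat) : set mR := cell n (Num.floor (n.+1%:R * x)).

Let mcell n k : measurable (cell n k).
Proof. exact: measurable_itv. Qed.

Let cell_width (n : nat) (k : int) : (k + 1)%:~R / n.+1%:R - k%:~R / n.+1%:R = n.+1%:R^-1 :> R.
Proof. by rewrite -mulrBl rmorphD /= addrC addKr mul1r. Qed.

Let cell_measure n k : L (cell n k) = (n.+1%:R^-1)%:E.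
Proof.
rewrite [LHS]lebesgue_measure_itv /= lte_fin ltr_pM2r ?invr_gt0// ltr_int ltrDl ltr01.
by rewrite -EFinB cell_width.
Qed.

Let mem_cell n (k : int) x : cell n k x <-> Num.floor (n.+1%:R * x) = k.
Proof.
have n0 : 0 < n.+1%:R :> R by [].
split=> [|<-].
  rewrite /cell /= in_itv /= ler_pdivrMr// ltr_pdivlMr// mulrC => ?.
  exact: floor_def.
by rewrite /cell /= in_itv /= ler_pdivrMr// ltr_pdivlMr// mulrC floor_itv.
Qed.

Let itv_dist (a b e x y : R) : a <= x -> x < b -> a <= y -> y < b -> b - a = e -> `|x - y| < e.
Proof. by move=> *; rewrite ltr_norml; apply/andP; split; lra. Qed.

Let bound_le (a b c e N : R) : a <= b + c -> c < e -> e <= 1 -> b + 1 < N -> a <= N.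
Proof. by move=> *; lra. Qed.

Let cell_ball x n y : cell_of x n y -> `|x - y| < n.+1%:R^-1.
Proof.
rewrite /cell_of /cell /= in_itv /= => /andP[y1 y2].
have : cell_of x n x by apply/mem_cell.
rewrite /cell_of /cell /= in_itv /= => /andP[x1 x2].
exact: (itv_dist x1 x2 y1 y2 (cell_width _ _)).
Qed.

(** The cell containing x has length 1/(n + 1) and lies in the ball of that radius around x, whose
    measure is twice as large: hence the constant 2. *)
Let nice x : nicely_shrinking x (cell_of x).
Proof.
split; first by move=> n; exact: mcell.
have e0 n : 0 < n.+1%:R^-1 :> R by rewrite invr_gt0.
exists (2, fun n => PosNum (e0 n)) => /=; split => //.
- exact: cvg_harmonic.
- by move=> n y; exact: cell_ball.
- move=> n; rewrite lebesgue_measure_ball ?invr_ge0//.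
  by rewrite [X in (_ * X)%E](cell_measure n _) -EFinM mulr_natl.
Qed.

Let locally_integrableP (f : mR -> R) : measurable_fun setT f ->
  (forall N : nat, (\int[L]_(x in `[(- N%:R)%R, N%:R]%classic) `|f x|%:E < +oo)%E) ->
  locally_integrable setT f.
Proof.
move=> mf fN; split => //; first exact: openT.
move=> A _ cA.
have mA : measurable (A : set mR) by exact: compact_measurable.
have [M [_ MA]] := compact_bounded cA.
have [N MN] : exists N : nat, M < N%:R.
  by exists (Num.truncn M).+1; exact: truncnS_gt.
apply: le_lt_trans (fN N); apply: ge0_subset_integral => //.
- by apply: mf_EFin; apply: mf_norm; exact: measurable_funTS.
- by move=> x Ax; rewrite /= in_itv /= -ler_norml; exact: (MA N%:R MN).
Qed.

(* The averages of G x over the grid cells of length 1 / (n + 1) are jointly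
   measurable, and converge almost everywhere by Lebesgue differentiation. *)
Lemma joint_representative_real (G : X -> mR -> R) :
  (forall x, measurable_fun setT (G x)) ->
  (forall x (N : nat), (\int[L]_(t in `[(- N%:R)%R, N%:R]%classic) `|G x t|%:E < +oo)%E) ->
  (forall a b : R, measurable_fun setT (fun x => \int[L]_(t in `[a, b[%classic) G x t)) ->
  exists2 g : X * mR -> R, measurable_fun setT g &
    forall x, {ae L, forall t, g (x, t) = G x t}.
Proof.
move=> mG GN mint.
pose a n (k : int) x := n.+1%:R * \int[L]_(t in cell n k) G x t.
pose gn n (z : X * mR) := a n (Num.floor (n.+1%:R * z.2)) z.1.
have ma n k : measurable_fun setT (a n k).
  by apply: mf_mul; [exact: measurable_cst|exact: mint].
(* On each of the countably many cells [gn n] depends on x only, through the measurable average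
   [a n k]. *)
have mgn n : measurable_fun setT (gn n).
  move=> _ B mB; rewrite setTI.
  rewrite (_ : gn n @^-1` B = \bigcup_(k : int) ((a n k @^-1` B) `*` cell n k)).
    apply: countable_bigcupT_measurable => // k; apply: measurableX => //.
    by rewrite -[X in measurable X]setTI; exact: ma.
  apply/seteqP; split => z /=.
    by move=> Bz; exists (Num.floor (n.+1%:R * z.2)) => //; split => //; apply/mem_cell.
  by move=> [k _ [/= Bz /mem_cell zk]]; rewrite /gn zk.
(* The upper limit is measurable and defined everywhere; for each x it differs from the limit of the
   averages only on a null set of t. *)
exists (fun z => fine (limn_esup (fun n => (gn n z)%:E))).
  apply: (measurableT_comp (@fine_measurable R setT measurableT)).
  by apply: measurable_fun_limn_esup => n; exact: mf_EFin.
move=> x; have lG := locally_integrableP (mG x) (GN x).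
have H : {ae L, forall t, lebesgue_pt (G x) t} by exact: (lebesgue_differentiation lG).
apply: (ae_imply2 (mu := L) H H) => t + _ => /(nice_lebesgue_differentiation nice lG).
have fin n : (\int[L]_(y in cell_of t n) (G x y)%:E)%E \is a fin_num.
  have [N tN] : exists N : nat, `|t| + 1 < N%:R.
    by exists (Num.truncn (`|t| + 1)).+1; exact: truncnS_gt.
  have sub : cell_of t n `<=` `[(- N%:R)%R, N%:R]%classic.
    move=> y ty; have : ball t n.+1%:R^-1 y by apply: (cell_ball ty).
    rewrite /ball /= => yt; rewrite in_itv /= -ler_norml.
    have n1 : n.+1%:R^-1 <= 1 :> R by rewrite invf_le1// ler1n.
    have := ler_normB t (t - y); rewrite subKr => ty'; exact: (bound_le ty' yt n1 tN).
  have iG : L.-integrable (`[(- N%:R)%R, N%:R]%classic : set mR) (EFin \o G x).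
    apply/integrableP; split; last exact: GN.
    by apply: mf_EFin; exact: measurable_funTS.
  have mI : measurable (`[(- N%:R)%R, N%:R]%classic : set mR) by exact: measurable_itv.
  apply: integrable_fin_num; first exact: mcell.
  exact: (integrableS mI (mcell _ _) sub iG).
have -> : (fun n => (L (cell_of t n))^-1 * \int[L]_(y in cell_of t n) (G x y)%:E)%E =
   (fun n => (gn n (x, t))%:E).
  apply/funext => n; rewrite cell_measure inver invr_eq0 pnatr_eq0 /= invrK.
  by rewrite /gn /a EFinM /Rintegral fineK// fin.
move=> h; rewrite is_cvg_limn_esupE; last by apply/cvg_ex; eexists; exact: h.
by rewrite (cvg_lim _ h).
Qed.

End joint_representative.

Lemma L2J d (T : measurableType d) (R : realType) (mu : {measure set T -> \bar R})
    (f : T -> R[i]) : L2 mu setT f -> L2 mu setT (fun x => (f x)^*%R).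
Proof.
move=> [mf fL]; split; first exact: cmeasurableJ.
by rewrite /sqnorm; under eq_integral do rewrite csqrJ.
Qed.

(** * Jointly measurable representatives of vectors *)

Section vector_representative.
Context (R : realType).
Local Notation mR := (measurableTypeR R).
Local Notation R2 := (mR * mR)%type.
Local Notation L := (@lebesgue_measure R).
Local Notation affine := ('cV[R]_2 * 'M[R]_2)%type.
Local Notation HR := (@haar_Rstar R).
Local Notation RS := (@Rstar R).
Implicit Types (F : affine -> mR -> R[i]) (phi : R2 * mR -> R[i]) (k : affine).

Definition Rweight (t : mR) : R := `|t|^-1.
Definition weightedR (h : mR -> R[i]) : mR -> R[i] := weighted id Rweight h.

Let mRweight : measurable_fun setT Rweight.
Proof. exact: measurable_Rstar_density. Qed.

Let Rweight_ge0 t : 0 <= Rweight t.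
Proof. by rewrite invr_ge0. Qed.

Let mRS : measurable RS.
Proof. by apply: measurableC; exact: measurable_set1. Qed.

Let Rweight_Rstar t : Rweight t != 0 -> RS t.
Proof. by rewrite invr_eq0 normr_eq0 => /eqP. Qed.

Lemma cmeasurable_weightedR h : cmeasurable RS h -> cmeasurable setT (weightedR h).
Proof. by move=> mh; apply: (cmeasurable_weighted mRS _ mRweight Rweight_Rstar mh); mfun. Qed.

Lemma sqnorm_weightedR h : cmeasurable RS h -> sqnorm HR RS h = sqnorm L setT (weightedR h).
Proof. exact: (sqnorm_weighted mRS Rweight_ge0 Rweight_Rstar (@transport_Rstar R)). Qed.

Lemma L2_weightedR h : L2 HR RS h -> L2 L setT (weightedR h).
Proof. by move=> [mh hL]; split; [exact: cmeasurable_weightedR|rewrite -sqnorm_weightedR]. Qed.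

Lemma inner_weightedR h h' : cmeasurable RS h -> cmeasurable RS h' ->
  inner HR RS h h' = cintegral L setT (fun t => weightedR h t * (weightedR h' t)^*%R).
Proof. exact: (inner_weighted mRS Rweight_ge0 Rweight_Rstar (@transport_Rstar R)). Qed.

(** The identity is required for every p, with an exceptional null set of t that may depend on p, so
    that it can be used at each point of [K]. At p = 0 the factor is 0, which forces the fibre of
    [phi] to vanish almost everywhere. *)
Definition represents F phi : Prop :=
  cmeasurable setT phi /\ forall p, {ae L, forall t,
    phi (p, t) = (Num.sqrt (nsq p)^-1)%:C * weightedR (F (Kcoord p)) t}.

(** The first row of the inverse of [k.2] for k in [K], that is (1,0) L^-1, written as a formula
    that is measurable on the whole ambient space. *)
Definition Kparam k : R2 :=
  (k.2 0 0 / (k.2 0 0 ^+ 2 + k.2 1 0 ^+ 2), k.2 1 0 / (k.2 0 0 ^+ 2 + k.2 1 0 ^+ 2)).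

Lemma measurable_Kparam : measurable_fun setT Kparam.
Proof.
have m (i j : 'I_2) : measurable_fun setT (fun k : affine => k.2 i j).
  exact: (measurableT_comp (measurable_mx_entry i j) measurable_snd).
by rewrite /Kparam; mfun; exact: m.
Qed.

Lemma KparamK k : K k -> Kcoord (Kparam k) = k.
Proof.
case: k => x M [/= -> [s [t [st ->]]]]; rewrite /Kcoord /Kpoint /Kparam !mxE /=.
have n0 : s ^+ 2 + t ^+ 2 != 0 by rewrite gt_eqF.
congr (_, _); rewrite /gamma enorm_rv2 sqr_sqrtr ?nsq_ge0// /nsq.
apply/matrixP => i j; rewrite !mxE.
by have [->|->] := ord2 i; have [->|->] := ord2 j; rewrite /=; field.
Qed.

Lemma KcoordP (p : R2) : (K (Kcoord p) : Prop) <-> nsq p != 0.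
Proof.
split=> [[_ [s [t [st]]]]|n0]; last by apply: Kweight_K; rewrite invr_eq0.
rewrite /Kcoord /= /gamma enorm_rv2 sqr_sqrtr ?nsq_ge0// => /matrixP g.
apply/eqP => n0; have := g 0 0; have := g 1 0; rewrite !mxE /= n0 invr0 !mul0r => t0 s0.
by move: st; rewrite -t0 -s0 expr0n addr0 ltxx.
Qed.

Lemma nsq_Kparam k : K k -> nsq (Kparam k) != 0.
Proof. by move=> Kk; apply/KcoordP; rewrite KparamK. Qed.

Let sqrtVK (a : R) : 0 < a -> Num.sqrt a * Num.sqrt a^-1 = 1.
Proof. by move=> a0; rewrite -sqrtrM ?ltW// divff ?sqrtr1// gt_eqF. Qed.

Section represented.
Variables (F : affine -> mR -> R[i]) (phi : R2 * mR -> R[i]).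
Hypotheses (FL : forall k, K k -> L2 HR RS (F k)) (rep : represents F phi).

Lemma representsE k : K k -> {ae L, forall t,
  weightedR (F k) t = (Num.sqrt (nsq (Kparam k)))%:C * phi (Kparam k, t)}.
Proof.
move=> Kk; have [_ /(_ (Kparam k))] := rep; rewrite KparamK//.
apply: filterS => t ->; rewrite mulrA -rmorphM /= sqrtVK ?mul1r//.
by rewrite lt_neqAle eq_sym nsq_Kparam//= nsq_ge0.
Qed.

Lemma sqnorm_represents k : K k ->
  sqnorm HR RS (F k) = ((nsq (Kparam k))%:E * sqnorm L setT (fun t => phi (Kparam k, t)))%E.
Proof.
move=> Kk; have [mF _] := FL Kk; have [mphi _] := rep.
have mp : cmeasurable setT (fun t => phi (Kparam k, t)) by exact: cmeasurable_pairl.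
rewrite sqnorm_weightedR// (ae_eq_sqnorm _ _ (representsE Kk)).
- by rewrite sqnormZ// csqr_real sqr_sqrtr ?nsq_ge0.
- exact: cmeasurable_weightedR.
- by apply: cmeasurableM => //; exact: cmeasurable_cst.
Qed.

Lemma sqnorm_represents_fiber p : (sqnorm L setT (fun t => phi (p, t)) < +oo)%E.
Proof.
have [mphi /(_ p) rp] := rep.
have mp : cmeasurable setT (fun t => phi (p, t)) by exact: cmeasurable_pairl.
have [n0|n0] := eqVneq (nsq p) 0.
  rewrite (_ : sqnorm _ _ _ = sqnorm L setT (fun=> 0 : R[i])).
    by have [] := L20 L.
  apply: ae_eq_sqnorm => //.
  by apply: filterS rp => t ->; rewrite n0 invr0 sqrtr0 mul0r.
have Kp : K (Kcoord p) by exact/KcoordP.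
have LF := L2_weightedR (FL Kp); have [mF _] := LF.
rewrite (ae_eq_sqnorm mp _ rp); last by apply: cmeasurableM => //; exact: cmeasurable_cst.
by have [] := L2Z (Num.sqrt (nsq p)^-1)%:C LF.
Qed.

Let mK := @measurable_K R.

Lemma measurable_sqnorm_represents : measurable_fun (@K R) (fun k => sqnorm HR RS (F k)).
Proof.
have [mphi _] := rep.
apply: (eq_measurable_fun (fun k => ((nsq (Kparam k))%:E * sqnorm L setT (fun t => phi (Kparam k,
  t)))%E)).
  by move=> k /set_mem Kk; rewrite sqnorm_represents.
apply: measurable_funTS; have mk := measurable_Kparam; apply: mf_emul.
  by apply: mf_EFin; rewrite /nsq; mfun.
by apply: (mf_comp (measurable_sqnormr L mphi)).
Qed.

Lemma vsqnorm_represents : vsqnorm (@haar_K R) (@K R) HR RS F = sqnorm (@leb3 R) setT phi.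
Proof.
have [mphi repp] := rep.
rewrite /vsqnorm (transportD mK (fun p w =>
  Kweight_K w) (@transport_K R) measurable_sqnorm_represents); last first.
  by move=> k _; exact: sqnorm_ge0.
rewrite (sqnorm_prod1 (@leb2 R) L mphi); apply: eq_integral => p _.
have mp : cmeasurable setT (fun t => phi (p, t)) by exact: cmeasurable_pairl.
have [n0|n0] := eqVneq (nsq p) 0.
  rewrite n0 invr0 mul0e; symmetry.
  rewrite (_ : sqnorm _ _ _ = sqnorm L setT (fun=> 0 : R[i])).
    by rewrite /sqnorm; under eq_integral do rewrite csqr0; rewrite integral0.
  apply: ae_eq_sqnorm => //.
  by apply: filterS (repp p) => t ->; rewrite n0 invr0 sqrtr0 mul0r.
have [mF _] := FL (proj2 (KcoordP p) n0).
have mwF := cmeasurable_weightedR mF.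
rewrite sqnorm_weightedR// (ae_eq_sqnorm mp _ (repp p)); last first.
  by apply: cmeasurableM => //; exact: cmeasurable_cst.
by rewrite sqnormZ// csqr_real sqr_sqrtr ?invr_ge0 ?nsq_ge0.
Qed.

Lemma inner_represents k h : K k -> L2 HR RS h ->
  inner HR RS (F k) h = (Num.sqrt (nsq (Kparam k)))%:C *
    cintegral L setT (fun t => phi (Kparam k, t) * (weightedR h t)^*%R).
Proof.
move=> Kk Lh; have [mh _] := Lh; have [mF _] := FL Kk; have [mphi _] := rep.
have mp : cmeasurable setT (fun t => phi (Kparam k, t)) by exact: cmeasurable_pairl.
have mwh := cmeasurable_weightedR mh; have mwF := cmeasurable_weightedR mF.
rewrite inner_weightedR// -cintZ; last first.
  by apply: cintegrableM_L2; [split => //; exact: sqnorm_represents_fiber|exact/L2J/L2_weightedR].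
apply: ae_eq_cint.
- by mfun.
- by mfun.
- by apply: filterS (representsE Kk) => t ->; rewrite mulrA.
Qed.

(** Coefficients of a vector with a jointly measurable representative are integrals depending on a
    parameter, hence measurable; this gives the weak measurability demanded by [vL2]. *)
Lemma L2K_represents : (sqnorm (@leb3 R) setT phi < +oo)%E -> L2K F.
Proof.
move=> phiL; have [mphi _] := rep; split => //; last by rewrite vsqnorm_represents.
move=> h Lh; have [mh _] := Lh; have mwh := cmeasurable_weightedR mh.
apply: (eq_cmeasurable (f := fun k => (Num.sqrt (nsq (Kparam k)))%:C *
    cintegral L setT (fun t => phi (Kparam k, t) * (weightedR h t)^*%R))).
  by move=> k /set_mem Kk; rewrite inner_represents.
apply: (cmeasurableS measurableT) => //; have mk := measurable_Kparam.
apply: cmeasurableM; first by rewrite /nsq; mfun.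
apply: (cmeasurable_comp (f := fun p => cintegral L setT (fun t => phi (p,
  t) * (weightedR h t)^*%R))) => //.
by apply: (cmeasurable_cintr L (f := fun z => phi z * (weightedR h z.2)^*%R)); mfun.
Qed.

End represented.

Section represented2.
Variables (F F' : affine -> mR -> R[i]) (phi phi' : R2 * mR -> R[i]).
Hypotheses (FL : forall k, K k -> L2 HR RS (F k)) (rep : represents F phi).
Hypotheses (FL' : forall k, K k -> L2 HR RS (F' k)) (rep' : represents F' phi').

Let fiber_int p : cintegrable L (fun t => phi (p, t) * (phi' (p, t))^*%R).
Proof.
have [mphi _] := rep; have [mphi' _] := rep'.
apply: cintegrableM_L2; last apply: L2J; split; try exact: cmeasurable_pairl.
  exact: sqnorm_represents_fiber FL rep _.
exact: sqnorm_represents_fiber FL' rep' _.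
Qed.

Let inner_represents2 k : K k ->
  inner HR RS (F k) (F' k) = (nsq (Kparam k))%:C *
    cintegral L setT (fun t => phi (Kparam k, t) * (phi' (Kparam k, t))^*%R).
Proof.
move=> Kk; have LF' := FL' Kk; have [mphi _] := rep; have [mphi' _] := rep'.
have mp : cmeasurable setT (fun t => phi (Kparam k, t)) by exact: cmeasurable_pairl.
have mp' : cmeasurable setT (fun t => phi' (Kparam k, t)) by exact: cmeasurable_pairl.
have [mF _] := FL Kk; have [mF' _] := LF'.
have mwF := cmeasurable_weightedR mF; have mwF' := cmeasurable_weightedR mF'.
rewrite inner_weightedR// -cintZ//; apply: ae_eq_cint.
- by mfun.
- by mfun.
- apply: filterS2 (representsE rep Kk) (representsE rep' Kk) => t -> ->.
  rewrite conjM (_ : (Num.sqrt _)%:C^*%R = (Num.sqrt (nsq (Kparam k)))%:C); last first.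
    by apply: complexP; rewrite ?ReJ ?ImJ //= oppr0.
  by rewrite mulrACA -rmorphM /= -expr2 sqr_sqrtr ?nsq_ge0.
Qed.

Lemma vinner_represents : vinner (@haar_K R) (@K R) HR RS F F' =
  cintegral (@leb2 R) setT (fun p => cintegral L setT (fun t => phi (p, t) * (phi' (p, t))^*%R)).
Proof.
have [mphi repp] := rep; have [mphi' repp'] := rep'; have mk := measurable_Kparam.
have mci : cmeasurable setT (fun p => cintegral L setT (fun t => phi (p, t) * (phi' (p, t))^*%R)).
  by apply: (cmeasurable_cintr L (f := fun z => phi z * (phi' z)^*%R)); mfun.
have mJ : cmeasurable (@K R) (fun k => inner HR RS (F k) (F' k)).
  apply: (eq_cmeasurable (f := fun k => (nsq (Kparam k))%:C *
    cintegral L setT (fun t => phi (Kparam k, t) * (phi' (Kparam k, t))^*%R))).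
    by move=> k /set_mem Kk; rewrite inner_represents2.
  apply: (cmeasurableS measurableT) => //.
  by apply: cmeasurableM; [rewrite /nsq; mfun|apply: (cmeasurable_comp mci)].
have w0 (p : R2) : 0 <= (nsq p)^-1 by rewrite invr_ge0 nsq_ge0.
rewrite /vinner (cintegral_param (@measurable_K R) w0 (fun p w => Kweight_K w) (@transport_K R) mJ).
apply: eq_cint => p; have [n0|n0] := eqVneq (nsq p) 0.
  rewrite n0 invr0 mul0r -[LHS](_ : cintegral L setT (fun=> 0) = 0); last first.
    by apply: complexP => /=; rewrite /Rintegral integral0.
  apply: ae_eq_cint.
  - exact: cmeasurable_cst.
  - apply: cmeasurableM; [|apply: cmeasurableJ]; exact: cmeasurable_pairl.
  - by apply: filterS (repp p) => t ->; rewrite n0 invr0 sqrtr0 !mul0r.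
have Kp := proj2 (KcoordP p) n0.
have KK : Kparam (Kcoord p) = p.
  case: p n0 {Kp} => a b n0; rewrite /Kparam /= !mxE /= enorm_rv2 sqr_sqrtr ?nsq_ge0//.
  by move: n0; rewrite /nsq /= => n0; congr (_, _); field; rewrite n0.
by rewrite inner_represents2// KK mulrA -rmorphM /= mulVf// mul1r.
Qed.

End represented2.

(** Weak measurability gives, for each interval, a measurable integral of the fibre over it as a
    function of p. This is what [joint_representative_real] needs to build a jointly measurable
    version of the real and imaginary parts. *)
Lemma representable F : L2K F -> exists phi, represents F phi.
Proof.
move=> [FL Fm Foo].
(* [F] is controlled only over [K] and [RS], so the fibre is set to 0 at p = 0 and at t = 0. *)
pose Gc (p : R2) (t : mR) : R[i] := if nsq p == 0 then 0 else
   if t \in RS then weightedR (F (Kcoord p)) t else 0.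
have mGc p : cmeasurable setT (Gc p).
  rewrite /Gc; case: eqP => n0; first exact: cmeasurable_cst.
  apply: cmeasurable_restrict => //.
  have [mF _] := FL _ (proj2 (KcoordP p) (introN eqP n0)).
  by apply: (cmeasurableS measurableT) => //; exact: cmeasurable_weightedR.
have GcE p t : nsq p != 0 -> Gc p t = weightedR (F (Kcoord p)) t.
  move=> n0; rewrite /Gc (negbTE n0); case: ifP => // /negP tR.
  rewrite /weightedR /weighted /Rweight (_ : t = 0) ?normr0 ?invr0 ?sqrtr0 ?mul0r//.
  by apply/eqP; apply/negPn/negP => t0; apply: tR; rewrite inE; exact/eqP.
have LGc p : (sqnorm L setT (Gc p) < +oo)%E.
  have [n0|n0] := eqVneq (nsq p) 0.
    by rewrite /Gc n0 eqxx; have [] := L20 L.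
  have [mF ?] := FL _ (proj2 (KcoordP p) n0).
  rewrite /sqnorm; under eq_integral do rewrite GcE//.
  by rewrite -[X in (X < _)%E]sqnorm_weightedR.
have mcoef (a b : R) : cmeasurable setT (fun p => cintegral L setT (fun t =>
  Gc p t * cindic (`[a, b[%classic : set mR) t)).
  (* The factor |t|^(1/2) cancels the square root of the Haar density: off t = 0 the function [h]
     becomes the indicator of [a, b[ in coordinates. *)
  pose h (t : mR) : R[i] := (Num.sqrt `|t|)%:C * cindic (`[a, b[%classic : set mR) t.
  have mI : measurable (`[a, b[%classic : set mR) by exact: measurable_itv.
  have mcI := @cmeasurable_cindic _ _ R _ mI.
  have mh : cmeasurable RS h.
    by apply: (cmeasurableS measurableT) => //; rewrite /h; mfun.
  have whE t : t != 0 -> weightedR h t = cindic (`[a, b[%classic : set mR) t.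
    move=> t0; rewrite /weightedR /weighted /h /Rweight mulrA -rmorphM /= [X in X%:C * _]mulrC
      sqrtVK ?mul1r//.
    by rewrite normr_gt0.
  have Lh : L2 HR RS h.
    split=> //; rewrite sqnorm_weightedR//.
    rewrite (@ae_eq_sqnorm _ _ _ L _ (cindic (`[a, b[%classic : set mR))).
    - rewrite sqnorm_cindic// [X in (X < _)%E]lebesgue_measure_itv /=.
      by case: ifP; rewrite ?ltry// -EFinB ltry.
    - exact: cmeasurable_weightedR.
    - by [].
    - by apply: filterS (ae_neq0 R) => t; exact: whE.
  have mJ := cmeasurable_restrict (@measurable_K R) (Fm h Lh).
  have := cmeasurable_comp mJ (@measurable_Kcoord R); apply: eq_cmeasurable => p _.
  have [n0|n0] := eqVneq (nsq p) 0.
    rewrite memNset; last by move/KcoordP; rewrite n0 eqxx.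
    transitivity (cintegral L setT (fun _ : mR => 0 : R[i])).
      by apply: complexP => /=; rewrite /Rintegral integral0.
    by apply: eq_cint => t; rewrite /Gc n0 eqxx mul0r.
  rewrite mem_set; last exact/KcoordP.
  have [mF _] := FL _ (proj2 (KcoordP p) n0).
  have mwF := cmeasurable_weightedR mF; have mwh := cmeasurable_weightedR mh.
  rewrite inner_weightedR//; apply: ae_eq_cint.
  - by mfun.
  - by have := mGc p => ?; mfun.
  - apply: filterS (ae_neq0 R) => t t0; rewrite GcE// whE//; congr (_ * _).
    by apply: complexP; rewrite ?ReJ ?ImJ //= oppr0.
(* Local integrability from |r| <= 1 + r^2, the interval having finite measure and the fibre being
   in L^2. *)
have ibound p (r : R[i] -> R) (N : nat) : (forall z, r z ^+ 2 <= csqr z) ->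
    measurable_fun setT (fun t => r (Gc p t)) ->
    (\int[L]_(t in `[(- N%:R)%R, N%:R]%classic) `|r (Gc p t)|%:E < +oo)%E.
  move=> rle mr; have mI : measurable (`[- N%:R, N%:R]%classic : set mR) by exact: measurable_itv.
  apply: (@le_lt_trans _ _ (L `[(- N%:R)%R, N%:R]%classic + sqnorm L setT (Gc p))%E); last first.
    apply: lte_add_pinfty (LGc p).
    by rewrite [X in (X < _)%E]lebesgue_measure_itv /=; case: ifP; rewrite ?ltry// -EFinB ltry.
  rewrite -[X in (_ <= X + _)%E](_ : (\int[L]_t (\1_`[(- N%:R)%R, N%:R]%classic t :
    R)%:E)%E = _); last first.
    by rewrite integral_indic// setIT.
  rewrite /sqnorm -integralDT.
  - rewrite [X in (X <= _)%E]integral_mkcond; apply: le_integralT.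
    + apply/(measurable_restrictT _ mI); apply: measurable_funTS.
      by apply: mf_EFin; exact: mf_norm.
    + by apply: mf_eadd; [apply: mf_EFin; exact: measurable_indic|exact: measurable_csqrE].
    + by move=> t; rewrite patchE; case: ifP => // _; rewrite lee_fin.
    + move=> t; rewrite patchE indicE; case: ifP => _; rewrite -EFinD lee_fin; last first.
        by rewrite addr_ge0 ?csqr_ge0.
      apply: le_trans (lerD (lexx _) (rle _)); rewrite -[r _ ^+ 2]real_normK ?num_real//.
      by rewrite [true%:R](_ : _ = 1)//; have := sqr_ge0 (`|r (Gc p t)| - 1); have :=
        normr_ge0 (r (Gc p t)); nra.
  - by apply: mf_EFin; exact: measurable_indic.
  - exact: measurable_csqrE.
  - by move=> t; rewrite lee_fin.
  - by move=> t; rewrite lee_fin csqr_ge0.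
have [g1 mg1 g1E] : exists2 g : R2 * mR -> R, measurable_fun setT g &
    forall p, {ae L, forall t, g (p, t) = Re (Gc p t)}.
  apply: (joint_representative_real (G := fun p t => Re (Gc p t))).
  - by move=> p; have [] := mGc p.
  - move=> p N; apply: ibound => [z|]; [by rewrite lerDl sqr_ge0|by have [] := mGc p].
  - move=> a b; have [m1 _] := mcoef a b; move: m1; congr (measurable_fun _ _).
    apply/funext => p /=; rewrite [RHS]Rintegral_mkcond; apply: eq_Rintegral => t _.
    rewrite patchE ReM /= mulr0 subr0 indicE.
    by case: (t \in _); rewrite ?mulr1 ?mulr0.
have [g2 mg2 g2E] : exists2 g : R2 * mR -> R, measurable_fun setT g &
    forall p, {ae L, forall t, g (p, t) = Im (Gc p t)}.
  apply: (joint_representative_real (G := fun p t => Im (Gc p t))).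
  - by move=> p; have [] := mGc p.
  - move=> p N; apply: ibound => [z|]; [by rewrite lerDr sqr_ge0|by have [] := mGc p].
  - move=> a b; have [_ m1] := mcoef a b; move: m1; congr (measurable_fun _ _).
    apply/funext => p /=; rewrite [RHS]Rintegral_mkcond; apply: eq_Rintegral => t _.
    rewrite patchE ImM /= mulr0 add0r indicE.
    by case: (t \in _); rewrite ?mulr1 ?mulr0.
exists (fun z => (Num.sqrt (nsq z.1)^-1)%:C * (g1 z +i* g2 z)); split.
  apply: cmeasurableM; last by split.
  by rewrite /nsq; mfun.
move=> p; apply: filterS2 (g1E p) (g2E p) => t /= -> ->.
have [n0|n0] := eqVneq (nsq p) 0; first by rewrite n0 invr0 sqrtr0 !mul0r.
by rewrite GcE//; congr (_ * _); exact: complexP.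
Qed.

End vector_representative.

(** * The representation in coordinates *)

Section sigma_coordinates.
Context (R : realType).
Local Notation mR := (measurableTypeR R).
Local Notation R2 := (mR * mR)%type.
Local Notation M4 := ((mR * mR) * (mR * mR))%type.
Local Notation L := (@lebesgue_measure R).
Local Notation affine := ('cV[R]_2 * 'M[R]_2)%type.
Local Notation HR := (@haar_Rstar R).
Local Notation RS := (@Rstar R).
Implicit Types (p x : R2) (A : M4).

Definition Gparam (g : affine) : M4 * R2 :=
  (((g.2 0 0, g.2 0 1), (g.2 1 0, g.2 1 1)), (g.1 0 0, g.1 1 0)).

Lemma GparamK g : Gcoord (Gparam g) = g.
Proof.
case: g => x A; rewrite /Gcoord /Gparam /=; congr (_, _).
  by apply/colP => i; rewrite mxE; have [->|->] := ord2 i.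
by apply/matrixP => i j; rewrite !mxE; have [->|->] := ord2 i; have [->|->] := ord2 j.
Qed.

Lemma measurable_Gparam : measurable_fun setT Gparam.
Proof.
have m1 (i : 'I_2) : measurable_fun setT (fun k : affine => k.1 i 0).
  exact: (measurableT_comp (measurable_mx_entry i 0) measurable_fst).
have m2 (i j : 'I_2) : measurable_fun setT (fun k : affine => k.2 i j).
  exact: (measurableT_comp (measurable_mx_entry i j) measurable_snd).
by rewrite /Gparam; apply: mf_pair; [apply: mf_pair; apply: mf_pair; exact: m2|apply: mf_pair;
  exact: m1].
Qed.

Lemma rv2_mulmx p A : rv2 p *m mx2_of A = rv2 (rowmul p A).
Proof.
apply/rowP => j; rewrite !mxE !big_ord_recl big_ord0 !mxE /= addr0.
by have [->|->] := ord2 j.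
Qed.

Lemma rv2_mulcv p x : (rv2 p *m cv2 x) 0 0 = dot p x.
Proof. by rewrite !mxE !big_ord_recl big_ord0 !mxE /= addr0. Qed.

Lemma rowmul_neq0 p A : nsq p != 0 -> det4 A != 0 -> nsq (rowmul p A) != 0.
Proof.
rewrite !nsq_eq0 => p0 d0; apply: contra p0 => /eqP[e1 e2].
have h1 : p.1 * det4 A = 0.
  by rewrite (_ : _ * _ = A.2.2 * 0 - A.2.1 * 0); [ring|rewrite -{1}e1 -e2 /det4; ring].
have h2 : p.2 * det4 A = 0.
  by rewrite (_ : _ * _ = A.1.1 * 0 - A.1.2 * 0); [ring|rewrite -{1}e2 -e1 /det4; ring].
move/eqP: h1; move/eqP: h2; rewrite !mulf_eq0 (negbTE d0) !orbF.
by case: (p) => a b /= /eqP -> /eqP ->.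
Qed.

Lemma vcoord_neq0 p A : nsq p != 0 -> det4 A != 0 -> vcoord p A != 0.
Proof.
move=> p0 d0; rewrite vcoordE !mulf_neq0// invr_eq0; exact: rowmul_neq0.
Qed.

Lemma invmx_gamma p : nsq p != 0 -> invmx (gamma (rv2 p)) = mx2 p.1 p.2 (- p.2) p.1.
Proof.
move=> n0; have u := gamma_unitmx (rv2_neq0 n0).
rewrite -[RHS](mulKmx u); have -> : gamma (rv2 p) *m mx2 p.1 p.2 (- p.2) p.1 = 1%:M.
  rewrite /gamma enorm_rv2 sqr_sqrtr ?nsq_ge0// -scalemxAl.
  apply/matrixP => i j; rewrite !mxE !big_ord_recl big_ord0 !mxE /=.
  by move: n0; rewrite /nsq => n0;
    have [->|->] := ord2 i; have [->|->] := ord2 j; rewrite /=; field.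
by rewrite mulmx1.
Qed.

Lemma row10_Kcoord p : nsq p != 0 -> row10 R *m invmx (Kcoord p).2 = rv2 p.
Proof. by move=> n0; rewrite gammaK//; exact: rv2_neq0. Qed.

Let lower_factor_entry p A j : nsq p != 0 -> lower_factor (rv2 p) (mx2_of A) 1 j =
  (rowmul (perp p) A).1 * gamma (rv2 (rowmul p A)) 0 j +
  (rowmul (perp p) A).2 * gamma (rv2 (rowmul p A)) 1 j.
Proof.
move=> n0; rewrite /lower_factor rv2_mulmx invmx_gamma//.
rewrite !mxE !big_ord_recl big_ord0 !mxE !big_ord_recl !big_ord0 !mxE /= !addr0.
by [].
Qed.

Lemma u_coord p A : nsq p != 0 -> u_ (rv2 p) (mx2_of A) = ucoord p A.
Proof.
move=> n0; rewrite /u_ lower_factor_entry// /gamma enorm_rv2 sqr_sqrtr ?nsq_ge0//.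
by rewrite !mxE /ucoord /dot; move: (nsq _)^-1 => r /=; ring.
Qed.

Lemma v_coord p A : nsq p != 0 -> v_ (rv2 p) (mx2_of A) = vcoord p A.
Proof.
move=> n0; rewrite /v_ lower_factor_entry// /gamma enorm_rv2 sqr_sqrtr ?nsq_ge0//.
by rewrite !mxE /vcoord /dot; move: (nsq _)^-1 => r /=; ring.
Qed.

Lemma sigma_coord A x F p t : nsq p != 0 ->
  sigma (Gcoord (A, x)) F (Kcoord p) t =
  (Num.sqrt `|det4 A| * Num.sqrt (nsq p) / Num.sqrt (nsq (rowmul p A)))%:C *
  expi (2 * pi * (dot p x + t^-1 * ucoord p A)) *
  F (Kcoord (rowmul p A)) ((vcoord p A)^-1 * t).
Proof.
move=> n0; rewrite /sigma /Gcoord /= row10_Kcoord// rv2_mulmx rv2_mulcv !enorm_rv2.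
by rewrite det_mx2_of u_coord// v_coord.
Qed.

Lemma coherent_coord eta g p t : nsq p != 0 ->
  coherent_vector eta g (Kcoord p) t = (eta (rv2 p))^*%R * (nsq p)%:C * g t :> R[i].
Proof.
move=> n0; rewrite /coherent_vector row10_Kcoord//; congr (_ * _ * _).
have -> : \det (Kcoord p).2 = (nsq p)^-1.
  rewrite /Kcoord /Kpoint /= det_mx2 /gamma enorm_rv2 sqr_sqrtr ?nsq_ge0// !mxE /=.
  by move: n0; rewrite /nsq => n0; field.
rewrite ger0_norm ?invr_ge0 ?nsq_ge0//.
by rewrite -[X in X^-1]/(real_complex R _) -fmorphV /= invrK.
Qed.

(** Dilations preserve null sets: the indicator of the exceptional set still has integral 0 after
    the substitution. *)
Lemma ae_scale (c : R) (P : mR -> Prop) : c != 0 ->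
  {ae L, forall t, P t} -> {ae L, forall t, P (c * t)}.
Proof.
move=> c0 [N [mN N0 PN]].
have mi : measurable_fun setT (fun t : mR => (\1_N t : R)%:E).
  by apply: mf_EFin; exact: measurable_indic.
have i0 (t : mR) : (0 <= (\1_N t : R)%:E)%E by rewrite lee_fin.
have h := integral_affine 0 c0 mi i0.
have iN : (\int[L]_t (\1_N t : R)%:E = 0)%E by rewrite integral_indic// setIT.
rewrite iN in h.
have mk : measurable_fun setT (fun t : mR => `|c|%:E * (\1_N (c * t + 0)%R : R)%:E)%E.
  by apply: mf_emul; [exact: measurable_cst|apply: (mf_comp mi); mfun].
have k0 (t : mR) : (0 <= `|c|%:E * (\1_N (c * t + 0)%R : R)%:E)%E by rewrite mule_ge0// lee_fin.
have k := integral_eq0_ae mk k0 h.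
apply: (ae_imply2 (mu := L) k k) => t + _; rewrite addr0 indicE -EFinM => -[] /eqP.
rewrite mulf_eq0 normr_eq0 (negbTE c0) /= pnatr_eq0 eqb0 => /negP tN.
by apply: contrapT => nP; apply: tN; rewrite inE; exact: PN.
Qed.

(** The representation acting on coordinates. The norms |p| and |p A| in [sigma] cancel against the
    weights |p|^-1 and |p A|^-1 of the representatives, and the weight |t|^(-1/2) leaves
    |v|^(-1/2). *)
Definition sigmaS (z : M4 * R2) (phi : R2 * mR -> R[i]) (y : R2 * mR) : R[i] :=
  (Num.sqrt `|det4 z.1| * Num.sqrt `|vcoord y.1 z.1|^-1)%:C *
  expi (2 * pi * (dot y.1 z.2 + y.2^-1 * ucoord y.1 z.1)) *
  phi (rowmul y.1 z.1, (vcoord y.1 z.1)^-1 * y.2).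

Lemma measurable_sigmaS z phi : cmeasurable setT phi -> cmeasurable setT (sigmaS z phi).
Proof.
move=> mphi.
have mr : measurable_fun setT (fun y : R2 * mR => rowmul y.1 z.1) by rewrite /rowmul; mfun.
have mr' : measurable_fun setT (fun y : R2 * mR => rowmul (perp y.1) z.1).
  by rewrite /rowmul /perp /=; mfun.
have mv : measurable_fun setT (fun y : R2 * mR => vcoord y.1 z.1).
  by rewrite /vcoord /dot /nsq /perp /=; mfun.
have mu : measurable_fun setT (fun y : R2 * mR => ucoord y.1 z.1).
  by rewrite /ucoord /dot /nsq /=; mfun.
by rewrite /sigmaS /dot; mfun.
Qed.

Lemma vcoord0 p A : nsq p = 0 -> vcoord p A = 0.
Proof. by move=> p0; rewrite vcoordE p0 !mul0r. Qed.

Lemma represents_sigma F phi A x : det4 A != 0 -> represents F phi ->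
  represents (sigma (Gcoord (A, x)) F) (sigmaS (A, x) phi).
Proof.
move=> d0 [mphi rep]; split; first exact: measurable_sigmaS.
move=> p; have [n0|n0] := eqVneq (nsq p) 0.
  apply: aeW => t; rewrite /sigmaS /= vcoord0// normr0 n0 !invr0 sqrtr0 mulr0.
  by rewrite !mul0r.
have v0 := vcoord_neq0 n0 d0; have w0 := rowmul_neq0 n0 d0.
have sc := ae_scale (P := fun t => phi (rowmul p A, t) = (Num.sqrt (nsq (rowmul p A))^-1)%:C *
    weightedR (F (Kcoord (rowmul p A))) t) (invr_neq0 v0) (rep (rowmul p A)).
apply: (ae_imply2 (mu := L) sc sc) => t + _.
rewrite /sigmaS /= => ->; rewrite /weightedR /weighted /Rweight sigma_coord//.
set f := F _ _; set e := expi _.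
have vp : 0 < `|vcoord p A| by rewrite normr_gt0.
have np : 0 < nsq p by rewrite lt_neqAle eq_sym n0 nsq_ge0.
have wp : 0 < nsq (rowmul p A) by rewrite lt_neqAle eq_sym w0 nsq_ge0.
have -> : Num.sqrt `|(vcoord p A)^-1 * t|^-1 = Num.sqrt `|vcoord p A| * Num.sqrt `|t|^-1.
  by rewrite normrM normfV invfM invrK sqrtrM// ltW.
rewrite !sqrtrV// ?ltW//.
have s1 : Num.sqrt `|vcoord p A| != 0 by rewrite gt_eqF// sqrtr_gt0.
have s2 : Num.sqrt (nsq p) != 0 by rewrite gt_eqF// sqrtr_gt0.
have s3 : Num.sqrt (nsq (rowmul p A)) != 0 by rewrite gt_eqF// sqrtr_gt0.
move: (Num.sqrt _) s1 (Num.sqrt (nsq p)) s2 (Num.sqrt (nsq (rowmul p A))) s3 =>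
  sv sv0 sp sp0 sw sw0.
move: (Num.sqrt `|det4 A|) => sd; move: (Num.sqrt `|t|)^-1 => st.
rewrite (_ : sd * sp / sw = (sd / sw) * sp); last by ring.
rewrite (_ : (sd / sv)%:C * e * (sw^-1%:C * ((sv * st)%:C * f)) =
   ((sd / sv) * sw^-1 * (sv * st))%:C * (e * f)); last by rewrite !rmorphM /=; ring.
rewrite [RHS](_ : _ = (sp^-1 * st * (sd / sw * sp))%:C * (e * f)); last by rewrite !rmorphM /=;
  ring.
by congr (_%:C * _); field; rewrite sv0 sw0 sp0.
Qed.

Section unitarity.
Variable z : M4 * R2.
Hypothesis d0 : det4 z.1 != 0.

Let transport_scale (v : R) (f : mR -> \bar R) : v != 0 -> measurable_fun setT f ->
  (forall t, 0 <= f t)%E -> (\int[L]_t ((`|v|^-1)%R%:E * f (v^-1 * t)%R) = \int[L]_t f t)%E.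
Proof.
move=> v0 mf f0; rewrite -[RHS](integral_affine 0 (invr_neq0 v0) mf f0).
by apply: eq_integral => t _; rewrite addr0 normfV.
Qed.

Lemma transport_rowmul (f : R2 -> \bar R) : measurable_fun setT f ->
  (forall p, 0 <= f p)%E ->
  (\int[@leb2 R]_p (`|det4 z.1|%:E * f (rowmul p z.1)) = \int[@leb2 R]_p f p)%E.
Proof.
move=> mf f0.
have dE : z.1.1.1 * z.1.2.2 - z.1.2.1 * z.1.1.2 = det4 z.1 by rewrite /det4; ring.
rewrite -[RHS](integral_linear2 (a := z.1.1.1) (b := z.1.2.1) (c := z.1.1.2) (d :=
  z.1.2.2) _ mf f0) dE//.
apply: eq_integral => p _; congr (_ * f _)%E.
by rewrite /rowmul; congr (_, _); rewrite (mulrC p.1) (mulrC p.2).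
Qed.

Lemma sqnorm_sigmaS_fiber phi p : cmeasurable setT phi -> nsq p != 0 ->
  sqnorm L setT (fun t => sigmaS z phi (p, t)) =
  (`|det4 z.1|%:E * sqnorm L setT (fun t => phi (rowmul p z.1, t)))%E.
Proof.
move=> mphi n0; have v0 := vcoord_neq0 n0 d0.
have mp : cmeasurable setT (fun t => phi (rowmul p z.1, t)) by exact: cmeasurable_pairl.
have mq := measurable_csqrE mp.
have q0 t : (0 <= (csqr (phi (rowmul p z.1, t)))%:E)%E by rewrite lee_fin csqr_ge0.
rewrite /sqnorm -(transport_scale v0 mq q0) -integralZT//; last 2 first.
- by mfun.
- by move=> t; rewrite mule_ge0// lee_fin invr_ge0.
apply: eq_integral => t _; rewrite /sigmaS /= !csqrM csqr_expi mulr1 csqr_real.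
by rewrite exprMn !sqr_sqrtr ?invr_ge0// !EFinM muleA.
Qed.

(** The phase has modulus 1, and |det A| and |v|^-1 are the Jacobians of p -> p A and t -> t / v. *)
Lemma sqnorm_sigmaS phi : cmeasurable setT phi ->
  sqnorm (@leb3 R) setT (sigmaS z phi) = sqnorm (@leb3 R) setT phi.
Proof.
move=> mphi; have mS := measurable_sigmaS z mphi.
rewrite (sqnorm_prod1 (@leb2 R) L mS) (sqnorm_prod1 (@leb2 R) L mphi).
have mN := measurable_sqnormr L mphi.
have N0 p : (0 <= sqnorm L setT (fun t => phi (p, t)))%E by exact: sqnorm_ge0.
rewrite -[RHS](transport_rowmul mN N0).
apply: ae_eq_ge0_integral.
- exact: (measurable_sqnormr L mS).
- have mr : measurable_fun setT (fun p : R2 => rowmul p z.1) by rewrite /rowmul; mfun.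
  by apply: mf_emul; [mfun|exact: (mf_comp mN mr)].
- by move=> p; exact: sqnorm_ge0.
- by move=> p; rewrite mule_ge0// lee_fin.
by apply: filterS (ae_leb2_neq0 R) => p n0; rewrite sqnorm_sigmaS_fiber.
Qed.

Lemma cint_sigmaS phi phi' : cmeasurable setT phi -> cmeasurable setT phi' ->
  (forall p, cintegrable L (fun t => phi (p, t) * (phi' (p, t))^*%R)) ->
  cintegral (@leb2 R) setT (fun p => cintegral L setT (fun t =>
    sigmaS z phi (p, t) * (sigmaS z phi' (p, t))^*%R)) =
  cintegral (@leb2 R) setT (fun p => cintegral L setT (fun t => phi (p, t) * (phi' (p, t))^*%R)).
Proof.
move=> mphi mphi' fi.
have mS := measurable_sigmaS z mphi; have mS' := measurable_sigmaS z mphi'.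
pose J p := cintegral L setT (fun t => phi (p, t) * (phi' (p, t))^*%R).
have mJ : cmeasurable setT J.
  by apply: (cmeasurable_cintr L (f := fun y => phi y * (phi' y)^*%R)); mfun.
have mr : measurable_fun setT (fun p : R2 => rowmul p z.1) by rewrite /rowmul; mfun.
rewrite -[RHS](cint_transport (phi := fun p => rowmul p z.1) (w := fun=> `|det4 z.1|) (fun=>
  normr_ge0 _) transport_rowmul mJ).
apply: ae_eq_cint.
- by apply: (cmeasurable_cintr L (f := fun y => sigmaS z phi y * (sigmaS z phi' y)^*%R)); mfun.
- by mfun.
apply: filterS (ae_leb2_neq0 R) => p n0.
have v0 := vcoord_neq0 n0 d0.
rewrite /J -cintZ//.
have mq : cmeasurable setT (fun t => `|det4 z.1|%:C * (phi (rowmul p z.1,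
  t) * (phi' (rowmul p z.1, t))^*%R)).
  by have mp := cmeasurable_pairl (rowmul p z.1) mphi; have mp' :=
    cmeasurable_pairl (rowmul p z.1) mphi'; mfun.
rewrite -[RHS](cint_transport (phi := fun t : mR => (vcoord p z.1)^-1 * t : mR) (w := fun=>
  `|vcoord p z.1|^-1) (fun=> _) (fun f => @transport_scale _ f v0) mq); last by rewrite invr_ge0.
apply: eq_cint => t; rewrite /sigmaS /= !conjM.
set c := (_ * _)%:C; set e := expi _; set f := phi _; set f' := phi' _.
rewrite (_ : c^*%R = c); last by apply: complexP; rewrite ?ReJ ?ImJ //= oppr0.
rewrite (_ : c * e * f * (c * e^*%R * f'^*%R) = (c * c) * (e * e^*%R) * (f * f'^*%R)); last by ring.
rewrite mul_conj_csqr csqr_expi mulr1 /c -rmorphM /= -expr2 exprMn !sqr_sqrtr ?invr_ge0//.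
by rewrite rmorphM /=; ring.
Qed.

End unitarity.

End sigma_coordinates.

Lemma eq_cintegral d (T : measurableType d) (R : realType) (mu : {measure set T -> \bar R})
    (D : set T) (f g : T -> R[i]) : {in D, f =1 g} ->
  cintegral mu D f = cintegral mu D g.
Proof.
by move=> fg; apply: complexP => /=; apply: eq_Rintegral => x xD; rewrite fg.
Qed.

(** * Group law and unitarity of the representation *)

Section sigma_representation.
Context (R : realType).
Local Notation mR := (measurableTypeR R).
Local Notation R2 := (mR * mR)%type.
Local Notation M4 := ((mR * mR) * (mR * mR))%type.
Local Notation L := (@lebesgue_measure R).
Local Notation affine := ('cV[R]_2 * 'M[R]_2)%type.
Local Notation HR := (@haar_Rstar R).
Local Notation RS := (@Rstar R).
Implicit Types (p x : R2) (A : M4) (g h : affine) (F : affine -> mR -> R[i]).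

Let mRS : measurable RS.
Proof. by apply: measurableC; exact: measurable_set1. Qed.

Let det_Gparam g : G2 g -> det4 (Gparam g).1 != 0.
Proof. by rewrite -{1}(GparamK g) Gcoord_G2. Qed.

Lemma L2_fiber F : L2K F -> forall k, K k -> L2 HR RS (F k).
Proof. by case. Qed.

(** [represents] identifies the fibre only almost everywhere, which gives its norm but not the
    measurability of the function itself; that is read off from the explicit formula
    [sigma_coord]. *)
Lemma L2_sigma_fiber g F : G2 g -> L2K F -> forall k, K k -> L2 HR RS (sigma g F k).
Proof.
move=> /det_Gparam; rewrite -{-1}(GparamK g); case: (Gparam g) => A x /= d0 LF k Kk.
have [phi rep] := representable LF; have [mphi _] := rep.
have repS := represents_sigma x d0 rep; have [mS _] := repS.
pose p := Kparam k; have n0 : nsq p != 0 by exact: nsq_Kparam.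
have v0 := vcoord_neq0 n0 d0; have w0 := rowmul_neq0 n0 d0.
have mF : cmeasurable RS (sigma (Gcoord (A, x)) F k).
  have [mFw _] := L2_fiber LF (proj2 (KcoordP (rowmul p A)) w0).
  have mF0 := cmeasurable_restrict mRS mFw.
  apply: (eq_cmeasurable (f := fun t : mR =>
    (Num.sqrt `|det4 A| * Num.sqrt (nsq p) / Num.sqrt (nsq (rowmul p A)))%:C *
    expi (2 * pi * (dot p x + t^-1 * ucoord p A)) *
    (if (vcoord p A)^-1 * t \in RS then F (Kcoord (rowmul p A)) ((vcoord p A)^-1 * t) else 0))).
    move=> t /set_mem tR; have t0 : t != 0 by exact/eqP.
    have -> : sigma (Gcoord (A, x)) F k t = sigma (Gcoord (A, x)) F (Kcoord p) t.
      by rewrite KparamK.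
    rewrite sigma_coord// mem_set//.
    by apply/eqP; rewrite mulf_neq0// invr_eq0.
  apply: (cmeasurableS measurableT) => //; apply: cmeasurableM; first by mfun.
  by apply: (cmeasurable_comp mF0); mfun.
split => //; rewrite sqnorm_weightedR//.
rewrite (ae_eq_sqnorm _ _ (representsE repS Kk)).
- rewrite sqnormZ; last exact: cmeasurable_pairl.
  rewrite lte_mul_pinfty ?lee_fin ?csqr_ge0//.
  have fin := sqnorm_represents_fiber (L2_fiber LF) rep (rowmul p A).
  by rewrite (@sqnorm_sigmaS_fiber _ (A, x) d0 phi p)// lte_mul_pinfty// lee_fin.
- exact: cmeasurable_weightedR.
- by apply: cmeasurableM; [exact: cmeasurable_cst|exact: cmeasurable_pairl].
Qed.

Lemma L2K_sigma g F : G2 g -> L2K F -> L2K (sigma g F).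
Proof.
move=> Gg LF; have [phi rep] := representable LF; have [mphi _] := rep.
have d0 := det_Gparam Gg.
have repS := represents_sigma (Gparam g).2 d0 rep; rewrite -surjective_pairing GparamK in repS.
apply: (L2K_represents (L2_sigma_fiber Gg LF) repS).
have [_ _] := LF; rewrite (sqnorm_sigmaS d0)//.
by rewrite -[X in (_ < _)%E -> (X < _)%E](vsqnorm_represents (L2_fiber LF) rep).
Qed.

Definition mul4 A B : M4 := (rowmul A.1 B, rowmul A.2 B).
Lemma mulG2_coord A B x y :
  mulG2 (Gcoord (A, x)) (Gcoord (B, y)) = Gcoord (mul4 A B, (x.1 + dot A.1 y, x.2 + dot A.2 y)).
Proof.
rewrite /mulG2 /Gcoord /=; congr (_, _).
  apply/colP => i; rewrite !mxE !big_ord_recl big_ord0 !mxE /= addr0.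
  by have [->|->] := ord2 i.
apply/matrixP => i j; rewrite !mxE !big_ord_recl big_ord0 !mxE /= addr0.
by have [->|->] := ord2 i; have [->|->] := ord2 j.
Qed.

Lemma rowmul_mul4 p A B : rowmul p (mul4 A B) = rowmul (rowmul p A) B.
Proof. by rewrite /rowmul /mul4 /=; congr (_, _); ring. Qed.

Lemma det4_mul A B : det4 (mul4 A B) = det4 A * det4 B.
Proof. by rewrite /det4 /mul4 /rowmul /=; ring. Qed.

Let rowmul_perp p A : nsq (rowmul p A) != 0 ->
  rowmul (perp p) A =
  (ucoord p A * (rowmul p A).1 - vcoord p A * (rowmul p A).2,
   ucoord p A * (rowmul p A).2 + vcoord p A * (rowmul p A).1).
Proof.
rewrite /ucoord /vcoord /dot; case: (rowmul p A) => a b; case: (rowmul (perp p) A) => c e.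
by rewrite /nsq /perp /= => n0; congr (_, _); field.
Qed.

(** With [ucoord_mul], the cocycle identity: the lower triangular factor of A B at p is that of A at
    p times that of B at p A. It is what makes [sigma] multiplicative. *)
Lemma vcoord_mul p A B : nsq (rowmul p A) != 0 ->
  vcoord p (mul4 A B) = vcoord p A * vcoord (rowmul p A) B.
Proof.
move=> n0; rewrite !vcoordE rowmul_mul4 det4_mul.
move: (nsq (rowmul (rowmul p A) B))^-1 (nsq (rowmul p A)) n0 => r q q0.
by field.
Qed.

Lemma ucoord_mul p A B : nsq (rowmul p A) != 0 -> nsq (rowmul (rowmul p A) B) != 0 ->
  ucoord p (mul4 A B) = ucoord p A + vcoord p A * ucoord (rowmul p A) B.
Proof.
move=> n0 n1; rewrite {1}/ucoord !rowmul_mul4 (rowmul_perp n0).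
move: (ucoord p A) (vcoord p A) (rowmul p A) n1 => u v w n1.
apply: (mulIf n1); rewrite mulfVK// mulrDl -(mulrA v) /ucoord mulfVK//.
by rewrite /dot /nsq /rowmul /perp /=; ring.
Qed.

Let sigma_mul_coord A B x y F p t : det4 A != 0 -> det4 B != 0 -> nsq p != 0 ->
  sigma (Gcoord (A, x)) (sigma (Gcoord (B, y)) F) (Kcoord p) t =
  sigma (mulG2 (Gcoord (A, x)) (Gcoord (B, y))) F (Kcoord p) t.
Proof.
move=> dA dB n0.
have w0 := rowmul_neq0 n0 dA; have w1 := rowmul_neq0 w0 dB.
rewrite mulG2_coord !sigma_coord// det4_mul rowmul_mul4 vcoord_mul// ucoord_mul//.
have v0 := vcoord_neq0 n0 dA.
have np : 0 < nsq (rowmul p A) by rewrite lt_neqAle eq_sym w0 nsq_ge0.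
have -> : (vcoord p A * vcoord (rowmul p A) B)^-1 * t = (vcoord (rowmul p A) B)^-1 * ((vcoord p
  A)^-1 * t).
  by rewrite invfM; ring.
set f := F _ _; rewrite [RHS](_ : _ = (Num.sqrt `|det4 A| * Num.sqrt (nsq p) / Num.sqrt (nsq
  (rowmul p A)))%:C *
   (Num.sqrt `|det4 B| * Num.sqrt (nsq (rowmul p A)) / Num.sqrt (nsq (rowmul (rowmul p A) B)))%:C *
   (expi (2 * pi * (dot p x + t^-1 * ucoord p A)) *
    expi (2 * pi * (dot (rowmul p A) y + ((vcoord p A)^-1 * t)^-1 * ucoord (rowmul p A) B))) * f).
  by rewrite /f; ring.
congr (_ * _ * _).
  rewrite -rmorphM /= normrM sqrtrM//; congr (_%:C).
  have s0 : Num.sqrt (nsq (rowmul p A)) != 0 by rewrite gt_eqF// sqrtr_gt0.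
  have s1 : Num.sqrt (nsq (rowmul (rowmul p A) B)) != 0.
    by rewrite gt_eqF// sqrtr_gt0 lt_neqAle eq_sym w1 nsq_ge0.
  by field; rewrite s0 s1.
rewrite -expiD; congr expi; rewrite invfM invrK /dot /rowmul /=; ring.
Qed.

Lemma sigma_mul g h F p t : G2 g -> G2 h -> nsq p != 0 ->
  sigma g (sigma h F) (Kcoord p) t = sigma (mulG2 g h) F (Kcoord p) t.
Proof.
move=> /det_Gparam dA /det_Gparam dB n0.
have := sigma_mul_coord (Gparam g).2 (Gparam h).2 F t dA dB n0.
by rewrite -!surjective_pairing !GparamK.
Qed.

(** With h = g^-1 y one has sigma(y) E = sigma(g) sigma(h) E at every point of [K], and unitarity
    removes sigma(g) from both entries. The identity holds at every point of [G2]. *)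
Lemma V_sigma E F g y : G2 g -> G2 y -> L2K E -> L2K F ->
  V E (sigma g F) y = V E F (mulG2 (invG2 g) y).
Proof.
move=> Gg Gy LE LF; set h := mulG2 (invG2 g) y.
have Gh : G2 h by rewrite /h /G2 /= unitmx_mul unitmx_inv; apply/andP; split.
have gh : mulG2 g h = y.
  case: y Gy @h Gh => y B Gy h Gh; rewrite /h /mulG2 /invG2 /=; congr (_, _).
    by rewrite mulmxDr mulmxN !mulKVmx// addrA subrr add0r.
  by rewrite mulKVmx.
have LsE := L2K_sigma Gh LE.
have [phi rep] := representable LF; have [psi rep'] := representable LsE.
have [mphi _] := rep; have [mpsi _] := rep'.
rewrite /V; transitivity (vinner (@haar_K R) (@K R) HR RS (sigma g F) (sigma g (sigma h E))).
  have eqE : {in @K R, (fun k => inner HR RS (sigma g F k) (sigma y E k)) =1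
     (fun k => inner HR RS (sigma g F k) (sigma g (sigma h E) k))}.
    move=> k /set_mem Kk; congr (inner HR RS _ _); apply/funext => t.
    by rewrite -(KparamK Kk) sigma_mul ?gh//; exact: nsq_Kparam.
  exact: (eq_cintegral (@haar_K R) eqE).
have d0 := det_Gparam Gg.
have repS := represents_sigma (Gparam g).2 d0 rep.
have repS' := represents_sigma (Gparam g).2 d0 rep'.
rewrite -surjective_pairing GparamK in repS; rewrite -surjective_pairing GparamK in repS'.
rewrite (vinner_represents (L2_sigma_fiber Gg LF) repS (L2_sigma_fiber Gg LsE) repS').
rewrite (vinner_represents (L2_fiber LF) rep (L2_fiber LsE) rep').
apply: (cint_sigmaS d0 mphi mpsi) => p.
apply: cintegrableM_L2; last apply: L2J; split; try exact: cmeasurable_pairl.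
  exact: sqnorm_represents_fiber (L2_fiber LF) rep p.
exact: sqnorm_represents_fiber (L2_fiber LsE) rep' p.
Qed.

End sigma_representation.

(** * The voice transforms *)

Section coherent_transform.
Context (R : realType).
Local Notation mR := (measurableTypeR R).
Local Notation R2 := (mR * mR)%type.
Local Notation M4 := ((mR * mR) * (mR * mR))%type.
Local Notation L := (@lebesgue_measure R).
Local Notation affine := ('cV[R]_2 * 'M[R]_2)%type.
Local Notation HR := (@haar_Rstar R).
Local Notation RS := (@Rstar R).
Local Notation F1 := (pfourier L (@phase1 R)).
Local Notation F2 := (pfourier (@leb2 R) (@phase2 R)).
Local Notation row_pullback := (pullback (@row_weight R) (@row_map R)).
Local Notation inv_pullback := (pullback (@inv_weight R) (@inv_map R)).

Definition planar (eta : 'rV[R]_2 -> R[i]) : R2 -> R[i] := weighted (@rv2 R) (@Oweight R) eta.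
Definition linear1 (g : mR -> R[i]) : mR -> R[i] := weighted id (@O1weight R) g.

Definition tensor (phi : R2 * mR -> R[i]) (a : R2 -> R[i]) (b : mR -> R[i])
    (y : (R2 * mR) * (R2 * mR)) : R[i] :=
  phi y.1 * (a y.2.1 * (b y.2.2)^*%R).

Variables (phi : R2 * mR -> R[i]) (a : R2 -> R[i]) (b : mR -> R[i]).
Hypotheses (Lphi : L2 (@leb3 R) setT phi)
  (fphi : forall p, (sqnorm L setT (fun t => phi (p, t)) < +oo)%E).
Hypotheses (La : L2 (@leb2 R) setT a)
  (fa : (\int[@leb2 R]_p ((nsq p)%:E * (csqr (a p))%:E) < +oo)%E).
Hypotheses (Lb : L2 L setT b)
  (fb : (\int[L]_t ((`|t|^-1)%R%:E * (csqr (b t))%:E) < +oo)%E).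

Let mphi : cmeasurable setT phi. Proof. by case: Lphi. Qed.
Let ma : cmeasurable setT a. Proof. by case: La. Qed.
Let mb : cmeasurable setT b. Proof. by case: Lb. Qed.

Lemma L2_tensor3 : L2 (@leb3 R \x @leb3 R)%E setT (tensor phi a b).
Proof.
apply: (L2_tensor (m1 := @leb3 R) (m2 := @leb3 R) (g := fun y => a y.1 * (b y.2)^*%R) Lphi).
apply: (L2_tensor (m1 := @leb2 R) (m2 := L) (g := fun t => (b t)^*%R) La).
exact: L2J.
Qed.

Let h := inv_pullback (tensor phi a b).

(** The factor |s|^(-3/2) of [inv_weight] is split as |s|^-1 times |s|^(-1/2): the first part gives
    [alpha] the norm of the fibre of [phi], the second makes the norm of [beta] the integral of
    |b|^2 against dt/|t|, independent of v != 0. *)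
Let alpha p (s : mR) : R[i] := (`|s|^-1)%:C * phi (p, s^-1).
Let beta (v : R) (s : mR) : R[i] := ((Num.sqrt `|s|)^-1)%:C * (b (s * v)^-1)^*%R.

Let malpha p : cmeasurable setT (alpha p).
Proof.
by rewrite /alpha; have m := cmeasurable_pairl p mphi; apply: cmeasurableM; [mfun|apply:
  (cmeasurable_comp m); mfun].
Qed.

Let mbeta v : cmeasurable setT (beta v).
Proof. by rewrite /beta; mfun. Qed.

Let sqnorm_alpha p : sqnorm L setT (alpha p) = sqnorm L setT (fun t => phi (p, t)).
Proof.
have m := cmeasurable_pairl p mphi.
have n0 (x : mR) : (0 <= (csqr (phi (p, x)))%:E)%E by rewrite lee_fin csqr_ge0.
have := integral_inv_sqr (oner_neq0 R) (measurable_csqrE m) n0.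
rewrite normr1 mul1e => e; refine (etrans _ e); apply: eq_integral => s _.
by rewrite /alpha csqrM csqr_real mul1r EFinM.
Qed.

Let B := fine (\int[L]_t ((`|t|^-1)%R%:E * (csqr (b t))%:E))%E.

Let BE : (\int[L]_t ((`|t|^-1)%R%:E * (csqr (b t))%:E) = B%:E)%E.
Proof.
by rewrite fineK// ge0_fin_numE// integral_ge0// => t _;
  rewrite mule_ge0// lee_fin ?invr_ge0 ?csqr_ge0.
Qed.

Let B0 : 0 <= B.
Proof.
by rewrite fine_ge0// integral_ge0// => t _; rewrite mule_ge0// lee_fin ?invr_ge0 ?csqr_ge0.
Qed.

Let sqnorm_beta v : v != 0 -> sqnorm L setT (beta v) = B%:E.
Proof.
move=> v0; rewrite -BE.
have mq := measurable_csqrE mb.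
have q0 (x : mR) : (0 <= (csqr (b x))%:E)%E by rewrite lee_fin csqr_ge0.
have mi : measurable_fun setT (fun x : mR => (csqr (b x^-1))%:E) by mfun.
rewrite -(integral_inv mq q0) -(integral_scale v0 mi); last by move=> x; exact: q0.
apply: eq_integral => s _; rewrite /beta csqrM csqr_real csqrJ exprVn sqr_sqrtr//.
by rewrite EFinM (mulrC s).
Qed.

Let hE p w v s : h (((p, w), v), s) = (`|v|^-1)%:C * a w * (alpha p s * beta v s).
Proof.
rewrite /h /pullback /inv_weight /inv_map /tensor /alpha /beta /=.
by rewrite invfM !rmorphM /=; ring.
Qed.

Let fiber_h y : cintegrable L (fun s => h (y, s)).
Proof.
case: y => -[p w] v; under eq_fun do rewrite hE.
have [->|v0] := eqVneq v 0.
  by under eq_fun do rewrite normr0 invr0 !mul0r; exact: cintegrable0.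
apply: cintegrableZ; apply: cintegrableM_L2; split => //.
  by rewrite sqnorm_alpha.
by rewrite sqnorm_beta// ltry.
Qed.

(** If det A = 0 then v = 0, and the factor |v|^-1 is 0 by convention. Singular matrices thus cause
    no trouble in [regular], which quantifies over all A. *)
Let det0_F1 A p : det4 A = 0 -> row_pullback (F1 h) (A, p) = 0.
Proof.
move=> d0; rewrite /pullback (_ : F1 h _ = 0) ?mulr0//.
rewrite /pfourier /fourier (_ : (fun x => _) = fun=> 0).
  by apply: complexP => /=; rewrite /Rintegral integral0.
apply/funext => s; rewrite /row_map /= hE vcoordE d0 mulr0 mul0r normr0 invr0.
by rewrite !mul0r mulr0.
Qed.

Lemma transform_tensor3_det0 A x : det4 A = 0 -> transform h (A, x) = 0.
Proof.
move=> d0; rewrite /transform /pfourier /fourier /=.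
transitivity (cintegral (@leb2 R) setT (fun _ : R2 => 0 : R[i])).
  by apply: eq_cint => p; rewrite [X in _ * X](det0_F1 p d0) mulr0.
by apply: complexP => /=; rewrite /Rintegral integral0.
Qed.

(** Bound the phase by 2 and the product of [alpha] and [c * beta] by the sum of the squares. All
    weights are put on the second factor; since |v| = |p|^2 |det A| / |p A|^2, the powers of |p|
    cancel and |det A|^-2 |p A|^2 |a(p A)|^2 remains, which is where the moment of [a] comes
    from. *)
Let row_h_le A p : det4 A != 0 ->
  ((n1 (row_pullback (F1 h) (A, p)))%:E <=
   2%:E * (sqnorm L setT (fun t => phi (p, t)) +
     ((`|det4 A|^-1 ^+ 2 * (nsq (rowmul p A) * csqr (a (rowmul p A)))) * B)%:E))%E.
Proof.
move=> d0; have r0 : (0 <= 2%:E * (sqnorm L setT (fun t => phi (p, t)) +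
     ((`|det4 A|^-1 ^+ 2 * (nsq (rowmul p A) * csqr (a (rowmul p A)))) * B)%:E))%E.
  rewrite mule_ge0// adde_ge0 ?sqnorm_ge0// lee_fin mulr_ge0// mulr_ge0 ?sqr_ge0//.
  by rewrite mulr_ge0 ?nsq_ge0 ?csqr_ge0.
have [n0|n0] := eqVneq (nsq p) 0.
  by rewrite /pullback /row_weight /= n0 mul0r mul0r /n1 /= normr0 addr0.
have v0 := vcoord_neq0 n0 d0; have w0 := rowmul_neq0 n0 d0.
set w := rowmul p A; set v := vcoord p A; set u := ucoord p A.
pose c : R[i] := (row_weight (A, p))%:C * ((`|v|^-1)%:C * a w).
have -> : row_pullback (F1 h) (A, p) =
    cintegral L setT (fun s => expi (- phase1 (s, u)) * (alpha p s * (c * beta v s))).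
  rewrite /pullback /pfourier /fourier -cintZ; last first.
    by apply: cintegrable_phase; [rewrite /phase1; mfun|exact: fiber_h].
  by apply: eq_cint => s; rewrite /= hE /c; ring.
have La' : L2 L setT (alpha p) by split => //; rewrite sqnorm_alpha.
have Lb' : L2 L setT (fun s => c * beta v s).
  by apply: L2Z; split => //; rewrite sqnorm_beta// ltry.
have [mb' _] := Lb'.
have ci : cintegrable L (fun s => expi (- phase1 (s, u)) * (alpha p s * (c * beta v s))).
  by apply: cintegrable_phase; [rewrite /phase1; mfun|exact: cintegrableM_L2].
apply: le_trans (n1_cint_le ci) _.
apply: (@le_trans _ _ (\int[L]_s (2%:E * ((csqr (alpha p s))%:E + (csqr (c * beta v s))%:E)))%E).
  apply: le_integralT.
  - by apply: mf_EFin; apply: measurable_n1; case: ci.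
  - by apply: mf_emul; [exact: measurable_cst|apply: mf_eadd; apply: measurable_csqrE].
  - by move=> s; rewrite lee_fin n1_ge0.
  - move=> s; rewrite -EFinD -EFinM lee_fin; apply: le_trans (n1M _ _) _.
    by apply: ler_pM; rewrite ?n1_ge0 ?n1_expi_le ?n1M_le.
rewrite integralZT//; last 2 first.
- by apply: mf_eadd; apply: measurable_csqrE.
- by move=> s; rewrite -EFinD lee_fin addr_ge0 ?csqr_ge0.
rewrite lee_wpmul2l// integralDT; last 4 first.
- exact: measurable_csqrE.
- exact: measurable_csqrE.
- by move=> s; rewrite lee_fin csqr_ge0.
- by move=> s; rewrite lee_fin csqr_ge0.
rewrite -[X in (X + _ <= _)%E]/(sqnorm L setT (alpha p)) sqnorm_alpha.
rewrite -[X in (_ + X <= _)%E]/(sqnorm L setT (fun s => c * beta v s)) sqnormZ// sqnorm_beta//.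
rewrite -EFinM leeD2l// lee_fin ler_wpM2r//.
rewrite le_eqVlt; apply/orP; left; apply/eqP.
rewrite /c !csqrM !csqr_real; move: (csqr (a w)) => q.
rewrite /row_weight /= -/w /v vcoordE -/w !normrM normfV !(ger0_norm (nsq_ge0 _)).
have nd : `|det4 A| != 0 by rewrite normr_eq0.
have s0 : Num.sqrt (nsq w) != 0 by rewrite sqrtr_eq0 -ltNge lt_neqAle eq_sym w0 nsq_ge0.
move: s0 (sqr_sqrtr (nsq_ge0 w)); move: (Num.sqrt (nsq w)) => r s0 <-.
by field; rewrite nd n0 s0.
Qed.

(** The bound [row_h_le] is integrable in p: its first term integrates to the norm of [phi], and the
    substitution p A turns the second into a multiple of the moment [fa]. *)
Lemma regular_tensor3 : regular h.
Proof.
split.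
- exact: (L2_pullback (@measurable_inv_weight R) (@measurable_inv_map R) (@inv_transport R)
  L2_tensor3).
- exact: fiber_h.
move=> A; have [d0|d0] := eqVneq (det4 A) 0.
  by under eq_fun do rewrite det0_F1//; exact: cintegrable0.
have mh : cmeasurable setT h.
  have [mt _] := L2_tensor3.
  exact: (cmeasurable_pullback (@measurable_inv_weight R) (@measurable_inv_map R) mt).
have mrow := cmeasurable_pullback (@measurable_row_weight R) (@measurable_row_map R)
  (cmeasurable_pfourier L (@measurable_phase1 R) mh).
have mN := measurable_sqnormr L mphi.
have mr : measurable_fun setT (fun p : R2 => rowmul p A) by rewrite /rowmul; mfun.
have mk : measurable_fun setT (fun p => (nsq p)%:E * (csqr (a p))%:E)%E.
  by apply: mf_emul; [apply: mf_EFin; rewrite /nsq; mfun|exact: measurable_csqrE].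
have mkr : measurable_fun setT (fun p => ((nsq (rowmul p A))%:E * (csqr (a (rowmul p A)))%:E)%E).
  exact: (mf_comp mk mr).
have k0 p : (0 <= (nsq p)%:E * (csqr (a p))%:E)%E.
  by rewrite mule_ge0// lee_fin ?nsq_ge0 ?csqr_ge0.
have C0 : 0 <= `|det4 A|^-1 ^+ 2 * B * `|det4 A|^-1 by rewrite !mulr_ge0 ?invr_ge0 ?sqr_ge0.
have tail_ge0 p : (0 <= (`|det4 A|^-1 ^+ 2 * B * `|det4 A|^-1)%:E *
     (`|det4 A|%:E * ((nsq (rowmul p A))%:E * (csqr (a (rowmul p A)))%:E)))%E.
  by apply: mule_ge0; [rewrite lee_fin|apply: mule_ge0; [rewrite lee_fin|exact: k0]].
apply: (cintegrable_le (h := fun p => (2%:E * (sqnorm L setT (fun t => phi (p, t)) +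
     (`|det4 A|^-1 ^+ 2 * B * `|det4 A|^-1)%:E * (`|det4 A|%:E * ((nsq (rowmul p A))%:E * (csqr
       (a (rowmul p A)))%:E))))%E)).
- exact: cmeasurable_pairl mrow.
- by apply: mf_emul; [exact: measurable_cst|apply: mf_eadd => //; do 2!(apply: mf_emul;
  first exact: measurable_cst)].
- move=> p; apply: le_trans (row_h_le p d0) _.
  rewrite lee_wpmul2l// leeD2l// -!EFinM lee_fin le_eqVlt; apply/orP; left; apply/eqP.
  have nd : `|det4 A| != 0 by rewrite normr_eq0.
  by field.
rewrite integralZT//; last 2 first.
- by apply: mf_eadd => //; do 2!(apply: mf_emul; first exact: measurable_cst).
- by move=> p; apply: adde_ge0; [exact: sqnorm_ge0|exact: tail_ge0].
rewrite integralDT//; last 2 first.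
- by do 2!(apply: mf_emul; first exact: measurable_cst).
- by move=> p; exact: sqnorm_ge0.
rewrite integralZT//; last 2 first.
- by apply: mf_emul; first exact: measurable_cst.
- by move=> p; apply: mule_ge0 => //; exact: k0.
rewrite (@transport_rowmul _ (A, (0, 0)) d0 _ mk k0) -(sqnorm_prod1 (@leb2 R) L mphi).
rewrite lte_mul_pinfty// lte_add_pinfty//; first by case: Lphi.
by rewrite lte_mul_pinfty.
Qed.

End coherent_transform.

Section voice_transform.
Context (R : realType).
Local Notation mR := (measurableTypeR R).
Local Notation R2 := (mR * mR)%type.
Local Notation M4 := ((mR * mR) * (mR * mR))%type.
Local Notation L := (@lebesgue_measure R).
Local Notation affine := ('cV[R]_2 * 'M[R]_2)%type.
Local Notation HR := (@haar_Rstar R).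
Local Notation RS := (@Rstar R).
Local Notation F1 := (pfourier L (@phase1 R)).
Local Notation F2 := (pfourier (@leb2 R) (@phase2 R)).
Local Notation row_pullback := (pullback (@row_weight R) (@row_map R)).
Local Notation inv_pullback := (pullback (@inv_weight R) (@inv_map R)).
Local Notation m3 := (@leb4 R \x @leb2 R)%E.

Let conjC_real (r : R) : (r%:C)^*%R = r%:C :> R[i].
Proof. by apply: complexP; rewrite ?ReJ ?ImJ //= oppr0. Qed.

Let Oweight_ge0 p : 0 <= @Oweight R p. Proof. by rewrite /Oweight. Qed.
Let O1weight_ge0 p : 0 <= @O1weight R p. Proof. by rewrite /O1weight. Qed.

Let Oweight_O (p : R2) : Oweight p != 0 -> O (rv2 p).
Proof. by rewrite /Oweight pnatr_eq0 eqb0 negbK; exact: rv2_neq0. Qed.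

Let O1weight_O1 (t : mR) : O1weight t != 0 -> @O1 R t.
Proof. by rewrite /O1weight pnatr_eq0 eqb0 negbK => /eqP. Qed.

Let mO1 : measurable (@O1 R).
Proof. by apply: measurableC; exact: measurable_set1. Qed.

Lemma planarE eta (p : R2) : nsq p != 0 -> planar eta p = eta (rv2 p).
Proof. by move=> n0; rewrite /planar /weighted /Oweight n0 sqrtr1 mul1r. Qed.

Lemma linear1E g (t : mR) : t != 0 -> linear1 g t = g t.
Proof. by move=> n0; rewrite /linear1 /weighted /O1weight n0 sqrtr1 mul1r. Qed.

Lemma cmeasurable_planar eta : cmeasurable (@O R) eta -> cmeasurable setT (planar eta).
Proof.
exact: (cmeasurable_weighted (@measurable_O R) (@measurable_rv2 R) (@measurable_Oweight R)
  Oweight_O).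
Qed.

Lemma cmeasurable_linear1 g : cmeasurable (@O1 R) g -> cmeasurable setT (linear1 g).
Proof.
move=> mg; apply: (cmeasurable_weighted mO1 _ (@measurable_O1weight R) O1weight_O1 mg).
exact: measurable_id.
Qed.

Lemma L2_planar eta : L2 (@leb_rV R) (@O R) eta -> L2 (@leb2 R) setT (planar eta).
Proof.
exact: (L2_weighted (@measurable_O R) (@measurable_rv2 R) (@measurable_Oweight R) Oweight_ge0
  Oweight_O (@transport_O R)).
Qed.

Lemma L2_linear1 g : L2 L (@O1 R) g -> L2 L setT (linear1 g).
Proof.
move=> Lg; have mid : measurable_fun setT (id : mR -> mR) by exact: measurable_id.
exact: (L2_weighted mO1 mid (@measurable_O1weight R) O1weight_ge0 O1weight_O1 (@transport_O1 R) Lg).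
Qed.

Lemma sqnorm_planar eta : cmeasurable (@O R) eta ->
  sqnorm (@leb_rV R) (@O R) eta = sqnorm (@leb2 R) setT (planar eta).
Proof.
exact: (sqnorm_weighted (@measurable_O R) Oweight_ge0 Oweight_O (@transport_O R)).
Qed.

Lemma sqnorm_linear1 g : cmeasurable (@O1 R) g ->
  sqnorm L (@O1 R) g = sqnorm L setT (linear1 g).
Proof. exact: (sqnorm_weighted mO1 O1weight_ge0 O1weight_O1 (@transport_O1 R)). Qed.

Lemma inner_planar eta eta' : cmeasurable (@O R) eta -> cmeasurable (@O R) eta' ->
  inner (@leb_rV R) (@O R) eta eta' =
  cintegral (@leb2 R) setT (fun p => planar eta p * (planar eta' p)^*%R).
Proof.
exact: (inner_weighted (@measurable_O R) Oweight_ge0 Oweight_O (@transport_O R)).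
Qed.

Lemma inner_linear1 g g' : cmeasurable (@O1 R) g -> cmeasurable (@O1 R) g' ->
  inner L (@O1 R) g g' =
  cintegral L setT (fun t => linear1 g t * (linear1 g' t)^*%R).
Proof. exact: (inner_weighted mO1 O1weight_ge0 O1weight_O1 (@transport_O1 R)). Qed.

Definition coherent_rep (eta : 'rV[R]_2 -> R[i]) (g : mR -> R[i]) (y : R2 * mR) : R[i] :=
  ((Num.sqrt (nsq y.1))%:C * (planar eta y.1)^*%R) * weightedR g y.2.

Lemma represents_coherent eta g : cmeasurable (@O R) eta -> cmeasurable RS g ->
  represents (coherent_vector eta g) (coherent_rep eta g).
Proof.
move=> me mg; have mp := cmeasurable_planar me; have mw := cmeasurable_weightedR mg.
split; first by rewrite /coherent_rep /nsq; mfun.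
move=> p; apply: aeW => t; rewrite /coherent_rep /=.
have [n0|n0] := eqVneq (nsq p) 0; first by rewrite n0 sqrtr0 invr0 sqrtr0 !mul0r.
rewrite planarE// /weightedR /weighted coherent_coord//.
have np : 0 < nsq p by rewrite lt_neqAle eq_sym n0 nsq_ge0.
have -> : (nsq p)%:C = (Num.sqrt (nsq p))%:C * (Num.sqrt (nsq p))%:C :> R[i].
  by rewrite -rmorphM /= -expr2 sqr_sqrtr// ltW.
have -> : Num.sqrt (nsq p)^-1 = (Num.sqrt (nsq p))^-1 by rewrite sqrtrV// ltW.
have s0 : Num.sqrt (nsq p) != 0 by rewrite gt_eqF// sqrtr_gt0.
move: (Num.sqrt (nsq p)) s0 => s s0.
have e : (s^-1)%:C * s%:C = 1 :> R[i] by rewrite -rmorphM /= mulVf.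
set E := (eta _)^*%R; set w := (Num.sqrt _)%:C.
rewrite (_ : s^-1%:C * (w * (E * (s%:C * s%:C) * g t)) =
   (s^-1%:C * s%:C) * (s%:C * E * (w * g t))); last by ring.
by rewrite e mul1r.
Qed.

Section formula.
Variables (F : affine -> mR -> R[i]) (phi : R2 * mR -> R[i]).
Variables (eta : 'rV[R]_2 -> R[i]) (g : mR -> R[i]).
Hypotheses (LF : L2K F) (rep : represents F phi).
Hypotheses (Leta : L2 (@leb_rV R) (@O R) eta) (Lg : L2 L (@O1 R) g).
Hypotheses (LgR : L2 HR RS g) (LE : L2K (coherent_vector eta g)).
Hypothesis feta : (\int[@leb2 R]_p ((nsq p)%:E * (csqr (planar eta p))%:E) < +oo)%E.

Lemma linear1_Rstar : (\int[L]_t ((`|t|^-1)%R%:E * (csqr (linear1 g t))%:E) < +oo)%E.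
Proof.
have [mg gL] := LgR; move: gL; rewrite (sqnorm_weightedR mg); congr (_ < _)%E.
apply: eq_integral => t _; rewrite /weightedR /weighted csqrM csqr_real sqr_sqrtr ?invr_ge0// EFinM.
have [->|t0] := eqVneq t 0; first by rewrite /Rweight normr0 invr0 !mul0e.
by rewrite linear1E.
Qed.

Lemma L2_rep : L2 (@leb3 R) setT phi.
Proof.
have [mphi _] := rep; split => //.
by have [_ _] := LF; rewrite (vsqnorm_represents (L2_fiber LF) rep).
Qed.

Lemma regular_rep : regular (inv_pullback (tensor phi (planar eta) (linear1 g))).
Proof.
apply: regular_tensor3.
- exact: L2_rep.
- exact: sqnorm_represents_fiber (L2_fiber LF) rep.
- exact: L2_planar.
- exact: feta.
- exact: L2_linear1.
- exact: linear1_Rstar.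
Qed.

(** The scalar product with sigma[x, A] E is an iterated integral over p and t. Writing t = 1/s
    turns the phase of [sigma] into the two Fourier phases of [transform]; the remaining real
    factors combine into the weights of the two pull-backs and |det A|^(3/2). The conjugate in E is
    undone by that of the scalar product, so eta itself appears. *)
Lemma V_transform A x : det4 A != 0 ->
  V (coherent_vector eta g) F (Gcoord (A, x)) =
  (Num.sqrt `|det4 A| ^+ 3)%:C * transform (inv_pullback (tensor phi (planar eta) (linear1 g)))
    (A, x).
Proof.
move=> d0; have [_ hi hj] := regular_rep.
have [meta _] := Leta; have [mgR _] := LgR; have [mphi _] := rep.
have repE := represents_coherent meta mgR.
have repS := represents_sigma x d0 repE; have [mS _] := repS.
have GA : G2 (Gcoord (A, x)) by exact/Gcoord_G2.
set h := inv_pullback _ in hi hj *.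
rewrite /V (vinner_represents (L2_fiber LF) rep (L2_sigma_fiber GA LE) repS).
set S := (_ ^+ 3)%:C.
have -> : S * transform h (A, x) = cintegral (@leb2 R) setT (fun p => S *
    (expi (- phase2 (p, x)) * row_pullback (F1 h) (A, p))).
  rewrite cintZ //; apply: cintegrable_phase; last exact: hj.
  by rewrite /phase2; mfun.
have [[mh _] _ _] := regular_rep; rewrite -/h in mh.
have mrow := cmeasurable_pullback (@measurable_row_weight R) (@measurable_row_map R)
  (cmeasurable_pfourier L (@measurable_phase1 R) mh).
have mrowA := cmeasurable_pairl A mrow.
apply: ae_eq_cint.
- by apply: (cmeasurable_cintr L (f := fun y => phi y * (sigmaS (A,
  x) (coherent_rep eta g) y)^*%R)); mfun.
- by apply: cmeasurableM; [exact: cmeasurable_cst|apply: cmeasurableM => //; apply: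
  cmeasurable_expi; rewrite /phase2; mfun].
apply: filterS (ae_leb2_neq0 R) => p n0.
have v0 := vcoord_neq0 n0 d0; have w0 := rowmul_neq0 n0 d0.
set w := rowmul p A; set v := vcoord p A; set u := ucoord p A.
have -> : S * (expi (- phase2 (p, x)) * row_pullback (F1 h) (A, p)) =
    cintegral L setT (fun s => (S * (expi (- phase2 (p, x)) * (row_weight (A, p))%:C)) *
      (expi (- phase1 (s, u)) * h (((p, w), v), s))).
  rewrite cintZ; last by apply: cintegrable_phase; [rewrite /phase1; mfun|exact: hi].
  by rewrite /pullback /pfourier /fourier /=; ring.
set f := (X in cintegral _ _ X = _).
have mf : cmeasurable setT f.
  by rewrite /f; have m1 := cmeasurable_pairl p mphi; have m2 := cmeasurable_pairl p mS; mfun.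
(* The substitution t = 1/s, which makes the phase u/t linear in the integration variable, has
   Jacobian |s|^-2. *)
have tr k : measurable_fun setT k -> (forall t, 0 <= k t)%E ->
  (\int[L]_s ((`|s|^-1 ^+ 2)%R%:E * k (s^-1)%R) = \int[L]_t k t)%E.
  move=> mk k0; have := integral_inv_sqr (oner_neq0 R) mk k0.
  by rewrite normr1 mul1e => <-; apply: eq_integral => s _; rewrite mul1r.
rewrite -(cint_transport (phi := fun s : mR => s^-1 : mR) (w := fun s => `|s|^-1 ^+ 2) (fun=>
  sqr_ge0 _) tr mf).
apply: ae_eq_cint.
- by apply: cmeasurableM; [mfun|apply: (cmeasurable_comp mf); mfun].
- apply: cmeasurableM; first exact: cmeasurable_cst.
  have mhy := cmeasurable_pairl ((p, w), v) mh.
  by apply: cmeasurableM => //; rewrite /phase1; mfun.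
apply: filterS (ae_neq0 R) => s s0.
rewrite /f /sigmaS /coherent_rep /h /pullback /inv_weight /inv_map /tensor /=.
have wR t : weightedR g t = (Num.sqrt (Rweight t))%:C * g t by [].
rewrite -/w -/v -/u wR linear1E; last by rewrite invr_eq0 mulf_neq0.
move: (planar eta w) => a.
rewrite !conjM !conj_expi !conjC_real conjCK invrK -invfM (mulrC v s).
have -> : expi (- (2 * pi * (dot p x + s * u))) = expi (- phase2 (p, x)) * expi (- phase1 (s, u)).
  by rewrite -expiD; congr expi; rewrite /phase1 /phase2 /dot /=; ring.
set c1 := (`|s|^-1 ^+ 2)%:C; set P := phi _; set e2 := expi _; set e1 := expi _.
set gg := (g _)^*%R.
have vE : `|v| = nsq p * `|det4 A| / nsq w.
  by rewrite /v vcoordE !normrM normfV !(ger0_norm (nsq_ge0 _)).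
(* Both sides are a real scalar times the same complex factors; what remains is an identity between
   the square roots of |v|, |w|^2, |det A| and |s|, using |v| = |p|^2 |det A| / |w|^2. *)
transitivity ((`|s|^-1 ^+ 2 * (Num.sqrt `|det4 A| * Num.sqrt `|v|^-1) * Num.sqrt (nsq w) *
   Num.sqrt (Rweight (s * v)^-1))%:C * (P * e2 * e1 * a * gg)).
  by rewrite !rmorphM /= /c1 rmorphXn /=; ring.
transitivity ((Num.sqrt `|det4 A| ^+ 3 * row_weight (A,
  p) * (`|v|^-1 * (`|s| * Num.sqrt `|s|)^-1))%:C *
  (P * e2 * e1 * a * gg)); last by rewrite !rmorphM /= /S; ring.
congr (_%:C * _).
have -> : Num.sqrt (Rweight (s * v)^-1) = Num.sqrt `|s| * Num.sqrt `|v|.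
  by rewrite /Rweight (normfV (s * v)) invrK (normrM s v) sqrtrM.
have vp : 0 < `|v| by rewrite normr_gt0.
rewrite (@sqrtrV _ `|v|) ?ltW// vE /row_weight /= -/w.
have np : 0 < nsq p by rewrite lt_neqAle eq_sym n0 nsq_ge0.
have wp : 0 < nsq w by rewrite lt_neqAle eq_sym w0 nsq_ge0.
have sv0 : Num.sqrt `|v| != 0 by rewrite gt_eqF// sqrtr_gt0.
have sw0 : Num.sqrt (nsq w) != 0 by rewrite gt_eqF// sqrtr_gt0.
have sd0 : Num.sqrt `|det4 A| != 0 by rewrite gt_eqF// sqrtr_gt0 normr_gt0.
have ss0 : Num.sqrt `|s| != 0 by rewrite gt_eqF// sqrtr_gt0 normr_gt0.
rewrite -vE.
move: sv0 sw0 sd0 ss0 (sqr_sqrtr (ltW wp)) (sqr_sqrtr (normr_ge0 (det4 A))) (sqr_sqrtr (normr_ge0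
  s)).
rewrite [X in _ = _ * (X^-1 * _)]vE.
move: (Num.sqrt `|v|) (Num.sqrt (nsq w)) (Num.sqrt `|det4 A|) (Num.sqrt `|s|) =>
  sv sw sd ss sv0 sw0 sd0 ss0 <- <- <-.
by field; rewrite sv0 sw0 sd0 ss0 n0.
Qed.

End formula.

End voice_transform.

Section inner_one.
Context d (T : measurableType d) (R : realType).
Variables (mu : {measure set T -> \bar R}) (D : set T).

Lemma sqnorm_inner1 (f : T -> R[i]) : L2 mu D f -> inner mu D f f = 1 -> sqnorm mu D f = 1%E.
Proof.
move=> [mf fL] i1; have := congr1 (@complex.Re R) i1 => /= r1.
rewrite -[LHS]fineK; last by rewrite ge0_fin_numE// sqnorm_ge0.
congr _%:E; rewrite -[RHS]r1 /Rintegral; congr fine; apply: eq_integral => x _.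
by rewrite mul_conj_csqr.
Qed.

End inner_one.

(** * Measurability, linearity and isometry of the voice transforms *)

Section voice_isometry.
Context (R : realType).
Local Notation mR := (measurableTypeR R).
Local Notation R2 := (mR * mR)%type.
Local Notation M4 := ((mR * mR) * (mR * mR))%type.
Local Notation L := (@lebesgue_measure R).
Local Notation affine := ('cV[R]_2 * 'M[R]_2)%type.
Local Notation HR := (@haar_Rstar R).
Local Notation RS := (@Rstar R).
Local Notation HG := (@haar_G2 R).
Local Notation m3 := (@leb4 R \x @leb2 R)%E.
Local Notation inv_pullback := (pullback (@inv_weight R) (@inv_map R)).

Definition onG (f : affine -> R[i]) : M4 * R2 -> R[i] := weighted (@Gcoord R) (@Gweight R) f.

Lemma cmeasurable_onG f : cmeasurable (@G2 R) f -> cmeasurable setT (onG f).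
Proof.
exact: (cmeasurable_weighted (@measurable_G2 R) (@measurable_Gcoord R) (@measurable_Gweight R)
  (@Gweight_G2 R)).
Qed.

Lemma sqnorm_onG f : cmeasurable (@G2 R) f -> sqnorm HG (@G2 R) f = sqnorm m3 setT (onG f).
Proof.
exact: (sqnorm_weighted (@measurable_G2 R) (@Gweight_ge0 R) (@Gweight_G2 R) (@transport_G2 R)).
Qed.

Lemma L2_onG f : L2 HG (@G2 R) f -> L2 m3 setT (onG f).
Proof. by move=> [mf fL]; split; [exact: cmeasurable_onG|rewrite -sqnorm_onG]. Qed.

Lemma inner_onG f f' : cmeasurable (@G2 R) f -> cmeasurable (@G2 R) f' ->
  inner HG (@G2 R) f f' = cintegral m3 setT (fun z => onG f z * (onG f' z)^*%R).
Proof.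
exact: (inner_weighted (@measurable_G2 R) (@Gweight_ge0 R) (@Gweight_G2 R) (@transport_G2 R)).
Qed.

Lemma represents_linear a (F F' : affine -> mR -> R[i]) (phi phi' : R2 * mR -> R[i]) :
  represents F phi -> represents F' phi' ->
  represents (fun k t => a * F k t + F' k t) (fun y => a * phi y + phi' y).
Proof.
move=> [mphi rep] [mphi' rep']; split; first by mfun.
move=> p; apply: filterS2 (rep p) (rep' p) => t -> ->.
by rewrite /weightedR /weighted; ring.
Qed.

Let L2_Rstar_linear a (h h' : mR -> R[i]) : L2 HR RS h -> L2 HR RS h' ->
  L2 HR RS (fun t => a * h t + h' t).
Proof.
move=> Lh Lh'; have [mh _] := Lh; have [mh' _] := Lh'.
have m : cmeasurable RS (fun t => a * h t + h' t).
  by apply: cmeasurableD => //; apply: cmeasurableM => //; exact: cmeasurable_cst.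
split => //; rewrite sqnorm_weightedR//.
have [_] := L2D (L2Z a (L2_weightedR Lh)) (L2_weightedR Lh'); congr (_ < _)%E.
by apply: eq_integral => t _; congr (csqr _)%:E; rewrite /weightedR /weighted; ring.
Qed.

Lemma L2K_linear a (F F' : affine -> mR -> R[i]) : L2K F -> L2K F' ->
  L2K (fun k t => a * F k t + F' k t).
Proof.
move=> LF LF'; have [phi rep] := representable LF; have [phi' rep'] := representable LF'.
have LD := L2D (L2Z a (L2_rep LF rep)) (L2_rep LF' rep').
apply: (L2K_represents _ (represents_linear a rep rep')); last by case: LD.
by move=> k Kk; apply: L2_Rstar_linear; apply: L2_fiber.
Qed.

Variables (eta : 'rV[R]_2 -> R[i]) (g : mR -> R[i]).
Hypotheses (Leta : L2 (@leb_rV R) (@O R) eta) (Lg : L2 L (@O1 R) g).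
Hypotheses (eta1 : inner (@leb_rV R) (@O R) eta eta = 1) (g1 : inner L (@O1 R) g g = 1).
Hypotheses (LgR : L2 HR RS g) (LE : L2K (coherent_vector eta g)).
Local Notation E := (coherent_vector eta g).
Implicit Types (F : affine -> mR -> R[i]) (phi : R2 * mR -> R[i]).

Let planar1 : sqnorm (@leb2 R) setT (planar eta) = 1%E.
Proof. by rewrite -sqnorm_planar; [exact: sqnorm_inner1|case: Leta]. Qed.

Let linear11 : sqnorm L setT (linear1 g) = 1%E.
Proof. by rewrite -sqnorm_linear1; [exact: sqnorm_inner1|case: Lg]. Qed.

(** [g] has norm 1 in L^2 of [O1], and multiplication by |t|^(-1/2), which is positive off t = 0,
    cannot make it vanish almost everywhere. *)
Let weightedR_neq0 : sqnorm L setT (weightedR g) != 0%E.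
Proof.
have [mg _] := LgR; have mw := cmeasurable_weightedR mg.
have ml : cmeasurable setT (linear1 g) by apply: cmeasurable_linear1; case: Lg.
apply/eqP => /(sqnorm_eq0 mw) w0.
suff : sqnorm L setT (linear1 g) = 0%E.
  by rewrite linear11 => /eqP; rewrite onee_eq0.
rewrite (ae_eq_sqnorm ml (cmeasurable_cst _ 0)).
  by rewrite /sqnorm; under eq_integral do rewrite csqr0; rewrite integral0.
apply: filterS2 w0 (ae_neq0 R) => t + t0; rewrite linear1E// /weightedR /weighted => /eqP.
rewrite mulf_eq0 => /orP[|/eqP//] /eqP/(congr1 (@complex.Re R)) /= /eqP.
by rewrite sqrtr_eq0 leNgt /Rweight invr_gt0 normr_gt0 t0.
Qed.

(** The squared norm of E factors as this integral times the squared norm of [weightedR g]. The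
    product is finite and the second factor is nonzero, so the first is finite. *)
Lemma coherent_moment :
  (\int[@leb2 R]_p ((nsq p)%:E * (csqr (planar eta p))%:E) < +oo)%E.
Proof.
have [me _] := Leta; have [mg _] := LgR.
have rep := represents_coherent me mg.
have [_ eoo] := L2_rep LE rep.
have mp := cmeasurable_planar me; have mw := cmeasurable_weightedR mg.
have mq : cmeasurable setT (fun p : R2 => (Num.sqrt (nsq p))%:C * (planar eta p)^*%R).
  by rewrite /nsq; mfun.
move: eoo; rewrite [X in (X < _)%E](sqnorm_tensor (@leb2 R) L mq mw) => eoo.
have -> : (\int[@leb2 R]_p ((nsq p)%:E * (csqr (planar eta p))%:E))%E =
   sqnorm (@leb2 R) setT (fun p : R2 => (Num.sqrt (nsq p))%:C * (planar eta p)^*%R).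
  by apply: eq_integral => p _; move: (planar eta p) => z;
    rewrite csqrM csqr_real csqrJ sqr_sqrtr ?nsq_ge0// EFinM.
move: eoo weightedR_neq0 (sqnorm_ge0 L setT (weightedR g)); rewrite ltNge => + n0 g0.
case: (sqnorm (@leb2 R) _ _) (sqnorm_ge0 (@leb2 R) setT (fun p : R2 =>
  (Num.sqrt (nsq p))%:C * (planar eta p)^*%R)) => [r _ _| _|//].
  by rewrite ltry.
by rewrite gt0_mulye ?leey// lt_neqAle eq_sym n0.
Qed.

Let tens phi := tensor phi (planar eta) (linear1 g).

(** The square root of the Haar density is |det A|^(-3/2), the inverse of the factor in
    [V_transform]. At singular matrices both sides are 0. *)
Lemma V_onG F phi z : L2K F -> represents F phi ->
  onG (V E F) z = transform (inv_pullback (tens phi)) z.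
Proof.
move=> LF rep; case: z => A x; have [d0|d0] := eqVneq (det4 A) 0.
  rewrite (transform_tensor3_det0 _ _ _ _ d0).
  by rewrite /onG /weighted /Gweight /= d0 normr0 invr0 mulr0 sqrtr0 mul0r.
rewrite /onG /weighted (V_transform LF rep Leta Lg LgR LE coherent_moment)//.
rewrite mulrA -rmorphM /=.
have n0 : 0 < `|det4 A| by rewrite normr_gt0.
suff -> : Num.sqrt (Gweight (A, x)) * Num.sqrt `|det4 A| ^+ 3 = 1 by rewrite mul1r.
rewrite /Gweight /= -invfM -exprSr sqrtrV ?exprn_ge0 ?ltW//.
have -> : Num.sqrt (`|det4 A| ^+ 3) = Num.sqrt `|det4 A| ^+ 3.
  by rewrite exprSr sqrtrM ?exprn_ge0// sqrtr_sqr normr_id exprSr sqr_sqrtr.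
by rewrite mulVf// expf_neq0// gt_eqF// sqrtr_gt0.
Qed.

Lemma V_G2 F phi y : L2K F -> represents F phi -> G2 y ->
  V E F y = (Num.sqrt `|det4 (Gparam y).1| ^+ 3)%:C * transform (inv_pullback (tens phi)) (Gparam
    y).
Proof.
move=> LF rep Gy; rewrite -[in LHS](GparamK y); case Ey : (Gparam y) => [A x].
rewrite (V_transform LF rep Leta Lg LgR LE coherent_moment)//.
by apply/(Gcoord_G2 (A, x)); rewrite -Ey GparamK.
Qed.

Let reg F phi : L2K F -> represents F phi -> regular (inv_pullback (tens phi)).
Proof. by move=> LF rep; exact: (regular_rep LF rep Leta Lg LgR coherent_moment). Qed.

Lemma cmeasurable_V F : L2K F -> cmeasurable (@G2 R) (V E F).
Proof.
move=> LF; have [phi rep] := representable LF.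
have [mt _] := L2_transform (reg LF rep).
have mG := @measurable_Gparam R.
apply: (eq_cmeasurable (f := fun y => (Num.sqrt `|det4 (Gparam y).1| ^+ 3)%:C * transform
  (inv_pullback (tens phi)) (Gparam y))).
  by move=> y /set_mem Gy; rewrite (V_G2 LF rep).
apply: (cmeasurableS measurableT) => //; apply: cmeasurableM.
  by rewrite /det4; mfun.
exact: (cmeasurable_comp mt mG).
Qed.

Lemma V_isometry F : L2K F ->
  sqnorm HG (@G2 R) (V E F) = vsqnorm (@haar_K R) (@K R) HR RS F.
Proof.
move=> LF; have [phi rep] := representable LF.
rewrite (sqnorm_onG (cmeasurable_V LF)).
have -> : onG (V E F) = transform (inv_pullback (tens phi)) by apply/funext => z; exact: V_onG.
have [mphi _] := rep; have [mp _] := L2_planar Leta; have [ml _] := L2_linear1 Lg.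
have mlJ : cmeasurable setT (fun t => (linear1 g t)^*%R) by mfun.
have mpl : cmeasurable setT (fun y : R2 * mR => planar eta y.1 * (linear1 g y.2)^*%R) by mfun.
have mtens : cmeasurable setT (tens phi) by rewrite /tens /tensor; mfun.
rewrite (transform_isometry (reg LF rep)) (sqnorm_pullback (@inv_transport R) mtens).
rewrite [LHS](sqnorm_tensor (@leb3 R) (@leb3 R) mphi mpl).
rewrite [X in (_ * X)%E](sqnorm_tensor (@leb2 R) L mp mlJ) planar1.
rewrite (_ : sqnorm L setT _ = sqnorm L setT (linear1 g)); last first.
  by apply: eq_integral => t _; rewrite csqrJ.
by rewrite linear11 !mule1 (vsqnorm_represents (L2_fiber LF) rep).
Qed.

Lemma L2_V F : L2K F -> L2 HG (@G2 R) (V E F).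
Proof.
by move=> LF; split; [exact: cmeasurable_V|rewrite V_isometry//; case: LF].
Qed.

Lemma V_linear a F F' y : L2K F -> L2K F' -> G2 y ->
  V E (fun k t => a * F k t + F' k t) y = a * V E F y + V E F' y.
Proof.
move=> LF LF' Gy; have [phi rep] := representable LF; have [phi' rep'] := representable LF'.
rewrite (V_G2 (L2K_linear a LF LF') (represents_linear a rep rep') Gy).
rewrite (V_G2 LF rep Gy) (V_G2 LF' rep' Gy).
have -> : tens (fun y => a * phi y + phi' y) = (fun y => a * tens phi y + tens phi' y).
  by apply/funext => z; rewrite /tens /tensor; ring.
rewrite pullback_linear (transform_linear a (reg LF rep) (reg LF' rep')).
move: (transform _ _) (transform _ _) (_ ^+ 3) => z z' r; ring.
Qed.

Lemma V_linear_isometry : linear_isometry (V E).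
Proof.
split.
- by move=> F; exact: L2_V.
- by move=> a F F' LF LF'; apply: aeW => y Gy; exact: V_linear.
- by move=> F; exact: V_isometry.
Qed.

End voice_isometry.

(** * Orthogonality and totality *)

Section polarization.
Context d (T : measurableType d) (R : realType) (mu : {measure set T -> \bar R}).
Implicit Types f g : T -> R[i].

Lemma sqnorm_expand c f g : L2 mu setT f -> L2 mu setT g ->
  sqnorm mu setT (fun x => c * g x + f x) =
  (csqr c * fine (sqnorm mu setT g) + fine (sqnorm mu setT f) +
   2 * Re (c^*%R * cintegral mu setT (fun x => f x * (g x)^*%R)))%:E.
Proof.
move=> Lf Lg; have [mf fL] := Lf; have [mg gL] := Lg.
have fgi := cintegrableM_L2 Lf (L2J Lg).
have [ri _] := (cintegrableP _ _).1 (cintegrableZ c^*%R fgi).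
have mfE := measurable_csqrE mf; have mgE := measurable_csqrE mg.
have fi : mu.-integrable setT (fun x => (csqr (f x))%:E).
  apply/integrableP; split => //; under eq_integral do rewrite gee0_abs ?lee_fin ?csqr_ge0//.
  exact: fL.
have gi : mu.-integrable setT (fun x => (csqr (g x))%:E).
  apply/integrableP; split => //; under eq_integral do rewrite gee0_abs ?lee_fin ?csqr_ge0//.
  exact: gL.
have -> : sqnorm mu setT (fun x => c * g x + f x) =
   (\int[mu]_x (((csqr c)%:E * (csqr (g x))%:E + (csqr (f x))%:E) +
      2%:E * (Re (c^*%R * (f x * (g x)^*%R)))%:E))%E.
  apply: eq_integral => x _; rewrite -!EFinM -!EFinD; congr _%:E.
  by rewrite /csqr !(ReD, ImD, ReM, ImM, ReJ, ImJ); ring.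
have gci : mu.-integrable setT (fun x => ((csqr c)%:E * (csqr (g x))%:E)%E) by exact: integrableZl.
rewrite integralD//; [|exact: integrableD|exact: integrableZl].
rewrite integralD// !integralZl//.
have gE : (\int[mu]_x (csqr (g x))%:E = (fine (sqnorm mu setT g))%:E)%E.
  by rewrite fineK// ge0_fin_numE// sqnorm_ge0.
have fE : (\int[mu]_x (csqr (f x))%:E = (fine (sqnorm mu setT f))%:E)%E.
  by rewrite fineK// ge0_fin_numE// sqnorm_ge0.
have rE : (\int[mu]_x (Re (c^*%R * (f x * (g x)^*%R)))%:E =
   (Re (c^*%R * cintegral mu setT (fun x => f x * (g x)^*%R)))%:E)%E.
  rewrite -(cintZ _ fgi) /= /Rintegral fineK//; exact: integrable_fin_num.
by rewrite gE fE rE -!EFinM -!EFinD.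
Qed.

End polarization.

(** Expanding the norm of c g + f isolates Re (conj c times the inner product); c = 1 and c = i
    recover its real and imaginary parts. An isometry known on a span thus preserves inner products,
    even between different measure spaces. *)
Lemma cint_polarization d d' (T : measurableType d) (T' : measurableType d') (R : realType)
    (mu : {measure set T -> \bar R}) (mu' : {measure set T' -> \bar R})
    (f g : T -> R[i]) (f' g' : T' -> R[i]) :
  L2 mu setT f -> L2 mu setT g -> L2 mu' setT f' -> L2 mu' setT g' ->
  sqnorm mu setT f = sqnorm mu' setT f' -> sqnorm mu setT g = sqnorm mu' setT g' ->
  (forall c, sqnorm mu setT (fun x => c * g x + f x) = sqnorm mu' setT (fun x => c * g' x +
    f' x)) ->
  cintegral mu setT (fun x => f x * (g x)^*%R) = cintegral mu' setT (fun x => f' x * (g' x)^*%R).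
Proof.
move=> Lf Lg Lf' Lg' nf ng h.
have key c : Re (c^*%R * cintegral mu setT (fun x => f x * (g x)^*%R)) =
    Re (c^*%R * cintegral mu' setT (fun x => f' x * (g' x)^*%R)).
  have := h c; rewrite !sqnorm_expand// nf ng => -[] /addrI.
  by apply: mulfI; rewrite pnatr_eq0.
apply: complexP.
  by have := key 1; rewrite conjC1 !mul1r.
have := key (0 +i* 1); rewrite !ReM !ReJ !ImJ /= !mul0r !sub0r !mulN1r !opprK.
by [].
Qed.

Section linear_span.
Context d (T : measurableType d) (R : realType) (mu : {measure set T -> \bar R}).
Variables (I : Type) (e : I -> T -> R[i]).

Definition lspan : set (T -> R[i]) :=
  [set f | exists s : seq (R[i] * I), f = fun x => \sum_(p <- s) p.1 * e p.2 x].

Lemma lspan_ind (S : set (T -> R[i])) : S (fun=> 0) ->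
  (forall a i f, S f -> S (fun x => a * e i x + f x)) -> lspan `<=` S.
Proof.
move=> S0 Sl _ [s ->]; elim: s => [|p s ih]; first by under eq_fun do rewrite big_nil.
by under eq_fun do rewrite big_cons; exact: Sl.
Qed.

Lemma lspan_linear a f g : lspan f -> lspan g -> lspan (fun x => a * f x + g x).
Proof.
move=> [s ->] [s' ->]; exists ([seq (a * p.1, p.2) | p <- s] ++ s').
apply/funext => x; rewrite big_cat big_map mulr_sumr; congr (_ + _).
by apply: eq_bigr => p _; rewrite mulrA.
Qed.

Lemma lspan_basis i : lspan (e i).
Proof. by exists [:: (1, i)]; apply/funext => x; rewrite big_seq1 mul1r. Qed.

Lemma lspan0 : lspan (fun=> 0).
Proof. by exists [::]; apply/funext => x; rewrite big_nil. Qed.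

Lemma lspan_subspace : (forall i, L2 mu setT (e i)) -> subspace mu lspan.
Proof.
move=> Le; split; last by move=> a f g; exact: lspan_linear.
apply: lspan_ind; first exact: L20.
by move=> a i f Lf; apply: L2D => //; exact: L2Z.
Qed.

End linear_span.

Section tensor_span.
Context d1 d2 (T1 : measurableType d1) (T2 : measurableType d2) (R : realType).
Variables (m1 : {sigma_finite_measure set T1 -> \bar R}).
Variables (m2 : {sigma_finite_measure set T2 -> \bar R}).
Variables (I J : Type) (a : I -> T1 -> R[i]) (b : J -> T2 -> R[i]).
Hypotheses (La : forall i, L2 m1 setT (a i)) (Lb : forall j, L2 m2 setT (b j)).
Hypothesis a_dense : forall f, L2 m1 setT f -> approx m1 (lspan a) f.
Hypothesis b_dense : forall f, L2 m2 setT f -> approx m2 (lspan b) f.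

Lemma tensor_span_dense f : L2 (m1 \x m2)%E setT f ->
  approx (m1 \x m2)%E (lspan (fun k : I * J => fun z => a k.1 z.1 * b k.2 z.2)) f.
Proof.
have Lt (k : I * J) : L2 (m1 \x m2)%E setT (fun z => a k.1 z.1 * b k.2 z.2).
  exact: (L2_tensor (La k.1) (Lb k.2)).
have [sub1 _] := lspan_subspace La; have [sub2 _] := lspan_subspace Lb.
apply: (approx_tensor sub1 sub2 (lspan_subspace Lt) a_dense b_dense).
move=> f1 f2 f1s f2s; apply: approx_self.
set S := lspan _.
suff : lspan a `<=` [set f1 | S (fun z => f1 z.1 * f2 z.2)] by exact.
apply: lspan_ind => [|c i {f1s}f1 /= f1s].
  have z0 : (fun z : T1 * T2 => 0 * f2 z.2) = fun=> 0 by apply/funext => z; rewrite mul0r.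
  by rewrite /= z0; exact: lspan0.
have ei : S (fun z => a i z.1 * f2 z.2).
  suff : lspan b `<=` [set f2 | S (fun z => a i z.1 * f2 z.2)] by exact.
  apply: lspan_ind => [|c' j f3 /= f3s].
    have z0 : (fun z : T1 * T2 => a i z.1 * 0) = fun=> 0 by apply/funext => z; rewrite mulr0.
    by rewrite /= z0; exact: lspan0.
  rewrite (_ : (fun z => _) = fun z => c' * (a i z.1 * b j z.2) + a i z.1 * f3 z.2); last first.
    by apply/funext => z /=; ring.
  apply: lspan_linear => //; exact: (lspan_basis _ (i, j)).
rewrite (_ : (fun z => _) = fun z => c * (a i z.1 * f2 z.2) + f1 z.1 * f2 z.2); last first.
  by apply/funext => z /=; ring.
exact: lspan_linear.
Qed.

End tensor_span.

(** * Orthogonality of the images and density of their sum *)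

Section direct_sum.
Context (R : realType) (I J : Type).
Local Notation mR := (measurableTypeR R).
Local Notation R2 := (mR * mR)%type.
Local Notation M4 := ((mR * mR) * (mR * mR))%type.
Local Notation L := (@lebesgue_measure R).
Local Notation affine := ('cV[R]_2 * 'M[R]_2)%type.
Local Notation HR := (@haar_Rstar R).
Local Notation RS := (@Rstar R).
Local Notation HG := (@haar_G2 R).
Local Notation m3 := (@leb4 R \x @leb2 R)%E.
Local Notation m0 := (@leb3 R \x @leb3 R)%E.
Local Notation inv_pullback := (pullback (@inv_weight R) (@inv_map R)).
Lemma KcoordK (p : R2) : nsq p != 0 -> Kparam (Kcoord p) = p.
Proof.
case: p => a b; rewrite /Kparam /Kcoord /Kpoint /gamma enorm_rv2 sqr_sqrtr ?nsq_ge0//.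
rewrite !mxE /nsq /= => n0.
have n1 : (a / (a ^+ 2 + b ^+ 2)) ^+ 2 + (b / (a ^+ 2 + b ^+ 2)) ^+ 2 = (a ^+ 2 + b ^+ 2)^-1.
  by field.
by rewrite ![_^-1 * _]mulrC n1 invrK !divfK.
Qed.

(** The fibres of an L^2 function are square integrable for almost every p only, whereas a vector
    must have this at every point of [K]. Setting [phi] to 0 over the null set of bad p, and at p =
    0, gives a function that represents a vector exactly. *)
Lemma represented_modification (phi : R2 * mR -> R[i]) : L2 (@leb3 R) setT phi ->
  exists F psi, [/\ L2K F, represents F psi & {ae @leb3 R, forall y, psi y = phi y}].
Proof.
move=> [mphi phiL]; have mN := measurable_sqnormr L mphi.
pose A := [set p : R2 | (sqnorm L setT (fun t => phi (p, t)) < +oo)%E] `&` [set p | nsq p != 0].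
have mA : measurable A.
  apply: measurableI.
    rewrite -[X in measurable X]setTI; exact: (emeasurable_fun_infty_o (measurableT) mN).
  have mn : measurable_fun setT (@nsq R) by rewrite /nsq; mfun.
  rewrite (_ : [set p | _] = ~` (@nsq R @^-1` [set 0])).
    by apply: measurableC; rewrite -[X in measurable X]setTI; exact: mn.
  by apply/seteqP; split => p /= /eqP.
pose psi (y : R2 * mR) := cindic A y.1 * phi y.
have mpsi : cmeasurable setT psi.
  by rewrite /psi; have mi := @cmeasurable_cindic _ _ R _ mA; mfun.
have aeA : {ae @leb2 R, forall p, A p}.
  apply: filterS2 (integral_lty_ae mN _ _) (ae_leb2_neq0 R) => //.
  - by move=> p; exact: sqnorm_ge0.
  - by rewrite -(sqnorm_prod1 (@leb2 R) L mphi).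
have aep : {ae @leb3 R, forall y, psi y = phi y}.
  have aeA' : {ae @leb3 R, forall y, A y.1} by exact: (ae_prod1 L aeA).
  apply: filterS aeA' => y Ay.
  by rewrite /psi /cindic indicE mem_set// mul1r.
have psi0 p t : nsq p = 0 -> psi (p, t) = 0.
  move=> n0; rewrite /psi /cindic indicE memNset ?mul0r// => -[_ /=].
  by rewrite n0 eqxx.
have psip p : (sqnorm L setT (fun t => psi (p, t)) < +oo)%E.
  have [pA|pA] := pselect (A p).
    rewrite (_ : sqnorm _ _ _ = sqnorm L setT (fun t => phi (p, t))); first by case: pA.
    by apply: eq_integral => t _; rewrite /psi /cindic indicE mem_set//= mul1r.
  rewrite (_ : sqnorm _ _ _ = sqnorm L setT (fun=> 0 : R[i])); first by have [] := L20 L.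
  by apply: eq_integral => t _; rewrite /psi /cindic indicE memNset//= mul0r.
pose F (k : affine) (t : mR) : R[i] :=
  (Num.sqrt (nsq (Kparam k)))%:C * ((Num.sqrt `|t|)%:C * psi (Kparam k, t)).
have wF k t : t != 0 -> weightedR (F k) t = (Num.sqrt (nsq (Kparam k)))%:C * psi (Kparam k, t).
  move=> t0; rewrite /weightedR /weighted /F /Rweight.
  have : (Num.sqrt `|t|^-1)%:C * (Num.sqrt `|t|)%:C = 1 :> R[i].
    by rewrite -rmorphM /= -sqrtrM ?invr_ge0// mulVf ?sqrtr1// normr_eq0.
  move: (psi _) (_%:C) (_%:C) (_%:C) => z a b c ab.
  by rewrite mulrCA [c * (b * z)]mulrA ab mul1r.
have mFk k : cmeasurable setT (F k).
  have mp : cmeasurable setT (fun t => psi (Kparam k, t)) by exact: cmeasurable_pairl.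
  by rewrite /F; move: (Num.sqrt (nsq _)) => c; mfun.
have rep : represents F psi.
  split => // p; apply: filterS (ae_neq0 R) => t t0.
  have [n0|n0] := eqVneq (nsq p) 0; first by rewrite psi0// n0 invr0 sqrtr0 mul0r.
  rewrite wF// KcoordK// mulrA -rmorphM /= -sqrtrM ?invr_ge0 ?nsq_ge0// mulVf// sqrtr1 mul1r //.
have FL k : K k -> L2 HR RS (F k).
  move=> Kk; have mk : cmeasurable RS (F k) by apply: (cmeasurableS measurableT).
  split => //; rewrite sqnorm_weightedR//.
  have mp : cmeasurable setT (fun t => psi (Kparam k, t)) by exact: cmeasurable_pairl.
  have mcp : cmeasurable setT (fun t => (Num.sqrt (nsq (Kparam k)))%:C * psi (Kparam k, t)).
    by apply: cmeasurableM => //; exact: cmeasurable_cst.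
  have ae : {ae L, forall t, weightedR (F k) t = (Num.sqrt (nsq (Kparam k)))%:C * psi (Kparam k,
    t)}.
    by apply: filterS (ae_neq0 R) => t; exact: wF.
  rewrite (ae_eq_sqnorm (cmeasurable_weightedR mk) mcp ae).
  by have [] := L2Z (Num.sqrt (nsq (Kparam k)))%:C (conj mp (psip (Kparam k))).
exists F, psi; split => //; apply: (L2K_represents FL rep).
by rewrite (ae_eq_sqnorm mpsi mphi aep).
Qed.

Variables (eta : I -> 'rV[R]_2 -> R[i]) (g : J -> mR -> R[i]).
Hypotheses (eta_basis : orthonormal_basis (@leb_rV R) (@O R) eta)
  (g_basis : orthonormal_basis L (@O1 R) g)
  (g_Rstar : forall j : J, L2 HR RS (g j))
  (E_L2K : forall (i : I) (j : J), L2K (coherent_vector (eta i) (g j))).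

Let Leta i : L2 (@leb_rV R) (@O R) (eta i). Proof. by case: eta_basis. Qed.
Let eta1 i : inner (@leb_rV R) (@O R) (eta i) (eta i) = 1. Proof. by case: eta_basis. Qed.
Let Lg j : L2 L (@O1 R) (g j). Proof. by case: g_basis. Qed.
Let g1 j : inner L (@O1 R) (g j) (g j) = 1. Proof. by case: g_basis. Qed.

Let E (k : I * J) := coherent_vector (eta k.1) (g k.2).
Let tens phi (k : I * J) := tensor phi (planar (eta k.1)) (linear1 (g k.2)).

Let moment k := coherent_moment (Leta k.1) (Lg k.2) (g1 k.2) (g_Rstar k.2) (E_L2K k.1 k.2).

Let L2_tens phi k : L2 (@leb3 R) setT phi -> L2 m0 setT (tens phi k).
Proof. by move=> Lphi; exact: (L2_tensor3 Lphi (L2_planar (Leta k.1)) (L2_linear1 (Lg k.2))). Qed.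

Let reg k F phi : L2K F -> represents F phi -> regular (inv_pullback (tens phi k)).
Proof.
move=> LF rep; exact: (regular_rep LF rep (Leta k.1) (Lg k.2) (g_Rstar k.2) (moment k)).
Qed.

Let onGV k F phi : L2K F -> represents F phi ->
  onG (V (E k) F) = transform (inv_pullback (tens phi k)).
Proof.
move=> LF rep; apply/funext => z.
exact: (V_onG (Leta k.1) (Lg k.2) (g1 k.2) (g_Rstar k.2) (E_L2K k.1 k.2) z LF rep).
Qed.

Let mV k F : L2K F -> cmeasurable (@G2 R) (V (E k) F).
Proof. exact: (cmeasurable_V (Leta k.1) (Lg k.2) (g1 k.2) (g_Rstar k.2) (E_L2K k.1 k.2)). Qed.

Let sqnorm_reg H : L2 m0 setT H -> regular (inv_pullback H) ->
  sqnorm m3 setT (transform (inv_pullback H)) = sqnorm m0 setT H.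
Proof.
move=> [mH _] rH; rewrite transform_isometry//.
exact: (sqnorm_pullback (@inv_transport R) mH).
Qed.

Let inner_onG_eq (f f' : affine -> R[i]) (u u' : M4 * R2 -> R[i]) :
  cmeasurable (@G2 R) f -> cmeasurable (@G2 R) f' -> onG f = u -> onG f' = u' ->
  inner HG (@G2 R) f f' = cintegral m3 setT (fun z => u z * (u' z)^*%R).
Proof. by move=> mf mf' <- <-; exact: inner_onG. Qed.

(** Polarization transfers the inner product to the tensors, where it is a product of three inner
    products; for distinct pairs of indices, that of the functions eta or that of the functions g is
    0. *)
Lemma V_orthogonal k k' F F' : k <> k' -> L2K F -> L2K F' ->
  inner HG (@G2 R) (V (E k) F) (V (E k') F') = 0.
Proof.
move=> kk' LF LF'; have [phi rep] := representable LF; have [phi' rep'] := representable LF'.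
have e1 := onGV k LF rep; have e2 := onGV k' LF' rep'.
rewrite (inner_onG_eq (mV k LF) (mV k' LF') e1 e2).
have Lphi := L2_rep LF rep; have Lphi' := L2_rep LF' rep'.
have r := reg k LF rep; have r' := reg k' LF' rep'.
have LH := L2_tens k Lphi; have LH' := L2_tens k' Lphi'.
rewrite (@cint_polarization _ _ _ _ _ m3 m0 _ _ (tens phi k) (tens phi' k')
  (L2_transform r) (L2_transform r') LH LH' (sqnorm_reg LH r) (sqnorm_reg LH' r')); last first.
  move=> c; have Lc : L2 m0 setT (fun z => c * tens phi' k' z + tens phi k z).
    by apply: L2D => //; exact: L2Z.
  have rc : regular (inv_pullback (fun z => c * tens phi' k' z + tens phi k z)).
    by rewrite pullback_linear; exact: regular_linear.
  apply: etrans _ (sqnorm_reg Lc rc); congr (sqnorm m3 setT _).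
  by rewrite pullback_linear (transform_linear c r' r).
have La := L2_planar (Leta k.1); have La' := L2_planar (Leta k'.1).
have Lb := L2_linear1 (Lg k.2); have Lb' := L2_linear1 (Lg k'.2).
have ia := cintegrableM_L2 La (L2J La').
have ib := cintegrableM_L2 (L2J Lb) Lb'.
have iphi := cintegrableM_L2 Lphi (L2J Lphi').
have iab := cintegrable_tensor (m1 := @leb2 R) (m2 := L) ia ib.
transitivity (cintegral m0 setT (fun z => (phi z.1 * (phi' z.1)^*%R) *
    ((planar (eta k.1) z.2.1 * (planar (eta k'.1) z.2.1)^*%R) *
     ((linear1 (g k.2) z.2.2)^*%R * linear1 (g k'.2) z.2.2)))).
  apply: eq_cint => z; rewrite /tens /tensor.
  move: (phi _) (phi' _) (planar _ _) (planar _ _) (linear1 _ _) (linear1 _ _) => x x' y y' w w'.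
  by rewrite !conjM conjCK; ring.
rewrite (cint_tensor (m1 := @leb3 R) (m2 := @leb3 R) iphi iab).
rewrite [X in _ * X](cint_tensor (m1 := @leb2 R) (m2 := L) ia ib).
have [me _] := Leta k.1; have [me' _] := Leta k'.1.
have [mg _] := Lg k.2; have [mg' _] := Lg k'.2.
have [k1|k1] := pselect (k.1 = k'.1).
  have k2 : k'.2 <> k.2.
    by move=> k2; apply: kk'; move: k1 k2; case: (k) (k') => ? ? [? ?] /= -> ->.
  rewrite [X in _ * (_ * X)](_ : _ = 0) ?mulr0//.
  have [_ _ orth _] := g_basis.
  rewrite -(orth _ _ k2) inner_linear1//; apply: eq_cint => t; exact: mulrC.
rewrite [X in _ * (X * _)](_ : _ = 0) ?mul0r ?mulr0//.
have [_ _ orth _] := eta_basis.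
by rewrite -(orth _ _ k1) inner_planar.
Qed.

(** For these functions, dense by [represented_modification], the transform of each tensor is
    exactly the coordinate form of some V_E F. *)
Definition good (phi : R2 * mR -> R[i]) : Prop :=
  L2 (@leb3 R) setT phi /\ exists2 F, L2K F & represents F phi.

Let good_dense f : L2 (@leb3 R) setT f -> approx (@leb3 R) good f.
Proof.
move=> Lf eps eps0; have [F [psi [LF rep ae]]] := represented_modification Lf.
exists psi; first by split; [exact: L2_rep LF rep|exists F].
have [mf _] := Lf; have [mp _] := rep.
rewrite /sqdist (@ae_eq_sqnorm _ _ _ _ _ (fun=> 0)).
- by rewrite /sqnorm; under eq_integral do rewrite csqr0; rewrite integral0.
- exact: cmeasurableB.
- exact: cmeasurable_cst.
- by apply: filterS ae => y ->; rewrite subrr.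
Qed.

Let planar_dense f : L2 (@leb2 R) setT f -> approx (@leb2 R) (lspan (fun i => planar (eta i))) f.
Proof.
move=> [mf fL] eps eps0.
pose f0 (w : 'rV[R]_2) := f (w 0 0, w 0 1).
have m0 (j : 'I_2) : measurable_fun setT (fun w : 'rV[R]_2 => w 0 j) by exact: measurable_mx_entry.
have mf0 : cmeasurable (@O R) f0.
  apply: (cmeasurableS measurableT) => //.
  by apply: (cmeasurable_comp mf); apply: mf_pair; exact: m0.
have pf0 : {ae @leb2 R, forall p, planar f0 p = f p}.
  by apply: filterS (ae_leb2_neq0 R) => -[a b] n0; rewrite planarE// /f0 !mxE.
have mpf := cmeasurable_planar mf0.
have Lf0 : L2 (@leb_rV R) (@O R) f0.
  by split => //; rewrite sqnorm_planar// (ae_eq_sqnorm mpf mf pf0).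
have [_ _ _ dense] := eta_basis; have [s sd] := dense _ Lf0 _ eps0.
exists (fun x => \sum_(p <- s) p.1 * planar (eta p.2) x); first by exists s.
apply: le_lt_trans sd; rewrite /sqdist.
have mS : cmeasurable (@O R) (fun x => \sum_(p <- s) p.1 * eta p.2 x).
  by apply: cmeasurable_sum => p; apply: cmeasurableM; [exact: cmeasurable_cst|case: (Leta p.2)].
have mB := cmeasurableB mf0 mS.
rewrite sqnorm_planar// le_eqVlt; apply/orP; left; apply/eqP; apply: ae_eq_sqnorm.
- apply: cmeasurableB => //; apply: cmeasurable_sum => p; apply: cmeasurableM; first exact:
  cmeasurable_cst.
  by apply: cmeasurable_planar; case: (Leta p.2).
- exact: cmeasurable_planar.
- apply: filterS2 pf0 (ae_leb2_neq0 R) => p <- n0; rewrite !planarE//; congr (_ - _).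
  by apply: eq_bigr => q _; rewrite planarE.
Qed.

Let linear1_dense f : L2 L setT f -> approx L (lspan (fun j t => (linear1 (g j) t)^*%R)) f.
Proof.
move=> Lf eps eps0; have [mf fL] := L2J Lf.
pose f0 (t : mR) := (f t)^*%R.
have mO1 : measurable (@O1 R) by apply: measurableC; exact: measurable_set1.
have mf0 : cmeasurable (@O1 R) f0 by apply: (cmeasurableS measurableT).
have pf0 : {ae L, forall t, linear1 f0 t = f0 t}.
  by apply: filterS (ae_neq0 R) => t n0; rewrite linear1E.
have mpf := cmeasurable_linear1 mf0.
have Lf0 : L2 L (@O1 R) f0.
  by split => //; rewrite sqnorm_linear1// (ae_eq_sqnorm mpf mf pf0).
have [_ _ _ dense] := g_basis; have [s sd] := dense _ Lf0 _ eps0.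
exists (fun x => \sum_(p <- [seq (p.1^*%R, p.2) | p <- s]) p.1 * (linear1 (g p.2) x)^*%R).
  by eexists.
apply: le_lt_trans sd; rewrite /sqdist.
have mS : cmeasurable (@O1 R) (fun x => \sum_(p <- s) p.1 * g p.2 x).
  by apply: cmeasurable_sum => p; apply: cmeasurableM; [exact: cmeasurable_cst|case: (Lg p.2)].
have mB := cmeasurableB mf0 mS; have [mf' _] := Lf.
rewrite sqnorm_linear1// (_ : sqnorm L setT (linear1 _) =
   sqnorm L setT (fun t => (linear1 (fun x => f0 x - \sum_(p <- s) p.1 * g p.2 x) t)^*%R));
     last first.
  by apply: eq_integral => t _; rewrite csqrJ.
rewrite le_eqVlt; apply/orP; left; apply/eqP; apply: ae_eq_sqnorm.
- apply: cmeasurableB => //; apply: cmeasurable_sum => p; apply: cmeasurableM; first exact: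
  cmeasurable_cst.
  by apply: cmeasurableJ; apply: cmeasurable_linear1; case: (Lg p.2).
- by apply: cmeasurableJ; exact: cmeasurable_linear1.
- apply: filterS (ae_neq0 R) => t t0; rewrite !linear1E// rmorphB /= /f0 conjCK; congr (_ - _).
  by rewrite big_map rmorph_sum /=; apply: eq_bigr => q _; rewrite linear1E// rmorphM.
Qed.

Let tens_dense H : L2 m0 setT H ->
  approx m0 (lspan (fun k : {phi | good phi} * (I * J) => tens (sval k.1) k.2)) H.
Proof.
have Lg0 (q : {phi | good phi}) : L2 (@leb3 R) setT (sval q) by case: q => phi [].
have Ll j : L2 L setT (fun t => (linear1 (g j) t)^*%R) by apply: L2J; exact: L2_linear1.
have Lp i : L2 (@leb2 R) setT (planar (eta i)) by exact: L2_planar.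
have pl_dense := tensor_span_dense (m1 := @leb2 R) (m2 := L) Lp Ll planar_dense linear1_dense.
have Lpl (k : I * J) : L2 (@leb3 R) setT (fun z =>
  planar (eta k.1) z.1 * (linear1 (g k.2) z.2)^*%R).
  exact: (L2_tensor (m1 := @leb2 R) (m2 := L) (g := fun t => (linear1 (g k.2) t)^*%R) (Lp k.1)).
have gd f : L2 (@leb3 R) setT f -> approx (@leb3 R) (lspan (fun q : {phi | good phi} => sval q)) f.
  move=> /good_dense; apply: approx_sub => phi gphi.
  exact: (lspan_basis (fun q : {phi | good phi} => sval q) (exist _ phi gphi)).
exact: (tensor_span_dense (m1 := @leb3 R) (m2 := @leb3 R) Lg0 Lpl gd pl_dense).
Qed.

Let Vl k a F F' (y : affine) := V_linear (Leta k.1) (Lg k.2) (g1 k.2) (g_Rstar k.2) (E_L2K k.1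
  k.2) a (F := F) (F' := F') (y := y).

Let V_image_scaled k a F : L2K F -> V_image (E k) (fun y => a * V (E k) F y).
Proof.
move=> LF; split; first by apply: cmeasurableM; [exact: cmeasurable_cst|exact: mV].
(* Linearity is available for combinations a F + F', so the multiple a F is written as (a - 1) F +
   F. *)
exists (fun x t => (a - 1) * F x t + F x t); first exact: L2K_linear.
apply: aeW => y Gy; apply/esym; apply: etrans (Vl k (a - 1) LF LF Gy) _.
by move: (V (E k) F y) => z; ring.
Qed.

(** Induction invariant along the span of tensors. Regularity is carried along because
    [transform_linear] applies to regular functions only. *)
Let realized H := regular (inv_pullback H) /\
  exists s : seq (affine -> R[i]),
    [/\ forall i, (i < size s)%N -> exists p, V_image (E p) (nth (fun=> 0) s i),
        cmeasurable (@G2 R) (fun x => \sum_(h <- s) h x) &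
        transform (inv_pullback H) = onG (fun x => \sum_(h <- s) h x)].

Let realized0 : realized (fun=> 0).
Proof.
have r0 : regular (inv_pullback (fun=> 0)).
  have -> : (fun=> 0 : R[i]) = tensor (fun=> 0) (fun=> 0) (fun=> 0) :> ((R2 * mR) * (R2 * mR) ->
    R[i]).
    by apply/funext => z; rewrite /tensor mul0r.
  apply: regular_tensor3; try exact: L20.
  - by move=> p; have [] := L20 L.
  - by under eq_integral do rewrite csqr0 mule0; rewrite integral0.
  - by under eq_integral do rewrite csqr0 mule0; rewrite integral0.
split => //; exists [::]; split => //.
  by under eq_fun do rewrite big_nil; exact: cmeasurable_cst.
have -> : inv_pullback (fun=> 0) = (fun z => -1 * inv_pullback (fun=> 0) z + inv_pullback (fun=>
  0) z).
  by apply/funext => z; rewrite /pullback mulN1r addNr mulr0.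
rewrite (transform_linear (-1) r0 r0); apply/funext => z.
by rewrite mulN1r addNr /onG /weighted big_nil mulr0.
Qed.

Let realized_span : lspan (fun k : {phi | good phi} * (I * J) => tens (sval k.1) k.2) `<=` realized.
Proof.
apply: lspan_ind => [|a [[phi [Lphi [F LF rep]]] k] H]; first exact: realized0.
rewrite [sval _]/= [X in tens _ X]/= => -[rH [s [sV ms sH]]].
have rk := reg k LF rep; split; first by rewrite pullback_linear; exact: regular_linear.
exists ((fun y => a * V (E k) F y) :: s); split.
- case=> [_|i]; [by exists k; exact: V_image_scaled|exact: sV].
- under eq_fun do rewrite big_cons; apply: cmeasurableD => //.
  by apply: cmeasurableM; [exact: cmeasurable_cst|exact: mV].
- rewrite pullback_linear (transform_linear a rk rH) sH; apply/funext => z.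
  rewrite -(congr1 (fun u => u z) (onGV k LF rep)) /onG /weighted big_cons.
  by move: (V _ _ _) (\sum_(_ <- _) _) (_%:C) => x y w; ring.
Qed.

(** The tensors are total and [transform] after the pull-back has dense range on their span, where
    each value is the coordinate form of a finite sum of elements of the images
    ([realized_span]). *)
Lemma V_image_dense f (eps : R) : L2 HG (@G2 R) f -> 0 < eps ->
  exists2 s : seq (affine -> R[i]),
    (forall i, (i < size s)%N -> exists p, V_image (E p) (nth (fun=> 0) s i)) &
    (sqdist HG (@G2 R) f (fun x => \sum_(h <- s) h x)%R < eps%:E)%E.
Proof.
move=> Lf eps0; pose S := lspan (fun k : {phi | good phi} * (I * J) => tens (sval k.1) k.2).
have Ltens (k : {phi | good phi} * (I * J)) : L2 m0 setT (tens (sval k.1) k.2).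
  by apply: L2_tens; case: k.1 => phi [].
have [SL _] := lspan_subspace Ltens.
have SLr H : S H -> L2 m0 setT H /\ regular (inv_pullback H).
  by move=> SH; split; [exact: SL|case: (realized_span SH)].
have [u [H SH <-]] := inv_transform_dense SLr tens_dense (L2_onG Lf) eps0.
have [_ [s [sV ms ->]]] := realized_span SH; exists s => //.
have [mf _] := Lf; rewrite /sqdist sqnorm_onG; last exact: cmeasurableB.
rewrite (_ : onG _ = fun z => onG f z - onG (fun x => \sum_(h <- s) h x) z)//.
by apply/funext => z; rewrite /onG /weighted mulrBr.
Qed.

End direct_sum.

(** * Closedness and invariance of the images *)

Section completeness.
Context d (T : measurableType d) (R : realType) (mu : {measure set T -> \bar R}).
Local Notation N2 := (sqnorm mu setT).

(** Let e_n = 2 C / 2^n, the sum of all increments allowed from n on. Then u - e increases, u + e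
    decreases, and e tends to 0, so both have the same limit and enclose it at each n. *)
Lemma geometric_cauchy (u : R ^nat) (C : R) :
  (forall n, `|u n.+1 - u n| <= C / 2 ^+ n) ->
  exists2 l, u n @[n --> \oo] --> l & forall n, `|l - u n| <= 2 * C / 2 ^+ n.
Proof.
move=> uC; pose e n := 2 * C / 2 ^+ n.
have C0 : 0 <= C by have := le_trans (normr_ge0 _) (uC 0%N); rewrite expr0 divr1.
have eS n : e n = e n.+1 + C / 2 ^+ n by rewrite /e exprS; field; rewrite expf_neq0.
have nd : {homo (fun n => u n - e n) : n m / (n <= m)%N >-> n <= m}.
  apply/nondecreasing_seqP => n; have := uC n; rewrite ler_norml => /andP[+ _].
  by rewrite (eS n); lra.
have ni : {homo (fun n => u n + e n) : n m / (n <= m)%N >-> m <= n}.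
  apply/nonincreasing_seqP => n; have := uC n; rewrite ler_norml => /andP[_].
  by rewrite (eS n); lra.
have e0 n : 0 <= e n by rewrite /e divr_ge0 ?exprn_ge0// mulr_ge0.
have ec : e n @[n --> \oo] --> 0.
  have := @cvg_geometric R (2 * C) 2^-1; rewrite ger0_norm ?invr_ge0// => /(_ _)h.
  rewrite (_ : e = geometric (2 * C) 2^-1); first by apply: h; lra.
  by apply/funext => n; rewrite /e /geometric /= exprVn.
have vc : cvgn (fun n => u n - e n).
  apply: nondecreasing_is_cvgn nd _; exists (u 0%N + e 0%N) => _ [n _ <-].
  by have := ni 0%N n (leq0n n); have := e0 n; lra.
pose l := limn (fun n => u n - e n).
have uc : u n @[n --> \oo] --> l.
  rewrite (_ : u = (fun n => (u n - e n) + e n)); last by apply/funext => n; rewrite subrK.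
  by rewrite -[l]addr0; apply: cvgD.
exists l => // n; rewrite ler_distl; apply/andP; split.
  exact: (nondecreasing_cvgn_le nd vc n).
have wc : u n + e n @[n --> \oo] --> l by rewrite -[l]addr0; apply: cvgD.
have := nonincreasing_cvgn_ge ni (cvgP _ wc) n.
by rewrite (cvg_lim _ wc).
Qed.

Lemma sum_half n : \sum_(0 <= i < n) (2 ^+ i)^-1 <= 2 :> R.
Proof.
suff -> : \sum_(0 <= i < n) (2 ^+ i)^-1 = 2 - 2 / 2 ^+ n :> R.
  by rewrite lerBlDr lerDl divr_ge0// exprn_ge0.
elim: n => [|n ih]; first by rewrite big_geq// expr0 divr1 subrr.
by rewrite big_nat_recr//= ih exprS; field; rewrite expf_neq0.
Qed.

Lemma sqr_le_csqr (z : R[i]) : Re z ^+ 2 <= csqr z /\ Im z ^+ 2 <= csqr z.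
Proof. by rewrite /csqr lerDl lerDr !sqr_ge0. Qed.

(** Riesz-Fischer for a fast Cauchy sequence. The series G of 4^n |phi_(n+1) - phi_n|^2 has integral
    at most 2, as 4^n / 8^n = 2^-n. Where G is finite the increments are at most G^(1/2) / 2^n, so
    the sequence converges with a tail bound whose square is a multiple of G / 4^n. *)
Lemma L2_complete (phi : nat -> T -> R[i]) : (forall n, L2 mu setT (phi n)) ->
  (forall n, N2 (fun x => (phi n.+1 x - phi n x)%R) <= ((8 ^+ n)^-1)%:E)%E ->
  exists2 f, L2 mu setT f &
    forall eps : R, 0 < eps -> exists N, forall n, (N <= n)%N ->
      (sqdist mu setT f (phi n) < eps%:E)%E.
Proof.
move=> Lphi fast.
have mphi n : cmeasurable setT (phi n) by case: (Lphi n).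
have md n : cmeasurable setT (fun x => phi n.+1 x - phi n x) by apply: cmeasurableB.
pose h n x := ((4 ^+ n)%:E * (csqr (phi n.+1 x - phi n x))%:E)%E.
have h0 n x : (0 <= h n x)%E by rewrite mule_ge0 ?lee_fin ?csqr_ge0// exprn_ge0.
have mh n : measurable_fun setT (h n).
  by apply: mf_emul; [exact: measurable_cst|exact: measurable_csqrE].
pose G x := (\sum_(0 <= n <oo) h n x)%E.
have mG : measurable_fun setT G by apply: ge0_emeasurable_sum => // n x _ _.
have G0 x : (0 <= G x)%E by apply: nneseries_ge0.
have GI : (\int[mu]_x G x <= 2%:E)%E.
  rewrite integral_nneseries//.
  apply: lime_le; first by apply: is_cvg_nneseries => n _ _; exact: integral_ge0.
  apply: nearW => n; apply: le_trans (_ : (\sum_(0 <= i < n) ((2 ^+ i)^-1)%:E <= _)%E); last first.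
    by rewrite sumEFin lee_fin sum_half.
  apply: lee_sum => i _; rewrite integralZT ?exprn_ge0//; first last.
  - by move=> x; rewrite lee_fin csqr_ge0.
  - exact: measurable_csqrE.
  apply: le_trans (lee_wpmul2l _ (fast i)) _; first by rewrite lee_fin exprn_ge0.
  rewrite -EFinM lee_fin le_eqVlt; apply/orP; left; apply/eqP.
  by rewrite -[8]/(4 * 2)%:R natrM exprMn; field; rewrite !expf_neq0.
pose A := [set x | (G x < +oo)%E].
have mA : measurable A.
  by rewrite -[A]setTI; exact: (emeasurable_fun_infty_o measurableT mG).
have aeA : {ae mu, forall x, A x}.
  by apply: (integral_lty_ae mG) => //; apply: le_lt_trans GI _; exact: ltry.
pose B x : R := Num.sqrt (fine (G x)).
(* Cutting off where G is infinite makes the sequence converge at every point, so that its limit is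
   measurable. *)
pose psi n x := cindic A x * phi n x.
have mpsi n : cmeasurable setT (psi n).
  by apply: cmeasurableM => //; exact: cmeasurable_cindic.
have dle n x : A x -> csqr (phi n.+1 x - phi n x) <= (B x / 2 ^+ n) ^+ 2.
  move=> Ax; rewrite expr_div_n sqr_sqrtr; last by rewrite fine_ge0.
  have : (h n x <= G x)%E.
    apply: le_trans (nneseries_lim_ge (u_ := fun n => h n x) (P := xpredT) (m := 0) n.+1 _) => //.
    by rewrite big_nat_recr//= leeDr// sume_ge0.
  have fG : G x \is a fin_num by rewrite ge0_fin_numE.
  rewrite -[X in (_ <= X)%E](fineK fG) /h -EFinM lee_fin => hG.
  rewrite ler_pdivlMr ?exprn_gt0// -exprM mulnC exprM.
  by rewrite (_ : 2 ^+ 2 = 4 :> R) 1?mulrC//; ring.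
have lim (p : R[i] -> R) (pB : forall z w, p (z - w) = p z - p w)
    (ple : forall z, p z ^+ 2 <= csqr z) x :
  exists2 l, p (psi n x) @[n --> \oo] --> l & A x -> forall n,
    `|l - p (phi n x)| <= 2 * B x / 2 ^+ n.
  have [Ax|nAx] := pselect (A x).
    have pE n : psi n x = phi n x by rewrite /psi /cindic indicE mem_set// mul1r.
    have [n|l lc le] := @geometric_cauchy (fun n => p (phi n x)) (B x).
      rewrite -pB -ler_sqr ?nnegrE// ?real_normK ?num_real//; last first.
        by rewrite divr_ge0 ?sqrtr_ge0// exprn_ge0.
      exact: le_trans (ple _) (dle n x Ax).
    by exists l => //; under eq_fun do rewrite pE.
  exists (p 0) => //; rewrite (_ : (fun n => p (psi n x)) = fun=> p 0); first exact: cvg_cst.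
  by apply/funext => n; rewrite /psi /cindic indicE memNset// mul0r.
have limR := lim (@complex.Re R) (fun z w => ReB z w) (fun z => (sqr_le_csqr z).1).
have limI := lim (@complex.Im R) (fun z w => ImB z w) (fun z => (sqr_le_csqr z).2).
pose f x : R[i] := s2val (cid2 (limR x)) +i* s2val (cid2 (limI x)).
have mf : cmeasurable setT f.
  split.
    apply: (measurable_fun_cvg (h := fun n x => Re (psi n x))) => [n|x _]; first by case: (mpsi n).
    exact: (s2valP (cid2 (limR x))).
  apply: (measurable_fun_cvg (h := fun n x => Im (psi n x))) => [n|x _]; first by case: (mpsi n).
  exact: (s2valP (cid2 (limI x))).
have fle n x : A x -> csqr (f x - phi n x) <= 8 / 4 ^+ n * fine (G x).
  move=> Ax; rewrite /csqr ReB ImB /f /=.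
  have sq (l : R) : `|l| <= 2 * B x / 2 ^+ n -> l ^+ 2 <= 4 / 4 ^+ n * fine (G x).
    rewrite -ler_sqr ?nnegrE//; last first.
      by rewrite divr_ge0 ?exprn_ge0// mulr_ge0// sqrtr_ge0.
    rewrite real_normK ?num_real// => /le_trans; apply.
    rewrite !exprMn sqr_sqrtr ?fine_ge0// exprVn -exprM mulnC exprM.
    by rewrite (_ : 2 ^+ 2 = 4 :> R) ?[_ * _ / _]mulrAC//; ring.
  have := sq _ (s2valP' (cid2 (limR x)) Ax n); have := sq _ (s2valP' (cid2 (limI x)) Ax n).
  have -> : 8 / 4 ^+ n * fine (G x) = 4 / 4 ^+ n * fine (G x) + 4 / 4 ^+ n * fine (G x) by ring.
  by move=> leI leR; exact: lerD leR leI.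
have dist n : (sqdist mu setT f (phi n) <= (16 / 4 ^+ n)%:E)%E.
  have mB := cmeasurableB mf (mphi n).
  have k0 : 0 <= 8 / 4 ^+ n :> R by rewrite divr_ge0// exprn_ge0.
  apply: (@le_trans _ _ (\int[mu]_x ((8 / 4 ^+ n)%:E * G x))%E).
    apply: ae_ge0_le_integral => //.
    - by move=> x _; rewrite lee_fin csqr_ge0.
    - exact: measurable_csqrE.
    - by move=> x _; rewrite mule_ge0// lee_fin.
    - by apply: mf_emul => //; exact: measurable_cst.
    - apply: filterS aeA => x Ax _.
      by rewrite -[G x]fineK ?ge0_fin_numE// -EFinM lee_fin fle.
  rewrite integralZT//; apply: le_trans (lee_wpmul2l _ GI) _; first by rewrite lee_fin.
  by rewrite -EFinM lee_fin; lra.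
exists f.
  rewrite (_ : f = fun x => phi 0%N x + (f x - phi 0%N x)); last by apply/funext => x;
    rewrite subrKC.
  apply: L2D => //; split; first exact: cmeasurableB.
  by apply: le_lt_trans (dist 0%N) _; exact: ltry.
move=> eps eps0; have := @cvg_geometric R 16 4^-1.
rewrite ger0_norm ?invr_ge0// => /(_ _)h4.
have /(cvgr_lt _) /(_ _ eps0) [N _ Nlt] : geometric (16 : R) 4^-1 n @[n --> \oo] --> 0 by apply:
  h4; lra.
exists N => n /Nlt; rewrite /geometric /= exprVn => lt.
by apply: le_lt_trans (dist n) _; rewrite lte_fin.
Qed.

End completeness.

(** * The images: invariance of Haar measure, closedness, intertwining *)

Section voice_image.
Context (R : realType).
Local Notation mR := (measurableTypeR R).
Local Notation R2 := (mR * mR)%type.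
Local Notation M4 := ((mR * mR) * (mR * mR))%type.
Local Notation L := (@lebesgue_measure R).
Local Notation affine := ('cV[R]_2 * 'M[R]_2)%type.
Local Notation HR := (@haar_Rstar R).
Local Notation RS := (@Rstar R).
Local Notation HG := (@haar_G2 R).
Local Notation m3 := (@leb4 R \x @leb2 R)%E.

Let integral_GL2 (f : M4 * R2 -> \bar R) : measurable_fun setT f -> (forall z, 0 <= f z)%E ->
  (\int[m3]_z f z = \int[@leb4 R]_B \int[@leb2 R]_y f (B, y))%E.
Proof. by move=> mf f0; rewrite -(fubini_tonelli1 f). Qed.

Lemma integral_translate2 (f : R2 -> \bar R) (a b : R) : measurable_fun setT f ->
  (forall z, 0 <= f z)%E ->
  (\int[@leb2 R]_z f (a + z.1, b + z.2)%R = \int[@leb2 R]_z f z)%E.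
Proof.
move=> mf f0.
have mg : measurable_fun setT (fun z : R2 => f (a + z.1, b + z.2)) by mfun.
rewrite (integral_leb2 mg) ?(integral_leb2 mf)//.
have mh : measurable_fun setT (fun x => \int[L]_y f (x, y))%E by exact: measurable_integralr.
rewrite -[RHS](integral_shift a mh); last by move=> x; exact: integral_ge0.
apply: eq_integral => x _.
rewrite -(integral_shift (f := fun y => f (x + a, y)) b) //; last by mfun.
by apply: eq_integral => y _ /=; rewrite (addrC a) (addrC b).
Qed.

(** Left invariance of Haar measure in coordinates: B -> A B has Jacobian |det A|^2, y -> x + A y
    has Jacobian |det A|, and the density [Gweight] is multiplied by |det A|^-3. *)
Lemma integral_left_translate (A : M4) (x : R2) (k : M4 * R2 -> \bar R) : det4 A != 0 ->
  measurable_fun setT k -> (forall z, 0 <= k z)%E ->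
  (\int[m3]_z ((Gweight z)%:E * k (mul4 A z.1, (x.1 + dot A.1 z.2, x.2 + dot A.2 z.2))%R) =
   \int[m3]_z ((Gweight z)%:E * k z))%E.
Proof.
move=> d0 mk k0; have mw := @measurable_Gweight R; have w0 := @Gweight_ge0 R.
have e0 z : (0 <= (Gweight z)%:E * k z)%E by rewrite mule_ge0// lee_fin.
have mwk : measurable_fun setT (fun z => (Gweight z)%:E * k z)%E.
  by apply: mf_emul => //; exact: mf_EFin.
have mt : measurable_fun setT (fun z : M4 * R2 => (mul4 A z.1, (x.1 + dot A.1 z.2, x.2 +
  dot A.2 z.2)) : M4 * R2).
  by rewrite /mul4 /rowmul /dot; mfun.
have mkt := mf_comp mk mt.
have mwkt : measurable_fun setT (fun z : M4 * R2 =>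
    (Gweight z)%:E * k (mul4 A z.1, (x.1 + dot A.1 z.2, x.2 + dot A.2 z.2))%R)%E.
  by apply: mf_emul => //; exact: mf_EFin.
rewrite (integral_GL2 mwk e0) (integral_GL2 mwkt); last by move=> z; rewrite mule_ge0// lee_fin.
pose KK (B : M4) := (\int[@leb2 R]_y ((Gweight (B, y))%:E * k (B, y)))%E.
have mKK : measurable_fun setT KK by exact: (measurable_integralr (@leb2 R) mwk).
have KK0 B : (0 <= KK B)%E by exact: integral_ge0.
transitivity (\int[@leb4 R]_B KK B)%E; last by [].
have dE : A.1.1 * A.2.2 - A.1.2 * A.2.1 = det4 A by [].
rewrite -(integral_linear4 (a := A.1.1) (b := A.1.2) (c := A.2.1) (d := A.2.2) _ mKK KK0) ?dE//.
apply: eq_integral => B _; rewrite -[X in KK X]/(mul4 A B) /KK.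
have mkB : measurable_fun setT (fun y : R2 => k (mul4 A B, y)) by mfun.
have wE y : Gweight (mul4 A B, y) = (`|det4 A| ^+ 3)^-1 * Gweight (B, (0, 0)).
  by rewrite /Gweight /= det4_mul normrM exprMn (exprSr _ 2) !invfM; ring.
under eq_integral do rewrite -[Gweight (B, _)]/(Gweight (B, (0, 0))).
under [in RHS]eq_integral do rewrite wE.
have c0 : 0 <= (`|det4 A| ^+ 3)^-1 * Gweight (B, (0, 0)) by rewrite mulr_ge0// invr_ge0 exprn_ge0.
have mkt' : measurable_fun setT (fun y : R2 => k (mul4 A B, (x.1 + dot A.1 y, x.2 + dot A.2 y))).
  by rewrite /dot; mfun.
rewrite !integralZT//.
rewrite -(integral_translate2 x.1 x.2 mkB)//.
have mkx : measurable_fun setT (fun y : R2 => k (mul4 A B, (x.1 + y.1, x.2 + y.2))) by mfun.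
rewrite -(integral_linear2 (a := A.1.1) (b := A.1.2) (c := A.2.1) (d := A.2.2) _ mkx) ?dE//.
rewrite integralZT// !muleA -!EFinM; congr (_%:E * _)%E.
have : `|det4 A| != 0 by rewrite normr_eq0.
by move: `|det4 A| (Gweight _) => a w a0; field.
Qed.

Lemma sqnorm_leftreg f (g : affine) : G2 g -> cmeasurable (@G2 R) f ->
  cmeasurable (@G2 R) (leftreg g f) /\
  sqnorm HG (@G2 R) (leftreg g f) = sqnorm HG (@G2 R) f.
Proof.
move=> Gg mf; have Gh : G2 (invG2 g) by rewrite /G2 /= unitmx_inv.
set h := invG2 g in Gh *; case Eh : (Gparam h) => [A x].
have hE : Gcoord (A, x) = h by rewrite -Eh GparamK.
have d0 : det4 A != 0 by apply/(Gcoord_G2 (A, x)); rewrite hE.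
have mG := @measurable_G2 R.
have GE y : (mulG2 h y \in @G2 R) = (y \in @G2 R).
  apply/idP/idP => /set_mem Gy; apply/mem_set; move: Gy; rewrite /G2 /= unitmx_mul.
    by case/andP.
  by move=> Gy; apply/andP; split.
pose f0 y := if y \in @G2 R then f y else 0.
have mf0 : cmeasurable setT f0 := cmeasurable_restrict mG mf.
pose tr (z : M4 * R2) : M4 * R2 := (mul4 A z.1, (x.1 + dot A.1 z.2, x.2 + dot A.2 z.2)).
have mt : measurable_fun setT tr by rewrite /tr /mul4 /rowmul /dot; mfun.
have trE z : Gcoord (tr z) = mulG2 h (Gcoord z).
  by case: z => B y; rewrite -hE mulG2_coord.
have mfc := cmeasurable_comp mf0 (@measurable_Gcoord R).
have mfr := cmeasurable_comp mfc (mf_comp mt (@measurable_Gparam R)).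
have lE y : G2 y -> leftreg g f y = f0 (Gcoord (tr (Gparam y))).
  by move=> Gy; rewrite trE GparamK /f0 GE mem_set.
have ml : cmeasurable (@G2 R) (leftreg g f).
  apply: (eq_cmeasurable (f := fun y => f0 (Gcoord (tr (Gparam y))))).
    by move=> y /set_mem Gy; rewrite lE.
  exact: (cmeasurableS measurableT).
split => //; rewrite !sqnorm_onG// /sqnorm.
have wE u z : (csqr (onG u z))%:E = ((Gweight z)%:E * (csqr (u (Gcoord z)))%:E)%E.
  by rewrite /onG /weighted; move: (u _) => w;
    rewrite csqrM csqr_real sqr_sqrtr ?Gweight_ge0// EFinM.
have mk := measurable_csqrE mfc.
transitivity (\int[m3]_z ((Gweight z)%:E * (csqr (f0 (Gcoord z)))%:E))%E.
  rewrite -(integral_left_translate x d0 mk); last by move=> z; rewrite lee_fin csqr_ge0.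
  apply: eq_integral => z _; rewrite wE; have [->|n0] := eqVneq (Gweight z) 0;
    first by rewrite !mul0e.
  by rewrite -/(tr z) trE /f0 GE mem_set//; exact: Gweight_G2.
apply: eq_integral => z _; rewrite wE; have [->|n0] := eqVneq (Gweight z) 0;
  first by rewrite !mul0e.
by rewrite /f0 mem_set//; exact: Gweight_G2.
Qed.

Variables (eta : 'rV[R]_2 -> R[i]) (g : mR -> R[i]).
Hypotheses (Leta : L2 (@leb_rV R) (@O R) eta) (Lg : L2 L (@O1 R) g).
Hypotheses (eta1 : inner (@leb_rV R) (@O R) eta eta = 1) (g1 : inner L (@O1 R) g g = 1).
Hypotheses (LgR : L2 HR RS g) (LE : L2K (coherent_vector eta g)).
Local Notation E := (coherent_vector eta g).

Let mV F : L2K F -> cmeasurable (@G2 R) (V E F).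
Proof. exact: (cmeasurable_V Leta Lg g1 LgR LE). Qed.

Let isoV F : L2K F -> sqnorm HG (@G2 R) (V E F) = vsqnorm (@haar_K R) (@K R) HR RS F.
Proof. exact: (V_isometry Leta Lg eta1 g1 LgR LE). Qed.

Lemma V_image_L2 : V_image E `<=` L2 HG (@G2 R).
Proof.
move=> f [mf [F LF fV]]; split => //.
rewrite (ae_equal_sqnorm (@measurable_G2 R) mf (mV LF) fV) isoV//; by case: LF.
Qed.

Lemma V_image_linear a f f' : V_image E f -> V_image E f' -> V_image E (fun x => a * f x + f' x).
Proof.
move=> [mf [F LF fV]] [mf' [F' LF' fV']]; split.
  by apply: cmeasurableD => //; apply: cmeasurableM => //; exact: cmeasurable_cst.
exists (fun k t => a * F k t + F' k t); first exact: L2K_linear.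
apply: filterS2 fV fV' => y fy fy' Gy.
by rewrite (V_linear Leta Lg g1 LgR LE a LF LF' Gy) fy// fy'.
Qed.

Lemma V_image0 : V_image E (fun=> 0).
Proof.
split; first exact: cmeasurable_cst.
(* The zero vector is obtained from E itself, which is in [L2K] by hypothesis. *)
exists (fun k t => -1 * E k t + E k t); first exact: L2K_linear.
apply: aeW => y Gy; rewrite (V_linear Leta Lg g1 LgR LE (-1) LE LE Gy).
by rewrite mulN1r addNr.
Qed.

Let sqdistD_le f h u : cmeasurable (@G2 R) f -> cmeasurable (@G2 R) h -> cmeasurable (@G2 R) u ->
  (sqdist HG (@G2 R) f u <= 2%:E * sqdist HG (@G2 R) f h + 2%:E * sqdist HG (@G2 R) h u)%E.
Proof.
move=> mf mh mu; have m1 := cmeasurableB mf mh; have m2 := cmeasurableB mh mu.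
rewrite /sqdist (sqnorm_onG (cmeasurableB mf mu)) (sqnorm_onG m1) (sqnorm_onG m2).
apply: le_trans (sqnormD_le _ (cmeasurable_onG m1) (cmeasurable_onG m2)).
rewrite le_eqVlt; apply/orP; left; apply/eqP; apply: eq_integral => z _; congr (csqr _)%:E.
by rewrite /onG /weighted; ring.
Qed.

Let sqdistC f h : sqdist HG (@G2 R) f h = sqdist HG (@G2 R) h f.
Proof. by apply: eq_integral => z _; rewrite -opprB csqrN. Qed.

Let sqdist_V F F' phi phi' : L2K F -> L2K F' -> represents F phi -> represents F' phi' ->
  sqdist HG (@G2 R) (V E F) (V E F') = sqdist (@leb3 R) setT phi phi'.
Proof.
move=> LF LF' rep rep'.
transitivity (sqnorm HG (@G2 R) (V E (fun k t => -1 * F' k t + F k t))).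
  apply: eq_integral => y /set_mem Gy.
  by rewrite (V_linear Leta Lg g1 LgR LE (-1) LF' LF Gy) mulN1r addrC.
have LD := L2K_linear (-1) LF' LF.
rewrite isoV// (vsqnorm_represents (L2_fiber LD) (represents_linear (-1) rep' rep)).
by apply: eq_integral => y _; rewrite mulN1r addrC.
Qed.

(** By isometry, approximants V_E F_n of [f] come from representatives that are Cauchy in L^2 of
    [leb3]. Their limit is modified on a null set to represent some F, and V_E F is at distance 0
    from [f]. *)
Lemma V_image_closed : closed_subspace HG (@G2 R) (V_image E).
Proof.
split; [exact: V_image_L2|exact: V_image0|exact: V_image_linear|].
move=> f [mf _] appr; split => //; have mG := @measurable_G2 R.
(* The accuracy 8^-n / 8 makes consecutive representatives 8^-n close: 2 (1/64 + 1/8) 8^-n is below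
   8^-n, as [L2_complete] asks. *)
have fast n : exists q : (affine -> mR -> R[i]) * (R2 * mR -> R[i]),
    [/\ L2K q.1, represents q.1 q.2 & (sqdist HG (@G2 R) f (V E q.1) < ((8 ^+ n)^-1 / 8)%:E)%E].
  have e0 : 0 < (8 ^+ n)^-1 / 8 :> R by rewrite divr_gt0// invr_gt0 exprn_gt0.
  have [h [mh [F LF hV]] fh] := appr _ e0; have [phi rep] := representable LF.
  exists (F, phi); split => //=; apply: le_lt_trans fh; rewrite le_eqVlt; apply/orP; left;
    apply/eqP.
  apply: (ae_equal_sqnorm mG); [by apply: cmeasurableB => //; exact: mV|exact: cmeasurableB|].
  by apply: filterS hV => y hy Gy; rewrite hy.
have [q qP] := choice fast.
have Lq n : L2K (q n).1 by case: (qP n).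
have rq n : represents (q n).1 (q n).2 by case: (qP n).
have dq n : (sqdist HG (@G2 R) f (V E (q n).1) < ((8 ^+ n)^-1 / 8)%:E)%E by case: (qP n).
have Lphi n : L2 (@leb3 R) setT (q n).2 by exact: L2_rep (Lq n) (rq n).
have [n|phi Lim lim] := @L2_complete _ _ _ (@leb3 R) (fun n => (q n).2) Lphi.
  rewrite -[X in (X <= _)%E](sqdist_V (Lq n.+1) (Lq n) (rq n.+1) (rq n)).
  apply: le_trans (sqdistD_le (mV (Lq n.+1)) mf (mV (Lq n))) _.
  rewrite [X in (_ * X + _)%E]sqdistC.
  apply: (@le_trans _ _ (2%:E * ((8 ^+ n.+1)^-1 / 8)%:E + 2%:E * ((8 ^+ n)^-1 / 8)%:E)%E).
    by apply: leeD; rewrite lee_wpmul2l// ?lee_fin// ltW.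
  rewrite -!EFinM -EFinD lee_fin exprS invfM.
  have : 0 <= (8 ^+ n)^-1 :> R by rewrite invr_ge0 exprn_ge0.
  by lra.
(* The L^2 limit need not represent a vector itself, but agrees almost everywhere with some [psi]
   that does, so distances to it are unchanged. *)
have [F [psi [LF rep ae]]] := represented_modification Lim.
exists F => //; apply: (sqdist_eq0 mG mf (mV LF)).
apply/eqP; rewrite eq_le sqnorm_ge0 andbT; apply/lee_addgt0Pr => eps eps0; rewrite add0e.
have e4 : 0 < eps / 4 by rewrite divr_gt0.
have [N Nlt] := lim _ e4.
have : geometric (1 : R) 8^-1 n @[n --> \oo] --> 0.
  by apply: cvg_geometric; rewrite ger0_norm ?invr_ge0//; lra.
move/(cvgr_lt _) => /(_ _ eps0) [N' _ N'lt].
pose n := maxn N N'.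
apply: le_trans (sqdistD_le mf (mV (Lq n)) (mV LF)) _.
rewrite (sqdist_V (Lq n) LF (rq n) rep).
have -> : sqdist (@leb3 R) setT (q n).2 psi = sqdist (@leb3 R) setT phi (q n).2.
  have [mq _] := Lphi n; have [mp _] := Lim; have [ms _] := rep.
  rewrite /sqdist (ae_eq_sqnorm (g := fun y => (q n).2 y - phi y)).
  - by apply: eq_integral => y _; rewrite -opprB csqrN.
  - exact: cmeasurableB.
  - exact: cmeasurableB.
  - by apply: filterS ae => y ->.
have a1 := Nlt n (leq_maxl _ _).
have := N'lt n (leq_maxr _ _); rewrite /geometric /= mul1r exprVn => a2.
apply: (@le_trans _ _ (2%:E * ((8 ^+ n)^-1 / 8)%:E + 2%:E * (eps / 4)%:E)%E).
  by apply: leeD; rewrite lee_wpmul2l// ?lee_fin// ltW.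
by rewrite -!EFinM -EFinD lee_fin; lra.
Qed.

Lemma V_image_V F : L2K F -> V_image E (V E F).
Proof. by move=> LF; split; [exact: mV|exists F => //; apply: aeW]. Qed.

Lemma V_intertwines : intertwines_sigma_leftreg (V E) (V_image E).
Proof.
split=> [F|h Gh F LF]; first exact: V_image_V.
by apply: aeW => y Gy; exact: V_sigma.
Qed.

(** An element of the image equals some V_E F only almost everywhere. Left translation is isometric,
    so the translates are still at distance 0, and the translate of V_E F is V_E applied to sigma(h)
    F. *)
Lemma V_image_leftreg : leftreg_invariant (V_image E).
Proof.
move=> h Gh f [mf [F LF fV]]; have [ml _] := sqnorm_leftreg Gh mf; split => //.
have mG := @measurable_G2 R; have LS := L2K_sigma Gh LF.
exists (sigma h F); first exact: LS.
apply: (sqdist_eq0 mG ml (mV LS)).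
have mB := cmeasurableB mf (mV LF); have [_ lB] := sqnorm_leftreg Gh mB.
rewrite -[RHS](ae_equal_sqdist mG mf (mV LF) fV) /sqdist -[RHS]lB.
by apply: eq_integral => y /set_mem Gy; rewrite (V_sigma Gh Gy LE LF).
Qed.

End voice_image.

Theorem theorem5p11 (R : realType) (I J : Type)
    (eta : I -> 'rV[R]_2 -> R[i]) (g : J -> measurableTypeR R -> R[i])
    (eta_basis : orthonormal_basis (@leb_rV R) (@O R) eta)
    (g_basis : orthonormal_basis (@lebesgue_measure R) (@O1 R) g)
    (g_Rstar : forall j : J, L2 (@haar_Rstar R) (@Rstar R) (g j))
    (E_L2K : forall (i : I) (j : J), L2K (coherent_vector (eta i) (g j))) :
  let E := fun p : I * J => coherent_vector (eta p.1) (g p.2) in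
  let M := fun p : I * J => V_image (E p) in
  (forall p : I * J,
     [/\ closed_subspace (@haar_G2 R) (@G2 R) (M p),
         leftreg_invariant (M p),
         linear_isometry (V (E p)) &
         intertwines_sigma_leftreg (V (E p)) (M p)]) /\
  orthogonal_direct_sum (@haar_G2 R) (@G2 R) M.
Proof.
move=> E M.
have Leta i : L2 (@leb_rV R) (@O R) (eta i) by case: eta_basis.
have eta1 i : inner (@leb_rV R) (@O R) (eta i) (eta i) = 1 by case: eta_basis.
have Lg j : L2 (@lebesgue_measure R) (@O1 R) (g j) by case: g_basis.
have g1 j : inner (@lebesgue_measure R) (@O1 R) (g j) (g j) = 1 by case: g_basis.
have closed p : closed_subspace (@haar_G2 R) (@G2 R) (M p) by exact: V_image_closed.
split.
  move=> p; split; [exact: closed|exact: V_image_leftreg|exact: V_linear_isometry|exact: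
    V_intertwines].
split => //; last by move=> f Lf eps eps0; exact: (V_image_dense eta_basis g_basis g_Rstar E_L2K).
(* Elements of the images are values of the transforms up to null sets, so their orthogonality
   follows from [V_orthogonal] by equality of integrals. *)
move=> p q pq f h [mf [F LF fV]] [mh [F' LF' hV]].
have mF := cmeasurable_V (Leta p.1) (Lg p.2) (g1 p.2) (g_Rstar p.2) (E_L2K p.1 p.2) LF.
have mF' := cmeasurable_V (Leta q.1) (Lg q.2) (g1 q.2) (g_Rstar q.2) (E_L2K q.1 q.2) LF'.
rewrite -(V_orthogonal eta_basis g_basis g_Rstar E_L2K pq LF LF').
apply: (ae_equal_cintegral (@measurable_G2 R)).
- exact: cmeasurableM mf (cmeasurableJ mh).
- exact: cmeasurableM mF (cmeasurableJ mF').
- by apply: filterS2 fV hV => y fy hy Gy; rewrite fy// hy.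
Qed.
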